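(* Let $p$ be a prime which is either $p=2$ or a regular odd prime, and let $n\ge 2$ be an integer with $p^n\ge 8$. Let $\mathscr C_1^\infty(p^n)$ denote the subgroup of the Jacobian $J_1(p^n)$ generated by the classes of degree-zero divisors supported on the $\infty$-cusps of $X_1(p^n)$. Then: (i) the $p$-rank of $\mathscr C_1^\infty(p^n)$ equals $\frac12(p-1)p^{n-2}-1$; (ii) for every integer $k\ge 1$, the number of copies of $\mathbb Z/p^{2k}\mathbb Z$ in the primary decomposition of $\mathscr C_1^\infty(p^n)$ is $\frac12(p-1)^2p^{n-k-2}-1$ if $p=2$ and $k\le n-3$; $\frac12(p-1)^2p^{n-k-2}-1$ if $p\ge 3$ and $k\le n-2$; $\frac12(p-5)$ if $p\ge5$ and $k=n-1$; and $0$ in all other cases; (iii) for every integer $k\ge1$, the number of copies of $\mathbb Z/p^{2k-1}\mathbb Z$ in the primary decomposition of $\mathscr C_1^\infty(p^n)$ is $1$ if $p=2$ and $k\le n-3$; $1$ if $p=3$ and $k\le n-2$; $1$ if $p\ge5$ and $k\le n-1$; and $0$ in all other cases.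
   Context: For a positive integer $N$, $X_1(N)$ is the modular curve of $\Gamma_1(N)$, taken with its model over $\mathbb Q$ on which the cusp $\infty$ is rational, and $J_1(N)$ is its Jacobian. The $\infty$-cusps of $X_1(N)$ are the cusps $k/N$ with $\gcd(k,N)=1$ (those lying over $\infty$ of $X_0(N)$); they are $\mathbb Q$-rational, and classes of degree-zero divisors supported on them are torsion in $J_1(N)$, so $\mathscr C_1^\infty(N)$ is a finite abelian group. For a finite abelian group $G$, its $p$-rank is the integer $r$ such that the kernel of multiplication by $p$ on $G$ has $p^r$ elements. An odd prime $p$ is regular if $p$ does not divide the numerators of the Bernoulli numbers $B_2,B_4,\dots,B_{p-3}$. *)

(* Defs.v *)
From HB Require Import structures.
From mathcomp Require Import all_boot all_order all_algebra.
From mathcomp Require Import all_classical all_reals all_analysis.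
From mathcomp Require Import complex generic_quotient ring_quotient freeg.
Set Implicit Arguments.
Unset Strict Implicit.
Unset Printing Implicit Defensive.
Import Order.TTheory GRing.Theory Num.Theory numFieldNormedType.Exports.
Local Open Scope classical_set_scope.
Local Open Scope card_scope.
Local Open Scope ring_scope.

(* B_0 = 1 and \sum_(k <= n) 'C(n.+1, k) B_k = 0 for n > 0, i.e. the Bernoulli
   numbers of t / (e^t - 1); bernoulli_seq n lists B_0, ..., B_(n-1). *)
Fixpoint bernoulli_seq (n : nat) : seq rat :=
  if n is m.+1 then
    let s := bernoulli_seq m in
    rcons s (if m is 0 then 1
             else - (m.+1)%:R^-1 * \sum_(k < m) 'C(m.+1, k)%:R * s`_k)
  else [::].

Definition bernoulli (n : nat) : rat := (bernoulli_seq n.+1)`_n.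

Definition regular_prime (p : nat) : Prop :=
  [/\ prime p, odd p &
      forall k, (2 <= k <= p - 3)%N -> ~~ odd k ->
        ~~ (p%:Z %| numq (bernoulli k))%Z].

Definition SL2Z (g : 'M[int]_2) : Prop := \det g = 1.

Definition Gamma1 (N : nat) (g : 'M[int]_2) : Prop :=
  [/\ SL2Z g, (g 0%R 0%R = 1 %[mod N])%Z, (g 1%R 1%R = 1 %[mod N])%Z
    & (N %| g 1%R 0%R)%Z].

(* {1, -1} Gamma_1(N): preimage of the image of Gamma_1(N) in PSL_2(Z) *)
Definition pmGamma1 (N : nat) (g : 'M[int]_2) : Prop :=
  Gamma1 N g \/ Gamma1 N (- g).

Definition translation (w : nat) : 'M[int]_2 := 1%:M + w%:Z *: delta_mx 0 1.

(* P^1(Q), with None for the point at infinity *)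
Definition cusp_act (g : 'M[int]_2) (s : option rat) : option rat :=
  let num := if s is Some x then (g 0 0)%:~R * x + (g 0 1)%:~R
             else (g 0 0)%:~R in
  let den := if s is Some x then (g 1 0)%:~R * x + (g 1 1)%:~R
             else (g 1 0)%:~R in
  if den == 0 then None else Some (num / den).

(* w is the width, for Gamma_1(N), of the cusp g oo: the least w > 0 such that
   g (1 w; 0 1) g^-1 lies in {1, -1} Gamma_1(N) *)
Definition is_cusp_width (N : nat) (g : 'M[int]_2) (w : nat) : Prop :=
  let stab (v : nat) := pmGamma1 N (g *m translation v *m invmx g) in
  [/\ (0 < w)%N, stab w & forall v, (0 < v)%N -> stab v -> (w <= v)%N].

Section OrderAlong.
Variables (K : numFieldType) (T : Type).
Implicit Types (F : set_system T) (t f g : T -> K).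

(* f ~ c t^m along F with c <> 0 *)
Definition has_order_along F t f (m : int) : Prop :=
  exists2 c : K, c != 0 & f z * t z ^ (- m) @[z --> F] --> c.

Lemma has_order_along1 F t : Filter F -> has_order_along F t (fun=> 1) 0.
Proof.
move=> FF; exists 1; first exact: oner_neq0.
by under eq_fun do rewrite oppr0 expr0z mulr1; exact: cvg_cst.
Qed.

Lemma has_order_along_div F t f g (m n : int) :
  Filter F -> (\forall z \near F, t z != 0) ->
  has_order_along F t f m -> has_order_along F t g n ->
  has_order_along F t (fun z => f z / g z) (m - n).
Proof.
move=> FF t0 [c c0 fc] [d d0 gd]; exists (c / d).
  by rewrite mulf_neq0 ?invr_eq0.
apply: (cvg_trans _ (cvgM fc (cvgV d0 gd))).
apply: near_eq_cvg; near=> z => /=.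
have tz : t z != 0 by near: z.
rewrite /= opprB addrC expfzDr // invfM invr_expz opprK.
by rewrite -!mulrA; congr (_ * _); rewrite mulrC -!mulrA; congr (_ * _);
   rewrite mulrC.
Unshelve. all: by end_near.
Qed.

Lemma has_order_along_neq0 F t f (m : int) :
  Filter F -> has_order_along F t f m -> \forall z \near F, f z != 0.
Proof.
move=> FF [c c0 fc].
by apply: filterS (cvgr_neq0 c fc c0) => z; rewrite mulf_eq0 negb_or => /andP[].
Qed.
End OrderAlong.

Lemma derivable_div (K : numFieldType) (f g : K^o -> K^o) (z : K^o) :
  derivable f z 1 -> derivable g z 1 -> g z != 0 ->
  derivable (fun z => f z / g z : K^o) z 1.
Proof.
move=> df dg g0; have dV := derivableV g0 dg.
exact: (derivableM df dV).
Qed.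

Section ModularCurve.
Variable R : realType.

(* R[i]^o is the complex field R[i] as a normed space over itself *)
Local Notation C := (R[i]^o).

Definition mobius (g : 'M[int]_2) (tau : C) : C :=
  ((g 0 0)%:~R * tau + (g 0 1)%:~R) / ((g 1 0)%:~R * tau + (g 1 1)%:~R).

Definition ext_act (g : 'M[int]_2) (x : C + option rat) : C + option rat :=
  match x with
  | inl tau => inl (mobius g tau)
  | inr s => inr (cusp_act g s)
  end.

Definition upper_half_plane : set C := [set tau | 0 < complex.Im tau].

Definition ext_upper_half_plane : set (C + option rat) :=
  [set x | if x is inl tau then upper_half_plane tau else True].

Definition orbit1 (N : nat) (x : C + option rat) : set (C + option rat) :=
  [set y | exists2 g, Gamma1 N g & y = ext_act g x].

(* X_1(N)(C): the type of Gamma_1(N)-orbits on the extended upper half-plane *)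
Definition X1 (N : nat) : choiceType :=
  set_type (orbit1 N @` ext_upper_half_plane).

Definition cexp (z : C) : C :=
  (expR (complex.Re z))%:C%C *
  (cos (complex.Im z) +i* sin (complex.Im z))%C.

(* e^(2 pi i z / w) *)
Definition qparam (w : nat) (z : C) : C :=
  cexp ((trigo.pi *+ 2)%:C%C * 'i%C * z / w%:R).

(* neighbourhoods of i oo in the upper half-plane: Im z -> +oo, uniformly in
   Re z *)
Definition at_ioo : set_system C :=
  filter_from setT (fun y : R => [set z : C | y < complex.Im z]).

(* f has order m at the point of X_1(N) represented by x, measured in a local
   parameter of X_1(N).
   At an interior point tau, ord_tau f = e * m for e the order of the
   stabilizer of tau in {1, -1} Gamma_1(N) / {1, -1} (so e = 1 if N >= 4).
   At a cusp g oo of width w, the local parameter is e^(2 pi i z / w) with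
   z = g^-1 tau. In particular f is meromorphic and not identically zero
   around x. *)
Definition has_order (N : nat) (f : C -> C) (x : C + option rat) (m : int) :
    Prop :=
  match x with
  | inl tau =>
      (\forall z \near tau^', derivable f z 1) /\
      exists2 k : int, has_order_along tau^' (fun z => z - tau) f k &
        forall e : nat,
          [set g | pmGamma1 N g /\ mobius g tau = tau] #= `I_(e.*2) ->
          k = e%:Z * m
  | inr s =>
      forall (g : 'M[int]_2) (w : nat), SL2Z g -> cusp_act g None = s ->
        is_cusp_width N g w ->
        has_order_along at_ioo (qparam w) (f \o mobius g) m
  end.

Definition Gamma1_invariant (N : nat) (f : C -> C) : Prop :=
  forall (g : 'M[int]_2) (tau : C), Gamma1 N g -> upper_half_plane tau ->
    f (mobius g tau) = f tau.

(* D is the divisor of a nonzero meromorphic function on X_1(N) *)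
Definition principal (N : nat) (D : {freeg (X1 N)}) : Prop :=
  exists2 f : C -> C, Gamma1_invariant N f &
    forall (P : X1 N) (x : C + option rat), (val P) x ->
      has_order N f x (coeff P D).

#[local] Instance at_ioo_filter : Filter at_ioo.
Proof.
apply: filter_from_filter; first by exists 0.
move=> y y' _ _; exists (Order.max y y') => // z /=.
by rewrite gt_max => /andP[].
Qed.

Let cexp_neq0 z : cexp z != 0.
Proof.
rewrite /cexp mulf_neq0 //.
  by apply/eqP => -[] /eqP; rewrite gt_eqF // expR_gt0.
apply/eqP => -[] c0 s0; have := cos2Dsin2 (complex.Im z).
by rewrite c0 s0 expr0n addr0 => /eqP; rewrite eq_sym oner_eq0.
Qed.

Let qparam_neq0 w z : qparam w z != 0. Proof. exact: cexp_neq0. Qed.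

Let has_order1 N x : has_order N (fun=> 1) x 0.
Proof.
case: x => [tau|s] /=; last by move=> *; exact: has_order_along1.
split; first by apply: nearW => z; exact: derivable_cst.
by exists 0; [exact: has_order_along1 | move=> e _; rewrite mulr0].
Qed.

Let has_order_div N f g x m n : has_order N f x m -> has_order N g x n ->
  has_order N (fun z => f z / g z) x (m - n).
Proof.
case: x => [tau|s] /=; last first.
  move=> fm gn h w hS hs hw; apply: has_order_along_div (fm h w hS hs hw) _.
    exact: nearW.
  exact: gn.
move=> [df [k fk km]] [dg [l gl ln]]; split.
  have g0 : \forall z \near tau^', g z != 0 by exact: has_order_along_neq0 gl.
  refine (filterS _ (filterI df (filterI dg g0))) => z [fz [gz gz0]].
  have gz0' : g z != 0 :> R[i] by exact: gz0.
  have fgz := @derivable_div R[i] f g z fz gz gz0'.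
  by apply: fgz.
exists (k - l); last by move=> e he; rewrite (km _ he) (ln _ he) mulrBr.
apply: has_order_along_div fk gl.
by near=> z; rewrite subr_eq0; near: z; exact: nbhs_dnbhs_neq.
Unshelve. all: by end_near.
Qed.

Lemma principal0 N : principal (0 : {freeg (X1 N)}).
Proof. by exists (fun=> 1) => // P x _; rewrite coeff0; exact: has_order1. Qed.

Lemma principalB N (D E : {freeg (X1 N)}) :
  principal D -> principal E -> principal (D - E).
Proof.
move=> [f fN fD] [g gN gE]; exists (fun z => f z / g z).
  by move=> h tau hN tauH; rewrite fN ?gN.
by move=> P x Px; rewrite coeffB; apply: has_order_div; [exact: fD|exact: gE].
Qed.

Definition deg0 N : {pred {freeg (X1 N)}} := [pred D | deg D == 0].

Fact deg0_zmod_closed N : zmod_closed (@deg0 N).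
Proof.
split=> [|D E]; rewrite !inE ?raddf0 //.
by move=> /eqP D0 /eqP E0; rewrite raddfB /= D0 E0 subrr.
Qed.
HB.instance Definition _ N :=
  GRing.isZmodClosed.Build {freeg (X1 N)} (@deg0 N) (deg0_zmod_closed N).

(* Div^0(X_1(N)) *)
Record Div0 N := MkDiv0 { Div0_val :> {freeg (X1 N)}; _ : Div0_val \in @deg0 N }.
HB.instance Definition _ N := [isSub for @Div0_val N].
HB.instance Definition _ N := [Choice of Div0 N by <:].
HB.instance Definition _ N := [SubChoice_isSubZmodule of Div0 N by <:].

Definition principal_pred N : {pred Div0 N} :=
  fun D => `[< principal (Div0_val D) >].

Fact principal_zmod_closed N : zmod_closed (@principal_pred N).
Proof.
split=> [|D E]; first by apply/asboolP; exact: principal0.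
by move=> /asboolP D0 /asboolP E0; apply/asboolP; exact: principalB.
Qed.
HB.instance Definition _ N :=
  GRing.isZmodClosed.Build (Div0 N) (@principal_pred N)
    (principal_zmod_closed N).

(* J_1(N)(C), as Pic^0 of the compact Riemann surface X_1(N)(C) *)
Definition J1 N : zmodType := Quotient.quot (@principal_pred N).

Definition divisor_class N (D : Div0 N) : J1 N :=
  (\pi_(Quotient.quot (@principal_pred N)) D)%qT.

Definition infinity_cusp N (P : X1 N) : Prop :=
  exists2 k : int, coprimez k N & (val P) (inr (Some (k%:~R / N%:R))).

Definition supported_at_infinity N (D : {freeg (X1 N)}) : Prop :=
  forall P, coeff P D != 0 -> infinity_cusp P.

Definition C1inf_pred N : {pred J1 N} := fun c =>
  `[< forall S : {pred J1 N}, zmod_closed S ->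
        (forall D : Div0 N, supported_at_infinity D -> divisor_class D \in S) ->
        c \in S >].

Fact C1inf_zmod_closed N : zmod_closed (@C1inf_pred N).
Proof.
split=> [|c d /asboolP Sc /asboolP Sd]; apply/asboolP => S S0 SD.
  by case: S0.
by case: (S0) => _; apply; [exact: Sc | exact: Sd].
Qed.
HB.instance Definition _ N :=
  GRing.isZmodClosed.Build (J1 N) (@C1inf_pred N) (C1inf_zmod_closed N).

(* the subgroup of J_1(N) generated by the classes of the degree-zero divisors
   supported on the oo-cusps *)
Record C1inf N := MkC1inf { C1inf_val :> J1 N; _ : C1inf_val \in @C1inf_pred N }.
HB.instance Definition _ N := [isSub for @C1inf_val N].
HB.instance Definition _ N := [Choice of C1inf N by <:].
HB.instance Definition _ N := [SubChoice_isSubZmodule of C1inf N by <:].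

End ModularCurve.

Definition is_p_rank (G : zmodType) (p r : nat) : Prop :=
  [set x : G | x *+ p = 0] #= `I_(p ^ r).

(* G is isomorphic to the direct sum of the Z/q for q in s, and each q is a
   power > 1 of a prime *)
Definition primary_decomposition (G : zmodType) (s : seq nat) : Prop :=
  (forall q, q \in s -> exists l e : nat, [/\ prime l, (0 < e)%N & q = (l ^ e)%N])
  /\
  exists2 phi : G -> forall i : 'I_(size s), 'Z_(nth 0%N s i),
    bijective phi & forall x y i, phi (x + y) i = phi x i + phi y i.

(* By uniqueness of primary decompositions, the choice of s is irrelevant. *)
Definition number_of_copies (G : zmodType) (q m : nat) : Prop :=
  exists2 s, primary_decomposition G s & count_mem q s = m.

(* Main.v *)
(* Let N = M_T, where M_t = p^t if p is odd and M_t = 2^(t+2) if p = 2, let H_t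
   be half the order of (Z/M_t)^*, and let c generate (Z/N)^* modulo 1, -1. The
   oo-cusps are the orbits of c^i / N, i < H_T.

   Divisors of functions are produced by f_(t,e)(p^(T-t) tau), where f_(t,e) is
   the product of the Klein forms of characteristic c^(i+1) / M_t, at M_t tau,
   with exponents e_i. If the sums of e over the classes mod H_(t-1) vanish, the
   zeros and poles lie at the oo-cusps only, with orders given by the second
   Bernoulli polynomial. Multiplying this Stickelberger operator by c^2 - X
   makes it integral, and regularity of p (through the Voronoi congruences)
   makes it a unit of F_p[X] / (X^(H_t) - 1).

   Conversely, if a modular unit f satisfies f^p = const * prod f_(t,e_t), the
   multipliers of p-th roots on parabolic elements show that p divides all e_t,
   by descending induction on t. Hence a degree-0 divisor x is principal up to
   a prime-to-p multiple iff for all 1 <= t < T, with k = T - t and y_i the sum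
   of x over the class of i mod H_t, p^(2k-1) divides y_(H_(t-1)) and p^(2k)
   divides y_(i+1) - c^2 y_i for H_(t-1) <= i < H_t - 1. These linear forms take
   all values independently, so the p-primary part can be read off; the
   prime-to-p part is finite and decomposes by the Smith normal form.

   The analytic input (a function without zeros and poles is constant) comes
   from Goursat's lemma on rectangles and the maximum principle. *)
Require Import Defs.
From HB Require Import structures.
From mathcomp Require Import all_boot all_order all_algebra all_fingroup all_solvable all_field.
From mathcomp Require Import ring lra zify.
Set Implicit Arguments.
Unset Strict Implicit.
Unset Printing Implicit Defensive.
Import Order.TTheory GRing.Theory Num.Theory.
Local Open Scope ring_scope.

(** The hard direction is that a divisor violating the congruences is not principal, since a modular
    unit is not known in advance to be a Siegel product. But [p^(2T) x] always satisfies the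
    congruences, so some [m p^(2T) x] with [m] prime to [p] is a Siegel divisor, and only [p]-th
    roots of Siegel products have to be studied. After a rescaling of [tau], such a root is
    invariant under a group modulo which the parabolic generator at the cusp [c^i / M_L] is a word
    in the translation at infinity and lower unipotent matrices of the group. Comparing multipliers
    gives [ord_i / p = c^(2i) ord_0 / p] modulo 1, the recursion killed by [c^2 - X]; what survives
    is a convolution with a unit. The exponents [2k] and [2k - 1] have one source. A Siegel product
    of level [M_s] has twisted differences of orders divisible by [p^(T-s)], and summing over
    classes modulo [H_s] contributes the same power again. The orders themselves lose one [p],
    because before normalization they are only known to be divisible by [2 M_(s-1)]. *)

(** * Units of the group algebra of a cyclic group in characteristic [p] *)

(** In characteristic [p] the polynomial [X^(h p^s) - 1] is the [p^s]-th power of [X^h - 1], which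
    splits over the powers of [z]. *)
Lemma coprimep_Xn_sub_1 (F : fieldType) (p h s : nat) (z : F) (P : {poly F}) :
  p \in [pchar F] -> h.-primitive_root z -> (forall l, ~~ root P (z ^+ l)) ->
  coprimep P ('X^(h * p ^ s) - 1).
Proof.
move=> pF hz Pz; have pP : p \in [pchar {poly F}] by rewrite (rmorph_pchar (@polyC F)).
have -> : 'X^(h * p ^ s) - 1 = ('X^h - 1) ^+ (p ^ s) :> {poly F}.
  elim: s => [|s IH]; first by rewrite muln1 expr1.
  rewrite expnSr [RHS]exprM -IH -(pFrobenius_autE pP) rmorphB rmorph1 /= pFrobenius_autE.
  by rewrite -exprM mulnA.
apply: coprimep_expr; rewrite -(factor_Xn_sub_1 hz).
apply: (big_ind (coprimep P)) => [|q r Pq Pr|l _]; first by rewrite coprimep1.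
  by rewrite coprimepMr Pq.
by rewrite coprimep_XsubC.
Qed.

(** The sums in the last hypothesis are, in another order, the entries of [P(S) v], with [S] the
    cyclic shift, [P] the polynomial with coefficients [th] and [v] the vector [e]. As [S^H v = v]
    and [P] is prime to [X^H - 1], a Bezout relation inverts [P(S)]. *)
Lemma circulant_unit (F : fieldType) (p h s H : nat) (z : F) (th e : nat -> F) :
  p \in [pchar F] -> h.-primitive_root z -> H = (h * p ^ s)%N -> (0 < H)%N ->
  (forall k, th (k + H)%N = th k) -> (forall l, \sum_(k < H) th k * (z ^+ l) ^+ k != 0) ->
  (forall i, (i < H)%N -> \sum_(j < H) e j * th (i + j).+1 = 0) ->
  forall j, (j < H)%N -> e j = 0.
Proof.
move=> pF hz HE H0 thH thz eth.
case: H HE H0 thH thz eth => // H HE _ thH thz eth.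
pose S : 'M[F]_H.+1 := \matrix_(i, j) ((j == (i.+1 %% H.+1)%N :> nat)%:R).
pose v : 'cV[F]_H.+1 := \col_j e j.
have SX k i : (S ^+ k *m v) i 0 = e ((i + k) %% H.+1)%N.
  elim: k i => [|k IH] i; first by rewrite mul1mx mxE addn0 modn_small.
  rewrite exprS -mulmxE -mulmxA mxE (bigD1 (inord (i.+1 %% H.+1))) //= big1 => [|j jn].
    by rewrite addr0 IH mxE inordK ?ltn_pmod // eqxx mul1r modnDml addSnnS.
  rewrite mxE; case: eqP => [jE|]; last by rewrite mul0r.
  by move: jn; rewrite -val_eqE /= inordK ?ltn_pmod // jE eqxx.
pose P : {poly F} := \poly_(k < H.+1) th k.
have hP : horner_mx S P *m v = 0.
  rewrite /P poly_def rmorph_sum /= mulmx_suml; apply/colP => m; rewrite summxE [RHS]mxE.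
  (* Row [m] of [P(S) v] is the hypothesis for [i = H - m], reindexed by [j = m + k] modulo
     [H.+1]. *)
  have mH := ltn_ord m; have iH : (H - m < H.+1)%N by rewrite ltnS leq_subr.
  rewrite -[RHS](eth _ iH) [RHS](reindex (fun k : 'I_H.+1 => inord ((m + k) %% H.+1))) /=; last first.
    exists (fun k : 'I_H.+1 => inord ((k + (H.+1 - m)) %% H.+1)) => k _; apply: val_inj => /=.
      rewrite !inordK ?ltn_pmod // ?inordK ?ltn_pmod // modnDml.
      have -> : (m + k + (H.+1 - m) = k + H.+1)%N by lia.
      by rewrite modnDr modn_small.
    rewrite !inordK ?ltn_pmod // ?inordK ?ltn_pmod // modnDmr.
    have -> : (m + (k + (H.+1 - m)) = k + H.+1)%N by lia.
    by rewrite modnDr modn_small.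
  apply: eq_bigr => k _; rewrite linearZ /= rmorphXn /= horner_mx_X -scalemxAl [LHS]mxE SX.
  rewrite inordK ?ltn_pmod // mulrC; congr (_ * _).
  have perK a b : th (a + b * H.+1)%N = th a by elim: b => [|b IHb]; rewrite ?addn0 // mulSn addnCA addnC thH.
  rewrite -(perK k 1%N) mul1n.
  have [lt|ge] := ltnP (m + k) H.+1.
    by rewrite modn_small //; congr th; lia.
  have -> : ((m + k) %% H.+1 = m + k - H.+1)%N.
    by rewrite -{1}(subnK ge) modnDr modn_small //; have := ltn_ord k; lia.
  by rewrite thH; congr th; lia.
have SH : S ^+ H.+1 *m v = v.
  by apply/colP => i; rewrite SX mxE modnDr modn_small.
have cop : coprimep P ('X^(h * p ^ s) - 1).
  apply: (coprimep_Xn_sub_1 s pF hz) => l.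
  by rewrite /root horner_poly; exact: thz.
rewrite -HE in cop; have [u uE] := Bezout_eq1_coprimepP _ _ cop.
have := congr1 (fun q => horner_mx S q *m v) uE.
rewrite /= rmorphD !rmorphM rmorphB /= rmorphXn /= horner_mx_X !rmorph1 -!mulmxE mulmxDl -!mulmxA hP mulmx0.
rewrite mulmxBl SH mul1mx subrr mulmx0 addr0 => v0 j jH.
by have := congr1 (fun w : 'cV_ _ => w (inord j) 0) v0; rewrite !mxE inordK.
Qed.


(** * Lifting the exponent *)

Lemma dvdz_expB (d a b : int) n : (d %| a - b)%Z -> (d %| a ^+ n - b ^+ n)%Z.
Proof. by move=> ab; rewrite subrXX; exact: dvdz_mulr. Qed.

Lemma expD_mod2 (a d : int) n :
  (d ^+ 2 %| (a + d) ^+ n.+1 - a ^+ n.+1 - n.+1%:Z * d * a ^+ n)%Z.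
Proof.
elim: n => [|n IH]; first by rewrite !expr1 expr0 (_ : _ - _ = 0) ?dvdz0 //; ring.
have -> : (a + d) ^+ n.+2 - a ^+ n.+2 - n.+2%:Z * d * a ^+ n.+1 =
  (a + d) * ((a + d) ^+ n.+1 - a ^+ n.+1 - n.+1%:Z * d * a ^+ n) + d ^+ 2 * (n.+1%:Z * a ^+ n).
  rewrite [(a + d) ^+ n.+2]exprS ![a ^+ n.+2]exprS [a ^+ n.+1]exprS (intS n.+1).
  by move: ((a + d) ^+ n.+1) (a ^+ n) => y z; ring.
by apply: rpredD; [exact: dvdz_mull|exact: dvdz_mulr].
Qed.

Lemma exp1D_mod3 (x : int) n : (x ^+ 3 %| (1 + x) ^+ n - 1 - n%:Z * x - 'C(n, 2)%:Z * x ^+ 2)%Z.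
Proof.
elim: n => [|n IH]; first by rewrite expr0 (_ : _ - _ = 0) ?dvdz0 //= bin0n /=; ring.
have -> : (1 + x) ^+ n.+1 - 1 - n.+1%:Z * x - 'C(n.+1, 2)%:Z * x ^+ 2 =
  (1 + x) * ((1 + x) ^+ n - 1 - n%:Z * x - 'C(n, 2)%:Z * x ^+ 2) + x ^+ 3 * 'C(n, 2)%:Z.
  by rewrite exprS binS bin1 PoszD intS; move: ((1 + x) ^+ n) => y; ring.
by apply: rpredD; [exact: dvdz_mull|exact: dvdz_mulr].
Qed.

Lemma lte_up (p : nat) (q : int) x y : prime p -> (p %| q)%Z -> (q %| x - y)%Z ->
  (p%:Z * q %| x ^+ p - y ^+ p)%Z.
Proof.
move=> pp pq /dvdzP[k kE]; have -> : x = y + k * q by rewrite -kE addrC subrK.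
have := expD_mod2 y (k * q) p.-1; rewrite prednK ?prime_gt0 // => H.
have -> : (y + k * q) ^+ p - y ^+ p = ((y + k * q) ^+ p - y ^+ p - p%:Z * (k * q) * y ^+ p.-1) + p%:Z * q * (k * y ^+ p.-1) by ring.
apply: rpredD; last exact: dvdz_mulr.
apply: dvdz_trans H; case/dvdzP: pq => r ->.
by apply/dvdzP; exists (k ^+ 2 * r); ring.
Qed.

(** Each step extracts one factor [p] from [d] by the first-order expansion, then replaces [(q, u)]
    by [(q p, v)] where [(1 + q u)^p = 1 + q p v]. The higher terms must not spoil that [v] is prime
    to [p]; this is where [p = 2] needs [4 | q]. *)
Lemma lte_down (p : nat) (q u : int) s d : prime p -> (p %| q)%Z -> q != 0 ->
  (odd p || (4 %| q)%Z) ->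
  ~~ (p %| u)%Z -> (q * (p ^ s)%:Z %| (1 + q * u) ^+ d - 1)%Z -> (p ^ s %| d)%N.
Proof.
move=> pp pq q0 qp; elim: s d q q0 u pq qp => [|s IH] d q q0 u pq qp pu H; first by rewrite dvd1n.
have pd : (p %| d)%N.
  case: d H => // d H.
  have H2 := expD_mod2 1 (q * u) d; rewrite !expr1n mulr1 in H2.
  have : (q * p%:Z %| d.+1%:Z * (q * u))%Z.
    have -> : d.+1%:Z * (q * u) = ((1 + q * u) ^+ d.+1 - 1) - ((1 + q * u) ^+ d.+1 - 1 - d.+1%:Z * (q * u)) by ring.
    apply: rpredB.
      by apply: dvdz_trans H; rewrite expnS PoszM mulrA dvdz_mulr.
    apply: dvdz_trans H2; case/dvdzP: pq => r rE; apply/dvdzP; exists (r * u ^+ 2).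
    have -> : (q * u) ^+ 2 = q * u ^+ 2 * q by ring.
    by rewrite {2}rE; ring.
  case/dvdzP => k kE; have : (p %| d.+1%:Z * u)%Z.
    by apply/dvdzP; exists k; apply: (mulfI q0); rewrite mulrCA kE; ring.
  by rewrite dvdzE abszM /= Euclid_dvdM // => /orP[//|pu']; move: pu; rewrite dvdzE /= pu'.
have [d' dE] := dvdnP pd; subst d; rewrite expnSr dvdn_pmul2r ?prime_gt0 //.
have [v [vE pv]] : exists v, (1 + q * u) ^+ p = 1 + (q * p%:Z) * v /\ ~~ (p %| v)%Z.
  case: (boolP (odd p)) qp => [op _|/(prime_oddPn pp) p2 /= /dvdzP[r rE]]; last first.
    exists (u + p%:Z * (r * u ^+ 2)); split; first by rewrite p2 rE; ring.
    apply/negP => pv; move/negP: pu; apply.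
  by have := rpredB pv (dvdz_mulr (r * u ^+ 2) (dvdzz p)); rewrite addrK.
  have /dvdzP[w wE] := exp1D_mod3 (q * u) p; have /dvdzP[r rE] := pq.
  have /dvdzP[b bE] : (p %| 'C(p, 2)%:Z)%Z.
    have p2 : (0 < 2 < p)%N := odd_prime_gt2 op pp.
    by rewrite dvdzE; exact: (prime_dvd_bin pp p2).
  exists (u + p%:Z * (w * r ^+ 2 * u ^+ 3 + b * r * u ^+ 2)); split.
    have -> : (1 + q * u) ^+ p = ((1 + q * u) ^+ p - 1 - p%:Z * (q * u) - 'C(p, 2)%:Z * (q * u) ^+ 2) + 1 + p%:Z * (q * u) + 'C(p, 2)%:Z * (q * u) ^+ 2 by ring.
    have E3 : (q * u) ^+ 3 = q * (r * p%:Z) ^+ 2 * u ^+ 3 by rewrite -rE; ring.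
    have E2 : (q * u) ^+ 2 = q * (r * p%:Z) * u ^+ 2 by rewrite -rE; ring.
    by rewrite wE bE E3 E2; ring.
  apply/negP => pv; move/negP: pu; apply.
  by have := rpredB pv (dvdz_mulr (w * r ^+ 2 * u ^+ 3 + b * r * u ^+ 2) (dvdzz p)); rewrite addrK.
apply: (IH d' (q * p%:Z) _ v) => //.
- by rewrite mulf_neq0 //; have := prime_gt0 pp; lia.
- exact: dvdz_mull.
- by case/orP: qp => [->//|/dvdz_mulr ->]; rewrite orbT.
- by move: H; rewrite mulnC exprM vE expnS PoszM mulrA.
Qed.

(** * Integral Stickelberger coefficients and their distribution relations *)

Definition crep (m : nat) (c : int) (k : nat) : int := (c ^+ k %% m)%Z.
(** This is [m^2 (B_2(x) - 1/6)] at [x] the fractional part of [c^k / m]. *)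
Definition beta (m : nat) (c : int) (k : nat) : int := crep m c k * (crep m c k - m%:Z).
(** The image of the sequence [beta / 2m] under [c^2 - X], with [X] acting as the shift; the
    division is exact by [thetaP]. *)
Definition theta (m : nat) (c : int) (k : nat) : int :=
  ((c ^+ 2 * beta m c k - beta m c k.+1) %/ (m%:Z *+ 2))%Z.

Lemma half_int (n : int) : exists k : int, n * (n + 1) = k *+ 2.
Proof.
have [m [->|->]] : exists m : int, n = m *+ 2 \/ n = m *+ 2 + 1 by exists (n %/ 2)%Z; lia.
  by exists (m * (m *+ 2 + 1)); ring.
by exists ((m *+ 2 + 1) * (m + 1)); ring.
Qed.

Section Theta.
Variables (m : nat) (c : int).
Hypothesis m0 : (0 < m)%N.
Local Notation a := (crep m c).
Let mz : m%:Z != 0. Proof. by lia. Qed.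

Lemma crep_bounds k : 0 <= a k < m%:Z.
Proof. by rewrite modz_ge0 //= ltz_pmod //; lia. Qed.

Lemma crep_mod k : (m %| c ^+ k - a k)%Z.
Proof. by rewrite -eqz_mod_dvd modz_mod. Qed.

Definition cquo k : int := ((c * a k) %/ m)%Z.

Lemma crepS k : a k.+1 = c * a k - m%:Z * cquo k.
Proof.
have := divz_eq (c * a k) m; rewrite -/(cquo k) /crep modzMmr -exprS => ->.
by rewrite [m%:Z * _]mulrC addrC addKr.
Qed.

(** With [a_(k+1) = c a_k - m q_k] the terms in [a_k^2] cancel, and the rest is divisible by [2 m]
    because [c (c - 1)] and [q_k (q_k + 1)] are even. *)
Lemma thetaE k (d f : int) : c * (c - 1) = d *+ 2 -> cquo k * (cquo k + 1) = f *+ 2 ->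
  theta m c k = a k * (c * cquo k - d) - m%:Z * f /\
  c ^+ 2 * beta m c k - beta m c k.+1 = m%:Z *+ 2 * theta m c k.
Proof.
move=> dE fE; have E : c ^+ 2 * beta m c k - beta m c k.+1 =
    (m%:Z *+ 2) * (a k * (c * cquo k - d) - m%:Z * f).
  transitivity (m%:Z * (2 * a k * c * cquo k - a k * (d *+ 2) - m%:Z * (f *+ 2))); last by ring.
  by rewrite -dE -fE /beta crepS; ring.
have m2 : m%:Z *+ 2 != 0 by lia.
have tE : theta m c k = a k * (c * cquo k - d) - m%:Z * f by rewrite /theta E mulKz.
by rewrite tE E.
Qed.

Lemma thetaP k : c ^+ 2 * beta m c k - beta m c k.+1 = m%:Z *+ 2 * theta m c k.
Proof.
have [d dE] := half_int (c - 1); rewrite subrK mulrC in dE.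
by have [f fE] := half_int (cquo k); case: (thetaE dE fE).
Qed.

(** The form [x (x - m)] is invariant under [x -> m - x], so [beta] sees [c^k] only up to sign. This
    is why indices live modulo half the order of the unit group. *)
Lemma beta_congr k x : (m %| c ^+ k - x)%Z || (m %| c ^+ k + x)%Z -> 0 <= x < m%:Z ->
  beta m c k = x * (x - m%:Z).
Proof.
move=> /orP[H|H] /andP[x0 xm].
  by rewrite /beta /crep; move: H; rewrite -eqz_mod_dvd => /eqP ->; rewrite modz_small // x0.
have : (m %| c ^+ k - - x)%Z by rewrite opprK.
rewrite /beta /crep -eqz_mod_dvd => /eqP ->.
have [->|xn] := eqVneq x 0; first by rewrite oppr0 mod0z !mul0r.
have -> : ((- x) %% m)%Z = m%:Z - x.
  have -> : - x = (-1) * m%:Z + (m%:Z - x) by ring.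
  by rewrite modzMDl modz_small //; lia.
by ring.
Qed.

Lemma beta_eq k l : (m %| c ^+ k - c ^+ l)%Z || (m %| c ^+ k + c ^+ l)%Z -> beta m c k = beta m c l.
Proof.
move=> H; apply: beta_congr (crep_bounds l); have := crep_mod l.
case/orP: H => H H2; apply/orP; [left|right].
  by have := rpredD H H2; rewrite addrA subrK.
by have := rpredB H H2; rewrite opprB addrCA addrA [_ + a l]addrC addrA addrK; rewrite addrC.
Qed.

End Theta.

Lemma sum_quad (a m L : int) n : 6 * (\sum_(r < n) (a + r%:Z * m) * (a + r%:Z * m - L)) =
  6 * n%:Z * a ^+ 2 + 6 * a * m * n%:Z * (n%:Z - 1) + m ^+ 2 * (n%:Z - 1) * n%:Z * (2 * n%:Z - 1)
  - 6 * n%:Z * L * a - 3 * L * m * n%:Z * (n%:Z - 1).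
Proof.
elim: n => [|n IH]; first by rewrite big_ord0; ring.
by rewrite big_ord_recr /= mulrDr IH intS; ring.
Qed.

Lemma sum_ord_mul (V : nmodType) (F : nat -> V) n h :
  \sum_(k < n * h) F k = \sum_(q < n) \sum_(k < h) F (k + q * h)%N.
Proof.
elim: n => [|n IH]; first by rewrite !big_ord0.
rewrite big_ord_recr /= -IH -!(big_mkord xpredT F) mulSnr (big_cat_nat (leq0n _) (leq_addr _ _)) /=.
congr (_ + _); rewrite -{1}[(n * h)%N]add0n big_addn addKn.
by rewrite (big_mkord xpredT (fun k => F (k + n * h)%N)).
Qed.

Section Levels.
Variables (p : nat) (c : int) (M H : nat -> nat).
Hypotheses (pp : prime p) (M0 : forall t, (0 < M t)%N) (MS : forall t, M t.+1 = (p * M t)%N).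
Hypotheses (H0 : forall t, (0 < H t)%N) (HS : forall t, (0 < t)%N -> H t.+1 = (p * H t)%N).
Hypothesis cp : ~~ (p %| c)%Z.
Hypothesis cM : forall t, coprimez (M t) c.
Hypothesis cH : forall t, (M t %| c ^+ H t - 1)%Z || (M t %| c ^+ H t + 1)%Z.
Hypothesis cinj : forall t i j, (i < H t)%N -> (j < H t)%N ->
  (M t %| c ^+ i - c ^+ j)%Z || (M t %| c ^+ i + c ^+ j)%Z -> i = j.

Lemma cHq t q k : (M t %| c ^+ (k + q * H t) - c ^+ k)%Z || (M t %| c ^+ (k + q * H t) + c ^+ k)%Z.
Proof.
elim: q => [|q IH]; first by rewrite addn0 subrr dvdz0.
rewrite mulSnr addnA exprD; set x := c ^+ (k + _) in IH *; set y := c ^+ H t; set z := c ^+ k in IH *.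
have := cH t; rewrite -/y => h.
have e1 : x * y - z = x * (y - 1) + (x - z) by ring.
have e2 : x * y - z = x * (y + 1) - (x + z) by ring.
have e3 : x * y + z = x * (y - 1) + (x + z) by ring.
have e4 : x * y + z = x * (y + 1) - (x - z) by ring.
case/orP: IH => u; case/orP: h => v.
- by apply/orP; left; rewrite e1; apply: rpredD => //; exact: dvdz_mull.
- by apply/orP; right; rewrite e4; apply: rpredB => //; exact: dvdz_mull.
- by apply/orP; right; rewrite e3; apply: rpredD => //; exact: dvdz_mull.
- by apply/orP; left; rewrite e2; apply: rpredB => //; exact: dvdz_mull.
Qed.

Lemma beta_per t k q : beta (M t) c (k + q * H t) = beta (M t) c k.
Proof. by apply: (beta_eq (M0 t)); exact: cHq. Qed.

Lemma theta_per t k q : theta (M t) c (k + q * H t) = theta (M t) c k.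
Proof. by rewrite /theta -addSn !beta_per. Qed.

(** The distribution relation of [B_2]. Up to sign, the residues of [c^(k + q H_t)] modulo [M_(t+1)]
    are the [p] lifts [a_0 + r M_t] of the residue of [c^k] modulo [M_t]; [cinj] makes [q -> r]
    injective, and the sum over [r] is a polynomial identity. *)
Lemma beta_distr t k : (0 < t)%N ->
  6 * \sum_(q < p) beta (M t.+1) c (k + q * H t) =
  6 * p%:Z * beta (M t) c k - (M t)%:Z ^+ 2 * p%:Z * (p%:Z ^+ 2 - 1).
Proof.
move=> t0; set m := M t; set a0 := crep m c k.
have p0 := prime_gt0 pp.
have mE : (M t.+1)%:Z = p%:Z * m%:Z by rewrite MS PoszM.
have mz : m%:Z != 0 by have := M0 t; rewrite -/m; lia.
pose P (q r : 'I_p) := (M t.+1 %| c ^+ (k + q * H t) - (a0 + r%:Z * m%:Z))%Z ||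
   (M t.+1 %| c ^+ (k + q * H t) + (a0 + r%:Z * m%:Z))%Z.
have /fin_all_exists[r rP] : forall q, exists r, P q r.
  move=> q.
  suff main (x : int) : (m %| x - a0)%Z -> exists r : 'I_p, (M t.+1 %| x - (a0 + r%:Z * m%:Z))%Z.
    have ka := crep_mod m c k; rewrite -/a0 in ka.
    have := cHq t q k; rewrite -/m => /orP[h|h].
      have [|r rP] := main (c ^+ (k + q * H t)); last by exists r; rewrite /P rP.
      by have := rpredD h ka; rewrite addrA subrK.
    have [|r rP] := main (- c ^+ (k + q * H t)); last first.
      exists r; rewrite /P orbC -[X in (_ %| X)%Z || _]opprK rpredN.
      by rewrite opprD rP.
    have -> : - c ^+ (k + q * H t) - a0 = (c ^+ k - a0) - (c ^+ (k + q * H t) + c ^+ k) by ring.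
    by rewrite rpredB.
  move=> /dvdzP[y yE]; have yp : (`|(y %% p)%Z| < p)%N.
    have pz : p%:Z != 0 by lia.
    by have := modz_ge0 y pz; have := ltz_pmod y (_ : 0 < p%:Z); lia.
  exists (Ordinal yp) => /=; rewrite gez0_abs ?modz_ge0 //; last by lia.
  apply/dvdzP; exists (y %/ p)%Z; rewrite opprD addrA yE {1}(divz_eq y p) mE; ring.
have rI : injective r.
  move=> q q' rqq'; have := rP q; have := rP q'; rewrite /P rqq'; set X := a0 + _ => h1 h2.
  have : (M t.+1 %| c ^+ k * (c ^+ (q * H t) - c ^+ (q' * H t)))%Z || (M t.+1 %| c ^+ k * (c ^+ (q * H t) + c ^+ (q' * H t)))%Z.
    rewrite mulrBr mulrDr -!exprD; move: h1 h2; set y := c ^+ (k + q * H t); set y' := c ^+ (k + q' * H t); move=> h1 h2; move: h1 h2.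
    case/orP=> h1; case/orP=> h2.
    - apply/orP; left; have -> : y - y' = (y - X) - (y' - X) by ring.
      exact: (rpredB h2 h1).
    - apply/orP; right; have -> : y + y' = (y + X) + (y' - X) by ring.
      exact: (rpredD h2 h1).
    - apply/orP; right; have -> : y + y' = (y - X) + (y' + X) by ring.
      exact: (rpredD h2 h1).
    - apply/orP; left; have -> : y - y' = (y + X) - (y' + X) by ring.
      exact: (rpredB h2 h1).
  have cop : coprimez (M t.+1) (c ^+ k) by apply: coprimezXr; exact: cM.
  rewrite !(Gauss_dvdzr _ cop) => h.
  have lt (s : 'I_p) : (s * H t < H t.+1)%N by rewrite HS // ltn_pmul2r // H0.
  have /eqP := cinj (lt q) (lt q') h.
  by rewrite eqn_pmul2r ?H0 // => /eqP qq; apply: val_inj.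
have [a00 a0m] : 0 <= a0 /\ a0 < m%:Z by apply/andP; exact: (crep_bounds c (M0 t)).
rewrite (eq_bigr (fun q => (a0 + (r q)%:Z * m%:Z) * (a0 + (r q)%:Z * m%:Z - p%:Z * m%:Z))); last first.
  move=> q _; rewrite -mE; apply: (beta_congr (M0 t.+1)); first exact: rP.
  apply/andP; split; first by apply: addr_ge0 => //; apply: mulr_ge0; lia.
  have rq := ltn_ord (r q); rewrite mE.
  have : (r q)%:Z * m%:Z + m%:Z <= p%:Z * m%:Z.
    by rewrite -[X in _ + X]mul1r -mulrDl ler_wpM2r //; lia.
  lia.
rewrite -(reindex_inj rI (P := xpredT) (F := fun r : 'I_p => (a0 + r%:Z * m%:Z) * (a0 + r%:Z * m%:Z - p%:Z * m%:Z))).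
by rewrite sum_quad /beta -/a0; ring.
Qed.

(** The constant left over, divided by 12, is a multiple of [p] under the hypothesis [c24] below, so
    modulo [p] the coefficients [theta] satisfy an exact distribution relation. *)
Lemma theta_distr t k : (0 < t)%N ->
  12 * \sum_(q < p) theta (M t.+1) c (k + q * H t) =
  12 * theta (M t) c k - (c ^+ 2 - 1) * (p%:Z ^+ 2 - 1) * (M t)%:Z.
Proof.
move=> t0; have m0 : (M t.+1)%:Z != 0 by have := M0 t.+1; lia.
apply: (mulfI m0).
transitivity (6 * \sum_(q < p) (M t.+1)%:Z *+ 2 * theta (M t.+1) c (k + q * H t)).
  by rewrite -mulr_sumr; ring.
under eq_bigr do rewrite -(thetaP _ (M0 _)) -addSn.
rewrite sumrB -mulr_sumr mulrBr beta_distr //.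
transitivity (c ^+ 2 * (6 * \sum_(q < p) beta (M t.+1) c (k + q * H t)) - (6 * p%:Z * beta (M t) c k.+1 -
  (M t)%:Z ^+ 2 * p%:Z * (p%:Z ^+ 2 - 1))); first by ring.
rewrite beta_distr // MS PoszM.
transitivity (6 * p%:Z * (c ^+ 2 * beta (M t) c k - beta (M t) c k.+1) - (c ^+ 2 - 1) * (p%:Z ^+ 2 - 1) * (p%:Z * (M t)%:Z ^+ 2)).
  by ring.
by rewrite (thetaP _ (M0 t)); ring.
Qed.

Local Notation F := 'F_p.
Let pF : p \in [pchar F]. Proof. exact: pchar_Fp. Qed.

Lemma dvdz_Fp (x : int) : (p %| x)%Z = (x%:~R == 0 :> F).
Proof. by rewrite (dvdz_pcharf pF). Qed.

Definition V t (l : F) : F := \sum_(k < H t) (theta (M t) c k)%:~R * l ^+ k.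

Hypothesis c24 : forall t, (0 < t)%N -> (12 * p%:Z %| (c ^+ 2 - 1) * (p%:Z ^+ 2 - 1) * (M t)%:Z)%Z.

Lemma theta_distr_Fp t k : (0 < t)%N ->
  \sum_(q < p) (theta (M t.+1) c (k + q * H t))%:~R = (theta (M t) c k)%:~R :> F.
Proof.
move=> t0; have [x xE] := dvdzP (c24 t0).
have : \sum_(q < p) theta (M t.+1) c (k + q * H t) = theta (M t) c k - p%:Z * x.
  by apply: (mulfI (_ : 12 != 0 :> int)) => //; rewrite theta_distr // xE; ring.
move=> /(congr1 (fun z : int => z%:~R : F)); rewrite rmorph_sum /= => ->.
by rewrite rmorphB rmorphM /= -pmulrn pchar_Fp_0 // mul0r subr0.
Qed.

(** At an [H_t]-th root of unity the terms of index [k + q H_t] collect, and the distribution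
    relation lowers the level. The powers of [c^2] in [F_p] are such roots for every [t > 0], so
    nonvanishing has to be checked at level 1 only. *)
Lemma V_level t l : (0 < t)%N -> l ^+ H t = 1 -> V t.+1 l = V t l.
Proof.
move=> t0 l1; rewrite /V HS // (sum_ord_mul (fun k => (theta (M t.+1) c k)%:~R * l ^+ k)) exchange_big /=.
apply: eq_bigr => k _; rewrite -theta_distr_Fp // mulr_suml; apply: eq_bigr => q _.
by rewrite exprD mulnC exprM l1 expr1n mulr1.
Qed.

Variable h : nat.
Hypothesis hz : h.-primitive_root ((c ^+ 2)%:~R : F).
Hypothesis hH : exists s, H 1 = (h * p ^ s)%N.
Hypothesis V1 : forall l, V 1 ((c ^+ 2)%:~R ^+ l) != 0.

Lemma H_form t : (0 < t)%N -> exists s, H t = (h * p ^ s)%N.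
Proof.
case: t => // t _; elim: t => [|t [s IH]]; first exact: hH.
by exists s.+1; rewrite HS // IH expnS mulnCA.
Qed.

Lemma theta_unit t (e : nat -> int) : (0 < t)%N ->
  (forall i, (i < H t)%N -> (p %| \sum_(j < H t) e j * theta (M t) c (i + j).+1)%Z) ->
  forall j, (j < H t)%N -> (p %| e j)%Z.
Proof.
move=> t0 eth; have [s sE] := H_form t0.
have Vt l : V t ((c ^+ 2)%:~R ^+ l) != 0.
  case: t t0 {eth s sE} => // t _; elim: t => [|t IH]; first exact: V1.
  rewrite V_level //; have [s ->] := @H_form t.+1 isT.
  by rewrite -exprM mulnCA exprM (prim_expr_order hz) expr1n.
move=> j jH; rewrite dvdz_Fp; apply/eqP.
apply: (@circulant_unit F p h s (H t) _ (fun k => (theta (M t) c k)%:~R) (fun j => (e j)%:~R) pF hz sE (H0 t)) jH.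
- by move=> k; have := theta_per t k 1; rewrite mul1n => ->.
- exact: Vt.
- move=> i iH; have := eth i iH; rewrite dvdz_Fp rmorph_sum /= => /eqP eth0.
  rewrite -[RHS]eth0; by apply: eq_bigr => j' _; rewrite rmorphM.
Qed.

End Levels.

(** ** Bernoulli numbers and power sums *)

Lemma size_bernoulli_seq n : size (bernoulli_seq n) = n.
Proof. by elim: n => //= n IH; rewrite size_rcons IH. Qed.

Lemma nth_bernoulli_seq n k : (k < n)%N -> (bernoulli_seq n)`_k = bernoulli k.
Proof.
elim: n => // n IH; rewrite ltnS leq_eqVlt => /orP[/eqP ->//|kn].
by rewrite -IH //= nth_rcons size_bernoulli_seq kn.
Qed.

Lemma bernoulli0 : bernoulli 0 = 1. Proof. by []. Qed.

Lemma bernoulli_rec m : (0 < m)%N -> \sum_(k < m.+1) 'C(m.+1, k)%:R * bernoulli k = 0.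
Proof.
case: m => // m _; rewrite big_ord_recr /= {2}/bernoulli /= -/(bernoulli_seq m.+1).
rewrite nth_rcons size_bernoulli_seq ltnn eqxx.
have -> : 'C(m.+2, m.+1)%:R = m.+2%:R :> rat by rewrite binSn.
rewrite mulNr mulrN mulrA mulfV ?pnatr_eq0 // mul1r; apply/eqP; rewrite subr_eq0; apply/eqP.
by apply: eq_bigr => k _; rewrite -(nth_bernoulli_seq (ltn_ord k)).
Qed.

Definition psum (n m : nat) : int := \sum_(a < n) a%:Z ^+ m.

Lemma psum_rec n m : \sum_(k < m.+1) 'C(m.+1, k)%:Z * psum n k = n%:Z ^+ m.+1.
Proof.
under eq_bigr do rewrite /psum mulr_sumr.
rewrite exchange_big /=; elim: n => [|n IH]; first by rewrite big_ord0 expr0n.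
rewrite big_ord_recr /= IH intS exprDn [RHS]big_ord_recr /= expr1n mul1r [RHS]addrC; congr (_ + _); last first.
  by apply: eq_bigr => k _; rewrite expr1n mul1r -mulr_natl natz.
by rewrite binn.
Qed.

Definition pint (p : nat) (x : rat) := exists u v : int, ~~ (p %| v)%Z /\ x = u%:~R / v%:~R.

Section PInt.
Variable p : nat.
Hypothesis pp : prime p.

Let pv0 (v : int) : ~~ (p %| v)%Z -> v%:~R != 0 :> rat.
Proof. by apply: contraNneq => /eqP; rewrite intr_eq0 => /eqP ->; rewrite dvdz0. Qed.

Lemma prime_dvdzM (x y : int) : (p %| x * y)%Z = (p %| x)%Z || (p %| y)%Z.
Proof. by rewrite !dvdzE abszM Euclid_dvdM. Qed.

Lemma pint_int (x : int) : pint p x%:~R.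
Proof.
exists x, 1; rewrite divr1; split=> //; rewrite dvdzE /= dvdn1.
by rewrite neq_ltn prime_gt1 ?orbT.
Qed.

Lemma pintM x y : pint p x -> pint p y -> pint p (x * y).
Proof.
move=> [u [v [pv ->]]] [u' [v' [pv' ->]]]; exists (u * u'), (v * v').
by rewrite prime_dvdzM negb_or pv pv' !rmorphM mulf_div.
Qed.

Lemma pintB x y : pint p x -> pint p y -> pint p (x - y).
Proof.
move=> [u [v [pv ->]]] [u' [v' [pv' ->]]]; exists (u * v' - u' * v), (v * v').
rewrite prime_dvdzM negb_or pv pv'; split=> //.
have := pv0 pv; have := pv0 pv'; rewrite !(rmorphB, rmorphM) /= => h h'; field.
by rewrite h h'.
Qed.

Lemma pint_sum (n : nat) (F : 'I_n -> rat) : (forall i, pint p (F i)) -> pint p (\sum_i F i).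
Proof.
move=> Fp; apply: (big_ind (pint p)) => [|x y xp yp|i _]; last exact: Fp.
  exact: (pint_int 0).
by rewrite -[y]opprK; apply: pintB => //; rewrite -[- y]sub0r; apply: pintB => //; exact: (pint_int 0).
Qed.

Lemma pint_div x (n : int) : ~~ (p %| n)%Z -> pint p (n%:~R * x) -> pint p x.
Proof.
move=> pn H; have -> : x = (1%:~R / n%:~R) * (n%:~R * x) by rewrite mulrA divfK ?mul1r ?pv0.
by apply: pintM => //; exists 1, n.
Qed.

(* both sequences satisfy the same recursion modulo p^2 *)
Lemma psum_bernoulli m : (m.+1 < p)%N ->
  pint p (((psum p m)%:~R - p%:R * bernoulli m) / p%:R ^+ 2).
Proof.
have p0 : p%:R != 0 :> rat by rewrite pnatr_eq0 -lt0n prime_gt0.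
elim/ltn_ind: m => m IH mp; have [->|m0] := posnP m.
  rewrite bernoulli0 mulr1 /psum; under eq_bigr do rewrite expr0.
  rewrite sumr_const card_ord natz -pmulrn subrr mul0r; exact: (pint_int 0).
apply: (@pint_div _ m.+1%:Z).
  by rewrite dvdzE /= gtnNdvd.
have E : \sum_(k < m.+1) 'C(m.+1, k)%:R * (((psum p k)%:~R - p%:R * bernoulli k) / p%:R ^+ 2) =
   (p%:Z ^+ m.-1)%:~R.
  transitivity ((\sum_(k < m.+1) ('C(m.+1, k)%:Z * psum p k)%:~R - p%:R * (\sum_(k < m.+1) 'C(m.+1, k)%:R * bernoulli k)) / p%:R ^+ 2 : rat).
    rewrite mulr_sumr -sumrB mulr_suml; apply: eq_bigr => k _.
    by rewrite rmorphM /= -pmulrn; ring.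
  rewrite bernoulli_rec // mulr0 subr0 -rmorph_sum /= psum_rec.
  rewrite -{1}(prednK m0) !exprS !rmorphM /= rmorphXn /= -!pmulrn; field.
  by [].
move: E; rewrite big_ord_recr /= -{2}[m]/m binSn => /eqP; rewrite addrC eq_sym -subr_eq => /eqP.
rewrite -[m.+1%:R]/(m.+1%:~R) => <-.
apply: pintB; first exact: pint_int.
apply: pint_sum => k; apply: pintM; first exact: (pint_int 'C(m.+1, k)%:Z).
by apply: IH => //; have := ltn_ord k; lia.
Qed.

(** If [p^2] divided the power sum, [psum_bernoulli] would make [B_m / p] integral at [p], and [p]
    would divide the numerator of [B_m]. *)
Lemma psum_regular m : (m.+1 < p)%N -> ~~ (p%:Z %| numq (bernoulli m))%Z ->
  ~~ ((p%:Z ^+ 2) %| psum p m)%Z.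
Proof.
have p0 : p%:R != 0 :> rat by rewrite pnatr_eq0 -lt0n prime_gt0.
move=> /psum_bernoulli H; apply: contraNN => /dvdzP[k kE].
have : pint p (bernoulli m / p%:R).
  have -> : bernoulli m / p%:R = k%:~R - ((psum p m)%:~R - p%:R * bernoulli m) / p%:R ^+ 2.
    by rewrite kE rmorphM rmorphXn /= -pmulrn; field.
  by apply: pintB => //; exact: pint_int.
move=> [u [v [pv E]]]; set b := bernoulli m in E *.
have v0 := pv0 pv; have d0 : (denq b)%:~R != 0 :> rat by rewrite intr_eq0 denq_eq0.
have : numq b * v = p%:Z * u * denq b.
  apply: (intr_inj (R := rat)); rewrite !rmorphM /=.
  have bE : b = (numq b)%:~R / (denq b)%:~R by rewrite divq_num_den.
  have : (numq b)%:~R = b * (denq b)%:~R :> rat by rewrite {2}bE divfK.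
  move=> ->; have -> : b = p%:R * (u%:~R / v%:~R) by rewrite -E mulrC divfK.
  by rewrite -pmulrn; field.
move=> h; have : (p %| numq b * v)%Z by rewrite h -mulrA dvdz_mulr.
by rewrite prime_dvdzM (negPf pv) orbF.
Qed.

End PInt.

(** * Voronoi congruences and regularity at level [p] *)

Section OddLevelOne.
Variables (p : nat) (c : int).
Hypotheses (pp : prime p) (podd : odd p).
Local Notation F := 'F_p.
Hypothesis cz : (p.-1).-primitive_root (c%:~R : F).
Hypothesis c2 : ~~ (p%:Z ^+ 2 %| c ^+ p.-1 - 1)%Z.
Local Notation a := (crep p c).
Local Notation z := (c%:~R : F).
Let p0 : (0 < p)%N := prime_gt0 pp.
Let p2 : (2 < p)%N := odd_prime_gt2 podd pp.
Let h := (p.-1)./2.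

Let hE : (h * 2 = p.-1)%N.
Proof. by rewrite muln2 halfK; case: p podd p0 => //= n; rewrite /= => /negPf ->; rewrite subn0. Qed.

Lemma pFp (x : int) : (p %| x)%Z = (x%:~R == 0 :> F).
Proof. exact: (dvdz_Fp pp). Qed.

Lemma p_Fp : p%:Z%:~R = 0 :> F.
Proof. by apply/eqP; rewrite -pFp dvdzz. Qed.

Lemma crep_Fp k : (a k)%:~R = z ^+ k :> F.
Proof.
by apply/esym/eqP; rewrite -subr_eq0 -rmorphXn -rmorphB /= -pFp; exact: crep_mod.
Qed.

Lemma z_neq0 : z != 0.
Proof.
apply/eqP => z0; have := prim_expr_order cz.
have pn : (p.-1 == 0%N) = false by apply/eqP; lia.
by rewrite z0 expr0n pn => /eqP; rewrite eq_sym oner_eq0.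
Qed.

Lemma crep_per k : a (k + p.-1)%N = a k.
Proof.
apply/eqP; rewrite eqz_mod_dvd pFp rmorphB !rmorphXn /= exprD (prim_expr_order cz) mulr1.
by rewrite subrr.
Qed.

Lemma theta_per_half k : theta p c (k + h) = theta p c k.
Proof.
have ch : (p %| c ^+ h - 1)%Z || (p %| c ^+ h + 1)%Z.
  rewrite -prime_dvdzM // -subr_sqr expr1n -exprM hE pFp rmorphB rmorphXn /= (prim_expr_order cz).
  by rewrite subrr.
have bp k' : beta p c (k' + h) = beta p c k'.
  apply: beta_eq => //; rewrite exprD -{2 4}[c ^+ k']mulr1 -mulrBr -mulrDr.
  by case/orP: ch => H; apply/orP; [left|right]; exact: dvdz_mull.
by rewrite /theta -addSn !bp.
Qed.

Lemma sum_crep (g : int -> int) : \sum_(k < p.-1) g (a k) = \sum_(1 <= x < p) g x.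
Proof.
have aP k : (0 < `|a k|%N < p)%N.
  have /andP[a0 ap] := crep_bounds c p0 k.
  have : a k != 0.
    apply/eqP => a00; have := crep_Fp k; rewrite a00 => /esym/eqP.
    by rewrite expf_eq0 (negPf z_neq0) andbF.
  by move=> an; lia.
pose f (k : 'I_p.-1) : 'I_p := Ordinal (andP (aP k)).2.
have fI : {in [set: 'I_p.-1] &, injective f}.
  move=> k l _ _ /(congr1 val) /= kl; apply: val_inj; apply/eqP.
  have ak (i : nat) : a i = `|a i|%N by have /andP[? ?] := crep_bounds c p0 i; rewrite gez0_abs.
  have : z ^+ k = z ^+ l by rewrite -!crep_Fp ak kl -ak.
  by move/eqP; rewrite (eq_prim_root_expr cz) !modn_small.
transitivity (\sum_(x in [set f k | k in [set: 'I_p.-1]]) g (x : nat)%:Z).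
  rewrite big_imset //=; apply: eq_big => k; first by rewrite inE.
  by move=> _; have /andP[? ?] := crep_bounds c p0 k; rewrite gez0_abs.
have -> : [set f k | k in [set: 'I_p.-1]] = [set x : 'I_p | (0 < x)%N].
  apply/eqP; rewrite eqEcard; apply/andP; split.
    by apply/subsetP => x /imsetP[k _ ->]; rewrite inE /=; case/andP: (aP k).
  rewrite card_in_imset // cardsT card_ord.
  have -> : [set x : 'I_p | (0 < x)%N] = [set~ Ordinal p0].
    by apply/setP => x; rewrite !inE -val_eqE /= lt0n.
  by rewrite cardsC1 card_ord.
rewrite (big_nat_widenl 1 0) // big_mkord; apply: eq_bigl => x; rewrite inE //.
Qed.

Lemma sum_crep_psum j : (0 < j)%N -> \sum_(k < p.-1) a k ^+ j = psum p j.
Proof.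
move=> j0; rewrite (sum_crep (fun x => x ^+ j)) /psum -(big_mkord xpredT (fun x : nat => x%:Z ^+ j)).
by rewrite (big_ltn p0) expr0n gtn_eqF // add0r.
Qed.

Definition vQ j : int := \sum_(k < p.-1) cquo p c k * a k ^+ j.

(** Expand [a_(k+1) = c a_k - p q_k] to first order modulo [p^2] and sum over a full period, where
    the shift of [k] leaves the power sum unchanged. *)
Lemma voronoi j : (p%:Z ^+ 2 %| (1 - c ^+ j.+1) * (\sum_(k < p.-1) a k ^+ j.+1) + j.+1%:Z * p%:Z * c ^+ j * vQ j)%Z.
Proof.
have -> : (1 - c ^+ j.+1) * (\sum_(k < p.-1) a k ^+ j.+1) + j.+1%:Z * p%:Z * c ^+ j * vQ j =
  \sum_(k < p.-1) (a k.+1 ^+ j.+1 - (c * a k) ^+ j.+1 - j.+1%:Z * (- (p%:Z * cquo p c k)) * (c * a k) ^+ j).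
  have shift : \sum_(k < p.-1) a k.+1 ^+ j.+1 = \sum_(k < p.-1) a k ^+ j.+1.
    case: (p.-1) crep_per => [|n] per; first by rewrite !big_ord0.
    by rewrite big_ord_recr /= -(add0n n.+1) per addrC [RHS]big_ord_recl.
  have e1 : \sum_(k < p.-1) (c * a k) ^+ j.+1 = c ^+ j.+1 * \sum_(k < p.-1) a k ^+ j.+1.
    by rewrite mulr_sumr; apply: eq_bigr => k _; rewrite exprMn.
  have e2 : \sum_(k < p.-1) j.+1%:Z * (- (p%:Z * cquo p c k)) * (c * a k) ^+ j =
      - (j.+1%:Z * p%:Z * c ^+ j * vQ j).
    by rewrite -mulrN -sumrN mulr_sumr; apply: eq_bigr => k _; rewrite exprMn; ring.
  by rewrite !sumrB shift e1 e2; ring.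
apply: rpred_sum => k _; have := expD_mod2 (c * a k) (- (p%:Z * cquo p c k)) j.
by rewrite -crepS // sqrrN; apply: dvdz_trans; rewrite exprMn; exact: dvdz_mulr.
Qed.

Hypothesis reg : forall k, (2 <= k <= p - 3)%N -> ~~ odd k -> ~~ (p%:Z %| numq (bernoulli k))%Z.

(** If [p | vQ j], the congruence gives [p^2 | (c^(j+1) - 1) S]. For [j+1 < p-1] the first factor is
    prime to [p], and regularity prevents [p^2 | S]. For [j+1 = p-1] the sum [S] is -1 modulo [p],
    and [p^2] does not divide the first factor because [c] is a primitive root modulo [p^2]. *)
Lemma vQ_unit j : odd j -> (j < p.-1)%N -> ~~ (p %| vQ j)%Z.
Proof.
move=> jodd jp; apply/negP => pQ; have := voronoi j; set S := \sum_(k < _) _ => H.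
have {}H : (p%:Z ^+ 2 %| (c ^+ j.+1 - 1) * S)%Z.
  have pQ2 : (p%:Z ^+ 2 %| j.+1%:Z * p%:Z * c ^+ j * vQ j)%Z.
    by case/dvdzP: pQ => q ->; apply/dvdzP; exists (j.+1%:Z * c ^+ j * q); ring.
  have := rpredB pQ2 H; rewrite opprD addrCA subrr addr0 -mulNr opprB; exact.
have cop (x : int) : ~~ (p %| x)%Z -> coprimez (p%:Z ^+ 2) x.
  by move=> px; rewrite coprimezXl // coprimezE /= prime_coprime // -dvdzE.
have [jlt|jge] := ltnP j.+1 p.-1.
  have pc : ~~ (p %| c ^+ j.+1 - 1)%Z.
    rewrite pFp rmorphB rmorphXn /= subr_eq0 -(prim_order_dvd cz).
    by rewrite gtnNdvd.
  move: H; rewrite Gauss_dvdzr ?cop // /S sum_crep_psum //; apply/negP.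
  apply: psum_regular => //; first by lia.
  apply: reg; last by rewrite /= jodd.
  (* [j + 1] is even and [p - 2] is odd, so [j + 1 < p - 1] already gives [j + 1 <= p - 3]. *)
  rewrite ltnS (odd_gt0 jodd) /=; have jp2 : j.+1 != (p - 2)%N.
    apply: contraTneq jodd => jE; have := congr1 odd jE; rewrite oddB ?(ltnW p2) //= podd.
    by move=> ->.
  by move: jlt jp2; clear; lia.
have jE : j.+1 = p.-1 by lia.
move: H; rewrite mulrC Gauss_dvdzr ?cop // ?jE ?(negPf c2) //.
rewrite pFp /S rmorph_sum /= jE; under eq_bigr do rewrite rmorphXn /= crep_Fp exprAC (prim_expr_order cz) expr1n.
rewrite sumr_const card_ord; apply/eqP => e.
have : (p.-1)%:R + 1 = 0 :> F by rewrite natr1 prednK // pchar_Fp_0.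
by rewrite e add0r => /eqP; rewrite oner_eq0.
Qed.

(** Modulo [p] one has [theta_k = a_k (c q_k - d)]. So, doubled to a full period, the sum at
    [z^(2l)] is [z] times the sum of [q_k w^k] minus [d] times the sum of [w^k], with
    [w = z^(2l+1)]. An odd power of a primitive root is not 1, so the geometric sum vanishes, and
    the other sum is [vQ j] modulo [p] with [j] odd. *)
Lemma V1_odd l : \sum_(k < h) (theta p c k)%:~R * ((c ^+ 2)%:~R ^+ l) ^+ k != 0 :> F.
Proof.
apply/eqP => V0; set lam : F := (c ^+ 2)%:~R ^+ l in V0.
have lamE : lam = z ^+ (l * 2) by rewrite /lam rmorphXn /= -exprM mulnC.
have lamh : lam ^+ h = 1 by rewrite lamE -exprM -mulnA [(2 * h)%N]mulnC hE mulnC exprM (prim_expr_order cz) expr1n.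
have V2 : \sum_(k < p.-1) (theta p c k)%:~R * lam ^+ k = 0.
  rewrite -hE mulnC (sum_ord_mul (fun k => (theta p c k)%:~R * lam ^+ k)) !big_ord_recl big_ord0 /= addr0.
  rewrite [X in _ + X](eq_bigr (fun k : 'I_h => (theta p c k)%:~R * lam ^+ k)); last first.
    by move=> k _; rewrite mul1n theta_per_half exprD lamh mulr1.
  rewrite [X in X + _](eq_bigr (fun k : 'I_h => (theta p c k)%:~R * lam ^+ k)); last first.
    by move=> k _; rewrite mul0n addn0.
  by rewrite V0 addr0.
pose w : F := z ^+ (l * 2).+1.
have w1 : w ^+ p.-1 = 1 by rewrite /w exprAC (prim_expr_order cz) expr1n.
have wn : w != 1.
  rewrite /w -(prim_order_dvd cz); apply/negP => /dvdnP[q] /(congr1 odd).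
  by rewrite /= -hE !oddM /= !andbF.
have geo : \sum_(k < p.-1) w ^+ k = 0.
  by apply/eqP; have /eqP := subrX1 w p.-1; rewrite w1 subrr eq_sym mulf_eq0 subr_eq0 (negPf wn).
have [d dE] := half_int (c - 1); rewrite subrK mulrC in dE.
have Q0 : \sum_(k < p.-1) (cquo p c k)%:~R * w ^+ k = 0 :> F.
  have : z * (\sum_(k < p.-1) (cquo p c k)%:~R * w ^+ k) - d%:~R * (\sum_(k < p.-1) w ^+ k) = 0.
    rewrite -[RHS]V2 !mulr_sumr -sumrB; apply: eq_bigr => k _.
    have [f fE] := half_int (cquo p c k).
    have [-> _] := thetaE p0 dE fE.
    have := crep_Fp k; move: (crep p c k) => ak akE.
    rewrite rmorphB !rmorphM rmorphB !rmorphM /= p_Fp mul0r subr0 akE lamE.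
    have -> : w ^+ k = z ^+ k * z ^+ (l * 2) ^+ k by rewrite /w exprSr exprMn mulrC.
    by ring.
  by rewrite geo mulr0 subr0 => /eqP; rewrite mulf_eq0 (negPf z_neq0) => /eqP.
pose j := ((l %% h) * 2).+1.
have h0 : (0 < h)%N by move: hE p2; lia.
have jp : (j < p.-1)%N by have := ltn_pmod l h0; rewrite /j -hE; lia.
have wj : w = z ^+ j.
  apply/eqP; rewrite (eq_prim_root_expr cz) /j -hE; apply/eqP.
  rewrite {1}(divn_eq l h) mulnDl -mulnA -!addnS -modnDm modnMl add0n modn_mod //.
have := @vQ_unit j _ jp; rewrite /j /= oddM andbF => /(_ isT).
rewrite pFp -/j /vQ rmorph_sum /= => /negP; apply; apply/eqP; rewrite -[RHS]Q0.
by apply: eq_bigr => k _; rewrite rmorphM rmorphXn /= crep_Fp wj exprAC.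
Qed.

End OddLevelOne.

(** * Levels, and generators of the units modulo signs *)

(** The shift by 2 for [p = 2] makes 5 generate the units modulo signs with [hlev 2 t = 2^t], so
    that both cases start from [hlev p 0 = 1]. *)
Definition lev (p t : nat) : nat := if p == 2%N then (2 ^ t.+2)%N else (p ^ t)%N.
(* half the order of the unit group modulo lev p t *)
Definition hlev (p t : nat) : nat :=
  if p == 2%N then (2 ^ t)%N else if t is s.+1 then ((p.-1)./2 * p ^ s)%N else 1%N.

(** The arithmetic of [p] and [c] in a form common to [p = 2] and odd [p]; regularity enters only
    through [ld_unit]. In [ld_geom] the ratio 1 accounts for [p = 3] at [t = 0], where [hlev] does
    not grow. *)
Record leveldata (p : nat) (c : int) : Prop := LevelData {
  ld_prime : prime p;
  ld_coprime : forall t, coprimez (lev p t) c;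
  ld_H : forall t, (lev p t %| c ^+ hlev p t - 1)%Z || (lev p t %| c ^+ hlev p t + 1)%Z;
  ld_inj : forall t i j, (i < hlev p t)%N -> (j < hlev p t)%N ->
    (lev p t %| c ^+ i - c ^+ j)%Z || (lev p t %| c ^+ i + c ^+ j)%Z -> i = j;
  ld_sq : forall t, ((lev p t)%:Z *+ 2 %| c ^+ 2 * (c ^+ (hlev p t * 2) - 1))%Z;
  ld_geom : forall t, exists rho, hlev p t.+1 = (rho * hlev p t)%N /\
    (rho = 1%N \/ (p %| \sum_(q < rho) (c ^+ 2) ^+ (q * hlev p t))%Z);
  ld_unit : forall t (e : nat -> int), (0 < t)%N ->
    (forall i, (i < hlev p t)%N ->
       (p %| \sum_(j < hlev p t) e j * theta (lev p t) c (i + j).+1)%Z) ->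
    forall j, (j < hlev p t)%N -> (p %| e j)%Z }.

Section LevBasics.
Variable p : nat.
Hypothesis pp : prime p.

Lemma lev_gt0 t : (0 < lev p t)%N.
Proof. by rewrite /lev; case: ifP => _; rewrite expn_gt0 ?(prime_gt0 pp). Qed.

Lemma levS t : lev p t.+1 = (p * lev p t)%N.
Proof. by rewrite /lev; case: eqP => [->|_]; rewrite expnS. Qed.

Lemma p_dvd_lev t : (0 < t)%N -> (p %| lev p t)%N.
Proof. by case: t => // t _; rewrite levS dvdn_mulr. Qed.

Lemma hlev_gt0 t : (0 < hlev p t)%N.
Proof.
rewrite /hlev; case: eqP => [_|/eqP p2]; first by rewrite expn_gt0.
case: t => // t; rewrite muln_gt0 expn_gt0 (prime_gt0 pp) andbT.
by have := prime_gt1 pp; case: (p) p2 => [|[|[|n]]].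
Qed.

Lemma hlevS t : (0 < t)%N -> hlev p t.+1 = (p * hlev p t)%N.
Proof.
rewrite /hlev; case: eqP => [-> _|_]; first by rewrite expnS.
by case: t => // t _; rewrite expnS mulnCA.
Qed.

Lemma hlev0 : hlev p 0 = 1%N. Proof. by rewrite /hlev; case: eqP. Qed.

Lemma lev_gt2 t : (0 < t)%N -> (2 < lev p t)%N.
Proof.
case: t => // t _; rewrite levS; have p1 := prime_gt1 pp; rewrite /lev.
case: eqP => [->|/eqP p2].
  have e0 : (0 < 2 ^ t)%N by rewrite expn_gt0.
  by rewrite !expnS; lia.
have : (0 < p ^ t)%N by rewrite expn_gt0 prime_gt0.
have : (2 < p)%N by rewrite ltn_neqAle eq_sym p2.
by move=> a b; apply: (leq_trans a); rewrite leq_pmulr.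
Qed.

Lemma totient_lev t : (0 < t)%N -> totient (lev p t) = (2 * hlev p t)%N.
Proof.
case: t => // t _; rewrite /lev /hlev; case: eqP => [_|/eqP p2].
  by rewrite totient_pfactor // mul1n (expnS 2 t.+1).
rewrite totient_pfactor //= mulnA mul2n halfK.
have po : odd p by apply: contraNT p2 => /(prime_oddPn pp) ->.
have -> : odd p.-1 = false by case: (p) po => //= n /negPf.
by rewrite subn0.
Qed.

End LevBasics.

Section Generators.
Variables (p : nat) (c : int).
Hypothesis D : leveldata p c.
Let pp := ld_prime D.

(** A count: the [2 H] signed powers of [c] are distinct units modulo [M], since [M > 2], and [M]
    has totient [2 H]. *)
Lemma ld_gen t (a : int) : (0 < t)%N -> coprimez (lev p t) a ->
  exists2 i, (i < hlev p t)%N & (lev p t %| a - c ^+ i)%Z || (lev p t %| a + c ^+ i)%Z.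
Proof.
move=> t0 cop; set m := lev p t; set h := hlev p t.
have m0 : (0 < m)%N := lev_gt0 pp t; have m2 : (2 < m)%N := lev_gt2 pp t0.
have mz : m%:Z != 0 by lia.
have md (x : int) : (`|(x %% m)%Z| < m)%N.
  by have := modz_ge0 x mz; have := ltz_pmod x (_ : 0 < m%:Z); lia.
have mdE (x : int) : (`|(x %% m)%Z|%N : int) = (x %% m)%Z by rewrite gez0_abs // modz_ge0.
pose f (bi : bool * 'I_h) : 'I_m := Ordinal (md ((-1) ^+ bi.1 * c ^+ bi.2)).
have fI : injective f.
  move=> [b i] [b' i'] /(congr1 val) /= /(congr1 (fun n : nat => n : int)); rewrite !mdE => /eqP.
  rewrite eqz_mod_dvd => H.
  have ii : i = i' :> nat.
    apply: (ld_inj D (ltn_ord i) (ltn_ord i')); rewrite -/m; move: H.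
    case: b; case: b'; rewrite ?expr0 ?expr1 ?mul1r ?mulN1r ?opprK => H.
    - by move: H; rewrite addrC -opprB rpredN -opprB rpredN => ->.
    - by move: H; rewrite -opprD rpredN => ->; rewrite orbT.
    - by rewrite H orbT.
    - by rewrite H.
  have {}ii : i = i' by apply: val_inj.
  rewrite ii in H *; congr (_, _); apply/eqP; apply: contraTT H => bb.
  have {}bb : (-1) ^+ b * c ^+ i' - (-1) ^+ b' * c ^+ i' = (-1) ^+ b * (c ^+ i' * 2).
    by case: b b' bb => [] [] //= _; rewrite ?expr0 ?expr1; ring.
  apply/negP => H; have {H} : (m %| c ^+ i' * 2)%Z.
    by move: H; rewrite bb; case: (b); rewrite ?expr0 ?expr1 ?mul1r ?mulN1r ?rpredN.
  rewrite Gauss_dvdzr; last by apply: coprimezXr; exact: (ld_coprime D).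
  by rewrite dvdzE /= gtnNdvd.
have cmod x : coprimez m x -> coprime m `|(x %% m)%Z|%N by rewrite /coprimez -gcdz_modr.
have fA bi : coprime m (f bi).
  have : coprimez m ((-1) ^+ bi.1 * c ^+ bi.2).
    rewrite coprimezMr; apply/andP; split; last by apply: coprimezXr; exact: (ld_coprime D).
    by case: (bi.1); rewrite coprimezE /= coprimen1.
  exact: cmod.
have cA : #|[set x : 'I_m | coprime m x]| = (2 * h)%N.
  rewrite -(totient_lev pp t0) totient_count_coprime big_mkord -sum1_card [LHS]big_mkcond /=.
  by apply: eq_bigr => x _; rewrite inE; case: (coprime m x).
have fim : [set f bi | bi in [set: bool * 'I_h]] = [set x : 'I_m | coprime m x].
  apply/eqP; rewrite eqEcard; apply/andP; split.
    by apply/subsetP => x /imsetP[bi _ ->]; rewrite inE fA.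
  by rewrite card_imset // cardsT card_prod card_bool card_ord cA.
have : Ordinal (md a) \in [set x : 'I_m | coprime m x].
  by rewrite inE /=; exact: cmod.
rewrite -fim => /imsetP[[b i] _ /(congr1 val) /= /(congr1 (fun n : nat => n : int))].
rewrite !mdE => /eqP; rewrite eqz_mod_dvd => H; exists i => //.
by move: H; case: b; rewrite ?expr0 ?expr1 ?mul1r ?mulN1r ?opprK => ->; rewrite ?orbT.
Qed.

End Generators.

Lemma dvd_sub_sqr (d x y : int) : (d %| x - y)%Z || (d %| x + y)%Z -> (d %| x ^+ 2 - y ^+ 2)%Z.
Proof. by rewrite subr_sqr => /orP[] h; [exact: dvdz_mulr|exact: dvdz_mull]. Qed.

(** In [F_2] every power of 25 is 1, so a single value decides: at level 8 the coefficients are -10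
    and -23, with odd sum. *)
Lemma V1_two (l : nat) :
  \sum_(k < 2) (theta 8 5 k)%:~R * (((5 : int) ^+ 2)%:~R ^+ l) ^+ k != 0 :> 'F_2.
Proof.
have -> : ((5 : int) ^+ 2)%:~R = 1 :> 'F_2 by apply/eqP; vm_compute.
rewrite big_ord_recl big_ord_recl big_ord0 !expr1n !mulr1 addr0.
have -> : theta 8 5 (ord0 : 'I_2) = -10 by vm_compute.
have -> : theta 8 5 (lift ord0 (ord0 : 'I_1)) = -23 by vm_compute.
by vm_compute.
Qed.

Lemma leveldata2 : leveldata 2 5.
Proof.
have H0 t : ((2 ^ t.+2)%N %| (5 : int) ^+ (2 ^ t) - 1)%Z.
  elim: t => [|t IH]; first by [].
  have := @lte_up 2 (2 ^ t.+2)%N _ _ isT _ IH; rewrite expr1n -exprM -expnSr.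
  by rewrite (expnS 2 t.+2) PoszM; apply; rewrite expnS PoszM dvdz_mulr.
have cop t : coprimez (2 ^ t.+2)%N 5 by rewrite coprimezE /= coprimeXl.
have inj t i j : (i < 2 ^ t)%N -> (j < 2 ^ t)%N -> ((2 ^ t.+2)%N %| (5 : int) ^+ i - 5 ^+ j)%Z || ((2 ^ t.+2)%N %| (5 : int) ^+ i + 5 ^+ j)%Z -> i = j.
  wlog ij : i j / (i <= j)%N.
    move=> H i2 j2 d; have [ij|/ltnW ij] := leqP i j; first exact: H.
    apply/esym; apply: H => //; case/orP: d => d; apply/orP; [left|right].
      by rewrite -rpredN opprB.
    by rewrite addrC.
  have mod4 k : (4 %| (5 : int) ^+ k - 1)%Z.
    by rewrite -[X in _ - X](expr1n _ k); apply: dvdz_expB.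
  (* A sum of two powers of 5 is 2 modulo 4, so only the minus sign can occur. *)
  move=> i2 j2 /orP[d|d]; last first.
    have d4 : (4 %| (5 : int) ^+ i + 5 ^+ j)%Z.
      by apply: dvdz_trans d; rewrite !expnS mulnA PoszM dvdz_mulr.
    have := rpredB d4 (rpredD (mod4 i) (mod4 j)).
    by have -> : (5 : int) ^+ i + 5 ^+ j - (5 ^+ i - 1 + (5 ^+ j - 1)) = 2 by ring.
  have {}d : ((2 ^ t.+2)%N %| (5 : int) ^+ (j - i) - 1)%Z.
    rewrite -(@Gauss_dvdzr _ (5 ^+ i)); last by apply: coprimezXr; exact: cop.
    by rewrite mulrBr -exprD subnKC // mulr1 -rpredN opprB.
  have := @lte_down 2 4 1 t (j - i) isT isT isT isT isT.
  rewrite mulr1 -[1 + 4]/(5 : int) -PoszM => /(_ _).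
  rewrite (_ : (4 * 2 ^ t)%N = (2 ^ t.+2)%N); last by rewrite !expnS mulnA.
  move=> /(_ d) dd; have : (j - i < 2 ^ t)%N by apply: leq_ltn_trans j2; exact: leq_subr.
  by case: (posnP (j - i)%N) => [ji0 _|ji0 lt]; [lia|move/(dvdn_leq ji0): dd; lia].
have H1 t : ((2 ^ t.+2)%N%:Z *+ 2 %| (5 : int) ^+ 2 * (5 ^+ (2 ^ t * 2) - 1))%Z.
  have -> : (2 ^ t.+2)%N%:Z *+ 2 = (2 ^ t.+3)%N by rewrite (expnS 2 t.+2) mulr2n; lia.
  by apply: dvdz_mull; have := H0 t.+1; rewrite (expnSr 2 t).
split=> //; rewrite /lev /hlev /=.
- by move=> t; rewrite H0.
- move=> t; exists 2; split; first by rewrite expnS.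
  right; rewrite !big_ord_recl big_ord0 mul0n expr0 addr0 mul1n /= -exprM.
  rewrite -[1 + _](subrK 2) ; apply: rpredD => //.
  have -> : 1 + (5 : int) ^+ (2 * 2 ^ t) - 2 = 5 ^+ (2 * 2 ^ t) - 1 by ring.
  by rewrite -[X in _ - X](expr1n _ (2 * 2 ^ t)); apply: dvdz_expB.
- apply: (@theta_unit 2 5 (fun t => (2 ^ t.+2)%N) (fun t => (2 ^ t)%N) isT _ _ _ _ isT _ _ _ _ 1) => //.
  + by move=> t; rewrite expn_gt0.
  + by move=> t; rewrite expn_gt0.
  + by move=> t _; rewrite expnS.
  + by move=> t; rewrite H0.
  + by move=> t _; apply: dvdz_mulr; apply: dvdz_mulr.
  + have -> : ((5 : int) ^+ 2)%:~R = 1 :> 'F_2 by apply/eqP.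
    by apply/andP; split=> //; apply/forallP => i; rewrite ord1 unity_rootE expr1 eqxx.
  + by exists 1%N.
  + exact: V1_two.
Qed.

(** Of the lifts [g] and [g + p] of a primitive root modulo [p], at least one is a primitive root
    modulo [p^2]; adding [p^2] then adjusts the parity. An even [c] supplies the factor 2 in
    [ld_sq]. *)
Lemma odd_generator p : prime p -> odd p -> exists c : int, [/\ (2 %| c)%Z,
  (p.-1).-primitive_root (c%:~R : 'F_p) & ~~ (p%:Z ^+ 2 %| c ^+ p.-1 - 1)%Z].
Proof.
move=> pp po; have p2 := odd_prime_gt2 po pp.
have p1 : (0 < p.-1)%N by lia.
pose rs := enum (predC1 (0 : 'F_p)).
have /hasP[z _ zP] : has (p.-1).-primitive_root rs.
  apply: has_prim_root => //.
  - apply/allP => x; rewrite mem_enum unity_rootE inE => x0.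
    have xp := expf_card x; rewrite card_Fp // in xp.
    have /eqP : x * x ^+ p.-1 = x by rewrite -exprS prednK //; lia.
    by rewrite -subr_eq0 -{3}[x]mulr1 -mulrBr mulf_eq0 (negPf x0) subr_eq0.
  - by rewrite enum_uniq.
  - by rewrite -cardE cardC1 card_Fp.
have Fint (x y : int) : (x%:~R == y%:~R :> 'F_p) = (p %| x - y)%Z.
  by rewrite (dvdz_Fp pp) rmorphB subr_eq0.
pose g : int := (z : nat).
have gz : g%:~R = z :> 'F_p by rewrite /g -pmulrn natr_Zp.
have pg : ~~ (p %| g)%Z.
  rewrite (dvdz_Fp pp) gz; apply/eqP => z0; have := prim_expr_order zP.
  by rewrite z0 expr0n gtn_eqF // => /eqP; rewrite eq_sym oner_eq0.
have [g' [g'z g'2]] : exists g' : int, g'%:~R = z :> 'F_p /\ ~~ (p%:Z ^+ 2 %| g' ^+ p.-1 - 1)%Z.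
  have [H|H] := boolP (p%:Z ^+ 2 %| g ^+ p.-1 - 1)%Z; last by exists g.
  exists (g + p%:Z); split; first by rewrite rmorphD /= gz -pmulrn pchar_Fp_0 // addr0.
  apply/negP => H2; have := expD_mod2 g p%:Z p.-2; rewrite prednK; last by lia.
  move=> H3; have := rpredB (rpredB H2 H) H3.
  have -> : (g + p%:Z) ^+ p.-1 - 1 - (g ^+ p.-1 - 1) - ((g + p%:Z) ^+ p.-1 - g ^+ p.-1 - p.-1%:Z * p%:Z * g ^+ p.-2) =
    p%:Z * (p.-1%:Z * g ^+ p.-2) by ring.
  rewrite expr2 dvdz_mul2l; last by lia.
  rewrite prime_dvdzM // dvdzE /= gtnNdvd //=; last by lia.
  apply/negP; move: pg; rewrite !(dvdz_Fp pp) rmorphXn /=; apply: contraNN.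
  by rewrite expf_eq0 => /andP[].
have [q [gq|gq]] : exists q : int, g' = q *+ 2 \/ g' = q *+ 2 + 1 by exists (g' %/ 2)%Z; lia.
  by exists g'; split=> //; [apply/dvdzP; exists q; rewrite gq; ring|rewrite g'z].
exists (g' + p%:Z ^+ 2); split.
- have [r rE] : exists r : int, p%:Z = r *+ 2 + 1.
    by exists (p./2); have := odd_double_half p; rewrite po; lia.
  by rewrite gq rE; apply/dvdzP; exists (q + r ^+ 2 *+ 2 + r *+ 2 + 1); ring.
- by rewrite rmorphD rmorphXn /= -pmulrn pchar_Fp_0 // expr0n addr0 g'z.
- apply: contraNN g'2 => H.
  have H2 : (p%:Z ^+ 2 %| (g' + p%:Z ^+ 2) ^+ p.-1 - g' ^+ p.-1)%Z.
    by apply: dvdz_expB; rewrite addrC addKr.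
  have := rpredB H H2.
  by have -> : (g' + p%:Z ^+ 2) ^+ p.-1 - 1 - ((g' + p%:Z ^+ 2) ^+ p.-1 - g' ^+ p.-1) = g' ^+ p.-1 - 1 by ring.
Qed.

Lemma leveldata_odd p : prime p -> regular_prime p -> exists c, leveldata p c.
Proof.
move=> pp [_ po reg]; have p2 := odd_prime_gt2 po pp.
have [c [ceven cz c2]] := odd_generator pp po; exists c.
have pn2 : (p == 2%N) = false by apply/eqP; lia.
have lE t : lev p t = (p ^ t)%N by rewrite /lev pn2.
have hE1 : ((p.-1)./2 * 2 = p.-1)%N.
  rewrite muln2 halfK (_ : odd p.-1 = false) ?subn0 //.
  by case: (p) po p2 => //= n /negPf.
have h0 : (0 < (p.-1)./2)%N by lia.
have hS t : hlev p t.+1 = ((p.-1)./2 * p ^ t)%N by rewrite /hlev pn2.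
have pc : ~~ (p %| c)%Z.
  rewrite (dvdz_Fp pp); apply/eqP => z0; have := prim_expr_order cz.
  have p1 : (0 < p.-1)%N by lia.
  by rewrite z0 expr0n gtn_eqF // => /eqP; rewrite eq_sym oner_eq0.
have copX t k : coprimez (p ^ t)%N (c ^+ k).
  by apply: coprimezXr; rewrite coprimezE /= coprimeXl // prime_coprime // -[`|c|%N]/(`|c|%N) -dvdzE.
have cF : (p %| c ^+ (p.-1) - 1)%Z.
  by rewrite (dvdz_Fp pp) rmorphB rmorphXn /= (prim_expr_order cz) subrr.
(* [e] is a sign and [p] is odd, so [e^p = e] and lifting the exponent carries the congruence from
   one level to the next. *)
have H1 t : exists2 e : int, e ^+ 2 = 1 & ((p ^ t)%N %| c ^+ hlev p t - e)%Z.
  case: t => [|t]; first by exists 1; rewrite ?expr1n // expn0 dvd1z.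
  have [e e2 eP] : exists2 e : int, e ^+ 2 = 1 & (p %| c ^+ (p.-1)./2 - e)%Z.
    have : (p %| c ^+ (p.-1)./2 - 1)%Z || (p %| c ^+ (p.-1)./2 + 1)%Z.
      by rewrite -prime_dvdzM // -subr_sqr expr1n -exprM hE1.
    case/orP => H; first by exists 1; rewrite ?expr1n.
    by exists (- 1); rewrite ?sqrrN ?expr1n ?opprK.
  have ep : e ^+ p = e.
    by rewrite -(odd_double_half p) po exprD expr1 -mul2n exprM e2 expr1n mulr1.
  exists e => //; elim: t => [|t IH]; first by rewrite hS expn0 muln1 expn1.
  have := @lte_up p (p ^ t.+1)%N _ _ pp _ IH; rewrite ep -exprM !hS (expnS p t.+1) PoszM.
  by rewrite -mulnA -expnSr; apply; rewrite expnS PoszM dvdz_mulr.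
have sq1 t : ((p ^ t)%N %| c ^+ (hlev p t * 2) - 1)%Z.
  by have [e e2 eP] := H1 t; rewrite exprM -e2; apply: dvd_sub_sqr; rewrite eP.
have inj t i j : (i < hlev p t)%N -> (j < hlev p t)%N ->
    ((p ^ t)%N %| c ^+ i - c ^+ j)%Z || ((p ^ t)%N %| c ^+ i + c ^+ j)%Z -> i = j.
  wlog ij : i j / (i <= j)%N.
    move=> H i2 j2 d; have [ij|/ltnW ij] := leqP i j; first exact: H.
    apply/esym; apply: H => //; case/orP: d => d; apply/orP; [left|right].
      by rewrite -rpredN opprB.
    by rewrite addrC.
  case: t => [|t]; first by rewrite hlev0 !ltnS !leqn0 => /eqP -> /eqP ->.
  move=> i2 j2 /dvd_sub_sqr d.
  have {}d : ((p ^ t.+1)%N %| c ^+ ((j - i) * 2) - 1)%Z.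
    rewrite -(@Gauss_dvdzr _ (c ^+ (i * 2))); last exact: copX.
    by rewrite mulrBr -exprD -mulnDl subnKC // mulr1 !exprM -rpredN opprB.
  have dp : (p %| c ^+ ((j - i) * 2) - 1)%Z.
    by apply: dvdz_trans d; rewrite expnS PoszM dvdz_mulr.
  have : (p.-1 %| (j - i) * 2)%N.
    move: dp; rewrite (dvdz_Fp pp) rmorphB rmorphXn /= subr_eq0 => /eqP e.
    by rewrite (prim_order_dvd cz) e.
  rewrite -hE1 dvdn_pmul2r // => /dvdnP[k kE].
  have [u uE] : exists u, c ^+ p.-1 = 1 + p%:Z * u.
    by case/dvdzP: cF => u uE; exists u; rewrite mulrC -uE addrC subrK.
  have pu : ~~ (p %| u)%Z.
    apply: contraNN c2 => /dvdzP[w wE]; rewrite uE wE; apply/dvdzP; exists w; ring.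
  have := @lte_down p p%:Z u t k pp; rewrite po dvdzz => /(_ isT _ isT pu).
  have -> : p%:Z * (p ^ t)%N = (p ^ t.+1)%N by rewrite expnS PoszM.
  rewrite -uE -exprM -hE1 -mulnA (mulnC 2%N) mulnA (mulnC _ k) -kE.
  move=> /(_ _ d) pk; have pz : p%:Z != 0 by lia.
  have {}pk := pk pz; have : (hlev p t.+1 %| j - i)%N by rewrite hS kE mulnC dvdn_mul.
  have lt : (j - i < hlev p t.+1)%N by apply: leq_ltn_trans j2; exact: leq_subr.
  case: (posnP (j - i)%N) => [ji0 _|ji0]; last by rewrite gtnNdvd.
  by apply/eqP; rewrite eqn_leq ij -subn_eq0 ji0.
split=> //.
- by move=> t; rewrite lE -(expr1 c).
- move=> t; rewrite lE; have [e /eqP e2 eP] := H1 t; move: e2; rewrite sqrf_eq1.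
  by case/orP => /eqP eE; move: eP; rewrite eE ?opprK => ->; rewrite ?orbT.
- by move=> t i j; rewrite lE; exact: inj.
- move=> t; rewrite lE -mulr_natr natz.
  have [d dE] := dvdzP ceven; have [f fE] := dvdzP (sq1 t).
  by apply/dvdzP; exists (d ^+ 2 * 2 * f); rewrite fE {1}dE; ring.
(* For [t = 0] the geometric sum times [c^2 - 1] is [c^(p-1) - 1]; for [t > 0] it has [p] terms, all
   equal to 1 modulo [p]. *)
- case=> [|t].
    exists (p.-1)./2; rewrite hS hlev0 expn0 !muln1; split=> //.
    have [->|hn1] := eqVneq (p.-1)./2 1%N; [by left|right].
    have c21 : ~~ (p %| c ^+ 2 - 1)%Z.
      rewrite (dvdz_Fp pp) rmorphB rmorphXn /= subr_eq0 -(prim_order_dvd cz) gtnNdvd //.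
      by move: hE1 hn1 h0; lia.
    have : (p %| (c ^+ 2 - 1) * \sum_(q < (p.-1)./2) (c ^+ 2) ^+ (q * 1))%Z.
      under eq_bigr do rewrite muln1.
      by rewrite -subrX1 -exprM mulnC hE1.
    by rewrite prime_dvdzM // (negPf c21).
  exists p; rewrite hlevS //; split=> //; right.
  have cp q : (p %| (c ^+ 2) ^+ (q * hlev p t.+1) - 1)%Z.
    rewrite -exprM mulnCA mulnC [(2 * _)%N]mulnC exprM -[X in _ - X](expr1n _ q); apply: dvdz_expB.
    by apply: dvdz_trans (sq1 t.+1); rewrite expnS PoszM dvdz_mulr.
  have -> : \sum_(q < p) (c ^+ 2) ^+ (q * hlev p t.+1) = \sum_(q < p) ((c ^+ 2) ^+ (q * hlev p t.+1) - 1) + p%:Z.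
    by rewrite sumrB sumr_const card_ord natz subrK.
  by apply: rpredD => //; apply: rpred_sum.
- have HH t : ((p ^ t)%N %| c ^+ hlev p t - 1)%Z || ((p ^ t)%N %| c ^+ hlev p t + 1)%Z.
    have [e /eqP e2 eP] := H1 t; move: e2; rewrite sqrf_eq1.
    by case/orP => /eqP eE; move: eP; rewrite eE ?opprK => ->; rewrite ?orbT.
  move=> t e t0; rewrite lE; move: t e t0.
  apply: (@theta_unit p c (fun t => (p ^ t)%N) (hlev p) pp _ _ _ _ pc _ HH inj _ (p.-1)./2) => //.
  + by move=> t; rewrite expn_gt0 prime_gt0.
  + by move=> t; rewrite expnS.
  + exact: hlev_gt0.
  + by move=> t t0; rewrite hlevS.
  + by move=> t; rewrite -(expr1 c).
  + case=> // t _; rewrite expnS PoszM.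
    (* For [p > 3] already [12 | p^2 - 1], by residues modulo 12; for [p = 3] the factor 3 comes
       from [c^2 - 1]. *)
    have /dvdzP[k kE] : (12 %| (c ^+ 2 - 1) * (p%:Z ^+ 2 - 1))%Z.
      have [p3|p3] := eqVneq p 3.
        by move: cF; rewrite p3 => /dvdzP[x ->]; apply/dvdzP; exists (x * 2); ring.
      apply: dvdz_mull; have h3 : ~~ (3 %| p)%N by rewrite dvdn_prime2 // eq_sym.
      have [r [q [pE rE]]] : exists r q : nat, p = (12 * q + r)%N /\ [|| r == 1, r == 5, r == 7 | r == 11]%N.
        by exists (p %% 12)%N, (p %/ 12)%N; have := odd_double_half p; rewrite po; lia.
      rewrite pE; case/or4P: rE => /eqP ->; apply/dvdzP.
      * by exists (12 * q%:Z ^+ 2 + 2 * q%:Z); rewrite PoszD PoszM; ring.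
      * by exists (12 * q%:Z ^+ 2 + 10 * q%:Z + 2); rewrite PoszD PoszM; ring.
      * by exists (12 * q%:Z ^+ 2 + 14 * q%:Z + 4); rewrite PoszD PoszM; ring.
      * by exists (12 * q%:Z ^+ 2 + 22 * q%:Z + 10); rewrite PoszD PoszM; ring.
    by rewrite kE; apply/dvdzP; exists (k * (p ^ t)%N); ring.
  + rewrite rmorphXn /=; have := exp_prim_root cz 2.
    have -> : (p.-1 %/ gcdn 2 p.-1 = (p.-1)./2)%N; last by [].
    by move: hE1; set h := (p.-1)./2; move=> <-; rewrite gcdnMl mulnK.
  + by exists 0%N; rewrite hS.
  + move=> l; rewrite /V hS expn0 muln1 expn1; exact: V1_odd.
Qed.

(** * The lattice of divisors of Siegel products *)

Definition per (H : nat) (x : nat -> int) := forall k, x (k + H)%N = x k.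

Lemma perM H x q k : per H x -> x (k + q * H)%N = x k.
Proof. by move=> xH; elim: q => [|q IH]; rewrite ?addn0 // mulSnr addnA xH. Qed.

Definition cls0 (rho h : nat) (e : nat -> int) :=
  forall l, (l < h)%N -> \sum_(q < rho) e (l + q * h)%N = 0.

(** Vanishing class sums allow [g] to be replaced, on each class, by its difference from one fixed
    value. *)
Lemma cls0_dvd (rho h : nat) (e g : nat -> int) (d : int) : cls0 rho h e ->
  (forall k, (d %| g (k + h)%N - g k)%Z) -> (d %| \sum_(j < rho * h) e j * g j)%Z.
Proof.
move=> eA gd; rewrite (sum_ord_mul (fun j => e j * g j)) exchange_big /=.
apply: rpred_sum => l _.
have gq q : (d %| g (l + q * h)%N - g l)%Z.
  elim: q => [|q IH]; first by rewrite addn0 subrr dvdz0.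
  by have := rpredD (gd (l + q * h)%N) IH; rewrite addrA subrK -addnA -mulSnr.
have -> : \sum_(q < rho) e (l + q * h)%N * g (l + q * h)%N =
   \sum_(q < rho) e (l + q * h)%N * (g (l + q * h)%N - g l) + (\sum_(q < rho) e (l + q * h)%N) * g l.
  by rewrite mulr_suml -big_split /=; apply: eq_bigr => q _; ring.
by rewrite eA // mul0r addr0; apply: rpred_sum => q _; exact: dvdz_mull.
Qed.

Lemma sum_per_shift (f : nat -> int) rho h i : per (rho * h) f ->
  \sum_(q < rho) f (i + h + q * h)%N = \sum_(q < rho) f (i + q * h)%N.
Proof.
case: rho => [|rho] fp; first by rewrite !big_ord0.
rewrite big_ord_recr [RHS]big_ord_recl /= addrC mul0n addn0; congr (_ + _).
  by rewrite -addnA -mulSn -[in RHS](fp i).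
by apply: eq_bigr => q _; rewrite -addnA -mulSn.
Qed.

Section Lattice.
Variables (p : nat) (c : int).
Hypothesis D : leveldata p c.
Local Notation M := (lev p).
Local Notation H := (hlev p).
Let pp := ld_prime D.
Let p0 := prime_gt0 pp.
Let M0 t : (0 < M t)%N := lev_gt0 pp t.
Let H0 t : (0 < H t)%N := hlev_gt0 pp t.

Definition rho t : nat := (H t.+1 %/ H t)%N.

Lemma rhoE t : H t.+1 = (rho t * H t)%N.
Proof. by have [r [E _]] := ld_geom D t; rewrite /rho E mulnK. Qed.

Lemma rho_gt0 t : (0 < rho t)%N.
Proof. by have := H0 t.+1; rewrite rhoE; case: (rho t). Qed.

Lemma rho_p t : (0 < t)%N -> rho t = p.
Proof. by move=> t0; rewrite /rho hlevS // mulnK. Qed.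

Lemma rho_geom t : rho t = 1%N \/ (p %| \sum_(q < rho t) (c ^+ 2) ^+ (q * H t))%Z.
Proof. by have [r [E r1]] := ld_geom D t; have <- : r = rho t; rewrite // /rho E mulnK. Qed.

Lemma beta_per_lev t : per (H t) (beta (M t) c).
Proof. by move=> k; have := beta_per M0 (ld_H D) t k 1; rewrite mul1n. Qed.

Lemma theta_per_lev t : per (H t) (theta (M t) c).
Proof. by move=> k; have := theta_per M0 (ld_H D) t k 1; rewrite mul1n. Qed.

(** Otherwise [c] is a sign, and the exponents 0 and 1 would collide at level 2. *)
Lemma c2H_neq1 t : c ^+ (H t * 2) != 1.
Proof.
apply/eqP => c1; have c21 : c ^+ 2 = 1.
  have : `|c| ^+ (H t * 2) = 1 by rewrite -normrX c1 normr1.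
  move=> /eqP; rewrite pexpr_eq1 ?muln_gt0 ?H0 //.
  by move=> /eqP n1; rewrite -real_normK ?num_real // n1 expr1n.
have h2 : (1 < H 2)%N.
  by rewrite hlevS // (leq_trans (prime_gt1 pp)) // leq_pmulr.
have : 0%N = 1%N; last by [].
apply: (ld_inj D (H0 2) h2).
move/eqP: c21; rewrite sqrf_eq1 expr0 expr1 => /orP[] /eqP ->; first by rewrite subrr dvdz0.
by rewrite subrr dvdz0 orbT.
Qed.

(** Periodicity forces [q_i = c^(2H) q_i]. This makes [c^2 - X] injective on periodic sequences, so
    that identities between twisted differences can be lifted to the sequences themselves. *)
Lemma geometric_per0 t (q : nat -> int) : per (H t) q -> (forall i, q i.+1 = c ^+ 2 * q i) ->
  forall i, q i = 0.
Proof.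
move=> qp qS i; have qn n : q (i + n)%N = c ^+ (n * 2) * q i.
  elim: n => [|n IH]; first by rewrite addn0 mul1r.
  by rewrite addnS qS IH mulrA -exprD -mulSn.
have := qn (H t); rewrite qp => /eqP; rewrite -subr_eq0 -{1}[q i]mul1r -mulrBl mulf_eq0 subr_eq0.
by rewrite eq_sym (negPf (c2H_neq1 t)) => /eqP.
Qed.

(** Up to a scalar, [W] lists the orders at the oo-cusps of the Siegel product with exponents [e];
    [Cv] is its image under [c^2 - X], divided by [2 M_t]. *)
Definition W t (e : nat -> int) (i : nat) : int := \sum_(j < H t) e j * beta (M t) c (i + j).+1.
Definition Cv t (e : nat -> int) (i : nat) : int := \sum_(j < H t) e j * theta (M t) c (i + j).+1.

Lemma W_per t e : per (H t) (W t e).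
Proof. by move=> i; apply: eq_bigr => j _; rewrite addnAC -addSn beta_per_lev. Qed.

Lemma Cv_per t e : per (H t) (Cv t e).
Proof. by move=> i; apply: eq_bigr => j _; rewrite addnAC -addSn theta_per_lev. Qed.

Lemma W_Cv t e i : c ^+ 2 * W t e i - W t e i.+1 = (M t)%:Z *+ 2 * Cv t e i.
Proof.
rewrite /W /Cv !mulr_sumr -sumrB; apply: eq_bigr => j _.
by rewrite addSn [RHS]mulrCA -thetaP //; ring.
Qed.

Definition Acl t e := cls0 (rho t) (H t) e.

(** By [cls0_dvd] it is enough that [beta] at level [t+1] changes by multiples of [2 M_t] under a
    shift by [H_t]. The residue [a] becomes [+-a + r M_t], and the factor 2 comes from
    [M_t r (r - p)] being even. *)
Lemma W_dvd t e i : Acl t e -> ((M t)%:Z *+ 2 %| W t.+1 e i)%Z.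
Proof.
move=> eA; rewrite /W rhoE; apply: (cls0_dvd (g := fun j => beta (M t.+1) c (i + j).+1) eA) => k.
rewrite -!addSn addnA; move: (i.+1 + k)%N => {}k.
have MS : (M t.+1)%:Z = p%:Z * (M t)%:Z by rewrite levS PoszM.
have cong : exists e r : int, (e = 1 \/ e = -1) /\ crep (M t.+1) c (k + H t) = e * crep (M t.+1) c k + r * (M t)%:Z.
  have d1 j : (M t %| c ^+ j - crep (M t.+1) c j)%Z.
    by apply: dvdz_trans (crep_mod _ _ _); rewrite MS dvdz_mull.
  have := cHq (ld_H D) t 1 k; rewrite mul1n; have h1 := d1 k; have h2 := d1 (k + H t)%N.
  set a := crep (M t.+1) c k in h1 *; set a' := crep (M t.+1) c (k + H t) in h2 *.
  case/orP => h.
    have /dvdzP[r rE] : (M t %| a' - a)%Z.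
      by have := rpredD (rpredB h h2) h1; congr (_ %| _)%Z; ring.
    by exists 1, r; split; [left|rewrite -rE; ring].
  have /dvdzP[r rE] : (M t %| a' + a)%Z.
    by have := rpredB (rpredB h h2) h1; congr (_ %| _)%Z; ring.
  by exists (-1), r; split; [right|rewrite -rE; ring].
have [e' [r [e1 rE]]] := cong; rewrite /beta rE MS; move: (crep _ _ k) => a {rE cong}.
have /dvdzP[w wE] : (2 %| (M t)%:Z * (r * (r - p%:Z)))%Z.
  have [pe|po] := boolP (odd p); last first.
    have -> : p = 2%N by apply/prime_oddPn.
    by rewrite /lev /= expnS PoszM -mulrA dvdz_mulr.
  have [n nE] := half_int (r - 1).
  have -> : r * (r - p%:Z) = n *+ 2 - (p./2)%:Z *+ 2 * r.
    have pE : p%:Z = 1 + (p./2)%:Z *+ 2 by have := odd_double_half p; rewrite pe; lia.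
    by rewrite -nE pE; ring.
  by apply/dvdzP; exists ((M t)%:Z * (n - (p./2)%:Z * r)); ring.
apply/dvdzP; case: e1 => ->; [exists (a * r + w)|exists (- a * r + a * p%:Z + w)].
  have -> : (1 * a + r * (M t)%:Z) * (1 * a + r * (M t)%:Z - p%:Z * (M t)%:Z) - a * (a - p%:Z * (M t)%:Z) =
    2 * a * r * (M t)%:Z + (M t)%:Z * ((M t)%:Z * (r * (r - p%:Z))) by ring.
  by rewrite wE; ring.
have -> : (-1 * a + r * (M t)%:Z) * (-1 * a + r * (M t)%:Z - p%:Z * (M t)%:Z) - a * (a - p%:Z * (M t)%:Z) =
    - 2 * a * r * (M t)%:Z + 2 * a * p%:Z * (M t)%:Z + (M t)%:Z * ((M t)%:Z * (r * (r - p%:Z))) by ring.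
by rewrite wE; ring.
Qed.

Lemma W_cls0 t e i : Acl t e -> \sum_(q < rho t) W t.+1 e (i + q * H t)%N = 0.
Proof.
move=> eA; rewrite /W exchange_big /=.
have -> : \sum_(j < H t.+1) \sum_(q < rho t) e j * beta (M t.+1) c (i + q * H t + j).+1 =
    \sum_(j < rho t * H t) e j * \sum_(q < rho t) beta (M t.+1) c (i.+1 + j + q * H t).
  rewrite -rhoE; apply: eq_bigr => j _; rewrite mulr_sumr; apply: eq_bigr => q _.
  by rewrite addnAC -!addSn.
apply/eqP; rewrite -dvd0z.
apply: (cls0_dvd (g := fun j => \sum_(q < rho t) beta (M t.+1) c (i.+1 + j + q * H t)) eA) => k.
rewrite dvd0z subr_eq0 addnA; apply/eqP; apply: sum_per_shift.
by rewrite -rhoE; exact: beta_per_lev.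
Qed.

(** [mu] is the determinant of the matrix of [theta], prime to [p] by [ld_unit]. The adjugate solves
    the system up to [mu] and shows that the kernel is trivial. *)
Lemma unit_matrix t : (0 < t)%N ->
  exists2 mu : int, ~~ (p %| mu)%Z & forall v : nat -> int,
    (exists e, forall i, (i < H t)%N -> Cv t e i = mu * v i) /\
    (forall e, (forall i, (i < H t)%N -> Cv t e i = 0) -> forall j, (j < H t)%N -> e j = 0).
Proof.
move=> t0; pose A : 'M[int]_(H t) := \matrix_(i, j) theta (M t) c (i + j).+1.
have AE (e : nat -> int) i : (A *m \col_j e j) i 0 = Cv t e i.
  by rewrite mxE; apply: eq_bigr => j _; rewrite !mxE mulrC.
have dA : ~~ (p %| \det A)%Z.
  apply/negP; rewrite (dvdz_Fp pp) -det_map_mx => /eqP d0.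
  have : \rank (map_mx (intr : int -> 'F_p) A)^T != H t.
    by rewrite mxrank_tr -[_ == _]/(row_free _) row_free_unit unitmxE d0 unitr0.
  rewrite -[_ == _]/(row_free _) -kermx_eq0 => /rowV0Pn[u /sub_kermxP uA u0].
  have /negP := u0; apply; apply/eqP/rowP => j; rewrite mxE.
  pose e (k : nat) : int := if insub k is Some k' then ((u 0 k' : 'F_p) : nat) else 0%N.
  have eE (k : 'I_(H t)) : (e k)%:~R = u 0 k by rewrite /e valK -pmulrn natr_Zp.
  rewrite -eE; apply/eqP; rewrite -(dvdz_Fp pp); apply: (ld_unit D t0) (ltn_ord j) => i iH.
  rewrite (dvdz_Fp pp) rmorph_sum /=; apply/eqP.
  have uA0 := congr1 (fun w : 'rV_ _ => w 0 (Ordinal iH)) uA; rewrite !mxE in uA0.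
  rewrite -[RHS]uA0.
  by apply: eq_bigr => k _; rewrite rmorphM /= eE !mxE.
exists (\det A) => // v; split.
  pose e := \adj A *m \col_j v j.
  exists (fun j => if insub j is Some j' then e j' 0 else 0) => i iH.
  have := AE (fun j => if insub j is Some j' then e j' 0 else 0) (Ordinal iH) => /= <-.
  have -> : \col_j (if insub (val j) is Some j' then e j' 0 else 0) = e.
    by apply/colP => j; rewrite mxE valK.
  by rewrite /e mulmxA mul_mx_adj mul_scalar_mx !mxE.
move=> e e0 j jH; have : A *m \col_j e j = 0.
  by apply/colP => i; rewrite AE mxE e0.
move=> /(congr1 (mulmx (\adj A))); rewrite mulmxA mul_adj_mx mul_scalar_mx mulmx0.
move=> /(congr1 (fun w : 'cV_ _ => w (Ordinal jH) 0)); rewrite !mxE => /eqP; rewrite mulf_eq0 => /orP[d0|/eqP //].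
by move: dA; rewrite (eqP d0) dvdz0.
Qed.

(** The class sums of the solution satisfy the homogeneous system, because those of [v] vanish;
    hence they vanish too. *)
Lemma solve_Cv t (v : nat -> int) : per (H t.+1) v -> Acl t v ->
  exists (mu : int) e, [/\ ~~ (p %| mu)%Z, Acl t e & forall i, Cv t.+1 e i = mu * v i].
Proof.
move=> vp vA; have [mu pmu sol] := @unit_matrix t.+1 isT.
have [[e eE] _] := sol v.
have {}eE i : Cv t.+1 e i = mu * v i.
  rewrite (divn_eq i (H t.+1)) addnC (perM _ _ (@Cv_per t.+1 e)) (perM _ _ vp).
  by apply: eE; rewrite ltn_mod.
exists mu, e; split=> // l lh.
pose eb j := \sum_(q < rho t) e ((j %% H t) + q * H t)%N.
have eb0 : forall j, (j < H t.+1)%N -> eb j = 0.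
  apply: (sol v).2 => i _; rewrite /Cv rhoE (sum_ord_mul (fun j => eb j * theta (M t.+1) c (i + j).+1)).
  have -> : \sum_(q < rho t) \sum_(k < H t) eb (k + q * H t)%N * theta (M t.+1) c (i + (k + q * H t)).+1 =
     \sum_(k < H t) \sum_(q' < rho t) e (k + q' * H t)%N * \sum_(q < rho t) theta (M t.+1) c (i.+1 + (k + q' * H t) + q * H t).
    rewrite exchange_big /=; apply: eq_bigr => k _.
    have tq q' : \sum_(q < rho t) theta (M t.+1) c (i.+1 + (k + q' * H t) + q * H t) =
                 \sum_(q < rho t) theta (M t.+1) c (i.+1 + k + q * H t).
      elim: q' => [|q' <-]; first by rewrite addn0.
      rewrite mulSnr !addnA; apply: sum_per_shift; rewrite -rhoE; exact: theta_per_lev.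
    under [RHS]eq_bigr do rewrite tq.
    rewrite -mulr_suml mulr_sumr; apply: eq_bigr => q _.
    by rewrite /eb (addnC (k : nat)) modnMDl modn_small // (addnC _ (k : nat)) addnA addSn.
  rewrite exchange_big -(sum_ord_mul (fun j => e j * \sum_(q < rho t) theta (M t.+1) c (i.+1 + j + q * H t))) /=.
  under eq_bigr do rewrite mulr_sumr.
  rewrite exchange_big /= (eq_bigr (fun q : 'I_(rho t) => mu * v (i + q * H t)%N)).
    rewrite -mulr_sumr (divn_eq i (H t)); have ih := ltn_pmod i (H0 t).
    have vs q' : \sum_(q < rho t) v (i %% H t + q' * H t + q * H t)%N = 0.
      elim: q' => [|q' IH]; first by under eq_bigr do rewrite addn0; exact: vA.
      by rewrite mulSnr addnA sum_per_shift ?IH // -rhoE.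
    by under eq_bigr do rewrite [(_ * _ + _)%N]addnC; rewrite vs mulr0.
  by move=> q _; rewrite -eE /Cv -rhoE; apply: eq_bigr => j _; rewrite addnAC -!addSn.
have := eb0 l; rewrite /eb modn_small //; apply; rewrite rhoE.
by apply: (leq_trans lh); rewrite leq_pmull // rho_gt0.
Qed.

End Lattice.

Lemma last_index (i h r : nat) : (h <= i)%N -> (i < r.+1 * h)%N -> (r.+1 * h <= i.+1)%N ->
  [/\ i = (h + (r * h - 1))%N, (0 < r * h)%N & i.+1 = (0 + r.+1 * h)%N].
Proof. by rewrite mulSn; move: (r * h)%N => n; split; lia. Qed.

Section Lattice2.
Variables (p : nat) (c : int).
Hypothesis D : leveldata p c.
Local Notation M := (lev p).
Local Notation H := (hlev p).
Local Notation rho := (rho p).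
Let pp := ld_prime D.
Let p0 := prime_gt0 pp.
Let pz : p%:Z != 0. Proof. by lia. Qed.
Let M0 t : (0 < M t)%N := lev_gt0 pp t.
Let H0 t : (0 < H t)%N := hlev_gt0 pp t.
Variable T : nat.

(* sums over the classes modulo H (T - k), for a sequence of period H T *)
Fixpoint yy (k : nat) (x : nat -> int) : nat -> int :=
  if k is k'.+1 then
    fun i => \sum_(q < rho (T - k)) yy k' x (i + q * H (T - k))%N
  else x.

Lemma yy_lin k (a b : int) x z i : yy k (fun j => a * x j + b * z j) i = a * yy k x i + b * yy k z i.
Proof.
elim: k i => //= k IH i; under eq_bigr do rewrite IH.
by rewrite big_split /= -!mulr_sumr.
Qed.

Lemma yyZ k (a : int) x i : yy k (fun j => a * x j) i = a * yy k x i.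
Proof.
by elim: k i => //= k IH i; under eq_bigr do rewrite IH; rewrite -mulr_sumr.
Qed.

Lemma eq_yy k x z : x =1 z -> yy k x =1 yy k z.
Proof. by move=> xz; elim: k => //= k IH i; apply: eq_bigr => q _; rewrite IH. Qed.

Lemma yy_per k x : (k <= T)%N -> per (H T) x -> per (H (T - k)) (yy k x).
Proof.
move=> kT xp; elim: k kT => [|k IH] kT; first by rewrite subn0.
move=> i; rewrite /=; apply: (@sum_per_shift (yy k x)).
have -> : (rho (T - k.+1) * H (T - k.+1) = H (T - k))%N by rewrite -(rhoE D) subnSK.
by apply: IH; exact: ltnW.
Qed.

Lemma yy_const s k x : (0 < s)%N -> (k + s <= T)%N -> per (H s) x ->
  forall i, yy k x i = (p%:Z) ^+ k * x i.
Proof.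
move=> s0 ks xp; elim: k ks => [|k IH] ks i; first by rewrite mul1r.
have Ts : (s <= T - k.+1)%N by lia.
have xpk : per (H (T - k.+1)) x.
  move: Ts; rewrite leq_eqVlt => /orP[/eqP <- //|]; elim: (T - k.+1)%N => // n IHn.
  rewrite ltnS leq_eqVlt => /orP[/eqP <-|sn] j; first by rewrite hlevS // perM.
  by rewrite hlevS ?(leq_trans s0) ?(ltnW sn) // perM //; exact: IHn.
rewrite /= (eq_bigr (fun=> p%:Z ^+ k * x i)); last first.
  by move=> q _; rewrite IH; [rewrite perM|lia].
by rewrite sumr_const card_ord (rho_p D) ?(leq_trans s0) // exprS -mulr_natl natz mulrA.
Qed.

Lemma yy0 k j x : yy k x =1 (fun=> 0) -> yy (k + j) x =1 (fun=> 0).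
Proof.
move=> x0; elim: j => [|j IH]; first by rewrite addn0.
by move=> i; rewrite addnS /= big1 // => q _; rewrite IH.
Qed.

Definition Cond (x : nat -> int) := forall t, (0 < t < T)%N ->
  (p%:Z ^+ (2 * (T - t)).-1 %| yy (T - t) x (H t.-1))%Z /\
  forall i, (H t.-1 <= i)%N -> (i.+1 < H t)%N ->
    (p%:Z ^+ (2 * (T - t)) %| yy (T - t) x i.+1 - c ^+ 2 * yy (T - t) x i)%Z.

Lemma eq_Cond x z : x =1 z -> Cond x -> Cond z.
Proof.
move=> xz Cx t tT; have [x1 x2] := Cx t tT; split; first by rewrite -(eq_yy _ xz).
by move=> i i1 i2; rewrite -!(eq_yy _ xz); exact: x2.
Qed.

Lemma Cond_lin (a b : int) x z : Cond x -> Cond z -> Cond (fun j => a * x j + b * z j).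
Proof.
move=> Cx Cz t tT; have [x1 x2] := Cx t tT; have [z1 z2] := Cz t tT; split.
  by rewrite yy_lin; apply: rpredD; exact: dvdz_mull.
move=> i i1 i2; rewrite !yy_lin.
have := rpredD (dvdz_mull a (x2 i i1 i2)) (dvdz_mull b (z2 i i1 i2)).
by congr (_ %| _)%Z; ring.
Qed.

Lemma Cond_cancel (m : int) x : ~~ (p %| m)%Z -> Cond (fun j => m * x j) -> Cond x.
Proof.
move=> pm Cx t tT; have [x1 x2] := Cx t tT.
have cop n : coprimez (p%:Z ^+ n) m.
  by apply: coprimezXl; rewrite coprimezE /= prime_coprime.
split; first by rewrite -(Gauss_dvdzr _ (cop _)) -yyZ.
move=> i i1 i2; rewrite -(Gauss_dvdzr _ (cop _)).
by have := x2 i i1 i2; rewrite !yyZ; congr (_ %| _)%Z; ring.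
Qed.

(* the divisor of the Siegel product f_(s,e)(p^(T-s) tau) satisfies the conditions *)
Lemma Cond_siegel s e w : (0 < s <= T)%N -> Acl p s.-1 e ->
  (forall i, (M T)%:Z *+ 2 * w i = p%:Z ^+ (2 * (T - s)) * W p c s e i) ->
  Cond w /\ yy (T - s).+1 w =1 (fun=> 0).
Proof.
case: s => // s /andP[_ sT] eA wE; set n := (T - s.+1)%N in wE *.
have Mz t : (M t)%:Z *+ 2 != 0 by have := M0 t; lia.
have ME k : (k + s <= T)%N -> (M (k + s))%:Z = p%:Z ^+ k * (M s)%:Z.
  by elim: k => [|k IH] ks; rewrite ?mul1r // addSn levS PoszM IH ?exprS ?mulrA // ltnW.
have MT : (M T)%:Z = p%:Z ^+ n.+1 * (M s)%:Z by rewrite -ME; [congr (M _)%:Z|]; lia.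
have MT' : (M T)%:Z = p%:Z ^+ n * (M s.+1)%:Z by rewrite MT exprSr levS PoszM mulrA.
have pn k : p%:Z ^+ k != 0 by rewrite expf_neq0.
have wp : per (H s.+1) w.
  by move=> i; apply: (mulfI (Mz T)); rewrite !wE W_per.
have w0 i : exists w0, p%:Z * w i = p%:Z ^+ n * w0.
  have /dvdzP[v vE] := W_dvd D i eA; exists v; apply: (mulfI (pn n)); apply: (mulfI (Mz s)).
  transitivity ((M T)%:Z *+ 2 * w i); first by rewrite MT exprSr; ring.
  by rewrite wE vE mulnC exprM; ring.
have wC i : c ^+ 2 * w i - w i.+1 = p%:Z ^+ n * Cv p c s.+1 e i.
  apply: (mulfI (pn n)); apply: (mulfI (Mz s.+1)).
  transitivity (c ^+ 2 * ((M T)%:Z *+ 2 * w i) - (M T)%:Z *+ 2 * w i.+1); first by rewrite MT'; ring.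
  rewrite !wE; transitivity (p%:Z ^+ (2 * n) * (c ^+ 2 * W p c s.+1 e i - W p c s.+1 e i.+1)); first by ring.
  by rewrite W_Cv // mulnC exprM; ring.
have y0 : yy n.+1 w =1 (fun=> 0).
  move=> i; apply: (mulfI (Mz T)); rewrite mulr0 -yyZ.
  rewrite (eq_yy n.+1 wE) yyZ /= (eq_bigr (fun q : 'I_(rho (T - n.+1)) => p%:Z ^+ n * W p c s.+1 e (i + q * H (T - n.+1))%N)).
    by rewrite -mulr_sumr (_ : (T - n.+1)%N = s) ?(W_cls0 D) ?mulr0 //; rewrite /n; lia.
  move=> q _; apply: (@yy_const s.+1) => //; first by rewrite /n; lia.
  exact: W_per.
(* Coarser class sums vanish. For [t >= s+1] the sequence already has period [H_t], so its class
   sums are [p^k w] with [k = T - t <= n]; and [p w] is divisible by [p^n], as are the twisted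
   differences of [w]. *)
split=> // t /andP[t0 tT]; have [ts|ts] := ltnP t s.+1.
  have z := yy0 (T - t - n.+1) y0; rewrite subnKC in z; last by rewrite /n; lia.
  by split=> [|i _ _]; rewrite !z ?mulr0 ?subrr dvdz0.
have yE : forall i, yy (T - t) w i = p%:Z ^+ (T - t) * w i.
  by apply: (@yy_const s.+1) => //; lia.
have kn : (T - t <= n)%N by rewrite /n; lia.
have k0 : (0 < T - t)%N by lia.
set k := (T - t)%N in yE kn k0 *; split=> [|i _ _]; rewrite !yE.
  have -> : (2 * k).-1 = (k + k.-1)%N by lia.
  rewrite exprD dvdz_mul //; have [v vE] := w0 (H t.-1).
  have : p%:Z * w (H t.-1) = p%:Z * (p%:Z ^+ n.-1 * v).
    by rewrite vE mulrA -exprS prednK //; lia.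
  move=> /(mulfI pz) ->; apply: dvdz_mulr; apply: dvdz_exp2l; lia.
have -> : p%:Z ^+ k * w i.+1 - c ^+ 2 * (p%:Z ^+ k * w i) = p%:Z ^+ k * (- (c ^+ 2 * w i - w i.+1)) by ring.
rewrite wC mul2n -addnn exprD dvdz_mul // rpredN; apply: dvdz_mulr; exact: dvdz_exp2l.
Qed.

(* with vanishing class sums, the conditions say that y is an approximate geometric progression *)
Lemma approx_geometric t (y : nat -> int) k : (0 < k)%N -> per (H t.+1) y -> Acl p t y ->
  (p%:Z ^+ (2 * k).-1 %| y (H t))%Z ->
  (forall i, (H t <= i)%N -> (i.+1 < H t.+1)%N -> (p%:Z ^+ (2 * k) %| y i.+1 - c ^+ 2 * y i)%Z) ->
  forall i, (p%:Z ^+ (2 * k) %| c ^+ 2 * y i - y i.+1)%Z.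
Proof.
move=> k0 yp yA yH yS; set d := p%:Z ^+ (2 * k); set h := H t in yA yH yS *.
have h0 : (0 < h)%N := H0 t.
suff main i : (i < H t.+1)%N -> (d %| c ^+ 2 * y i - y i.+1)%Z.
  move=> i; rewrite (divn_eq i (H t.+1)) addnC -addSn !(perM _ _ yp).
  by apply: main; rewrite ltn_mod.
(* If the classes have one element each, vanishing class sums already force [y = 0]. *)
have [r1|geo] := rho_geom D t.
  have y0 i' : (i' < H t.+1)%N -> y i' = 0.
    rewrite (rhoE D) r1 mul1n => ih; have := yA i' ih; rewrite r1 big_ord1 mul0n addn0 //.
  move=> ih; rewrite y0 //; have [iS|iS] := ltnP i.+1 (H t.+1); first by rewrite y0 // mulr0 subrr dvdz0.
  have -> : i.+1 = (0 + H t.+1)%N by lia.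
  by rewrite yp y0 // mulr0 subrr dvdz0.
set eta := y h in yH.
(* From index [h] on, [y] is [c^(2j) eta] modulo [d], and each earlier value is minus the rest of
   its class. The two seams, at [h] and at the end of the period, close because the geometric sum is
   divisible by [p] and [eta] by [p^(2k-1)]. *)
have yj j : (h + j < H t.+1)%N -> (d %| y (h + j)%N - c ^+ (j * 2) * eta)%Z.
  elim: j => [|j IH] hj; first by rewrite addn0 mul1r subrr dvdz0.
  have hj' : (h + j < H t.+1)%N by lia.
  have a1 := yS (h + j)%N (leq_addr _ _) (ltac:(by rewrite -addnS)).
  rewrite addnS; have := rpredD a1 (dvdz_mull (c ^+ 2) (IH hj')).
  by congr (_ %| _)%Z; rewrite mulSn exprD; ring.
have [r rE] : exists r, rho t = r.+1 by exists (rho t).-1; rewrite prednK // (rho_gt0 D).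
pose Sg : int := \sum_(q < r) (c ^+ 2) ^+ (q * h).
have geoE : \sum_(q < rho t) (c ^+ 2) ^+ (q * h) = Sg + (c ^+ 2) ^+ (r * h).
  by rewrite rE big_ord_recr.
have geoE' : \sum_(q < rho t) (c ^+ 2) ^+ (q * h) = 1 + (c ^+ 2) ^+ h * Sg.
  rewrite rE big_ord_recl mul0n expr0 mulr_sumr; congr (1 + _); apply: eq_bigr => q _.
  by rewrite /= /bump leq0n add1n mulSn exprD.
have geoD : (d %| (\sum_(q < rho t) (c ^+ 2) ^+ (q * h)) * eta)%Z.
  have -> : d = p%:Z * p%:Z ^+ (2 * k).-1 by rewrite -exprS prednK //; lia.
  exact: (dvdz_mul geo yH).
have Hrh : H t.+1 = (r.+1 * h)%N by rewrite (rhoE D) rE.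
have yl l : (l < h)%N -> (d %| y l + c ^+ (l * 2) * Sg * eta)%Z.
  move=> lh; have := yA l lh; rewrite rE big_ord_recl mul0n addn0 => /eqP; rewrite addr_eq0 => /eqP ->.
  rewrite /Sg mulr_sumr mulr_suml addrC -sumrB; apply: rpred_sum => q _.
  rewrite /= /bump leq0n add1n mulSn addnCA; have q1 := ltn_ord q.
  have b1 : (h + (l + q * h) < H t.+1)%N.
    have le : ((q + 2) * h <= r.+1 * h)%N by rewrite leq_mul2r addn2 !ltnS q1 orbT.
    rewrite Hrh (leq_trans _ le) //; have -> : (h + (l + q * h) = q * h + h + l)%N by ring.
    by rewrite mulnDl mul2n -addnn addnA ltn_add2l.
  have e : c ^+ ((l + q * h) * 2) = c ^+ (l * 2) * (c ^+ 2) ^+ (q * h).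
    by rewrite -exprM -exprD; congr (c ^+ _); ring.
  by have := yj _ b1; rewrite -rpredN opprB e.
clearbody h => iH; have [ih|ih] := ltnP i h.
  have a1 := dvdz_mull (c ^+ 2) (yl i ih).
  have [ih1|ih1] := ltnP i.+1 h.
    have := rpredB a1 (yl _ ih1); congr (_ %| _)%Z; rewrite mulSn exprD; ring.
  have hi : h = i.+1 by apply/eqP; rewrite eqn_leq ih ih1.
  rewrite -hi; have := rpredB a1 geoD; rewrite geoE' -/eta; congr (_ %| _)%Z.
  have -> : c ^+ 2 ^+ h = c ^+ 2 * c ^+ (i * 2) by rewrite -exprM hi mulnS (mulnC 2%N) exprD.
  by ring.
have [iS|iS] := ltnP i.+1 (H t.+1).
  by have := yS i ih iS; rewrite -rpredN opprB.
have [iE rh0 iE'] : [/\ i = (h + (r * h - 1))%N, (0 < r * h)%N & i.+1 = (0 + H t.+1)%N].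
  by rewrite Hrh in iH iS *; exact: last_index.
rewrite iE'.
rewrite yp; have a0 := yl 0%N h0; rewrite mul0n expr0 mul1r in a0.
have a1 := yj (r * h - 1)%N; rewrite -iE in a1.
have := rpredB (rpredD (dvdz_mull (c ^+ 2) (a1 iH)) geoD) a0; rewrite geoE.
congr (_ %| _)%Z; have -> : (c ^+ 2) ^+ (r * h) = c ^+ 2 * c ^+ ((r * h - 1) * 2).
  by rewrite -exprM -exprD; congr (c ^+ _); rewrite -{1}(prednK rh0) subn1 mulnS (mulnC 2%N).
by ring.
Qed.

(** Class sums are killed from coarse to fine. With [k = T - s - 1], the class sums [y] modulo
    [H_(s+1)] have vanishing sums modulo [H_s], so their twisted differences are [p^(2k)] times an
    integral [v]. A Siegel product of level [s+1] then realizes [mu y], and subtracting its divisor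
    kills the finer class sums as well. *)
Lemma Cond_rep x : per (H T) x -> yy T x 0%N = 0 -> Cond x ->
  exists (m : int) (E : nat -> nat -> int), [/\ ~~ (p %| m)%Z, forall t, Acl p t (E t.+1) &
    forall i, (M T)%:Z *+ 2 * (m * x i) = \sum_(t < T) p%:Z ^+ (2 * (T - t.+1)) * W p c t.+1 (E t.+1) i].
Proof.
move=> xp xs xC.
have Mz t : (M t)%:Z *+ 2 != 0 by have := M0 t; lia.
have pn k : p%:Z ^+ k != 0 by rewrite expf_neq0.
suff main s : (s <= T)%N -> exists (m : int) (E : nat -> nat -> int) x', [/\ ~~ (p %| m)%Z, forall t, Acl p t (E t.+1),
    per (H T) x', Cond x' & yy (T - s) x' =1 (fun=> 0) /\
    forall i, (M T)%:Z *+ 2 * (m * x i - x' i) = \sum_(t < s) p%:Z ^+ (2 * (T - t.+1)) * W p c t.+1 (E t.+1) i].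
  have [m [E [x' [pm EA _ _ [x0 xE]]]]] := main T (leqnn _).
  exists m, E; split=> // i; rewrite -xE; rewrite subnn /= in x0.
  by rewrite (x0 i) subr0.
elim: s => [|s IH] sT.
  exists 1, (fun _ _ => 0), x; split=> //; last split.
  - by rewrite dvdzE /= dvdn1; have := prime_gt1 pp; lia.
  - by move=> t l _; rewrite big1.
  - move=> i; rewrite subn0; have := yy_per (leqnn T) xp; rewrite subnn hlev0 => y1.
    by rewrite -[i]muln1 -[(i * 1)%N]add0n perM.
  - by move=> i; rewrite big_ord0 mul1r subrr mulr0.
have [m [E [x' [pm EA x'p x'C [x'0 x'E]]]]] := IH (ltnW sT).
set k := (T - s.+1)%N; have kE : (T - s = k.+1)%N by rewrite /k; lia.
have Tk : (T - k = s.+1)%N by rewrite /k; lia.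
pose y := yy k x'.
have yp : per (H s.+1) y by rewrite -Tk; apply: yy_per => //; rewrite /k; lia.
have yA : Acl p s y.
  by move=> l lh; have := x'0 l; rewrite kE /= (_ : (T - k.+1)%N = s) // ; lia.
have yg i : (p%:Z ^+ (2 * k) %| c ^+ 2 * y i - y i.+1)%Z.
  have [k0|k0] := posnP k; first by rewrite k0 dvd1z.
  have [|c1 c2] := x'C s.+1; first by rewrite /k in k0; lia.
  exact: (approx_geometric k0 yp yA c1 c2).
pose v i := ((c ^+ 2 * y i - y i.+1) %/ (p%:Z ^+ (2 * k)))%Z.
have vE i : c ^+ 2 * y i - y i.+1 = p%:Z ^+ (2 * k) * v i by rewrite [RHS]mulrC divzK.
have vp : per (H s.+1) v by move=> i; rewrite /v -addSn !yp.
have vA : Acl p s v.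
  move=> l lh; apply: (mulfI (pn (2 * k)%N)); rewrite mulr0 mulr_sumr.
  under eq_bigr do rewrite -vE -addSn.
  rewrite sumrB -mulr_sumr yA // mulr0 sub0r; apply/eqP; rewrite oppr_eq0; apply/eqP.
  have [lh'|lh'] := ltnP l.+1 (H s); first exact: yA.
  have -> : l.+1 = (0 + H s)%N by lia.
  rewrite sum_per_shift; last by rewrite -(rhoE D).
  exact: yA.
have [mu [e [pmu eA eE]]] := solve_Cv D vp vA.
(* Both sides have the same image under [c^2 - X] and are periodic. *)
have Wy i : p%:Z ^+ (2 * k) * W p c s.+1 e i = (M s.+1)%:Z *+ 2 * (mu * y i).
  apply/eqP; rewrite -subr_eq0; apply/eqP; move: i.
  apply: (geometric_per0 D (t := s.+1)).
    by move=> i; rewrite W_per // yp.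
  move=> i; have := W_Cv D s.+1 e i; rewrite eE => h1; have h2 := vE i.
  apply/eqP; rewrite eq_sym -subr_eq0; apply/eqP.
  transitivity (p%:Z ^+ (2 * k) * (c ^+ 2 * W p c s.+1 e i - W p c s.+1 e i.+1) - (M s.+1)%:Z *+ 2 * (mu * (c ^+ 2 * y i - y i.+1))); first by ring.
  by rewrite h1 h2; ring.
have MS : (M s.+1)%:Z = p%:Z * (M s)%:Z by rewrite levS PoszM.
(* [W] is divisible by [2 M_s], so [p mu y] is divisible by [p^(2k)], and [2k - 1 >= k] as soon as
   [k > 0]. *)
have wex i : exists w, p%:Z ^+ k * w = mu * y i.
  have /dvdzP[u uE] := W_dvd D i eA; have h := Wy i.
  have h' : p%:Z ^+ (2 * k) * u = p%:Z * (mu * y i).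
    apply: (mulfI (Mz s)); move: h; rewrite uE MS => h.
    transitivity (p%:Z ^+ (2 * k) * (u * ((M s)%:Z *+ 2))); first by ring.
    by rewrite h; ring.
  have [k0|k0] := posnP k; first by exists (mu * y i); rewrite k0 mul1r.
  exists (p%:Z ^+ k.-1 * u); apply: (mulfI pz); rewrite -h'.
  transitivity ((p%:Z * p%:Z ^+ k.-1) * p%:Z ^+ k * u); first by ring.
  by rewrite -exprS prednK // -exprD addnn -mul2n.
pose w i := ((mu * y i) %/ (p%:Z ^+ k))%Z.
have wE i : p%:Z ^+ k * w i = mu * y i.
  by have [w0 w0E] := wex i; rewrite /w -w0E mulrC divzK // dvdz_mulr.
have MT : (M T)%:Z = p%:Z ^+ k * (M s.+1)%:Z.
  rewrite -(subnK sT) -/k; elim: k {y kE Tk yp yA yg v vE vp vA eE Wy wex w wE} => [|k' IHk]; first by rewrite mul1r.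
  by rewrite addSn levS PoszM IHk exprS mulrA.
have wW i : (M T)%:Z *+ 2 * w i = p%:Z ^+ (2 * (T - s.+1)) * W p c s.+1 e i.
  by rewrite -/k Wy -wE MT; ring.
have [wC _] := @Cond_siegel s.+1 _ _ sT eA wW.
have wp : per (H s.+1) w by move=> i; rewrite /w yp.
exists (mu * m), (fun t => if t == s.+1 then e else fun j => mu * E t j), (fun j => mu * x' j + (-1) * w j); split; last split.
- by rewrite dvdzE abszM Euclid_dvdM // negb_or -!dvdzE pmu.
- move=> t; case: eqP => [[->] //|_] l lh; rewrite -mulr_sumr EA ?mulr0 //.
- move=> j; rewrite x'p; congr (_ + _ * _).
  have : per (H T) w.
    rewrite -(subnK sT); elim: (T - s.+1)%N => [|n IHn] //.
    by move=> i; rewrite addSn hlevS // ?addn_gt0 ?orbT // perM.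
  exact.
- exact: Cond_lin.
- move=> i; rewrite -/k yy_lin (@yy_const s.+1 k w) //; last by rewrite /k; lia.
  by rewrite wE -/y mulN1r subrr.
- move=> i; rewrite big_ord_recr /= eqxx -wW.
  have -> : (M T)%:Z *+ 2 * (mu * m * x i - (mu * x' i + -1 * w i)) =
    mu * ((M T)%:Z *+ 2 * (m * x i - x' i)) + (M T)%:Z *+ 2 * w i by ring.
  rewrite x'E mulr_sumr; congr (_ + _); apply: eq_bigr => t _.
  have -> : (t.+1 == s.+1) = false by rewrite eqSS; apply/eqP; have := ltn_ord t; lia.
  rewrite mulrCA; congr (_ * _); rewrite /W mulr_sumr; apply: eq_bigr => j _; ring.
Qed.

(** Below the top level each term gives an integral divisor by [W_dvd], and [Cond_siegel] applies to
    it. For the top term [W_dvd] is short of one [p]; its integrality comes from being the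
    difference between [m x] and the integral rest. *)
Lemma rep_Cond (m : int) x E : ~~ (p %| m)%Z -> (forall t, Acl p t (E t.+1)) ->
  (forall i, (M T)%:Z *+ 2 * (m * x i) = \sum_(t < T) p%:Z ^+ (2 * (T - t.+1)) * W p c t.+1 (E t.+1) i) ->
  Cond x.
Proof.
move=> pm EA xE; apply: (Cond_cancel pm).
have Mz t : (M t)%:Z *+ 2 != 0 by have := M0 t; lia.
case: (posnP T) => [T0|T0]; first by move=> t; rewrite T0 ltn0 andbF.
have main s : (s < T)%N -> exists z, Cond z /\ forall i, (M T)%:Z *+ 2 * z i =
    \sum_(t < s) p%:Z ^+ (2 * (T - t.+1)) * W p c t.+1 (E t.+1) i.
  elim: s => [|s IH] sT.
    exists (fun=> 0); split=> [t _|i]; last by rewrite mulr0 big_ord0.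
    have z k : yy k (fun=> 0) =1 (fun=> 0) by elim: k => //= k IHk i; rewrite big1 // => q _; exact: IHk.
    by split=> [|i _ _]; rewrite !z ?mulr0 ?subrr dvdz0.
  have [z [zC zE]] := IH (ltnW sT).
  set n := (T - s.+1)%N; have n0 : (0 < n)%N by rewrite /n; lia.
  have MT : (M T)%:Z = p%:Z ^+ n.+1 * (M s)%:Z.
    have -> : T = (n.+1 + s)%N by rewrite /n; lia.
    elim: (n.+1) => [|k IHk]; first by rewrite mul1r.
    by rewrite addSn levS PoszM IHk exprS mulrA.
  pose w i := p%:Z ^+ n.-1 * (W p c s.+1 (E s.+1) i %/ ((M s)%:Z *+ 2))%Z.
  have wE i : (M T)%:Z *+ 2 * w i = p%:Z ^+ (2 * n) * W p c s.+1 (E s.+1) i.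
    rewrite -[in RHS](divzK (W_dvd D i (EA s))) MT /w.
    have -> : p%:Z ^+ (2 * n) = p%:Z ^+ n.+1 * p%:Z ^+ n.-1 by rewrite -exprD; congr (_ ^+ _); lia.
    by ring.
  have [wC _] := @Cond_siegel s.+1 _ _ (ltnW sT) (EA s) wE.
  exists (fun j => 1 * z j + 1 * w j); split; first exact: Cond_lin.
  by move=> i; rewrite big_ord_recr /= -wE -zE; ring.
have [z [zC zE]] := main T.-1 (ltac:(by rewrite prednK)).
have TT : T = T.-1.+1 by rewrite prednK.
have wE i : (M T)%:Z *+ 2 * (m * x i - z i) = p%:Z ^+ (2 * (T - T.-1.+1)) * W p c T.-1.+1 (E T.-1.+1) i.
  pose F t := p%:Z ^+ (2 * (T - t.+1)) * W p c t.+1 (E t.+1) i.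
  have FE n : (0 < n)%N -> \sum_(t < n) F t = \sum_(t < n.-1) F t + F n.-1.
    by case: n => // n _; rewrite big_ord_recr.
  by rewrite mulrBr xE zE (FE T T0) addrC addKr.
have TT' : (0 < T.-1.+1 <= T)%N by rewrite prednK ?T0 ?leqnn.
have [wC _] := Cond_siegel TT' (EA T.-1) wE.
have := Cond_lin 1 1 wC zC; apply: eq_Cond => j; ring.
Qed.

End Lattice2.

(** * Independence and number of the congruence conditions *)

Section ClassSums.
Variables (p : nat) (c : int).
Hypothesis D : leveldata p c.
Local Notation H := (hlev p).
Local Notation rho := (rho p).
Let pp := ld_prime D.
Let H0 t : (0 < H t)%N := hlev_gt0 pp t.

Lemma per_mod h (f : nat -> int) i : per h f -> f (i %% h)%N = f i.
Proof. by move=> fp; rewrite {2}(divn_eq i h) addnC perM. Qed.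

Lemma yy_total T x : per (H T) x -> yy p T T x 0%N = \sum_(i < H T) x i.
Proof.
move=> xp; suff tot k : (k <= T)%N -> \sum_(i < H (T - k)) yy p T k x i = \sum_(i < H T) x i.
  by rewrite -(tot T) // subnn hlev0 big_ord1.
elim: k => [|k IH] kT; first by rewrite subn0.
rewrite -IH 1?ltnW // -(subnSK kT) (rhoE D) sum_ord_mul exchange_big.
by apply: eq_bigr.
Qed.

Lemma yy_lift s k x z i : (forall l, yy p s.+1 1 x l = z l) -> yy p s.+1 k.+1 x i = yy p s k z i.
Proof.
move=> xz; elim: k i => [|k IH] i; first exact: xz.
rewrite [LHS]/= [RHS]/= subSS; apply: eq_bigr => q _; exact: IH.
Qed.

(** Passing to a finer level, the values at [H_s <= i < H_(s+1)] are free, and the first [H_s]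
    values correct the class sums to the ones already prescribed. *)
Lemma class_sums_surj (Y : nat -> nat -> int) s : exists z, [/\ per (H s) z, yy p s s z 0%N = 0 &
  forall t i, (0 < t <= s)%N -> (H t.-1 <= i < H t)%N -> yy p s (s - t) z i = Y t i].
Proof.
elim: s => [|s [z [zp z0 zY]]].
  by exists (fun=> 0); split=> // t i /andP[t0]; rewrite leqNgt t0.
have rH : H s.+1 = (rho s * H s)%N := rhoE D s.
have [r rE] : exists r, rho s = r.+1 by exists (rho s).-1; rewrite prednK // (rho_gt0 D).
pose f i := if (i < H s)%N then z i - \sum_(q < r) Y s.+1 (i + q.+1 * H s)%N else Y s.+1 i.
pose z' i := f (i %% H s.+1)%N.
have z'p : per (H s.+1) z' by move=> i; rewrite /z' modnDr.
have z'z l : yy p s.+1 1 z' l = z l.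
  rewrite [LHS]/= subSS subn0; pose F l := \sum_(q < rho s) z' (l + q * H s)%N.
  have Fp : per (H s) F by move=> i; apply: sum_per_shift; rewrite -rH.
  rewrite -/(F l) -(per_mod l Fp) -[RHS](per_mod l zp); have : (l %% H s < H s)%N by rewrite ltn_mod.
  move: (l %% H s)%N => i iH; rewrite /F rE big_ord_recl /= mul0n addn0.
  have z'f q : (q < r.+1)%N -> z' (i + q * H s)%N = f (i + q * H s)%N.
    move=> qr; rewrite /z' modn_small // rH rE.
    have : (q.+1 * H s <= r.+1 * H s)%N by rewrite leq_mul2r qr orbT.
    by apply: leq_trans; rewrite mulSn ltn_add2r.
  have -> : z' i = f i by have := z'f 0%N isT; rewrite mul0n addn0.
  rewrite {1}/f iH; under eq_bigr => q _.
    rewrite z'f; last by have := ltn_ord q.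
    rewrite /f ltnNge mulSn addnCA leq_addr /=.
    over.
  by under eq_bigr do rewrite addnCA -mulSn; rewrite subrK.
exists z'; split=> //; first by rewrite (@yy_lift s s z' z).
move=> t i /andP[t0 ts] /andP[i1 i2]; move: ts; rewrite leq_eqVlt => /orP[/eqP tE|ts].
  rewrite tE subnn /= /z' modn_small; last by rewrite -tE.
  by rewrite /f ltnNge; move: i1; rewrite tE /= => ->.
by rewrite subSn // (yy_lift _ _ z'z) zY ?t0 // i1.
Qed.

Definition cond_form T (k : nat * nat) (x : nat -> int) : int :=
  if k.2 == H k.1.-1 then yy p T (T - k.1) x k.2 else yy p T (T - k.1) x k.2 - c ^+ 2 * yy p T (T - k.1) x k.2.-1.

Definition cond_exp T (k : nat * nat) : nat :=
  if k.2 == H k.1.-1 then (2 * (T - k.1)).-1 else (2 * (T - k.1))%N.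

Definition cond_keys T : seq (nat * nat) :=
  [seq (t, j) | t <- iota 1 T.-1, j <- index_iota (H t.-1) (H t)].

Lemma cond_keysP T t j : ((t, j) \in cond_keys T) = (0 < t < T)%N && (H t.-1 <= j < H t)%N.
Proof.
apply/allpairsPdep/idP => [[t' [j' [h1 h2 [-> ->]]]]|/andP[h1 h2]].
  by move: h1 h2; rewrite mem_iota mem_index_iota => /andP[h3 h] ->; rewrite h3 andbT /=; move: h3 h; clear; lia.
case/andP: h1 => t0 tT; exists t, j; split; rewrite ?mem_index_iota //.
by rewrite mem_iota t0 add1n prednK // (leq_ltn_trans _ tT).
Qed.

Lemma cond_keys_uniq T : uniq (cond_keys T).
Proof.
apply: allpairs_uniq_dep; [exact: iota_uniq|by move=> t _; exact: iota_uniq|].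
by move=> [t j] [t' j'] _ _ /= [-> ->].
Qed.

Lemma cond_exp_gt0 T k : k \in cond_keys T -> (0 < cond_exp T k)%N.
Proof. by case: k => t j; rewrite cond_keysP /cond_exp => /andP[h _]; case: ifP => _ /=; lia. Qed.

Lemma Cond_forms T x : per (H T) x -> yy p T T x 0%N = 0 -> Cond p c T x <-> forall k, k \in cond_keys T -> (p%:Z ^+ cond_exp T k %| cond_form T k x)%Z.
Proof.
move=> xp x0; split=> [Cx [t j]|Cx t tT].
  rewrite cond_keysP => /andP[tT /andP[j1 j2]]; have [x1 x2] := Cx t tT.
  rewrite /cond_exp /cond_form /=; case: eqP => [->//|/eqP ne].
  have j3 : (H t.-1 < j)%N by rewrite ltn_neqAle eq_sym ne.
  by case: j j1 j2 ne j3 => // j j1 j2 ne j3; exact: x2.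
split=> [|i i1 i2]; last first.
  have k : (t, i.+1) \in cond_keys T by rewrite cond_keysP tT leqW.
  have ne : (i.+1 == H t.-1) = false by apply/negbTE; rewrite neq_ltn orbC ltnS i1.
  by have := Cx _ k; rewrite /cond_exp /cond_form /= ne.
have [lt|ge] := ltnP (H t.-1) (H t).
  have k : (t, H t.-1) \in cond_keys T by rewrite cond_keysP tT leqnn.
  by have := Cx _ k; rewrite /cond_exp /cond_form /= eqxx.
(* An empty block forces [t = 1] and ratio 1; the class sum is then the total, which vanishes. *)
case/andP: tT => t0 tT; have tE : t.-1.+1 = t by rewrite prednK.
have r1 : rho t.-1 = 1%N.
  have := rhoE D t.-1; rewrite tE => E; have r0 := rho_gt0 D t.-1.
  have : (rho t.-1 * H t.-1 <= 1 * H t.-1)%N by rewrite mul1n -E.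
  by rewrite leq_pmul2r // => r1; apply/eqP; rewrite eqn_leq r1.
have t1 : t = 1%N.
  case: (posnP t.-1) => [h|h]; first by rewrite -tE h.
  by have := prime_gt1 pp; rewrite -(rho_p D h) r1.
have TE : T = (T - 1).+1 by rewrite subnSK ?subn0 //; apply: leq_trans tT.
have -> : yy p T (T - t) x (H t.-1) = 0; last exact: dvdz0.
have z : yy p T T x =1 (fun=> 0).
  have tp : per 1%N (yy p T T x) by have := yy_per D (leqnn T) xp; rewrite subnn hlev0.
  by move=> i; rewrite -(per_mod i tp) modn1.
have := z (H t.-1); rewrite [X in yy p T X]TE t1 /= (_ : T - (T - 1).+1 = 0)%N; last by rewrite -TE subnn.
by move: r1; rewrite t1 /= => ->; rewrite big_ord1 mul0n addn0.
Qed.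

Lemma cond_form_lin T k a b x z : cond_form T k (fun j => a * x j + b * z j) = a * cond_form T k x + b * cond_form T k z.
Proof. by rewrite /cond_form; case: ifP => _; rewrite !yy_lin; ring. Qed.

(** Within a block the forms determine the class sums recursively, and arbitrary class sums occur by
    [class_sums_surj]. *)
Lemma cond_forms_surj T (n : nat * nat -> int) : exists x, [/\ per (H T) x, yy p T T x 0%N = 0 &
  forall k, k \in cond_keys T -> cond_form T k x = n k].
Proof.
pose fix Yg (t k : nat) : int := if k is k'.+1 then c ^+ 2 * Yg t k' + n (t, H t.-1 + k)%N else n (t, H t.-1).
have [x [xp x0 xY]] := class_sums_surj (fun t i => Yg t (i - H t.-1)%N) T.
exists x; split=> // -[t j]; rewrite cond_keysP => /andP[/andP[t0 tT] /andP[j1 j2]].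
have tT' : (0 < t <= T)%N by rewrite t0 ltnW.
rewrite /cond_form /=; case: eqP => [jE|/eqP ne]; first by rewrite xY ?j1 // {1}jE subnn /= -jE.
have j3 : (H t.-1 < j)%N by rewrite ltn_neqAle eq_sym ne.
have r1 : (H t.-1 <= j < H t)%N by rewrite j1.
have r2 : (H t.-1 <= j.-1 < H t)%N by apply/andP; split; lia.
rewrite (xY t j tT' r1) (xY t j.-1 tT' r2).
have -> : (j - H t.-1 = (j.-1 - H t.-1).+1)%N by lia.
rewrite /= (_ : (H t.-1 + (j.-1 - H t.-1).+1 = j)%N); [by ring|by lia].
Qed.

Lemma count_cond_exp T e : count (fun k => cond_exp T k == e) (cond_keys T) =
  \sum_(1 <= t < T) ((e == (2 * (T - t)).-1) * (H t.-1 < H t) + (e == 2 * (T - t)) * (H t - H t.-1 - 1))%N.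
Proof.
rewrite /cond_keys count_flatten -map_comp sumnE big_map /index_iota subn1; apply: eq_bigr => t _ /=.
rewrite count_map; under eq_count => j do rewrite /= /cond_exp /=.
move: (H t.-1) (H t) => a b; case: (ltnP a b) => ab; last first.
  have -> : (b - a = 0)%N by lia.
  by rewrite /= !muln0.
have -> : (b - a = (b - a).-1.+1)%N by lia.
rewrite /= eqxx muln1 subn1 /= (eq_sym e) (eq_sym e (2 * _)%N); congr (nat_of_bool _ + _)%N.
rewrite (@eq_in_count _ _ (fun=> 2 * (T - t) == e)%N); last first.
  move=> j; rewrite mem_iota => /andP[ja _]; case: (j =P a) => // E; by rewrite E ltnn in ja.
case: (_ == e); rewrite ?mul1n ?mul0n; last by rewrite count_pred0.
by rewrite count_predT size_iota.
Qed.

Lemma size_cond_keys T : (0 < T)%N -> size (cond_keys T) = (H T.-1 - 1)%N.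
Proof.
move=> T0; rewrite size_allpairs_dep sumnE big_map.
have HH t : (H t <= H t.+1)%N by rewrite (rhoE D) -{1}[H t]mul1n leq_mul2r (rho_gt0 D) orbT.
case: T T0 => // n _ /=; elim: n => [|n IH]; first by rewrite big_nil hlev0.
rewrite -[n.+1]addn1 iotaD big_cat IH /= big_seq1 size_iota add1n /= addn1 /=.
by have := HH n; have := H0 n; lia.
Qed.

End ClassSums.

From mathcomp Require Import all_classical all_reals all_analysis complex.
Import numFieldNormedType.Exports.
Local Open Scope classical_set_scope.

(** * Complex modulus, limits and derivatives by explicit estimates *)

Section ComplexBasics.
Variable R : realType.
Local Notation C := (R[i]^o).
Implicit Types (z w h l : C) (f g : C -> C).

(** The norm of [R[i]] takes values in [R[i]]; estimates are made with this real-valued modulus. *)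
Definition nm (z : R[i]) : R := Num.sqrt (complex.Re z ^+ 2 + complex.Im z ^+ 2).

Lemma normE z : `|z| = (nm z)%:C%C. Proof. exact: normc_def. Qed.

Lemma nmE z : nm z = Normc.normc z. Proof. by case: z. Qed.

Lemma nm_ge0 z : 0 <= nm z. Proof. exact: sqrtr_ge0. Qed.

Lemma nmM z w : nm (z * w) = nm z * nm w.
Proof. by rewrite !nmE Normc.normcM. Qed.

Lemma nmV z : nm z^-1 = (nm z)^-1.
Proof. by rewrite !nmE Normc.normcV. Qed.

Lemma nmD z w : nm (z + w) <= nm z + nm w.
Proof. by rewrite !nmE le_normcD. Qed.

Lemma nmN z : nm (- z) = nm z.
Proof. by rewrite !nmE normcN. Qed.

Lemma nmB z w : nm (z - w) <= nm z + nm w.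
Proof. by rewrite -(nmN w) nmD. Qed.

Lemma nmBC z w : nm (z - w) = nm (w - z).
Proof. by rewrite -nmN opprB. Qed.

Lemma nm0 : nm 0 = 0. Proof. by rewrite nmE Normc.normc0. Qed.
Lemma nm1 : nm 1 = 1. Proof. by rewrite nmE Normc.normc1. Qed.

Lemma nm_eq0 z : (nm z == 0) = (z == 0).
Proof.
apply/eqP/eqP => [|->]; last exact: nm0.
by rewrite nmE; exact: Normc.eq0_normc.
Qed.

Lemma nm_gt0 z : (0 < nm z) = (z != 0).
Proof. by rewrite lt_def nm_eq0 nm_ge0 andbT. Qed.

Lemma nm_real (x : R) : nm x%:C%C = `|x|.
Proof. by rewrite /nm /= expr0n addr0 sqrtr_sqr. Qed.

Lemma nmX z n : nm (z ^+ n) = nm z ^+ n.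
Proof. by elim: n => [|n IH]; rewrite ?nm1 // !exprS nmM IH. Qed.

Lemma nm_prod (I : Type) (r : seq I) (P : pred I) (F : I -> R[i]) :
  nm (\prod_(i <- r | P i) F i) = \prod_(i <- r | P i) nm (F i).
Proof. by apply: (big_morph nm nmM nm1). Qed.

Lemma nm_sum (I : Type) (r : seq I) (P : pred I) (F : I -> R[i]) :
  nm (\sum_(i <- r | P i) F i) <= \sum_(i <- r | P i) nm (F i).
Proof.
apply: (big_ind2 (fun a b => nm a <= b)); rewrite ?nm0 // => a b c d ab cd.
by apply: le_trans (nmD _ _) _; exact: lerD.
Qed.

Lemma Re_le_nm z : `|complex.Re z| <= nm z.
Proof. by rewrite -sqrtr_sqr ler_wsqrtr // lerDl sqr_ge0. Qed.

Lemma Im_le_nm z : `|complex.Im z| <= nm z.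
Proof. by rewrite -sqrtr_sqr ler_wsqrtr // lerDr sqr_ge0. Qed.

Lemma nm_le_ReIm z : nm z <= `|complex.Re z| + `|complex.Im z|.
Proof.
rewrite -(@ler_pXn2r _ 2) ?nnegrE ?nm_ge0 ?addr_ge0 //.
rewrite sqr_sqrtr ?addr_ge0 ?sqr_ge0 // sqrrD !real_normK ?num_real //.
by rewrite -addrA lerD2l lerDr mulrn_wge0 // mulr_ge0.
Qed.

Lemma nm_sqr z : nm z ^+ 2 = complex.Re z ^+ 2 + complex.Im z ^+ 2.
Proof. by rewrite sqr_sqrtr ?addr_ge0 ?sqr_ge0. Qed.

Lemma nm_dist_triangle z w (u : C) : nm (z - w) <= nm (z - u) + nm (u - w).
Proof. by rewrite -[z - w](subrKA u) nmD. Qed.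

Lemma nm_lower z w : nm z - nm w <= nm (z - w).
Proof. by rewrite lerBlDr -{1}(subrK w z) nmD. Qed.

Lemma cReD z w : complex.Re (z + w) = complex.Re z + complex.Re w.
Proof. by case: z; case: w. Qed.
Lemma cImD z w : complex.Im (z + w) = complex.Im z + complex.Im w.
Proof. by case: z; case: w. Qed.
Lemma cReN z : complex.Re (- z) = - complex.Re z. Proof. by case: z. Qed.
Lemma cImN z : complex.Im (- z) = - complex.Im z. Proof. by case: z. Qed.
Lemma cReM z w : complex.Re (z * w) =
  complex.Re z * complex.Re w - complex.Im z * complex.Im w.
Proof. by case: z; case: w. Qed.
Lemma cImM z w : complex.Im (z * w) =
  complex.Re z * complex.Im w + complex.Im z * complex.Re w.
Proof. by case: z; case: w. Qed.

Lemma eq_cplx z w : complex.Re z = complex.Re w ->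
  complex.Im z = complex.Im w -> z = w.
Proof. by case: z; case: w => a b c d /= -> ->. Qed.

(** ** Neighbourhoods and limits in terms of the real-valued modulus *)

Lemma nbhs_cplxP z (P : set C) :
  nbhs z P <-> exists2 d : R, 0 < d & forall w, nm (w - z) < d -> P w.
Proof.
split=> [/nbhs_ballP[e /= e0 eP]|[d d0 dP]].
  have e0' : 0 < complex.Re e by move: e0; rewrite ltcE => /andP[].
  exists (complex.Re e) => // w wz; apply: eP.
  rewrite -ball_normE /= normE nmBC.
  by move: e0; rewrite !ltcE /= => /andP[/eqP -> _]; rewrite eqxx.
apply/nbhs_ballP; exists d%:C%C => /=; first by rewrite ltcR.
by move=> w; rewrite -ball_normE /= normE ltcR nmBC => /dP.
Qed.

Lemma dnbhs_cplxP z (P : set C) :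
  nbhs z^' P <->
  exists2 d : R, 0 < d & forall w, nm (w - z) < d -> w != z -> P w.
Proof.
rewrite -[nbhs _ _]/(nbhs z (fun w => w != z -> P w)); exact: nbhs_cplxP.
Qed.

Lemma cvg_cplxP (T : Type) (F : set_system T) {FF : Filter F} (f : T -> C) (l : C) :
  (f x @[x --> F] --> l) <->
  forall e : R, 0 < e -> \forall x \near F, nm (f x - l) < e.
Proof.
split=> [/cvgrPdist_lt fl e e0|fl].
  have := fl e%:C%C; rewrite ltcR => /(_ e0); apply: filterS => x.
  by rewrite normE ltcR nmBC.
apply/cvgrPdist_lt => e; rewrite ltcE /= => /andP[/eqP ie e0].
apply: filterS (fl _ e0) => x; rewrite normE ltcE /= nmBC ie eqxx.
by [].
Qed.

Definition ccont f z := forall e : R, 0 < e ->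
  exists2 d : R, 0 < d & forall w, nm (w - z) < d -> nm (f w - f z) < e.

Definition cdiff f z l := forall e : R, 0 < e ->
  exists2 d : R, 0 < d & forall h, nm h < d ->
    nm (f (z + h) - f z - l * h) <= e * nm h.

Lemma derivableP1 f z : derivable f z 1 <-> exists l, cdiff f z l.
Proof.
split=> [/cvg_ex[l /cvg_cplxP fl]|[l fl]].
  exists l => e e0; have /dnbhs_cplxP[d d0 dP] := fl _ e0.
  exists d => // h hd; have [->|h0] := eqVneq h 0.
    by rewrite addr0 mulr0 subr0 subrr nm0 mulr0.
  have := dP h; rewrite subr0 => /(_ hd h0).
  have -> : h^-1 *: (f (h *: 1 + z) - f z) - l
     = (f (z + h) - f z - l * h) / h :> C.
    rewrite -[h *: 1]/(h * 1) mulr1 addrC -[_ *: _]/(_ * _).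
    by rewrite -[in LHS](mulfK h0 l); rewrite (addrC h z); ring.
  by rewrite nmM nmV => /ltW; rewrite ler_pdivrMr ?nm_gt0.
apply/cvg_ex; exists l; apply/cvg_cplxP => e e0.
have e2 : 0 < e / 2 by lra.
have [d d0 dP] := fl _ e2.
apply/dnbhs_cplxP; exists d => // h; rewrite subr0 => hd h0.
have -> : h^-1 *: (f (h *: 1 + z) - f z) - l
     = (f (z + h) - f z - l * h) / h :> C.
  rewrite -[h *: 1]/(h * 1) mulr1 addrC -[_ *: _]/(_ * _).
  by rewrite -[in LHS](mulfK h0 l); rewrite (addrC h z); ring.
rewrite nmM nmV ltr_pdivrMr ?nm_gt0 //.
apply: le_lt_trans (dP h hd) _; rewrite ltr_pM2r ?nm_gt0 //; lra.
Qed.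
End ComplexBasics.

Lemma is_derive_eps (R : realType) (f : R -> R) (x l : R) : is_derive x 1 f l ->
  forall e : R, 0 < e -> exists2 d : R, 0 < d &
    forall h : R, `|h| < d -> `|f (x + h) - f x - l * h| <= e * `|h|.
Proof.
move=> fl e e0; have [fd lE] := fl.
have /cvgrPdist_lt/(_ e e0) : (h^-1 *: (f (h *: 1 + x) - f x)) @[h --> 0^'] --> l.
  by rewrite -lE; exact: fd.
move=> /nbhs_ballP[d /= d0 dP]; exists d => // h hd.
have [->|h0] := eqVneq h 0; first by rewrite addr0 mulr0 subr0 subrr normr0 mulr0.
have := dP h; rewrite -ball_normE /= sub0r normrN => /(_ hd h0).
have -> : l - h^-1 *: (f (h *: 1 + x) - f x) = - ((f (x + h) - f x - l * h) / h).
  rewrite -[h *: 1]/(h * 1) mulr1 -[_ *: _]/(_ * _) (addrC h x).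
  by rewrite -[in LHS](mulfK h0 l); ring.
by rewrite normrN normrM normfV => /ltW; rewrite ler_pdivrMr ?normr_gt0.
Qed.

Section Holomorphy.
Variable R : realType.
Local Notation C := (R[i]^o).
Implicit Types (z w h l : C) (f g : C -> C).

Definition holo f z : Prop := exists l, cdiff f z l.

Lemma holoP f z : holo f z <-> derivable f z 1.
Proof. by split=> /derivableP1. Qed.

Lemma holo_cst (c : C) z : holo (fun=> c) z.
Proof. by apply/holoP; exact: derivable_cst. Qed.
Lemma holo_id z : holo id z. Proof. by apply/holoP; exact: derivable_id. Qed.
Lemma holoD f g z : holo f z -> holo g z -> holo (fun z => f z + g z) z.
Proof. by move=> /holoP hf /holoP hg; apply/holoP; exact: (derivableD hf hg). Qed.
Lemma holoN f z : holo f z -> holo (fun z => - f z) z.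
Proof. by move=> /holoP hf; apply/holoP; exact: (derivableN hf). Qed.
Lemma holoB f g z : holo f z -> holo g z -> holo (fun z => f z - g z) z.
Proof. by move=> hf hg; exact: (holoD hf (holoN hg)). Qed.
Lemma holoM f g z : holo f z -> holo g z -> holo (fun z => f z * g z) z.
Proof. by move=> /holoP hf /holoP hg; apply/holoP; exact: (derivableM hf hg). Qed.
Lemma holoV f z : f z != 0 -> holo f z -> holo (fun z => (f z)^-1) z.
Proof. by move=> f0 /holoP hf; apply/holoP; exact: (@derivableV _ _ f z 1 f0 hf). Qed.
Lemma holo_div f g z : g z != 0 -> holo f z -> holo g z ->
  holo (fun z => f z / g z) z.
Proof. by move=> g0 hf hg; exact: (holoM hf (holoV g0 hg)). Qed.
Lemma holo_comp f g z : holo g z -> holo f (g z) -> holo (fun z => f (g z)) z.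
Proof.
move=> /holoP/derivable1_diffP hg /holoP/derivable1_diffP hf.
by apply/holoP/derivable1_diffP; exact: (differentiable_comp hg hf).
Qed.
Lemma holoZ (c : C) f z : holo f z -> holo (fun z => c * f z) z.
Proof. by move=> hf; exact: (holoM (holo_cst c z) hf). Qed.
Lemma holoXn f n z : holo f z -> holo (fun z => f z ^+ n) z.
Proof.
move=> hf; elim: n => [|n IH]; first exact: holo_cst.
by under eq_fun do rewrite exprS; exact: (holoM hf IH).
Qed.
Lemma holoXz f (n : int) z : f z != 0 -> holo f z -> holo (fun z => f z ^ n) z.
Proof.
move=> f0 hf; case: n => n; first exact: (holoXn n hf).
by apply: (holoV _ (holoXn n.+1 hf)); rewrite expf_neq0.
Qed.
Lemma holo_prod (I : Type) (r : seq I) (F : I -> C -> C) z :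
  (forall i, holo (F i) z) -> holo (fun z => \prod_(i <- r) F i z) z.
Proof.
move=> hF; elim: r => [|i r IH].
  by under eq_fun do rewrite big_nil; exact: holo_cst.
by under eq_fun do rewrite big_cons; exact: (holoM (hF i) IH).
Qed.
Lemma holo_near f g z : (\forall w \near z, f w = g w) -> holo f z -> holo g z.
Proof. by move=> fg /holoP hf; apply/holoP; exact: (near_eq_derivable fg hf). Qed.

Lemma ccontP f z : ccont f z <-> {for z, continuous f}.
Proof.
have P := @cvg_cplxP R _ (nbhs z) _ f (f z).
split=> [fc|/P fc e e0].
  apply/P => e e0; have [d d0 dP] := fc e e0.
  by apply/nbhs_cplxP; exists d.
by have /nbhs_cplxP[d d0 dP] := fc e e0; exists d.
Qed.

Lemma holo_ccont f z : holo f z -> ccont f z.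
Proof.
by move=> /holoP/derivable1_diffP fd; apply/ccontP; exact: (differentiable_continuous fd).
Qed.

Lemma ccontM f g z : ccont f z -> ccont g z -> ccont (fun z => f z * g z) z.
Proof.
by move=> /ccontP fz /ccontP gz; apply/ccontP; exact: (@cvgM C C _ _ f g _ _ fz gz).
Qed.
Lemma ccontV f z : f z != 0 -> ccont f z -> ccont (fun z => (f z)^-1) z.
Proof. by move=> f0 /ccontP fz; apply/ccontP; exact: (@cvgV C C _ _ f _ f0 fz). Qed.
Lemma ccont_cst (c : C) z : ccont (fun=> c) z.
Proof. by move=> e e0; exists 1 => // w _; rewrite subrr nm0. Qed.
Lemma ccont_comp f g z : ccont g z -> ccont f (g z) -> ccont (fun z => f (g z)) z.
Proof.
move=> /ccontP gz /ccontP fz; apply/ccontP.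
exact: (@cvg_comp _ _ _ g f _ _ _ gz fz).
Qed.
Lemma ccont_near f g z : (\forall w \near z, f w = g w) -> ccont f z -> ccont g z.
Proof.
move=> fg fz e e0; have [d d0 dP] := fz e e0.
have /nbhs_cplxP[d' d'0 d'P] := fg.
exists (Num.min d d') => [|w]; first by rewrite lt_min d0.
by rewrite lt_min => /andP[/dP + /d'P <-]; rewrite (nbhs_singleton fg).
Qed.

(** ** The exponential *)

Lemma cexpE z : cexp z = (expR (complex.Re z) * cos (complex.Im z) +i*
  (expR (complex.Re z) * sin (complex.Im z)))%C.
Proof. by rewrite /cexp; apply: eq_cplx; rewrite ?cReM ?cImM /=; ring. Qed.

Lemma cexpD z w : cexp (z + w) = cexp z * cexp w.
Proof.
rewrite !cexpE cReD cImD; apply: eq_cplx; rewrite ?cReM ?cImM /= expRD ?cosD ?sinD; ring.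
Qed.

Lemma cexp0 : cexp (0 : C) = 1.
Proof.
by rewrite cexpE /= expR0 cos0 sin0; apply: eq_cplx; rewrite /= ?mul1r.
Qed.

Lemma nm_cexp z : nm (cexp z) = expR (complex.Re z).
Proof.
rewrite cexpE /nm /= !exprMn -mulrDr cos2Dsin2 mulr1 sqrtr_sqr ger0_norm //.
Qed.

Lemma cexp_neq0 z : cexp z != 0.
Proof. by rewrite -nm_gt0 nm_cexp expR_gt0. Qed.

Lemma cexp_cdiff0 : cdiff (@cexp R) 0 1.
Proof.
suff H e : 0 < e <= 1 -> exists2 d : R, 0 < d & forall h : C, nm h < d ->
    nm (cexp h - cexp 0 - h) <= e * nm h.
  move=> e e0; have : 0 < Num.min e 1 <= 1 by rewrite lt_min e0 ltr01 ge_min lexx orbT.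
  case/H => d d0 dP; exists d => // h /dP; rewrite add0r mul1r => /le_trans; apply.
  by rewrite ler_wpM2r ?nm_ge0 // ge_min lexx.
case/andP => e0 e1; have e8 : 0 < e / 8 by lra.
have [d1 d10 H1] := is_derive_eps (is_derive_expR 0) e8.
have [d2 d20 H2] := is_derive_eps (is_derive_cos 0) e8.
have [d3 d30 H3] := is_derive_eps (is_derive_sin 0) e8.
pose d := Num.min (Num.min d1 (Num.min d2 d3)) (e / 8).
have dP (x : R) : x < d -> [/\ x < d1, x < d2, x < d3 & x < e / 8].
  by rewrite !lt_min => /andP[/and3P[? ? ?] ?].
exists d; first by rewrite !lt_min; apply/andP; split; [apply/and3P; split|]; lra.
case=> x y hd; set h := (x +i* y)%C in hd *.
have [hx hy] : `|x| <= nm h /\ `|y| <= nm h.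
  by split; [exact: (Re_le_nm h)|exact: (Im_le_nm h)].
have [xd1 _ _ xe] := dP _ (le_lt_trans hx hd).
have [_ yd2 yd3 ye] := dP _ (le_lt_trans hy hd).
have := H1 x xd1; have := H2 y yd2; have := H3 y yd3.
rewrite !add0r expR0 sin0 oppr0 !mul0r !subr0 !mul1r cos0 mul1r !addr0 => s1 c1 E1.
have ex2 : expR x <= 2.
  have : expR x <= expR (1 / 4) by rewrite ler_expR; move: xe; rewrite ltr_norml; lra.
  have := expR_ge1Dx (- (1 / 4) : R); have := expRxMexpNx_1 (1 / 4 : R).
  have := expR_gt0 (1 / 4 : R); nra.
have ex0 := expR_gt0 x.
have exm : `|expR x - 1| <= 2 * `|x|.
  have -> : expR x - 1 = (expR x - 1 - x) + x by ring.
  apply: le_trans (ler_normD _ _) _.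
  have : e / 8 * `|x| <= 1 * `|x| by rewrite ler_wpM2r //; lra.
  by lra.
rewrite cexp0; apply: le_trans (nm_le_ReIm _) _.
rewrite cexpE !cReD !cImD !cReN !cImN /= subr0.
have A1 : `|expR x * cos y - 1 - x| <= e / 8 * `|x| + 2 * (e / 8 * `|y|).
  have -> : expR x * cos y - 1 - x = (expR x - 1 - x) + expR x * (cos y - 1) by ring.
  apply: le_trans (ler_normD _ _) _; apply: lerD => //.
  by rewrite normrM (gtr0_norm ex0); apply: ler_pM => //; exact: ltW.
have A2 : `|expR x * sin y - y| <= 2 * (e / 8 * `|y|) + 2 * `|x| * (e / 8).
  have -> : expR x * sin y - y = expR x * (sin y - y) + (expR x - 1) * y by ring.
  apply: le_trans (ler_normD _ _) _; apply: lerD; rewrite normrM ?(gtr0_norm ex0).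
    by apply: ler_pM => //; exact: ltW.
  by apply: ler_pM => //; exact: ltW.
have := ler_wpM2l (ltW e0) hx; have := ler_wpM2l (ltW e0) hy.
have := mulr_ge0 (ltW e0) (nm_ge0 h).
move=> h0 h1 h2; apply: le_trans (lerD A1 A2) _; lra.
Qed.

Lemma cexp_cdiff z : cdiff (@cexp R) z (cexp z).
Proof.
move=> e e0; have e0' : 0 < e / nm (cexp z) by rewrite divr_gt0 // nm_cexp expR_gt0.
have [d d0 dP] := cexp_cdiff0 e0'; exists d => // h /dP.
rewrite add0r cexp0 mul1r => H; rewrite cexpD.
have -> : cexp z * cexp h - cexp z - cexp z * h = cexp z * (cexp h - 1 - h) by ring.
have c0 : 0 < nm (cexp z) by rewrite nm_cexp expR_gt0.
by rewrite nmM mulrC -ler_pdivlMr // mulrAC.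
Qed.

Lemma holo_cexp z : holo (@cexp R) z.
Proof. by exists (cexp z); exact: cexp_cdiff. Qed.

Definition tpi : C := (pi *+ 2)%:C%C * 'i%C.
Definition ce z : C := cexp (tpi * z).

Lemma tpi_neq0 : tpi != 0.
Proof.
rewrite mulf_neq0 //; last by apply/eqP => -[] /eqP; rewrite oner_eq0.
by apply/eqP => -[] /eqP; rewrite mulrn_eq0 /= gt_eqF ?pi_gt0.
Qed.

Lemma ReIm_tpiM z : tpi * z =
  (- (pi *+ 2 * complex.Im z) +i* (pi *+ 2 * complex.Re z))%C.
Proof. by case: z => x y; apply: eq_cplx => /=; ring. Qed.

Lemma ceD z w : ce (z + w) = ce z * ce w.
Proof. by rewrite /ce mulrDr cexpD. Qed.
Lemma ce0 : ce 0 = 1. Proof. by rewrite /ce mulr0 cexp0. Qed.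
Lemma ce_neq0 z : ce z != 0. Proof. exact: cexp_neq0. Qed.
Lemma ceN z : ce (- z) = (ce z)^-1.
Proof. by apply: (mulIf (ce_neq0 z)); rewrite mulVf ?ce_neq0 // -ceD addNr ce0. Qed.
Lemma ceB z w : ce (z - w) = ce z / ce w. Proof. by rewrite ceD ceN. Qed.
Lemma nm_ce z : nm (ce z) = expR (- (pi *+ 2 * complex.Im z)).
Proof. by rewrite /ce nm_cexp ReIm_tpiM. Qed.
Lemma ce1 : ce 1 = 1.
Proof.
rewrite /ce cexpE ReIm_tpiM /= !mulr0 oppr0 expR0 mulr1 sin2pi cos2pi.
by apply: eq_cplx; rewrite /= ?mul1r.
Qed.
Lemma ceMn z n : ce (z *+ n) = ce z ^+ n.
Proof. by elim: n => [|n IH]; rewrite ?ce0 // mulrSr ceD IH exprSr. Qed.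
Lemma ceMz z (n : int) : ce (z *~ n) = ce z ^ n.
Proof.
by case: n => n; rewrite ?ceMn // NegzE mulrNz ceN ceMn.
Qed.
Lemma ce_int (n : int) : ce n%:~R = 1. Proof. by rewrite ceMz ce1 exp1rz. Qed.
Lemma ce_half : ce (1 / 2) = -1.
Proof.
have -> : (1 / 2 : C) = (1 / 2 : R)%:C%C.
  by rewrite fmorph_div rmorph1 rmorph_nat.
rewrite /ce cexpE ReIm_tpiM /= mulr0 oppr0 expR0 mulr2n.
have -> : (pi + pi) * (1 / 2) = pi :> R by field.
by rewrite sinpi cospi; apply: eq_cplx; rewrite /= ?mul1r ?oppr0.
Qed.
Lemma holo_ce z : holo ce z.
Proof.
exact: (@holo_comp (@cexp R) (fun z => tpi * z) z (holoZ tpi (holo_id z)) (holo_cexp _)).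
Qed.

(** The modulus forces [z] to be real. If [r] is its fractional part and [r > 0], then
    [cos (2 pi r) = 1] contradicts [sin (pi r) > 0]. *)
Lemma ce_eq1 z : ce z = 1 -> exists n : int, z = n%:~R.
Proof.
move=> cz; have i0 : complex.Im z = 0.
  have := nm_ce z; rewrite cz nm1 -expR0 => /esym/expR_inj/eqP.
  by rewrite oppr_eq0 mulf_eq0 mulrn_eq0 /= gt_eqF ?pi_gt0 //= => /eqP.
pose n := Num.floor (complex.Re z); pose r := complex.Re z - n%:~R.
have cr : ce (z - n%:~R) = 1 by rewrite ceB ce_int cz divr1.
have zr : z - n%:~R = r%:C%C.
  have iE : (n%:~R : C) = (n%:~R : R)%:C%C by rewrite rmorph_int.
  by rewrite iE; apply: eq_cplx; rewrite ?cReD ?cImD ?cReN ?cImN /= ?i0 ?subr0.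
have r01 : 0 <= r < 1.
  rewrite /r subr_ge0 ge_floor /= ltrBlDl; have := lt_succ_floor (complex.Re z).
  by rewrite intrD addrC.
exists n; suff r0 : r = 0 by apply/eqP; rewrite -subr_eq0 zr r0.
apply/eqP; apply: contraT => rn0.
have /andP[r0 r1] := r01; have rp : 0 < r by rewrite lt_def rn0.
have rpi : 0 < r * pi < pi by rewrite mulr_gt0 ?pi_gt0 //= gtr_pMl ?pi_gt0.
have s0 := sin_gt0_pi rpi.
have : cos (r * pi *+ 2) = 1.
  move: cr => /(congr1 (@complex.Re R)).
  by rewrite zr /ce cexpE ReIm_tpiM /= mulr0 oppr0 expR0 mul1r mulrnAl (mulrC pi).
rewrite mulr2n cosD -!expr2 => c1; have := cos2Dsin2 (r * pi).
move: c1 s0; move: (cos _) (sin _) => u v; clear; nra.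
Qed.

End Holomorphy.

(** * Integrals of continuous functions on segments, and bisection *)

Section RealIntegral.
Variable R : realType.
Implicit Types (a b c x y : R) (h : R -> R).

Definition rcont h a b := forall x, a <= x <= b -> forall e : R, 0 < e ->
  exists2 d : R, 0 < d & forall y, `|y - x| < d -> `|h y - h x| < e.

Definition J a b h : R := \int[lebesgue_measure]_(x in `[a, b]) h x.

Lemma rcont_continuous h a b : rcont h a b -> {within `[a, b], continuous h}.
Proof.
move=> hc; apply: continuous_in_subspaceT => x; rewrite inE /= in_itv /= => xab.
apply/cvgrPdist_lt => e e0; have [d d0 dP] := hc x xab e e0.
apply/nbhs_ballP; exists d => // y yx.
by rewrite distrC; apply: dP; rewrite distrC; exact: yx.
Qed.

Lemma rcont_sub h a b a' b' : a <= a' -> b' <= b -> rcont h a b -> rcont h a' b'.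
Proof. by move=> aa bb hc x xab; apply: hc; lra. Qed.

Lemma J_integrable h a b : rcont h a b ->
  lebesgue_measure.-integrable `[a, b] (EFin \o h).
Proof.
move=> hc; apply: continuous_compact_integrable; first exact: segment_compact.
exact: rcont_continuous.
Qed.

Lemma J_split h a b c : rcont h a b -> a <= c <= b -> J a b h = J a c h + J c b h.
Proof.
move=> hc /andP[ac cb]; rewrite /J.
have hi := J_integrable hc.
have := @Rintegral_itvB R h (BLeft a) (BRight b) c hi.
rewrite !bnd_simp ac cb => /(_ isT isT).
rewrite Rintegral_itv_obnd_cbnd; first by move=> <-; rewrite addrC subrK.
apply: (integrableS _ _ _ hi) => //.
by move=> x /=; rewrite !in_itv /=; lra.
Qed.

Lemma J_aa h a : J a a h = 0.
Proof. by rewrite /J set_itv1 Rintegral_set1. Qed.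

Lemma J_diff h1 h2 a b (k M : R) : a <= b -> rcont h1 a b -> rcont h2 a b ->
  (forall x, a <= x <= b -> `|h1 x - h2 x - k| <= M) ->
  `|J a b h1 - J a b h2 - k * (b - a)| <= M * (b - a).
Proof.
move=> ab /J_integrable i1 /J_integrable i2 hM.
have mI : measurable (`[a, b]%classic : set R) by [].
have ik (r : R) : lebesgue_measure.-integrable `[a, b] (EFin \o cst r).
  apply: continuous_compact_integrable; first exact: segment_compact.
  by apply: continuous_subspaceT => x; exact: cvg_cst.
have Jk (r : R) : \int[lebesgue_measure]_(x in `[a, b]) (cst r) x = r * (b - a).
  rewrite Rintegral_cst //= lebesgue_measure_itv /= lte_fin.
  have [//|ba] := ltP a b; have -> : a = b by apply/eqP; rewrite eq_le ab.
  by rewrite subrr mulr0.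
have i12 : lebesgue_measure.-integrable `[a, b] (EFin \o (fun x => h1 x - h2 x)).
  exact: (integrableB _ i1 i2).
have i12k : lebesgue_measure.-integrable `[a, b] (EFin \o (fun x => h1 x - h2 x - k)).
  exact: (integrableB _ i12 (ik k)).
rewrite /J -RintegralB // -Jk -RintegralB //.
apply: le_trans (le_normr_Rintegral _ i12k) _ => //.
rewrite -Jk; apply: le_Rintegral; [exact: mI| |exact: (ik M)|].
  exact: (integrable_abse i12k).
by move=> x /=; rewrite in_itv /= => /hM.
Qed.

Lemma rcont_cst (k : R) a b : rcont (fun=> k) a b.
Proof. by move=> x _ e e0; exists 1 => // y _; rewrite subrr normr0. Qed.
Arguments rcont_cst : clear implicits.

Lemma J_bound h a b (k M : R) : a <= b -> rcont h a b ->
  (forall x, a <= x <= b -> `|h x - k| <= M) ->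
  `|J a b h - k * (b - a)| <= M * (b - a).
Proof.
move=> ab hc hM; have := @J_diff h (fun=> 0) a b k M ab hc (rcont_cst _ _ _).
have -> : J a b (fun=> 0) = 0.
  have /= := @J_diff (fun=> 0) (fun=> 0) a b 0 0 ab (rcont_cst _ _ _) (rcont_cst _ _ _).
  by rewrite /J Rintegral_cst // mul0r.
by rewrite subr0; apply => x /hM; rewrite subr0.
Qed.

Lemma J_ge0 h a b : a <= b -> rcont h a b -> (forall x, a <= x <= b -> 0 <= h x) ->
  0 <= J a b h.
Proof. by move=> ab hc h0; apply: Rintegral_ge0 => x /=; rewrite in_itv /= => /h0. Qed.

(** A value below [k] would, by continuity, lower the function by at least [e] on a whole interval
    [[u, v]], and the mean with it. *)
Lemma J_eq_max h a b (k : R) : a < b -> rcont h a b ->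
  (forall x, a <= x <= b -> h x <= k) -> J a b h = k * (b - a) ->
  forall x, a <= x <= b -> h x = k.
Proof.
move=> ab hc hk Jk x1 x1ab; apply/eqP; rewrite eq_le hk //=.
rewrite leNgt; apply/negP => hx1.
pose e := (k - h x1) / 2; have e0 : 0 < e by rewrite /e; lra.
have [d d0 dP] := hc x1 x1ab e e0.
pose u := Num.max a (x1 - d / 2); pose v := Num.min b (x1 + d / 2).
have [uv uP] : u < v /\ a <= u.
  rewrite /u /v lt_min !gt_max le_max lexx; split => //.
  by apply/andP; split; apply/andP; split; lra.
have vb : v <= b by rewrite /v ge_min lexx.
have small x : u <= x <= v -> h x <= k - e.
  rewrite /u /v ge_max le_min => /andP[/andP[_ h1] /andP[_ h2]].
  have := dP x; rewrite ltr_norml ltr_norml => H.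
  have /H : - d < x - x1 < d by lra.
  rewrite /e; lra.
have bnd p q K : a <= p -> p <= q -> q <= b -> (forall x, p <= x <= q -> h x <= K :> R) ->
    J p q h <= K * (q - p).
  move=> ap pq qb hK.
  have hc' : rcont h p q by apply: rcont_sub hc.
  have hc'' : rcont (fun x => K - h x) p q.
    move=> x xpq e' e'0; have [d' d'0 d'P] := hc' x xpq e' e'0; exists d' => // y /d'P.
    have -> : K - h y - (K - h x) = - (h y - h x) by ring.
    by rewrite normrN.
  have J0 : 0 <= J p q (fun=> K) - J p q h.
    have -> : J p q (fun=> K) - J p q h = J p q (fun x => K - h x).
      rewrite /J RintegralB //; [|exact: J_integrable].
      by apply: J_integrable; exact: rcont_cst.
    by apply: J_ge0 => // x /hK; rewrite subr_ge0.
  have JK : J p q (fun=> K) = K * (q - p).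
    apply/eqP; rewrite -subr_eq0 -normr_le0 -(mul0r (q - p)).
    by apply: J_bound => // [|x _]; [exact: rcont_cst|rewrite subrr normr0].
  by rewrite JK in J0; lra.
have Js : J a b h = J a u h + J u v h + J v b h.
  have hub : rcont h u b by apply: rcont_sub hc; lra.
  by rewrite (@J_split h a b u) ?(@J_split h u b v) // ?addrA //; lra.
have B1 : J a u h <= k * (u - a) by apply: bnd => // [|x ?]; [lra|apply: hk; lra].
have B2 : J u v h <= (k - e) * (v - u) by apply: bnd => //; lra.
have B3 : J v b h <= k * (b - v) by apply: bnd => // [|x ?]; [lra|apply: hk; lra].
have : 0 < e * (v - u) by rewrite mulr_gt0 ?subr_gt0.
move: Jk; rewrite Js; nra.
Qed.

Lemma nested_intervals (U V : nat -> R) : (forall n, U n <= V n) -> (forall n, U n <= U n.+1) ->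
  (forall n, V n.+1 <= V n) -> exists x, forall n, U n <= x <= V n.
Proof.
move=> UV Ui Vd.
have Um m n : (m <= n)%N -> U m <= U n.
  by move=> /subnK <-; elim: (_ - _)%N => //= k IH; rewrite addSn; apply: le_trans IH _.
have Vm m n : (m <= n)%N -> V n <= V m.
  by move=> /subnK <-; elim: (_ - _)%N => //= k IH; rewrite addSn; apply: le_trans (Vd _) IH.
have UVmn m n : U m <= V n.
  have [mn|/ltnW nm] := leqP m n; first exact: le_trans (Um _ _ mn) (UV n).
  exact: le_trans (UV m) (Vm _ _ nm).
have hs : has_sup (range U).
  by split; [exists (U 0%N), 0%N|exists (V 0%N) => _ [n _ <-]].
exists (sup (range U)) => n; apply/andP; split.
  by apply: sup_upper_bound => //; exists n.
by apply: ge_sup => [|_ [m _ <-]]; [exists (U 0%N), 0%N|].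
Qed.

(** ** Bisection of rectangles *)

Section Bisection.
Variables (E : R -> R -> R -> R -> R) (a0 b0 c0 d0 eps : R).
Hypotheses (ab0 : a0 <= b0) (cd0 : c0 <= d0).
Hypothesis Ex : forall a m b c d, a0 <= a -> a <= m -> m <= b -> b <= b0 ->
  c0 <= c -> c <= d -> d <= d0 -> E a b c d = E a m c d + E m b c d.
Hypothesis Ey : forall a b c m d, a0 <= a -> a <= b -> b <= b0 ->
  c0 <= c -> c <= m -> m <= d -> d <= d0 -> E a b c d = E a b c m + E a b m d.
Hypothesis Eloc : forall x y, a0 <= x <= b0 -> c0 <= y <= d0 ->
  exists2 dl : R, 0 < dl & forall a b c d, a0 <= a -> a <= x <= b -> b <= b0 ->
    c0 <= c -> c <= y <= d -> d <= d0 -> (b - a) + (d - c) < dl ->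
    `|E a b c d| <= eps * ((b - a) + (d - c)) ^+ 2.

Let rect := (R * R * R * R)%type.
Let Eq (q : rect) := let: (a, b, c, d) := q in E a b c d.
Let sz (q : rect) := let: (a, b, c, d) := q in (b - a) + (d - c).
Let big (q : rect) := eps * sz q ^+ 2 < `|Eq q|.
Let half (q : rect) : rect :=
  let: (a, b, c, d) := q in
  let m := (a + b) / 2 in let n := (c + d) / 2 in
  if big (a, m, c, n) then (a, m, c, n) else if big (m, b, c, n) then (m, b, c, n)
  else if big (a, m, n, d) then (a, m, n, d) else (m, b, n, d).
Let inside (q : rect) := let: (a, b, c, d) := q in
  [/\ a0 <= a, a <= b & b <= b0] /\ [/\ c0 <= c, c <= d & d <= d0].

Let half_inside q : inside q -> inside (half q).
Proof.
case: q => [[[a b] c] d] [[h1 h2 h3] [h4 h5 h6]]; rewrite /half.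
by do 3?case: ifP => _; split; split; lra.
Qed.

Let half_big q : inside q -> big q -> big (half q).
Proof.
case: q => [[[a b] c] d] [[h1 h2 h3] [h4 h5 h6]] H; rewrite /half.
set m := (a + b) / 2; set n := (c + d) / 2.
have mE : m = (a + b) / 2 by []. have nE : n = (c + d) / 2 by [].
case: ifP => // /negbT B1; case: ifP => // /negbT B2; case: ifP => // /negbT B3.
move: B1 B2 B3 H; rewrite /big /Eq /sz -!leNgt => B1 B2 B3.
rewrite (@Ex a m b c d) ?(@Ey a m c n d) ?(@Ey m b c n d); try lra.
move=> H; rewrite ltNge; apply/negP => B4.
have := le_trans (ler_normD _ _) (lerD (ler_normD (E a m c n) (E a m n d)) (ler_normD (E m b c n) (E m b n d))).
move: H B1 B2 B3 B4; rewrite mE nE.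
set e1 := `|E a _ c _|; set e2 := `|E _ b c _|; set e3 := `|E a _ _ d|; set e4 := `|E _ b _ d|.
set tot := `|_ + _ + _|.
have -> : eps * ((b - a) + (d - c)) ^+ 2 = 4 * (eps * (((b - a) / 2) + ((d - c) / 2)) ^+ 2) by field.
have -> : (a + b) / 2 - a = (b - a) / 2 by field.
have -> : b - (a + b) / 2 = (b - a) / 2 by field.
have -> : (c + d) / 2 - c = (d - c) / 2 by field.
have -> : d - (c + d) / 2 = (d - c) / 2 by field.
lra.
Qed.

Let Q n := iter n half (a0, b0, c0, d0).
Let A n := (Q n).1.1.1. Let B n := (Q n).1.1.2.
Let CC n := (Q n).1.2. Let D n := (Q n).2.

Let Q_inside n : inside (Q n).
Proof. by elim: n => [|n IH]; [split; split|rewrite /Q iterS; exact: half_inside]. Qed.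

Let Q_step n : [/\ A n <= A n.+1, B n.+1 <= B n & B n.+1 - A n.+1 = (B n - A n) / 2] /\
  [/\ CC n <= CC n.+1, D n.+1 <= D n & D n.+1 - CC n.+1 = (D n - CC n) / 2].
Proof.
rewrite /A /B /CC /D /Q iterS -/(Q n); have := Q_inside n.
case: (Q n) => [[[a b] c] d] /= [[h1 h2 h3] [h4 h5 h6]].
by do 3?case: ifP => _ /=; split; split; lra.
Qed.

(** Quartering a rectangle divides the bound by 4, so if the bound fails it fails for some quarter.
    The nested quarters shrink to a point, where [Eloc] gives a contradiction. *)
Lemma bisection : `|E a0 b0 c0 d0| <= eps * ((b0 - a0) + (d0 - c0)) ^+ 2.
Proof.
rewrite leNgt; apply/negP => H.
have bigQ n : big (Q n).
  by elim: n => [//|n IH]; rewrite /Q iterS; apply: half_big => //; exact: Q_inside.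
have insE n : [/\ a0 <= A n, A n <= B n & B n <= b0] /\
    [/\ c0 <= CC n, CC n <= D n & D n <= d0].
  by have := Q_inside n; rewrite /A /B /CC /D; case: (Q n) => [[[a b] c] d].
have [x xP] : exists x, forall n, A n <= x <= B n.
  apply: nested_intervals => n; first by have [[]] := insE n.
    by have [[]] := Q_step n.
  by have [[]] := Q_step n.
have [y yP] : exists y, forall n, CC n <= y <= D n.
  apply: nested_intervals => n; first by have [_ []] := insE n.
    by have [_ []] := Q_step n.
  by have [_ []] := Q_step n.
have xab : a0 <= x <= b0 by exact: (xP 0%N).
have ycd : c0 <= y <= d0 by exact: (yP 0%N).
have [dl dl0 dlP] := Eloc xab ycd.
have szE n : (B n - A n) + (D n - CC n) = ((b0 - a0) + (d0 - c0)) / 2 ^+ n.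
  elim: n => [|n IH]; first by rewrite expr0 divr1.
  have [[_ _ ->] [_ _ ->]] := Q_step n.
  by rewrite -mulrDl IH exprSr invfM mulrA.
have [n nP] : exists n, ((b0 - a0) + (d0 - c0)) / 2 ^+ n < dl.
  exists (Num.bound (((b0 - a0) + (d0 - c0)) / dl)).
  rewrite ltr_pdivrMr ?exprn_gt0 // -ltr_pdivrMl // mulrC.
  apply: lt_le_trans (archi_boundP _) _; first by rewrite divr_ge0 //; lra.
  by rewrite -natrX ler_nat ltnW // ltn_expl.
have [[i1 i2 i3] [i4 i5 i6]] := insE n.
have := dlP _ _ _ _ i1 (xP n) i3 i4 (yP n) i6; rewrite szE => /(_ nP).
have := bigQ n; rewrite /big /Eq /sz -szE /A /B /CC /D.
by case: (Q n) => [[[a b] c] d] /= K /(lt_le_trans K); rewrite ltxx.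
Qed.
End Bisection.
End RealIntegral.

(** * Goursat's lemma with isolated exceptional points *)

Section Goursat.
Variable R : realType.
Local Notation C := (R[i]^o).
Implicit Types (a b c d x y : R) (g : C -> C) (z w l : C).

Definition inrect a b c d z :=
  (a <= complex.Re z <= b) && (c <= complex.Im z <= d).

(** The imaginary part of the integral of [g] around the rectangle. Multiplying [g] by constants
    recovers the full information. *)
Definition E g a b c d : R :=
  J a b (fun x => complex.Im (g (x +i* c)%C)) - J a b (fun x => complex.Im (g (x +i* d)%C))
  + J c d (fun y => complex.Re (g (b +i* y)%C)) - J c d (fun y => complex.Re (g (a +i* y)%C)).

Lemma nm_rect a b c d z w : inrect a b c d z -> inrect a b c d w ->
  nm (z - w) <= (b - a) + (d - c).
Proof.
case: z => x y; case: w => x' y' /andP[/= h1 h2] /andP[/= h3 h4].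
by apply: le_trans (nm_le_ReIm _) _; rewrite cReD cImD cReN cImN /=;
  apply: lerD; rewrite ler_norml; lra.
Qed.

Lemma inrect_sub a b c d a1 b1 c1 d1 z : a <= a1 -> b1 <= b -> c <= c1 -> d1 <= d ->
  inrect a1 b1 c1 d1 z -> inrect a b c d z.
Proof. by rewrite /inrect => *; lra. Qed.

Let shrink_lt (e s ts : R) : 0 <= s -> 0 < e -> ts <= e / (4 * (s + 1)) * s ->
  e <= 2 * 1 * ts -> False.
Proof.
move=> s0 e0 h1 h2; have : e / (4 * (s + 1)) * s <= e / 4.
  by rewrite mulrAC ler_pdivrMr; [nra|lra].
lra.
Qed.

Section Rect.
Variables (g : C -> C) (a0 b0 c0 d0 : R).
Hypothesis gc : forall z, inrect a0 b0 c0 d0 z -> ccont g z.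

Lemma rcont_h (f : C -> R) y : (forall z, `|f z| <= nm z) ->
  (forall z w, f (z - w) = f z - f w) -> c0 <= y <= d0 ->
  rcont (fun x => f (g (x +i* y)%C)) a0 b0.
Proof.
move=> fb fB ycd x xab e e0; have /gc/(_ e e0)[d dd0 dP] : inrect a0 b0 c0 d0 (x +i* y)%C.
  by rewrite /inrect /= xab.
exists d => // x' xx; rewrite -fB; apply: le_lt_trans (fb _) _; apply: dP.
by rewrite -[_ - _]/((x' - x) +i* (y - y))%C subrr nm_real.
Qed.

Lemma rcont_v (f : C -> R) x : (forall z, `|f z| <= nm z) ->
  (forall z w, f (z - w) = f z - f w) -> a0 <= x <= b0 ->
  rcont (fun y => f (g (x +i* y)%C)) c0 d0.
Proof.
move=> fb fB xab y ycd e e0; have /gc/(_ e e0)[d dd0 dP] : inrect a0 b0 c0 d0 (x +i* y)%C.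
  by rewrite /inrect /= xab.
exists d => // y' yy; rewrite -fB; apply: le_lt_trans (fb _) _; apply: dP.
rewrite -[_ - _]/((x - x) +i* (y' - y))%C subrr; apply: le_lt_trans (nm_le_ReIm _) _.
by rewrite /= normr0 add0r.
Qed.

Let ReB z w : complex.Re (z - w) = complex.Re z - complex.Re w.
Proof. by rewrite cReD cReN. Qed.
Let ImB z w : complex.Im (z - w) = complex.Im z - complex.Im w.
Proof. by rewrite cImD cImN. Qed.

Let rcIm y := @rcont_h _ y (@Im_le_nm R) ImB.
Let rcRe x := @rcont_v _ x (@Re_le_nm R) ReB.

Lemma E_splitx a m b c d : a0 <= a -> a <= m -> m <= b -> b <= b0 ->
  c0 <= c -> c <= d -> d <= d0 -> E g a b c d = E g a m c d + E g m b c d.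
Proof.
move=> *; rewrite /E.
rewrite (@J_split _ (fun x => complex.Im (g (x +i* c)%C)) a b m); last by lra.
  rewrite (@J_split _ (fun x => complex.Im (g (x +i* d)%C)) a b m); last by lra.
    by ring.
  by apply: rcont_sub (rcIm _) => //; lra.
by apply: rcont_sub (rcIm _) => //; lra.
Qed.

Lemma E_splity a b c m d : a0 <= a -> a <= b -> b <= b0 ->
  c0 <= c -> c <= m -> m <= d -> d <= d0 -> E g a b c d = E g a b c m + E g a b m d.
Proof.
move=> *; rewrite /E.
rewrite (@J_split _ (fun y => complex.Re (g (a +i* y)%C)) c d m); last by lra.
  rewrite (@J_split _ (fun y => complex.Re (g (b +i* y)%C)) c d m); last by lra.
    by ring.
  by apply: rcont_sub (rcRe _) => //; lra.
by apply: rcont_sub (rcRe _) => //; lra.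
Qed.

(** Affine functions contribute nothing to the boundary integral, so only the error of the affine
    approximation counts. *)
Lemma E_bound a b c d (g0 l z0 : C) (M : R) : a0 <= a -> a <= b -> b <= b0 ->
  c0 <= c -> c <= d -> d <= d0 ->
  (forall z, inrect a b c d z -> nm (g z - g0 - l * (z - z0)) <= M) ->
  `|E g a b c d| <= 2 * M * ((b - a) + (d - c)).
Proof.
move=> a0a ab bb0 c0c cd dd0 gM.
have gM2 z w : inrect a b c d z -> inrect a b c d w ->
    nm (g z - g w - l * (z - w)) <= 2 * M.
  move=> /gM zM /gM wM.
  have -> : g z - g w - l * (z - w) = (g z - g0 - l * (z - z0)) - (g w - g0 - l * (w - z0)).
    by ring.
  by apply: le_trans (nmB _ _) _; lra.
have rI y : c <= y <= d -> rcont (fun x => complex.Im (g (x +i* y)%C)) a b.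
  by move=> ?; apply: rcont_sub (rcIm _) => //; lra.
have rR x : a <= x <= b -> rcont (fun y => complex.Re (g (x +i* y)%C)) c d.
  by move=> ?; apply: rcont_sub (rcRe _) => //; lra.
have B1 := @J_diff _ _ _ a b (complex.Re l * (c - d)) (2 * M) ab (rI c _) (rI d _).
have B2 := @J_diff _ _ _ c d (complex.Re l * (b - a)) (2 * M) cd (rR b _) (rR a _).
have {}B1 : `|J a b (fun x => complex.Im (g (x +i* c)%C)) - J a b (fun x => complex.Im (g (x +i* d)%C))
   - complex.Re l * (c - d) * (b - a)| <= 2 * M * (b - a).
  apply: B1 => [||x xab]; try lra.
  rewrite -ImB; have -> : complex.Re l * (c - d) = complex.Im (l * ((x +i* c)%C - (x +i* d)%C)).
    by rewrite cImM cReD cImD cReN cImN /= subrr mulr0 addr0.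
  rewrite -ImB; apply: le_trans (Im_le_nm _) _.
  by apply: gM2; rewrite /inrect /=; lra.
have {}B2 : `|J c d (fun y => complex.Re (g (b +i* y)%C)) - J c d (fun y => complex.Re (g (a +i* y)%C))
   - complex.Re l * (b - a) * (d - c)| <= 2 * M * (d - c).
  apply: B2 => [||y ycd]; try lra.
  rewrite -ReB; have -> : complex.Re l * (b - a) = complex.Re (l * ((b +i* y)%C - (a +i* y)%C)).
    by rewrite cReM cReD cImD cReN cImN /= subrr mulr0 subr0.
  rewrite -ReB; apply: le_trans (Re_le_nm _) _.
  by apply: gM2; rewrite /inrect /=; lra.
rewrite /E mulrDr; apply: le_trans (lerD B1 B2); apply: le_trans (ler_normD _ _).
by rewrite le_eqVlt; apply/orP; left; apply/eqP; congr (`| _ |); ring.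
Qed.

Lemma goursat1 a b c d : a0 <= a -> a <= b -> b <= b0 ->
  c0 <= c -> c <= d -> d <= d0 -> (forall z, inrect a b c d z -> holo g z) ->
  E g a b c d = 0.
Proof.
move=> a0a ab bb0 c0c cd dd0 gh.
suff H eps : 0 < eps -> `|E g a b c d| <= eps * ((b - a) + (d - c)) ^+ 2.
  apply/eqP; rewrite -normr_le0 leNgt; apply/negP => E0.
  pose s := ((b - a) + (d - c)) ^+ 2.
  have s0 : 0 <= s by exact: sqr_ge0.
  have e0 : 0 < `|E g a b c d| / (2 * (s + 1)) by rewrite divr_gt0 //; lra.
  have := H _ e0; rewrite -/s => K.
  have : `|E g a b c d| / (2 * (s + 1)) * s <= `|E g a b c d| / 2.
    rewrite mulrAC ler_pdivrMr; last by lra.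
    by nra.
  lra.
move=> e0; apply: bisection => //.
- by move=> *; apply: E_splitx => //; lra.
- by move=> *; apply: E_splity => //; lra.
move=> x y xab ycd.
have [|l gl] := gh (x +i* y)%C; first by rewrite /inrect /= xab.
have e2 : 0 < eps / 2 by lra.
have [dl dl0 dlP] := gl _ e2; exists dl => // a' b' c' d' h1 h2 h3 h4 h5 h6 hs.
have -> : eps * (b' - a' + (d' - c')) ^+ 2 =
  2 * (eps / 2 * (b' - a' + (d' - c'))) * (b' - a' + (d' - c')) by field.
apply: (@E_bound a' b' c' d' (g (x +i* y)%C) l (x +i* y)%C); try lra.
move=> z zin; have zs : nm (z - (x +i* y)%C) <= b' - a' + (d' - c').
  by apply: nm_rect => //; rewrite /inrect /=; lra.
have := dlP (z - (x +i* y)%C) (le_lt_trans zs hs).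
have -> : (x +i* y)%C + (z - (x +i* y)%C) = z by ring.
move=> /le_trans; apply; rewrite ler_wpM2l //; lra.
Qed.

Hypotheses (ab0 : a0 <= b0) (cd0 : c0 <= d0).

(** The local bound of [bisection] holds with [eps = 0]: around a point, the rectangle is cut into
    four pieces on which the integral vanishes and a small one, whose contribution is at most a
    multiple of its size. *)
Theorem goursat : (forall z, inrect a0 b0 c0 d0 z -> exists2 d : R, 0 < d &
    forall w, w != z -> nm (w - z) < d -> holo g w) -> E g a0 b0 c0 d0 = 0.
Proof.
move=> gh; apply/eqP; rewrite -normr_le0 -[leRHS](mul0r ((b0 - a0 + (d0 - c0)) ^+ 2)).
apply: bisection => //.
- by move=> *; apply: E_splitx => //; lra.
- by move=> *; apply: E_splity => //; lra.
move=> x y xab ycd; set z0 := (x +i* y)%C.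
have z0in : inrect a0 b0 c0 d0 z0 by rewrite /inrect /= xab.
have [d1 d10 d1P] := gh _ z0in.
have [d2 d20 d2P] := gc z0in ltr01.
exists (Num.min d1 d2) => [|a b c d a0a xab' bb0 c0c ycd' dd0]; first by rewrite lt_min d10.
rewrite lt_min => /andP[s1 s2]; rewrite mul0r.
have ab : a <= b by lra. have cd : c <= d by lra.
have out a' b' c' d' : a <= a' -> a' <= b' -> b' <= b -> c <= c' -> c' <= d' -> d' <= d ->
    ~~ inrect a' b' c' d' z0 -> E g a' b' c' d' = 0.
  move=> h1 h2 h3 h4 h5 h6 nz; apply: goursat1; try lra.
  move=> z zin; apply: d1P; first by apply: contraNneq nz => <-.
  apply: le_lt_trans s1; apply: nm_rect; rewrite /inrect /=; move: zin; rewrite /inrect; lra.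
have degx a' c' d' : E g a' a' c' d' = 0 by rewrite /E !J_aa; ring.
have degy a' b' c' : E g a' b' c' c' = 0 by rewrite /E !J_aa; ring.
rewrite leNgt; apply/negP => E0.
pose s := (b - a) + (d - c); have s0 : 0 <= s by rewrite /s; lra.
(* The shrinking factor is chosen so that the bound [2 t s] for the small rectangle stays below
   [|E| / 2]. *)
pose t := Num.min 1 (`|E g a b c d| / (4 * (s + 1))).
have t0 : 0 < t by rewrite lt_min ltr01 divr_gt0 //; lra.
have t1 : t <= 1 by rewrite ge_min lexx.
pose a1 := x - t * (x - a); pose b1 := x + t * (b - x).
pose c1 := y - t * (y - c); pose dd1 := y + t * (d - y).
have [ha1 ha2] : a <= a1 /\ a1 <= x by rewrite /a1; split; nra.
have [hb1 hb2] : b1 <= b /\ x <= b1 by rewrite /b1; split; nra.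
have [hc1 hc2] : c <= c1 /\ c1 <= y by rewrite /c1; split; nra.
have [hd1 hd2] : dd1 <= d /\ y <= dd1 by rewrite /dd1; split; nra.
have a1b1 := le_trans ha2 hb2; have c1d1 := le_trans hc2 hd2.
have a1b := le_trans a1b1 hb1; have ab1 := le_trans ha1 a1b1.
have c1d := le_trans c1d1 hd1; have cd1 := le_trans hc1 c1d1.
have lt0 u v : 0 < t * (u - v) -> (u <= v) = false.
  by move=> h; apply/negbTE; rewrite -ltNge -subr_gt0 -(pmulr_rgt0 _ t0).
have tpos u v : v <= u -> u != v -> 0 < t * (u - v).
  by move=> h1 h2; rewrite mulr_gt0 // subr_gt0 lt_def h2.
have a1x : x != a -> (x <= a1) = false.
  move=> xa; apply/negbTE; rewrite -ltNge /a1 ltrBlDr ltrDl.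
  by apply: tpos => //; case/andP: xab'.
have b1x : x != b -> (b1 <= x) = false.
  move=> xa; apply/negbTE; rewrite -ltNge /b1 ltrDl.
  by apply: tpos; rewrite 1?eq_sym //; case/andP: xab'.
have c1y : y != c -> (y <= c1) = false.
  move=> xa; apply/negbTE; rewrite -ltNge /c1 ltrBlDr ltrDl.
  by apply: tpos => //; case/andP: ycd'.
have d1y : y != d -> (dd1 <= y) = false.
  move=> xa; apply/negbTE; rewrite -ltNge /dd1 ltrDl.
  by apply: tpos; rewrite 1?eq_sym //; case/andP: ycd'.
have Z1 : E g a a1 c d = 0.
  have [xa|xa] := eqVneq x a; first by rewrite (_ : a1 = a) // /a1 xa; ring.
  by apply: out => //; rewrite /inrect /= a1x // andbF.
have Z2 : E g b1 b c d = 0.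
  have [xa|xa] := eqVneq x b; first by rewrite (_ : b1 = b) // /b1 xa; ring.
  by apply: out => //; rewrite /inrect /= b1x.
have Z3 : E g a1 b1 c c1 = 0.
  have [xa|xa] := eqVneq y c; first by rewrite (_ : c1 = c) // /c1 xa; ring.
  by apply: out => //; rewrite /inrect /= c1y // !andbF.
have Z4 : E g a1 b1 dd1 d = 0.
  have [xa|xa] := eqVneq y d; first by rewrite (_ : dd1 = d) // /dd1 xa; ring.
  by apply: out => //; rewrite /inrect /= d1y // andbF.
have sE : b1 - a1 + (dd1 - c1) = t * s by rewrite /b1 /a1 /dd1 /c1 /s; ring.
have inz z : inrect a1 b1 c1 dd1 z -> inrect a b c d z.
  exact: inrect_sub.
have zin0 : inrect a b c d z0 by rewrite /inrect /= xab'.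
clear out degx degy gh d1P; clearbody a1 b1 c1 dd1.
have a0a1 := le_trans a0a ha1; have b1b0 := le_trans hb1 bb0.
have c0c1 := le_trans c0c hc1; have d1d0 := le_trans hd1 dd0.
have EE : E g a b c d = E g a1 b1 c1 dd1.
  rewrite (@E_splitx a a1 b c d) // (@E_splitx a1 b1 b c d) // Z1 Z2 add0r addr0.
  by rewrite (@E_splity a1 b1 c c1 d) // (@E_splity a1 b1 c1 dd1 d) // Z3 Z4 add0r addr0.
have := @E_bound a1 b1 c1 dd1 (g z0) 0 z0 1; rewrite -EE.
rewrite sE.
have -> : (forall z, inrect a1 b1 c1 dd1 z -> nm (g z - g z0 - 0 * (z - z0)) <= 1) = True.
  rewrite propeqE; split=> // _ z zin; rewrite mul0r subr0; apply/ltW/d2P.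
  by apply: le_lt_trans s2; apply: nm_rect => //; exact: inz.
move=> K; have {K} : `|E g a b c d| <= 2 * 1 * (t * s) by apply: K.
apply: (@shrink_lt `|E g a b c d| s (t * s) s0 E0).
by rewrite ler_wpM2r // /t ge_min lexx orbT.
Qed.
End Rect.

(** ** Mean values and the maximum principle *)

(** Continuous, and holomorphic off isolated points: the class that contains quotients filled in by
    their limits, and for which Goursat's lemma was arranged. *)
Definition cregular g z := ccont g z /\ exists2 d : R, 0 < d &
    forall w, w != z -> nm (w - z) < d -> holo g w.

Lemma vertical_mean g a b c d : a <= b -> c <= d ->
  (forall z, inrect a b c d z -> cregular g z) ->
  (forall x, g (x +i* c)%C = g (x +i* d)%C) ->
  J c d (fun y => complex.Re (g (a +i* y)%C)) = J c d (fun y => complex.Re (g (b +i* y)%C)).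
Proof.
move=> ab cd gr gper.
have := @goursat g a b c d (fun z zin => (gr z zin).1) ab cd (fun z zin => (gr z zin).2).
rewrite /E; under eq_fun do rewrite gper.
by rewrite subrr add0r => /eqP; rewrite subr_eq0 => /eqP.
Qed.

Lemma cregularZ g z (k : C) : cregular g z -> cregular (fun z => k * g z) z.
Proof.
move=> [gc [d d0 dP]]; split; first exact: (ccontM (ccont_cst k z) gc).
by exists d => // w wz wd; exact: (holoZ k (dP w wz wd)).
Qed.

Lemma holo_cregular g z : (\forall w \near z, holo g w) -> cregular g z.
Proof.
move=> gz; split; first exact: (holo_ccont (nbhs_singleton gz)).
by have /nbhs_cplxP[d d0 dP] := gz; exists d => // w _; exact: dP.
Qed.

End Goursat.

(** * Mean values and the maximum principle *)

Section MaximumPrinciple.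
Variable R : realType.
Local Notation C := (R[i]^o).
Implicit Types (a b c d x y : R) (f g : C -> C) (z w l : C).

Lemma ccont_Re f z e : ccont f z -> 0 < e -> exists2 d : R, 0 < d &
  forall w, nm (w - z) < d -> `|complex.Re (f w) - complex.Re (f z)| < e.
Proof.
move=> fc e0; have [d d0 dP] := fc e e0; exists d => // w /dP wz.
by rewrite -cReN -cReD; apply: le_lt_trans (Re_le_nm _) wz.
Qed.

Lemma ccont_nm f z e : ccont f z -> 0 < e -> exists2 d : R, 0 < d &
  forall w, nm (w - z) < d -> `|nm (f w) - nm (f z)| < e.
Proof.
move=> fc e0; have [d d0 dP] := fc e e0; exists d => // w /dP wz.
apply: le_lt_trans wz; rewrite ler_norml nm_lower lerNl opprB nmBC.
by rewrite andbT nm_lower.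
Qed.

Lemma nm_pair x y x' y' : nm ((x +i* y)%C - (x' +i* y')%C : C) <= `|x - x'| + `|y - y'|.
Proof. by apply: le_trans (nm_le_ReIm _) _. Qed.

Lemma rect_max (phi : C -> R) a b c d : a <= b -> c <= d ->
  (forall z, inrect a b c d z -> forall e : R, 0 < e -> exists2 dl : R, 0 < dl &
     forall w, nm (w - z) < dl -> `|phi w - phi z| < e) ->
  exists2 z0, inrect a b c d z0 & forall z, inrect a b c d z -> phi z <= phi z0.
Proof.
move=> ab cd phic.
have cpt : compact (`[a, b] `*` `[c, d] : set (R * R)).
  by apply: compact_setX; exact: segment_compact.
have ne0 : (`[a, b] `*` `[c, d] : set (R * R)) !=set0.
  by exists (a, c); split; rewrite /= in_itv /= lexx ?ab ?cd.
have [|[x0 y0] x0in mx] := @compact_EVT_max _ _ (fun q : R * R => phi (q.1 +i* q.2)%C)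
    (`[a, b] `*` `[c, d]) ne0 cpt.
  apply: continuous_in_subspaceT => -[x y]; rewrite inE => -[] /=.
  rewrite !in_itv /= => xab ycd.
  apply/cvgrPdist_lt => e e0; have [|dl dl0 dlP] := phic (x +i* y)%C _ e e0.
    by rewrite /inrect /= xab.
  have dl2 : 0 < dl / 2 by lra.
  exists (ball x (dl / 2), ball y (dl / 2)) => /=.
    by split; exact: nbhsx_ballx.
  move=> [x' y'] [/= xx yy]; rewrite distrC; apply: dlP.
  apply: le_lt_trans (nm_pair _ _ _ _) _.
  by move: xx yy; rewrite /ball /= => xx yy; rewrite (distrC x') (distrC y'); lra.
exists (x0 +i* y0)%C.
  by move: x0in; rewrite inE /= => -[]; rewrite /= !in_itv /= => ? ?; apply/andP.
case=> x y /andP[/= h1 h2]; apply: (mx (x, y)).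
by rewrite inE; split; rewrite /= in_itv.
Qed.

Lemma polar z : nm z = 1 -> exists2 t : R, 0 <= t <= pi *+ 2 &
  z = (cos t +i* sin t)%C.
Proof.
case: z => x y n1; have xy : x ^+ 2 + y ^+ 2 = 1 by have := nm_sqr (x +i* y)%C; rewrite n1 /= expr1n.
have x1 : -1 <= x <= 1 by rewrite -ler_norml -n1; exact: (Re_le_nm (x +i* y)%C).
have [/andP[a0 api] ca] := acos_def x1.
have y2 : 1 - x ^+ 2 = y ^+ 2 by rewrite -xy; ring.
have pi0 := pi_ge0 R; have [y0|y0] := leP 0 y.
  exists (acos x); first by rewrite a0 mulr2n; lra.
  by rewrite ca sin_acos // y2 sqrtr_sqr ger0_norm.
exists (pi *+ 2 - acos x); first by rewrite mulr2n; lra.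
rewrite cosB sinB cos2pi sin2pi !mul0r !mul1r addr0 sub0r ca sin_acos // y2 sqrtr_sqr.
by rewrite ltr0_norm // opprK.
Qed.

Lemma cexp_pair x y : cexp (x +i* y)%C = (expR x)%:C%C * (cos y +i* sin y)%C :> C.
Proof. by []. Qed.

(** In the coordinate [z0 + e^w] circles become vertical segments of length [2 pi]. By
    [vertical_mean] the mean does not depend on the radius, and as the radius tends to 0 it tends to
    the value at the centre. The factor [l] recovers [f] from real parts. *)
Lemma mean_circle f z0 (l : C) d r : 0 < r -> r < d -> ccont f z0 ->
  (forall w, w != z0 -> nm (w - z0) < d -> holo f w) ->
  J 0 (pi *+ 2) (fun y => complex.Re (l * f (z0 + cexp (ln r +i* y)%C))) =
  complex.Re (l * f z0) * (pi *+ 2).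
Proof.
move=> r0 rd fc fh; have pi0 := pi_gt0 R; have pi20 : 0 <= pi *+ 2 :> R by rewrite mulr2n; lra.
pose s := (r + d) / 2; have [s0 rs sd] : [/\ 0 < s, r < s & s < d] by rewrite /s; split; lra.
clearbody s.
pose g w := l * f (z0 + cexp w).
have nmc w : complex.Re w <= ln s -> nm (cexp w) <= s.
  by rewrite nm_cexp -{2}(@lnK _ s) ?posrE // ler_expR.
have gr w : complex.Re w <= ln s -> holo g w.
  move=> wr; apply: holoZ; apply: (@holo_comp _ f (fun w => z0 + cexp w)).
    exact: (holoD (holo_cst z0 w) (holo_cexp w)).
  apply: fh; first by rewrite -subr_eq0 addrAC subrr add0r cexp_neq0.
  by rewrite addrAC subrr add0r; apply: le_lt_trans (nmc _ wr) sd.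
have gper x : g (x +i* 0)%C = g (x +i* (pi *+ 2))%C.
  by rewrite /g !cexp_pair cos0 sin0 cos2pi sin2pi.
have gcr w : complex.Re w < ln s -> cregular g w.
  move=> wr; apply: holo_cregular; apply/nbhs_cplxP; exists (ln s - complex.Re w); first lra.
  move=> v vw; apply: gr; have := Re_le_nm (v - w); rewrite cReD cReN ler_norml; lra.
pose Q x := J 0 (pi *+ 2) (fun y => complex.Re (g (x +i* y)%C)).
have grc x : x <= ln s -> rcont (fun y => complex.Re (g (x +i* y)%C)) 0 (pi *+ 2).
  move=> xr y _ e e0; have [dl dl0 dlP] := ccont_Re (holo_ccont (@gr (x +i* y)%C xr)) e0.
  exists dl => // y' yy; apply: dlP; apply: le_lt_trans (nm_pair _ _ _ _) _.
  by rewrite subrr normr0 add0r.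
have Qc x x' : x <= x' -> x' < ln s -> Q x = Q x'.
  move=> xx xr; apply: vertical_mean => // w; rewrite /inrect => /andP[/andP[_ h] _].
  by apply: gcr; lra.
(* Q is continuous at ln s and tends to the value at the centre at -oo *)
have near_const x k e : x <= ln s -> (forall y, `|complex.Re (g (x +i* y)%C) - k| <= e) ->
    `|Q x - k * (pi *+ 2)| <= e * (pi *+ 2).
  by move=> xr H; have := @J_bound _ _ 0 (pi *+ 2) k e pi20 (grc x xr) (fun y _ => H y); rewrite subr0.
have lc : ccont (fun z => l * f z) z0 := ccontM (ccont_cst l z0) fc.
have Qlim e : 0 < e -> exists2 x0, x0 < ln s & forall x, x <= x0 ->
    `|Q x - complex.Re (l * f z0) * (pi *+ 2)| <= e * (pi *+ 2).
  move=> e0; have [dl dl0 dlP] := ccont_Re lc e0.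
  exists (Num.min (ln (dl / 2)) (ln s - 1)); first by rewrite gt_min; apply/orP; right; lra.
  move=> x; rewrite le_min => /andP[xd xr]; apply: near_const; first lra.
  move=> y; apply/ltW/dlP; rewrite addrAC subrr add0r nm_cexp /=.
  apply: (@le_lt_trans _ _ (dl / 2)); last by lra.
  by rewrite -(@lnK _ (dl / 2)) ?ler_expR // posrE; lra.
have Qin x : x < ln s -> Q x = complex.Re (l * f z0) * (pi *+ 2).
  move=> xr; apply/eqP; rewrite -subr_eq0 -normr_le0 leNgt; apply/negP => Q0.
  have e0 : 0 < `|Q x - complex.Re (l * f z0) * (pi *+ 2)| / (2 * (pi *+ 2)).
    by apply: divr_gt0 => //; rewrite mulr2n; lra.
  have [x0 x0r x0P] := Qlim _ e0.
  have := x0P (Num.min x x0); rewrite ge_min lexx orbT => /(_ isT).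
  rewrite (Qc (Num.min x x0) x) ?ge_min ?lexx //.
  set q := `|_|; have -> : q / (2 * (pi *+ 2)) * (pi *+ 2) = q / 2.
    by rewrite invfM mulrA divfK // gt_eqF // mulr2n; lra.
  by move=> h; move: Q0; rewrite -/q; lra.
by apply: Qin; rewrite ltr_ln ?posrE.
Qed.

End MaximumPrinciple.

Section MaximumPrinciple2.
Variable R : realType.
Local Notation C := (R[i]^o).
Implicit Types (a b c d x y : R) (f g : C -> C) (z w l : C).

(** The equality case of Cauchy-Schwarz: the hypotheses bound [|v - c|^2] by 0. *)
Lemma eq_of_Re_conj (c v : C) : nm v <= nm c ->
  complex.Re ((c^*)%C * v) = nm c ^+ 2 -> v = c.
Proof.
case: c => a b; case: v => x y; rewrite -(ler_sqr) ?nnegrE ?nm_ge0 // !nm_sqr /= => h1 h2.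
have : (x - a) ^+ 2 + (y - b) ^+ 2 <= 0.
  have -> : (x - a) ^+ 2 + (y - b) ^+ 2 =
    (x ^+ 2 + y ^+ 2) - 2 * (a * x - - b * y) + (a ^+ 2 + b ^+ 2) by ring.
  by rewrite h2; lra.
have := sqr_ge0 (x - a); have := sqr_ge0 (y - b) => k1 k2 k3.
have /eqP : (x - a) ^+ 2 = 0 by lra.
have /eqP : (y - b) ^+ 2 = 0 by lra.
by rewrite !sqrf_eq0 !subr_eq0 => /eqP -> /eqP ->.
Qed.

Lemma Re_conj_le (c v : C) : nm v <= nm c -> complex.Re ((c^*)%C * v) <= nm c ^+ 2.
Proof.
case: c => a b; case: v => x y; rewrite -(ler_sqr) ?nnegrE ?nm_ge0 // !nm_sqr /= => h1.
have k1 := sqr_ge0 (x - a); have k2 := sqr_ge0 (y - b).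
have E : (x - a) ^+ 2 + (y - b) ^+ 2 =
    (x ^+ 2 + y ^+ 2) - 2 * (a * x - - b * y) + (a ^+ 2 + b ^+ 2) by ring.
by lra.
Qed.

Lemma Re_conj_self (c : C) : complex.Re ((c^*)%C * c) = nm c ^+ 2.
Proof. by case: c => a b; rewrite nm_sqr /=; ring. Qed.

(** With [l] the conjugate of [f z0], the real part of [l f] on a small circle is at most [|f z0|^2]
    and has this mean; so it is constant there, and [eq_of_Re_conj] gives [f] itself. *)
Lemma max_local f z0 (r : R) : 0 < r -> cregular f z0 ->
  (forall w, nm (w - z0) < r -> nm (f w) <= nm (f z0)) ->
  exists2 d : R, 0 < d & forall w, nm (w - z0) < d -> f w = f z0.
Proof.
move=> r0 [fc [d d0 fh]] fmax; exists (Num.min d r); first by rewrite lt_min d0.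
move=> w; rewrite lt_min => /andP[wd wr]; have [->//|wz] := eqVneq w z0.
have rho0 : 0 < nm (w - z0) by rewrite nm_gt0 subr_eq0.
have pi0 := pi_gt0 R; have pi20 : 0 < pi *+ 2 :> R by rewrite mulr2n; lra.
have [|t tpi wE] := @polar _ ((w - z0) / (nm (w - z0))%:C%C).
  by rewrite nmM nmV nm_real ger0_norm ?nm_ge0 // divff ?gt_eqF.
have n0 : (nm (w - z0))%:C%C != 0 :> C by rewrite -nm_gt0 nm_real gtr0_norm.
have cE : cexp (ln (nm (w - z0)) +i* t)%C = w - z0 :> C.
  by rewrite cexp_pair (lnK rho0) -wE mulrC; exact: (divfK n0).
have {wE cE} wE : w = z0 + cexp (ln (nm (w - z0)) +i* t)%C.
  by rewrite cE addrC; exact: (esym (subrK _ _)).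
have nmE y : nm (z0 + cexp (ln (nm (w - z0)) +i* y)%C - z0) = nm (w - z0).
  by rewrite addrAC subrr add0r nm_cexp /= lnK.
pose l : C := ((f z0)^*)%C.
have M := @mean_circle _ f z0 l d (nm (w - z0)) rho0 wd fc fh.
apply: eq_of_Re_conj; first by exact: fmax.
pose h y := complex.Re (l * f (z0 + cexp (ln (nm (w - z0)) +i* y)%C)).
have -> : complex.Re ((f z0)^*%C * f w) = h t by rewrite /h -wE.
apply: (@J_eq_max _ h 0 (pi *+ 2) (nm (f z0) ^+ 2) pi20) => //.
- move=> y _ e e0; set z1 := (ln (nm (w - z0)) +i* y)%C.
  have gh : holo (fun v => l * f (z0 + cexp v)) z1.
    apply: holoZ; apply: (@holo_comp _ f (fun w => z0 + cexp w)).
      exact: (holoD (holo_cst z0 _) (holo_cexp _)).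
    apply: fh; first by rewrite -subr_eq0 -nm_gt0 nmE.
    by rewrite nmE.
  have [dl dl0 dlP] := ccont_Re (holo_ccont gh) e0.
  exists dl => // y' yy; apply: dlP; apply: le_lt_trans (nm_pair _ _ _ _) _.
  by rewrite subrr normr0 add0r.
- by move=> y _; apply: Re_conj_le; apply: fmax; rewrite nmE.
- by rewrite M Re_conj_self subr0.
Qed.

Lemma segment_clopen (P : R -> Prop) : P 0 ->
  (forall t, 0 <= t <= 1 -> P t ->
    exists2 d : R, 0 < d & forall s, 0 <= s <= 1 -> `|s - t| < d -> P s) ->
  (forall t, 0 <= t <= 1 -> ~ P t ->
    exists2 d : R, 0 < d & forall s, 0 <= s <= 1 -> `|s - t| < d -> ~ P s) -> P 1.
Proof.
move=> P0 Po Pc; pose S := [set t : R | 0 <= t <= 1 /\ forall s, 0 <= s <= t -> P s].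
have S0 : S 0.
  by split; [rewrite lexx ler01|move=> s s0; have -> : s = 0 by lra].
have hS : has_sup S by split; [exists 0|exists 1 => t [/andP[]]].
pose u := sup S.
have u01 : 0 <= u <= 1.
  apply/andP; split; first exact: sup_upper_bound.
  by apply: ge_sup => [|t [/andP[]]] //; exists 0.
have below s : 0 <= s -> s < u -> P s.
  move=> s0 su; have us : 0 < u - s by lra.
  have [t [t01 tP] st] := sup_adherent us hS.
  by apply: tP; rewrite s0 /=; move: st; rewrite -/u; lra.
have Pu : P u.
  apply: contrapT => nPu; have [d d0 dP] := Pc u u01 nPu.
  have [u0|u0] := eqVneq u 0; first by apply: nPu; rewrite u0.
  have up : 0 < u by rewrite lt_def u0; case/andP: u01.
  pose s := Num.max 0 (u - d / 2).
  have [s0 su sd] : [/\ 0 <= s, s < u & u - d < s].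
    by rewrite /s le_max lexx gt_max lt_max up /=; split => //; lra.
  apply: (dP s) (below s s0 su); first lra.
  by rewrite ltr_norml; lra.
have [d d0 dP] := Po u u01 Pu.
have [u1|u1] := eqVneq u 1; first by rewrite -u1.
have ult : u < 1 by rewrite lt_def eq_sym u1; case/andP: u01.
pose v := Num.min 1 (u + d / 2).
have [v1 uv vd] : [/\ v <= 1, u < v & v < u + d].
  by rewrite /v ge_min lexx lt_min gt_min ult /=; split => //; lra.
have Sv : S v.
  split; first lra.
  move=> s /andP[s0 sv]; have [su|us] := ltP s u; first exact: below.
  by apply: dP; [lra|rewrite ltr_norml; lra].
by have := sup_upper_bound hS Sv; rewrite -/u => vu; move: (lt_le_trans uv vu); rewrite ltxx.
Qed.

Lemma max_global (U : C -> Prop) f z0 :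
  (forall z w t, U z -> U w -> 0 <= t <= 1 -> U (z + t%:C%C * (w - z))) ->
  (forall z, U z -> exists2 d : R, 0 < d & forall w, nm (w - z) < d -> U w) ->
  (forall z, U z -> cregular f z) -> U z0 ->
  (forall w, U w -> nm (f w) <= nm (f z0)) -> forall w, U w -> f w = f z0.
Proof.
move=> Uconv Uopen fr Uz0 fmax w Uw.
pose gam (t : R) : C := z0 + t%:C%C * (w - z0).
have gamB s t : nm (gam s - gam t) = `|s - t| * nm (w - z0).
  rewrite /gam opprD addrACA subrr add0r -mulrBl nmM -nm_real.
  by congr (nm _ * _); rewrite rmorphB.
have nz : 0 < nm (w - z0) + 1 by rewrite ltr_pwDr // nm_ge0.
have gamd (d : R) s t : 0 < d -> `|s - t| < d / (nm (w - z0) + 1) -> nm (gam s - gam t) < d.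
  move=> d0; rewrite gamB ltr_pdivlMr // => h; apply: le_lt_trans h.
  by rewrite ler_wpM2l // lerDl.
suff : f (gam 1) = f z0 by rewrite /gam mul1r addrC subrK.
apply: (@segment_clopen (fun t => f (gam t) = f z0)).
- by rewrite /gam mul0r addr0.
- move=> t t01 ft; have Ut : U (gam t) by exact: Uconv.
  have [r r0 rP] := Uopen _ Ut.
  have [|d d0 dP] := max_local r0 (fr _ Ut).
    by move=> v /rP /fmax; rewrite ft.
  exists (d / (nm (w - z0) + 1)) => [|s s01 st]; first exact: divr_gt0.
  by rewrite (dP (gam s)) ?ft //; exact: gamd.
- move=> t t01 ft; have Ut : U (gam t) by exact: Uconv.
  have e0 : 0 < nm (f (gam t) - f z0) by rewrite nm_gt0 subr_eq0; exact/eqP.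
  have [d d0 dP] := (fr _ Ut).1 _ e0.
  exists (d / (nm (w - z0) + 1)) => [|s s01 st fs]; first exact: divr_gt0.
  have := dP (gam s) (gamd _ _ _ d0 st).
  by rewrite fs nmBC ltxx.
Qed.

Definition UHP z := 0 < complex.Im z.

Lemma UHP_conv z w (t : R) : UHP z -> UHP w -> 0 <= t <= 1 -> UHP (z + t%:C%C * (w - z)).
Proof.
rewrite /UHP => z0 w0 t01; rewrite cImD cImM cImD cImN /= mul0r addr0.
by nra.
Qed.

Lemma UHP_open z : UHP z -> exists2 d : R, 0 < d & forall w, nm (w - z) < d -> UHP w.
Proof.
move=> z0; exists (complex.Im z) => // w h; have := le_lt_trans (Im_le_nm _) h.
by rewrite cImD cImN ltr_norml /UHP; lra.
Qed.

Lemma period_int f (s : C) : (forall z, f (z + s) = f z) ->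
  forall (m : int) z, f (z + m%:~R * s) = f z.
Proof.
move=> fs; have nat (m : nat) z : f (z + m%:R * s) = f z.
  elim: m z => [|m IH] z; first by rewrite mul0r addr0.
  by rewrite mulrSr mulrDl mul1r addrA fs IH.
case=> m z; first exact: nat.
by rewrite -(nat m.+1) NegzE mulrNz mulNr addrNK.
Qed.

Let mi : C := Complex 0 (-1).

(* mean values over horizontal segments near the cusp i oo *)
Lemma max_cusp f (c : C) (Y : R) :
  (forall z, Y < complex.Im z -> cregular f z) ->
  (forall z, f (z + 1) = f z) ->
  (forall e : R, 0 < e -> exists y0 : R, forall z, y0 < complex.Im z -> nm (f z - c) < e) ->
  (forall z, Y < complex.Im z -> nm (f z) <= nm c) ->
  forall z, Y < complex.Im z -> f z = c.
Proof.
move=> fr fper flim fle z0 z0Y.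
pose l : C := (c^*)%C.
(* Multiplication by [-i] turns horizontal segments into vertical ones, so that [vertical_mean]
   applies. *)
pose g w := l * f (w * mi).
have rotE x y : ((x +i* y)%C : C) * mi = (y +i* (- x))%C.
  by apply: eq_cplx; rewrite /=; ring.
have fcreg (w : C) : complex.Re w < - Y -> cregular g w.
  move=> wY; apply: cregularZ.
  have [fc [d d0 dP]] : cregular f (w * mi).
    by apply: fr; rewrite cImM /=; lra.
  have nmr v : nm (v * mi - w * mi) = nm (v - w).
    have n1 : nm mi = 1 :> R by rewrite /nm /= expr0n add0r sqrrN expr1n sqrtr1.
    by rewrite -mulrBl nmM n1 mulr1.
  have hr v : holo (fun w : C => w * mi) v.
    exact: (holoM (holo_id v) (holo_cst _ v)).
  split; first exact: (ccont_comp (holo_ccont (hr w)) fc).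
  exists d => // v vw vd; apply: (holo_comp (hr v)); apply: dP; last by rewrite nmr.
  by rewrite -subr_eq0 -nm_gt0 nmr nm_gt0 subr_eq0.
pose Q x := J 0 1 (fun y => complex.Re (g (x +i* y)%C)).
have Qc x x' : x <= x' -> x' < - Y -> Q x = Q x'.
  move=> xx xY; apply: vertical_mean => //.
    by move=> w; rewrite /inrect => /andP[/andP[_ h] _]; apply: fcreg; lra.
  move=> t; rewrite /g !rotE -fper; congr (_ * f _).
  by apply: eq_cplx; rewrite /= ?add0r ?addr0.
have rc x : x < - Y -> rcont (fun y => complex.Re (g (x +i* y)%C)) 0 1.
  move=> xY y _ e e0; have [dl dl0 dlP] := ccont_Re (fcreg (x +i* y)%C xY).1 e0.
  exists dl => // y' yy; apply: dlP; apply: le_lt_trans (nm_pair _ _ _ _) _.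
  by rewrite subrr normr0 add0r.
have Qlim x : x < - Y -> Q x = nm c ^+ 2.
  move=> xY; apply/eqP; rewrite -subr_eq0 -normr_le0 leNgt; apply/negP => Q0.
  pose e := `|Q x - nm c ^+ 2| / (2 * (nm c + 1)).
  have c1 : 0 < nm c + 1 by rewrite ltr_pwDr // nm_ge0.
  have e0 : 0 < e by rewrite divr_gt0 // mulr_gt0.
  have [y0 y0P] := flim e e0.
  pose x' := Num.min x (- y0 - 1).
  have x'x : x' <= x by rewrite ge_min lexx.
  have x'y : x' <= - y0 - 1 by rewrite ge_min lexx orbT.
  have := @J_bound _ _ 0 1 (nm c ^+ 2) (nm c * e) ler01 (rc x' (le_lt_trans x'x xY)).
  rewrite -/(Q x') (Qc x' x) // subr0 !mulr1 => K.
  have : `|Q x - nm c ^+ 2| <= nm c * e.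
    apply: K => y _; rewrite -Re_conj_self -/l -cReN -cReD -mulrBr.
    apply: le_trans (Re_le_nm _) _; rewrite nmM /l.
    have -> : nm (c^*)%C = nm c by case: (c) => u v; rewrite /nm /= sqrrN.
    by rewrite ler_wpM2l ?nm_ge0 // rotE; apply/ltW/y0P => /=; lra.
  rewrite /e mulrA ler_pdivlMr ?mulr_gt0 //; have := nm_ge0 c; nra.
have [x0 [y0 [z0E x0Y y01]]] : exists x0 y0 : R, [/\ f z0 = f ((x0 +i* y0)%C * mi), x0 < - Y & 0 <= y0 <= 1].
  pose n := Num.floor (complex.Re z0).
  have per (m : int) z : f (z + m%:~R) = f z by rewrite -[RHS](period_int fper m z) mulr1.
  exists (- complex.Im z0), (complex.Re z0 - n%:~R); split; last 2 first.
  - lra.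
  - have := ge_floor (complex.Re z0); have := lt_succ_floor (complex.Re z0).
    by rewrite -/n intrD; lra.
  rewrite rotE -(per (- n) z0); congr f.
  have iE : ((- n)%:~R : C) = ((- n)%:~R : R)%:C%C by rewrite rmorph_int.
  by rewrite iE; apply: eq_cplx; rewrite ?cReD ?cImD /= ?mulrNz ?addr0 ?opprK.
rewrite z0E; apply: eq_of_Re_conj; first by apply: fle; rewrite rotE /=; lra.
apply: (@J_eq_max _ (fun y => complex.Re (g (x0 +i* y)%C)) 0 1 _ ltr01 (rc x0 x0Y)) => //.
- by move=> y _; apply: Re_conj_le; apply: fle; rewrite rotE /=; lra.
- by rewrite -/(Q x0) Qlim // subr0 mulr1.
Qed.

(** ** Doubly periodic functions *)

Lemma liouville_torus f (tau : C) : 0 < complex.Im tau -> (forall z, cregular f z) ->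
  (forall z, f (z + 1) = f z) -> (forall z, f (z + tau) = f z) ->
  forall z w, f z = f w.
Proof.
move=> tau0 fr f1 ft.
(* [L] maps the unit square onto a period parallelogram, where the modulus of [f] attains its global
   maximum. *)
pose L z : C := (complex.Re z)%:C%C + (complex.Im z)%:C%C * tau.
have LB z w : nm (L z - L w) <= (1 + nm tau) * nm (z - w).
  have -> : L z - L w = (complex.Re (z - w))%:C%C + (complex.Im (z - w))%:C%C * tau.
    by rewrite /L cReD cImD cReN cImN !rmorphD !rmorphN; ring.
  apply: le_trans (nmD _ _) _; rewrite nmM !nm_real mulrDl mul1r; apply: lerD.
    exact: Re_le_nm.
  by rewrite mulrC ler_wpM2l ?nm_ge0 // Im_le_nm.
have [|z0 z0in z0max] := @rect_max _ (fun z => nm (f (L z))) 0 1 0 1 ler01 ler01.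
  move=> z _ e e0; have [d d0 dP] := ccont_nm (fr (L z)).1 e0.
  have t1 : 0 < 1 + nm tau by rewrite ltr_pwDl // nm_ge0.
  exists (d / (1 + nm tau)) => [|w wz]; first exact: divr_gt0.
  by apply: dP; apply: le_lt_trans (LB _ _) _; rewrite mulrC -ltr_pdivlMr.
have red w : exists2 z, inrect 0 1 0 1 z & f w = f (L z).
  pose v := complex.Im w / complex.Im tau; pose u := complex.Re w - v * complex.Re tau.
  have wE : w = u%:C%C + v%:C%C * tau.
    apply: eq_cplx; rewrite ?cReD ?cImD ?cReM ?cImM /= /u /v; first by ring.
    by field; rewrite gt_eqF.
  pose m := Num.floor u; pose n := Num.floor v.
  exists ((u - m%:~R) +i* (v - n%:~R))%C.
    rewrite /inrect /= !subr_ge0 !ge_floor /=.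
    by have := lt_succ_floor u; have := lt_succ_floor v; rewrite !intrD -/m -/n; lra.
  rewrite /L /= -[RHS](period_int f1 m) -[RHS](period_int ft n) wE; congr f.
  by rewrite !rmorphB /= !rmorph_int; ring.
have glob w : f w = f (L z0).
  apply: (@max_global (fun=> True)) => // [|v _]; first by exists 1.
  by have [z zin ->] := red v; exact: z0max.
by move=> z w; rewrite !glob.
Qed.
End MaximumPrinciple2.

(** * Limits with geometric convergence, and infinite products *)

Section GeometricLimits.
Variable R : realType.
Local Notation C := (R[i]^o).
Implicit Types (f g : C -> C) (z w l t q : C).

Definition ccvg (s : nat -> C) l := forall e : R, 0 < e ->
  exists N : nat, forall n, (N <= n)%N -> nm (s n - l) < e.

Lemma ccvg_unique s l l' : ccvg s l -> ccvg s l' -> l = l'.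
Proof.
move=> sl sl'; apply/eqP; rewrite -subr_eq0 -nm_eq0 eq_le nm_ge0 andbT leNgt.
apply/negP => n0; have n2 : 0 < nm (l - l') / 2 by lra.
have [N1 H1] := sl _ n2; have [N2 H2] := sl' _ n2.
have := H1 _ (leq_maxl N1 N2); have := H2 _ (leq_maxr N1 N2).
have := nm_dist_triangle l l' (s (maxn N1 N2)); rewrite (nmBC l (s _)).
lra.
Qed.

Lemma geom_small (K rho e : R) : 0 <= K -> 0 <= rho < 1 -> 0 < e ->
  exists N : nat, forall n, (N <= n)%N -> K * rho ^+ n < e.
Proof.
move=> K0 /andP[r0 r1] e0.
have : (rho ^+ n) @[n --> \oo] --> (0 : R) by apply: cvg_expr; rewrite ger0_norm.
move=> /cvgrPdist_lt/(_ (e / (K + 1))) [|N _ NP]; first by rewrite divr_gt0 //; lra.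
exists N => n /NP /=; rewrite sub0r normrN ger0_norm ?exprn_ge0 //.
rewrite ltr_pdivlMr; last by lra.
by have := exprn_ge0 n r0; nra.
Qed.

Lemma geom_limit_real (x : nat -> R) (K rho : R) : 0 <= K -> 0 <= rho < 1 ->
  (forall n, `|x n.+1 - x n| <= K * rho ^+ n) ->
  exists l : R, forall n, `|x n - l| <= K / (1 - rho) * rho ^+ n.
Proof.
move=> K0 /andP[r0 r1] xK; pose c := K / (1 - rho).
have c0 : 0 <= c by rewrite divr_ge0 //; lra.
have cE : c * (1 - rho) = K by rewrite divfK //; apply/eqP; lra.
have step n : c * rho ^+ n - c * rho ^+ n.+1 = K * rho ^+ n.
  by rewrite -cE exprS; ring.
have [|||l lP] := @nested_intervals R (fun n => x n - c * rho ^+ n) (fun n => x n + c * rho ^+ n).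
- by move=> n; have := mulr_ge0 c0 (exprn_ge0 n r0); lra.
- by move=> n; have := step n; have := xK n; rewrite ler_norml; lra.
- by move=> n; have := step n; have := xK n; rewrite ler_norml; lra.
by exists l => n; have := lP n; rewrite ler_norml -/c; lra.
Qed.

Lemma geom_limit (s : nat -> C) (K rho : R) : 0 <= K -> 0 <= rho < 1 ->
  (forall n, nm (s n.+1 - s n) <= K * rho ^+ n) ->
  exists l, forall n, nm (s n - l) <= 2 * K / (1 - rho) * rho ^+ n.
Proof.
move=> K0 rP sK.
have [|a aP] := @geom_limit_real (fun n => complex.Re (s n)) K rho K0 rP.
  by move=> n; apply: le_trans (sK n); rewrite -cReN -cReD; exact: Re_le_nm.
have [|b bP] := @geom_limit_real (fun n => complex.Im (s n)) K rho K0 rP.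
  by move=> n; apply: le_trans (sK n); rewrite -cImN -cImD; exact: Im_le_nm.
exists (a +i* b)%C => n; apply: le_trans (nm_le_ReIm _) _.
rewrite cReD cReN cImD cImN /= -!mulrA mulr_natl mulr2n mulrA.
exact: (lerD (aP n) (bP n)).
Qed.

Lemma geom_ccvg s l (K rho : R) : 0 <= K -> 0 <= rho < 1 ->
  (forall n, nm (s n - l) <= K * rho ^+ n) -> ccvg s l.
Proof.
move=> K0 rP sK e e0; have [N NP] := geom_small K0 rP e0.
by exists N => n /NP; apply: le_lt_trans.
Qed.

Lemma geom_ccvg_bound s l (K rho : R) : 0 <= K -> 0 <= rho < 1 ->
  (forall n, nm (s n.+1 - s n) <= K * rho ^+ n) -> ccvg s l ->
  forall n, nm (s n - l) <= 2 * K / (1 - rho) * rho ^+ n.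
Proof.
move=> K0 rP sK sl; have [l' l'P] := geom_limit K0 rP sK.
have K' : 0 <= 2 * K / (1 - rho) by rewrite divr_ge0 ?mulr_ge0 //; lra.
by have -> : l = l' by apply: ccvg_unique sl (geom_ccvg K' rP l'P).
Qed.

Lemma cdiff_bound f z l (B d : R) : 0 < d -> cdiff f z l ->
  (forall h, nm h < d -> nm (f (z + h) - f z) <= B * nm h) -> nm l <= B.
Proof.
move=> d0 fl fB; rewrite leNgt; apply/negP => lB.
have e0 : 0 < (nm l - B) / 2 by lra.
have [d1 d10 d1P] := fl _ e0.
pose h : C := (Num.min d d1 / 2)%:C%C.
have m0 : 0 < Num.min d d1 by rewrite lt_min d0.
have nh : nm h = Num.min d d1 / 2 by rewrite nm_real gtr0_norm //; lra.
have [md md1] : Num.min d d1 <= d /\ Num.min d d1 <= d1 by rewrite !ge_min !lexx orbT.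
have := fB h; have := d1P h; rewrite nh => H1 H2.
have {}H1 := H1 ltac:(lra). have {}H2 := H2 ltac:(lra).
have := nmD (f (z + h) - f z) (- (f (z + h) - f z - l * h)).
have -> : f (z + h) - f z + - (f (z + h) - f z - l * h) = l * h by ring.
rewrite nmN nmM nh => H3.
have nlB : 0 < nm l - B by lra.
by have := mulr_gt0 nlB m0; lra.
Qed.

(* Tannery's theorem for difference quotients *)
Lemma holo_geom (F : nat -> C -> C) f z0 (K rho d : R) : 0 <= K -> 0 <= rho < 1 -> 0 < d ->
  (forall n, holo (F n) z0) -> (forall z, nm (z - z0) < d -> ccvg (F^~ z) (f z)) ->
  (forall n z, nm (z - z0) < d ->
     nm ((F n.+1 z - F n z) - (F n.+1 z0 - F n z0)) <= K * rho ^+ n * nm (z - z0)) ->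
  holo f z0.
Proof.
move=> K0 rP d0 Fh Ff FK.
have zz : nm (z0 - z0) < d by rewrite subrr nm0.
pose l n := projT1 (cid (Fh n)); have lP n : cdiff (F n) z0 (l n) := projT2 (cid (Fh n)).
have lK n : nm (l n.+1 - l n) <= K * rho ^+ n.
  apply: (@cdiff_bound (fun z => F n.+1 z - F n z) z0 _ _ d d0).
    move=> e e0; have e2 : 0 < e / 2 by lra.
    have [d1 d10 H1] := lP n.+1 _ e2; have [d2 d20 H2] := lP n _ e2.
    exists (Num.min d1 d2) => [|h]; first by rewrite lt_min d10.
    rewrite lt_min => /andP[/H1 k1 /H2 k2].
    have -> : F n.+1 (z0 + h) - F n (z0 + h) - (F n.+1 z0 - F n z0) - (l n.+1 - l n) * h =
      (F n.+1 (z0 + h) - F n.+1 z0 - l n.+1 * h) - (F n (z0 + h) - F n z0 - l n * h) by ring.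
    by apply: le_trans (nmB _ _) _; lra.
  by move=> h hd; have := FK n (z0 + h); rewrite addrAC subrr add0r => /(_ hd).
have [L LP] := geom_limit K0 rP lK.
have K' : 0 <= 2 * K / (1 - rho) by rewrite divr_ge0 ?mulr_ge0 //; lra.
exists L => e e0; have e3 : 0 < e / 3 by lra.
have [N NP] := geom_small K' rP e3.
have [d1 d10 H1] := lP N _ e3.
exists (Num.min d d1) => [|h]; first by rewrite lt_min d0.
rewrite lt_min => /andP[hd /H1 k1].
have hzd : nm (z0 + h - z0) < d by rewrite addrAC subrr add0r.
have c2 : ccvg (fun n => F n (z0 + h) - F n z0) (f (z0 + h) - f z0).
  move=> e' e'0; have e'2 : 0 < e' / 2 by lra.
  have [N1 Q1] := Ff _ hzd _ e'2; have [N2 Q2] := Ff _ zz _ e'2.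
  exists (maxn N1 N2) => n; rewrite geq_max => /andP[/Q1 q1 /Q2 q2].
  have -> : F n (z0 + h) - F n z0 - (f (z0 + h) - f z0) =
    (F n (z0 + h) - f (z0 + h)) - (F n z0 - f z0) by ring.
  by apply: le_lt_trans (nmB _ _) _; lra.
have k2 : nm (F N (z0 + h) - F N z0 - (f (z0 + h) - f z0)) <= 2 * (K * nm h) / (1 - rho) * rho ^+ N.
  apply: (@geom_ccvg_bound (fun n => F n (z0 + h) - F n z0)) => //.
    by rewrite mulr_ge0 ?nm_ge0.
  move=> n; have := FK n _ hzd; rewrite [z0 + h - z0]addrAC subrr add0r => k.
  have -> : F n.+1 (z0 + h) - F n.+1 z0 - (F n (z0 + h) - F n z0) =
    F n.+1 (z0 + h) - F n (z0 + h) - (F n.+1 z0 - F n z0) by ring.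
  by apply: le_trans k _; rewrite mulrAC.
have k3 : nm (l N - L) * nm h <= e / 3 * nm h.
  by rewrite ler_wpM2r ?nm_ge0 //; apply: le_trans (LP N) (ltW (NP N (leqnn N))).
have k2' : nm (F N (z0 + h) - F N z0 - (f (z0 + h) - f z0)) <= e / 3 * nm h.
  apply: le_trans k2 _; have -> : 2 * (K * nm h) / (1 - rho) * rho ^+ N =
    2 * K / (1 - rho) * rho ^+ N * nm h by ring.
  by rewrite ler_wpM2r ?nm_ge0 //; exact: ltW (NP N (leqnn N)).
have -> : f (z0 + h) - f z0 - L * h = (F N (z0 + h) - F N z0 - l N * h)
  - (F N (z0 + h) - F N z0 - (f (z0 + h) - f z0)) + (l N - L) * h by ring.
apply: le_trans (nmD _ _) _; rewrite nmM.
have := nmB (F N (z0 + h) - F N z0 - l N * h) (F N (z0 + h) - F N z0 - (f (z0 + h) - f z0)).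
lra.
Qed.

(** ** The infinite product (t; q)_oo *)

Definition pp n t q : C := \prod_(k < n) (1 - t * q ^+ k).
Definition phi t q : C := xget 0 [set l | ccvg (fun n => pp n t q) l].

Lemma ppS n t q : pp n.+1 t q = pp n t q * (1 - t * q ^+ n).
Proof. by rewrite /pp big_ord_recr. Qed.

Lemma ppSl n t q : pp n.+1 t q = (1 - t) * pp n (t * q) q.
Proof.
rewrite /pp big_ord_recl expr0 mulr1; congr (_ * _); apply: eq_bigr => k _.
by rewrite exprS mulrA.
Qed.

Definition ppbound (T rho : R) : R := expR (T / (1 - rho)).

Lemma ppbound_ge1 T rho : 0 <= T -> rho < 1 -> 1 <= ppbound T rho.
Proof.
move=> T0 r1; apply: le_trans (expR_ge1Dx _); rewrite lerDl divr_ge0 //; lra.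
Qed.

Lemma prod_bound n T rho : 0 <= T -> 0 <= rho < 1 ->
  1 <= \prod_(k < n) (1 + T * rho ^+ k) <= ppbound T rho.
Proof.
move=> T0 /andP[r0 r1]; have f1 k : 0 <= T * rho ^+ k by rewrite mulr_ge0 ?exprn_ge0.
apply/andP; split.
  by elim/big_ind: _ => // [x y x1 y1|i _]; [rewrite mulr_ege1|rewrite lerDl].
have : \prod_(k < n) (1 + T * rho ^+ k) <= expR (\sum_(k < n) T * rho ^+ k).
  rewrite expR_sum; apply: ler_prod => i _; rewrite addr_ge0 //=; exact: expR_ge1Dx.
move=> /le_trans; apply; rewrite ler_expR -mulr_sumr ler_wpM2l //.
have r1' : 1 - rho != 0 by rewrite gt_eqF //; lra.
have -> : \sum_(i < n) rho ^+ i = (1 - rho ^+ n) / (1 - rho).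
  apply: (mulIf r1'); rewrite divfK //.
  by have := subrX1 rho n; rewrite -[rho - 1]opprB -[_ ^+ _ - 1]opprB mulNr => /oppr_inj ->; rewrite mulrC.
rewrite -[leRHS]mul1r ler_wpM2r ?invr_ge0 ?subr_ge0 ?(ltW r1) //.
by rewrite gerBl exprn_ge0.
Qed.

Lemma nm_pp n t q T rho : nm t <= T -> nm q <= rho -> rho < 1 -> nm (pp n t q) <= ppbound T rho.
Proof.
move=> tT qr r1; have T0 := le_trans (nm_ge0 _) tT; have r0 := le_trans (nm_ge0 _) qr.
have rP : 0 <= rho < 1 by rewrite r0.
have /andP[_] := prod_bound n T0 rP; apply: le_trans.
rewrite nm_prod; apply: ler_prod => k _; rewrite nm_ge0 /=.
apply: le_trans (nmB _ _) _; rewrite nm1 lerD2l nmM nmX.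
by rewrite ler_pM ?exprn_ge0 ?nm_ge0 // lerXn2r ?nnegrE ?nm_ge0.
Qed.

Lemma pp_step n t q T rho : nm t <= T -> nm q <= rho -> rho < 1 ->
  nm (pp n.+1 t q - pp n t q) <= ppbound T rho * T * rho ^+ n.
Proof.
move=> tT qr r1; have T0 := le_trans (nm_ge0 _) tT; have r0 := le_trans (nm_ge0 _) qr.
have -> : pp n.+1 t q - pp n t q = - (pp n t q * (t * q ^+ n)) by rewrite ppS; ring.
rewrite nmN !nmM nmX -mulrA ler_pM ?mulr_ge0 ?exprn_ge0 ?nm_ge0 //; first exact: nm_pp.
by rewrite ler_pM ?exprn_ge0 ?nm_ge0 // lerXn2r ?nnegrE ?nm_ge0.
Qed.

Lemma phi_ccvg t q : nm q < 1 -> ccvg (fun n => pp n t q) (phi t q).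
Proof.
move=> q1; have rP : 0 <= nm q < 1 by rewrite nm_ge0.
have K0 : 0 <= ppbound (nm t) (nm q) * nm t by rewrite mulr_ge0 ?expR_ge0 ?nm_ge0.
have [n|l lP] := @geom_limit (fun n => pp n t q) _ _ K0 rP; first exact: pp_step.
have K' : 0 <= 2 * (ppbound (nm t) (nm q) * nm t) / (1 - nm q).
  by rewrite divr_ge0 ?mulr_ge0 ?expR_ge0 ?nm_ge0 ?subr_ge0 ?(ltW q1).
by apply: (@xgetPex _ 0 [set l | ccvg (fun n => pp n t q) l]); exists l; exact: geom_ccvg lP.
Qed.

Lemma phi_near1 t q T rho : nm t <= T -> nm q <= rho -> rho < 1 ->
  nm (phi t q - 1) <= 2 * (ppbound T rho * T) / (1 - rho).
Proof.
move=> tT qr r1; have T0 := le_trans (nm_ge0 _) tT; have r0 := le_trans (nm_ge0 _) qr.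
have rP : 0 <= rho < 1 by rewrite r0.
have K0 : 0 <= ppbound T rho * T by rewrite mulr_ge0 ?expR_ge0.
have := @geom_ccvg_bound (fun n => pp n t q) (phi t q) _ _ K0 rP.
move=> /(_ (fun n => pp_step n tT qr r1) (phi_ccvg t (le_lt_trans qr r1)) 0%N).
by rewrite expr0 mulr1 /pp big_ord0 nmBC.
Qed.

Lemma phi_rec t q : nm q < 1 -> phi t q = (1 - t) * phi (t * q) q.
Proof.
move=> q1; apply: ccvg_unique (phi_ccvg t q1) _ => e e0.
have t1 : 0 < nm (1 - t) + 1 by rewrite ltr_pwDr // nm_ge0.
have [N NP] := phi_ccvg (t * q) q1 (divr_gt0 e0 t1).
exists N.+1 => -[//|n] nN; rewrite ppSl -mulrBr nmM.
have := NP n nN; rewrite ltr_pdivlMr // => /(le_lt_trans _); apply.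
by rewrite mulrC ler_wpM2l ?nm_ge0 // lerDl.
Qed.

Lemma phi_recn n t q : nm q < 1 -> phi t q = pp n t q * phi (t * q ^+ n) q.
Proof.
move=> q1; elim: n => [|n IH]; first by rewrite /pp big_ord0 mul1r expr0 mulr1.
by rewrite IH ppS (phi_rec _ q1) exprSr !mulrA.
Qed.

(** Far enough out, [phi_near1] puts the tail of the product within distance less than 1 of 1; the
    finitely many other factors are nonzero by hypothesis. *)
Lemma phi_neq0 t q : nm q < 1 -> (forall n, t * q ^+ n != 1) -> phi t q != 0.
Proof.
move=> q1 tq; have rP : 0 <= nm q < 1 by rewrite nm_ge0.
have B0 : 0 <= 2 * ppbound (nm t) (nm q) * nm t / (1 - nm q).
  by rewrite divr_ge0 ?mulr_ge0 ?expR_ge0 ?nm_ge0 ?subr_ge0 ?(ltW q1).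
have [N NP] := geom_small B0 rP ltr01.
rewrite (phi_recn N) //; apply: mulf_neq0.
  by rewrite /pp; apply/prodf_neq0 => k _; rewrite subr_eq0 eq_sym.
apply/eqP => p0; have T1 : nm (t * q ^+ N) <= nm t * nm q ^+ N by rewrite nmM nmX.
have := phi_near1 T1 (lexx _) q1; rewrite p0 sub0r nmN nm1.
apply/negP; rewrite -ltNge; apply: le_lt_trans (NP N (leqnn N)).
have mono : ppbound (nm t * nm q ^+ N) (nm q) <= ppbound (nm t) (nm q).
  rewrite ler_expR ler_wpM2r ?invr_ge0 ?subr_ge0 ?(ltW q1) //.
  by rewrite -[leRHS]mulr1 ler_wpM2l ?nm_ge0 // exprn_ile1 ?nm_ge0 ?ltW.
have -> : 2 * ppbound (nm t) (nm q) * nm t / (1 - nm q) * nm q ^+ N =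
  2 * (ppbound (nm t) (nm q) * (nm t * nm q ^+ N)) / (1 - nm q) by ring.
rewrite ler_wpM2r ?invr_ge0 ?subr_ge0 ?(ltW q1) // ler_wpM2l //.
by rewrite ler_wpM2r ?mulr_ge0 ?exprn_ge0 ?nm_ge0.
Qed.

Lemma pow_lipschitz q q0 (rho rho1 D : R) n : nm q <= rho -> nm q0 <= rho -> rho < rho1 ->
  nm (q - q0) <= D -> nm (q ^+ n - q0 ^+ n) <= D / (rho1 - rho) * rho1 ^+ n.
Proof.
move=> qr q0r rr qD; have r0 := le_trans (nm_ge0 _) qr; have D0 := le_trans (nm_ge0 _) qD.
have rr0 : 0 < rho1 - rho by lra.
have c0 : 0 <= D / (rho1 - rho) by rewrite divr_ge0 // ltW.
have cE : D / (rho1 - rho) * (rho1 - rho) = D by rewrite divfK // gt_eqF.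
elim: n => [|n IH]; first by rewrite !expr0 subrr nm0 mulr1.
have -> : q ^+ n.+1 - q0 ^+ n.+1 = q * (q ^+ n - q0 ^+ n) + (q - q0) * q0 ^+ n.
  by rewrite !exprS; ring.
apply: le_trans (nmD _ _) _; rewrite !nmM nmX.
have h1 : nm q * nm (q ^+ n - q0 ^+ n) <= rho * (D / (rho1 - rho) * rho1 ^+ n).
  by rewrite ler_pM ?nm_ge0.
have h2 : nm (q - q0) * nm q0 ^+ n <= D * rho1 ^+ n.
  rewrite ler_pM ?exprn_ge0 ?nm_ge0 // lerXn2r ?nnegrE ?nm_ge0 //; lra.
apply: le_trans (lerD h1 h2) _; rewrite -{2}cE exprS.
by rewrite le_eqVlt; apply/orP; left; apply/eqP; ring.
Qed.

(** The partial products satisfy the hypotheses of [holo_geom]. The variation of [t q^n] at [z0] is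
    at most [B rho1^n] times the distance, where [rho < rho1 < 1] leaves room for the factor [n]
    produced by differences of [n]-th powers. *)
Lemma holo_phi (t q : C -> C) z0 : holo t z0 -> holo q z0 -> nm (q z0) < 1 ->
  holo (fun z => phi (t z) (q z)) z0.
Proof.
move=> th qh q1.
have lip f : holo f z0 -> exists2 L : R, 0 <= L & exists2 d : R, 0 < d &
    forall z, nm (z - z0) < d -> nm (f z - f z0) <= L * nm (z - z0).
  move=> [l fl]; exists (nm l + 1); first by rewrite addr_ge0 ?nm_ge0.
  have [d d0 dP] := fl _ ltr01; exists d => // z zd; have := dP _ zd.
  have -> : z0 + (z - z0) = z by ring.
  rewrite mul1r => h; have -> : f z - f z0 = l * (z - z0) + (f z - f z0 - l * (z - z0)) by ring.
  by apply: le_trans (nmD _ _) _; rewrite nmM mulrDl mul1r lerD2l.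
have [Lt Lt0 [dt dt0 tL]] := lip _ th; have [Lq Lq0 [dq dq0 qL]] := lip _ qh.
pose rho := (1 + nm (q z0)) / 2; pose rho1 := (1 + rho) / 2.
have [qrho rr rho11] : [/\ nm (q z0) < rho, rho < rho1 & rho1 < 1].
  by rewrite /rho1 /rho; split; lra.
have rho0 : 0 <= rho by apply: le_trans (nm_ge0 _) (ltW qrho).
pose T := nm (t z0) + 1.
have qr0 : 0 < rho - nm (q z0) by lra.
have [d1 d10 d1P] := ccont_nm (holo_ccont qh) qr0.
have [d2 d20 d2P] := ccont_nm (holo_ccont th) (ltr01 : 0 < 1 :> R).
pose d := Num.min (Num.min dt dq) (Num.min d1 d2).
have d0 : 0 < d by rewrite !lt_min dt0 dq0 d10 d20.
have dP z : nm (z - z0) < d -> [/\ nm (t z - t z0) <= Lt * nm (z - z0),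
    nm (q z - q z0) <= Lq * nm (z - z0), nm (q z) <= rho & nm (t z) <= T].
  rewrite !lt_min => /andP[/andP[h1 h2] /andP[h3 h4]]; split; [exact: tL|exact: qL| |].
    by have := d1P _ h3; rewrite ltr_norml; lra.
  by have := d2P _ h4; rewrite /T ltr_norml; lra.
have [_ _ q0r t0T] : [/\ nm (t z0 - t z0) <= Lt * nm (z0 - z0),
    nm (q z0 - q z0) <= Lq * nm (z0 - z0), nm (q z0) <= rho & nm (t z0) <= T].
  by apply: dP; rewrite subrr nm0.
clearbody rho rho1 T d.
have T0 := le_trans (nm_ge0 _) t0T.
have rho1' : rho < 1 by lra.
have r1P : 0 <= rho1 < 1 by lra.
have rP : 0 <= rho < 1 by lra.
pose A := ppbound T rho; have A1 : 1 <= A by exact: ppbound_ge1.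
have A0 : 0 <= A by lra.
pose B := Lt + T * (Lq / (rho1 - rho)).
have B0 : 0 <= B by rewrite addr_ge0 // mulr_ge0 // divr_ge0 //; lra.
have powle n : rho ^+ n <= rho1 ^+ n by rewrite lerXn2r ?nnegrE; lra.
have pow0 n : 0 <= rho1 ^+ n by rewrite exprn_ge0; lra.
have uL n z : nm (z - z0) < d -> nm (t z * q z ^+ n - t z0 * q z0 ^+ n) <= B * rho1 ^+ n * nm (z - z0).
  move=> /dP[h1 h2 h3 h4].
  have -> : t z * q z ^+ n - t z0 * q z0 ^+ n =
    (t z - t z0) * q z0 ^+ n + t z * (q z ^+ n - q z0 ^+ n) by ring.
  apply: le_trans (nmD _ _) _; rewrite !nmM nmX.
  have k1 : nm (t z - t z0) * nm (q z0) ^+ n <= Lt * nm (z - z0) * rho1 ^+ n.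
    rewrite ler_pM ?exprn_ge0 ?nm_ge0 //; apply: le_trans (powle n).
    by rewrite lerXn2r ?nnegrE ?nm_ge0.
  have k2 : nm (t z) * nm (q z ^+ n - q z0 ^+ n) <= T * (Lq * nm (z - z0) / (rho1 - rho) * rho1 ^+ n).
    by rewrite ler_pM ?nm_ge0 //; exact: pow_lipschitz.
  apply: le_trans (lerD k1 k2) _; rewrite /B le_eqVlt; apply/orP; left; apply/eqP; ring.
have un n z : nm (z - z0) < d -> nm (t z * q z ^+ n) <= T * rho ^+ n.
  move=> /dP[h1 h2 h3 h4]; rewrite nmM nmX ler_pM ?exprn_ge0 ?nm_ge0 //.
  by rewrite lerXn2r ?nnegrE ?nm_ge0.
have zz : nm (z0 - z0) < d by rewrite subrr nm0.
(* A majorant of the partial products; carrying it through the induction makes the error estimate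
   multiplicative. *)
pose a n := \prod_(k < n) (1 + T * rho ^+ k).
have aP n : 1 <= a n <= A by exact: prod_bound.
have eL n z : nm (z - z0) < d -> nm (pp n (t z) (q z) - pp n (t z0) (q z0)) <=
    a n * (A * B * nm (z - z0) * \sum_(k < n) rho1 ^+ k).
  move=> zd; elim: n => [|n IH]; first by rewrite /pp !big_ord0 subrr nm0 !mulr0.
  have aS : a n.+1 = a n * (1 + T * rho ^+ n) by rewrite /a big_ord_recr.
  rewrite !ppS big_ord_recr /=; set S := \sum_(k < n) _ in IH *.
  have S0 : 0 <= S by apply: sumr_ge0.
  have -> : pp n (t z) (q z) * (1 - t z * q z ^+ n) - pp n (t z0) (q z0) * (1 - t z0 * q z0 ^+ n) =
    (pp n (t z) (q z) - pp n (t z0) (q z0)) * (1 - t z * q z ^+ n)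
    - pp n (t z0) (q z0) * (t z * q z ^+ n - t z0 * q z0 ^+ n) by ring.
  apply: le_trans (nmB _ _) _; rewrite !nmM.
  have k1 : nm (pp n (t z) (q z) - pp n (t z0) (q z0)) * nm (1 - t z * q z ^+ n) <=
     a n * (A * B * nm (z - z0) * S) * (1 + T * rho ^+ n).
    rewrite ler_pM ?nm_ge0 //; apply: le_trans (nmB _ _) _.
    by rewrite nm1 lerD2l; exact: un.
  have k2 : nm (pp n (t z0) (q z0)) * nm (t z * q z ^+ n - t z0 * q z0 ^+ n) <=
      A * (B * rho1 ^+ n * nm (z - z0)).
    by rewrite ler_pM ?nm_ge0 //; [exact: nm_pp|exact: uL].
  apply: le_trans (lerD k1 k2) _.
  have k3 : A * (B * rho1 ^+ n * nm (z - z0)) <= a n.+1 * (A * (B * rho1 ^+ n * nm (z - z0))).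
    rewrite -[leLHS]mul1r ler_wpM2r ?mulr_ge0 ?nm_ge0 //.
    by case/andP: (aP n.+1).
  apply: le_trans (lerD (lexx _) k3) _.
  by rewrite aS le_eqVlt; apply/orP; left; apply/eqP; ring.
have sumle n : \sum_(k < n) rho1 ^+ k <= (1 - rho1)^-1.
  have r1' : 1 - rho1 != 0 by rewrite gt_eqF //; lra.
  rewrite -[leRHS]mul1r ler_pdivlMr; last by lra.
  have := subrX1 rho1 n; have := pow0 n; rewrite mulrC; lra.
pose K := A * (A * B / (1 - rho1)) * T + A * B.
have K0 : 0 <= K.
  by rewrite /K addr_ge0 ?mulr_ge0 // invr_ge0; lra.
apply: (@holo_geom (fun n z => pp n (t z) (q z)) _ z0 K rho1 d) => //.
- move=> n; apply: holo_prod => k.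
  exact: (holoB (holo_cst 1 z0) (holoM th (holoXn k qh))).
- by move=> z /dP[_ _ qr _]; apply: phi_ccvg; lra.
move=> n z zd; rewrite !ppS.
have -> : pp n (t z) (q z) * (1 - t z * q z ^+ n) - pp n (t z) (q z)
    - (pp n (t z0) (q z0) * (1 - t z0 * q z0 ^+ n) - pp n (t z0) (q z0)) =
  - ((pp n (t z) (q z) - pp n (t z0) (q z0)) * (t z * q z ^+ n)
    + pp n (t z0) (q z0) * (t z * q z ^+ n - t z0 * q z0 ^+ n)) by ring.
rewrite nmN; apply: le_trans (nmD _ _) _; rewrite !nmM.
have k1 : nm (pp n (t z) (q z) - pp n (t z0) (q z0)) <= A * (A * B * nm (z - z0) * (1 - rho1)^-1).
  apply: le_trans (eL n z zd) _; case/andP: (aP n) => a1 aA.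
  rewrite ler_pM ?mulr_ge0 ?nm_ge0 ?sumr_ge0 //; first lra.
  by rewrite ler_wpM2l ?mulr_ge0 ?nm_ge0.
have k2 : nm (t z) * nm (q z ^+ n) <= T * rho1 ^+ n.
  rewrite -nmM; apply: le_trans (un n z zd) _.
  by rewrite ler_wpM2l.
have k3 : nm (pp n (t z0) (q z0)) * nm (t z * q z ^+ n - t z0 * q z0 ^+ n) <=
      A * (B * rho1 ^+ n * nm (z - z0)).
  by rewrite ler_pM ?nm_ge0 //; [exact: nm_pp|exact: uL].
have k4 := ler_pM (nm_ge0 _) (mulr_ge0 (nm_ge0 (t z)) (nm_ge0 _)) k1 k2.
apply: le_trans (lerD k4 k3) _; rewrite /K le_eqVlt; apply/orP; left; apply/eqP; ring.
Qed.
End GeometricLimits.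

(** * The theta function and its modular transformation *)

Section Theta.
Variable R : realType.
Local Notation C := (R[i]^o).
Implicit Types (f g : C -> C) (z w l t q tau : C).

Definition sh z : C := ce (z / 2) - ce (- (z / 2)).
(** With [q = e^(2 pi i tau)], this is [2 i sin (pi z)] times the product over [n >= 1] of [(1 - q^n
    e^(2 pi i z)) (1 - q^n e^(-2 pi i z))], the Jacobi theta function with a simple zero at 0, up to
    a factor depending on [tau] alone. *)
Definition sg z tau : C := sh z * phi (ce (tau + z)) (ce tau) * phi (ce (tau - z)) (ce tau).

Lemma nm_ce_lt1 tau : UHP tau -> nm (ce tau) < 1.
Proof.
move=> t0; rewrite nm_ce -expR0 ltr_expR oppr_lt0 mulr_gt0 //.
by rewrite mulr2n addr_gt0 ?pi_gt0.
Qed.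

Lemma ce_half_sqr z : ce (z / 2) * ce (z / 2) = ce z.
Proof. by rewrite -ceD; congr ce; field. Qed.

Lemma ceD1 z : ce (z + 1) = ce z. Proof. by rewrite ceD ce1 mulr1. Qed.

Lemma ceB1 z : ce (z - 1) = ce z. Proof. by rewrite ceB ce1 divr1. Qed.

Lemma sgD1 z tau : sg (z + 1) tau = - sg z tau.
Proof.
rewrite /sg addrA ceD1 opprD addrA ceB1 /sh.
have -> : (z + 1) / 2 = z / 2 + 1 / 2 by field.
rewrite opprD !ceD !ceN ce_half invrN1 !mulrN1.
by move: (ce _) (phi _ _) (phi _ _) => u v w; ring.
Qed.

Lemma sgDtau z tau : UHP tau -> sg (z + tau) tau = - ce (- z - tau / 2) * sg z tau.
Proof.
move=> /nm_ce_lt1 q1; rewrite /sg.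
have -> : tau - (z + tau) = - z by ring.
rewrite (phi_rec (ce (- z)) q1) (phi_rec (ce (tau + z)) q1) -!ceD.
have -> : tau + z + tau = tau + (z + tau) by ring.
have -> : - z + tau = tau - z by ring.
set A := phi _ _; set B := phi (ce (tau - z)) _.
rewrite /sh; have -> : (z + tau) / 2 = z / 2 + tau / 2 by field.
rewrite !ceN (ceD (z / 2)) (ceB (- z)) (ceD tau z) ceN -(ce_half_sqr z) -(ce_half_sqr tau).
have g0 := ce_neq0 (z / 2); have s0 := ce_neq0 (tau / 2).
move: g0 s0; move: (ce (z / 2)) (ce (tau / 2)) => g s g0 s0.
by field; rewrite g0 s0.
Qed.

Definition altsign (n : int) : C := (-1) ^ n.

Lemma altsign_neq0 n : altsign n != 0. Proof. by rewrite expfz_neq0 // oppr_eq0 oner_eq0. Qed.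
Lemma altsignD m n : altsign (m + n) = altsign m * altsign n.
Proof. by rewrite /altsign expfzDr // oppr_eq0 oner_eq0. Qed.
Lemma altsign_sqr n : altsign n * altsign n = 1.
Proof. by rewrite -expfzMl // mulrNN mulr1 exp1rz. Qed.

Lemma sg_int z tau (m : int) : sg (z + m%:~R) tau = altsign m * sg z tau.
Proof.
have nat (m' : nat) z' : sg (z' + m'%:R) tau = altsign m' * sg z' tau.
  elim: m' z' => [|k IH] z'; first by rewrite addr0 mul1r.
  by rewrite mulrSr addrA sgD1 IH -addn1 PoszD altsignD {3}/altsign expr1z mulrN1 mulNr.
case: m => m; first exact: nat.
have := nat m.+1 (z + (Negz m)%:~R); rewrite NegzE mulrNz addrNK => ->.
by rewrite mulrA -altsignD addNr mul1r.
Qed.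

Lemma sg_lattice z tau (m n : int) : UHP tau ->
  sg (z + n%:~R * tau + m%:~R) tau =
  altsign (m + n) * ce (- (n%:~R * z) - n%:~R ^+ 2 * tau / 2) * sg z tau.
Proof.
move=> t0; suff H : sg (z + n%:~R * tau) tau =
    altsign n * (ce (- (n%:~R * z) - n%:~R ^+ 2 * tau / 2) * sg z tau).
  by rewrite sg_int H altsignD !mulrA.
have step z' : sg (z' + tau) tau = - ce (- z' - tau / 2) * sg z' tau by exact: sgDtau.
have nat (k : nat) z' : sg (z' + k%:R * tau) tau =
    altsign k * (ce (- (k%:R * z') - k%:R ^+ 2 * tau / 2) * sg z' tau).
  elim: k z' => [|k IH] z'.
    have -> : - (0%:R * z') - 0%:R ^+ 2 * tau / 2 = 0 by ring.
    by rewrite mul0r addr0 ce0 /altsign expr0z !mul1r.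
  have -> : z' + k.+1%:R * tau = (z' + k%:R * tau) + tau by rewrite -addn1 natrD; ring.
  rewrite step IH -(addn1 k) PoszD altsignD {3}/altsign expr1z.
  have -> : - ((k + 1)%:R * z') - (k + 1)%:R ^+ 2 * tau / 2 =
    (- (z' + k%:R * tau) - tau / 2) + (- (k%:R * z') - k%:R ^+ 2 * tau / 2).
    by rewrite natrD; field.
  by rewrite [in RHS]ceD; ring.
case: n => n; first exact: nat.
have := nat n.+1 (z + (Negz n)%:~R * tau).
rewrite NegzE mulrNz mulNr addrNK -[(n.+1 : int)%:~R]/(n.+1%:R) => ->.
have sN : altsign (- n.+1%:Z) * altsign n.+1 = 1 by rewrite -altsignD addNr.
have ceE : ce (- (- n.+1%:R * z) - (- n.+1%:R) ^+ 2 * tau / 2) *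
    ce (- (n.+1%:R * (z - n.+1%:R * tau)) - n.+1%:R ^+ 2 * tau / 2) = 1.
  by rewrite -ceD (_ : _ + _ = 0) ?ce0 //; field.
have comb (s u s' v w : C) : s * s' = 1 -> u * v = 1 -> s * (u * (s' * (v * w))) = w.
  move=> ss uv; have -> : s * (u * (s' * (v * w))) = (s * s') * (u * v) * w by ring.
  by rewrite ss uv !mul1r.
exact: (esym (comb _ _ _ _ _ sN ceE)).
Qed.

Lemma sg_eq0 z tau : UHP tau -> sg z tau = 0 -> exists m n : int, z = m%:~R + n%:~R * tau.
Proof.
move=> t0 /eqP; have q1 := nm_ce_lt1 t0; rewrite /sg !mulf_eq0 -orbA => /or3P[].
- rewrite /sh ceN subr_eq0 => /eqP h; have : ce z = 1.
    by rewrite -ce_half_sqr {1}h mulVf ?ce_neq0.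
  by move=> /ce_eq1[m ->]; exists m, 0; rewrite mul0r addr0.
- move=> p0; have [k] : exists k, ce (tau + z) * ce tau ^+ k = 1.
    apply: contrapT => nk; move: p0; apply/negP; apply: phi_neq0 => // k.
    by apply/eqP => kE; apply: nk; exists k.
  rewrite -ceMn -ceD => /ce_eq1[m mE]; exists m, (- k.+1%:Z).
  rewrite -mE mulrNz -[(k.+1 : int)%:~R]/(k.+1%:R) -[tau *+ k]mulr_natl.
  by rewrite -addn1 natrD; ring.
- move=> p0; have [k] : exists k, ce (tau - z) * ce tau ^+ k = 1.
    apply: contrapT => nk; move: p0; apply/negP; apply: phi_neq0 => // k.
    by apply/eqP => kE; apply: nk; exists k.
  rewrite -ceMn -ceD => /ce_eq1[m mE]; exists (- m), k.+1.
  rewrite mulrNz -mE -[(k.+1 : int)%:~R]/(k.+1%:R) -[tau *+ k]mulr_natl.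
  by rewrite -addn1 natrD; ring.
Qed.

Lemma holo_sh (f : C -> C) s : holo f s -> holo (fun s => sh (f s)) s.
Proof.
move=> fh; have h2 : holo (fun s => f s / 2) s by exact: (holoM fh (holo_cst _ s)).
apply: holoB; first exact: (holo_comp h2 (holo_ce _)).
exact: (holo_comp (holoN h2) (holo_ce _)).
Qed.

Lemma holo_sg (f g : C -> C) s : holo f s -> holo g s -> UHP (g s) ->
  holo (fun s => sg (f s) (g s)) s.
Proof.
move=> fh gh g0; have q1 := nm_ce_lt1 g0.
have qh : holo (fun s => ce (g s)) s := holo_comp gh (holo_ce _).
apply: holoM; first apply: holoM; first exact: holo_sh.
  by apply: (@holo_phi _ (fun s => ce (g s + f s)) (fun s => ce (g s))) => //;
    exact: (holo_comp (holoD gh fh) (holo_ce _)).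
by apply: (@holo_phi _ (fun s => ce (g s - f s)) (fun s => ce (g s))) => //;
  exact: (holo_comp (holoB gh fh) (holo_ce _)).
Qed.

(** ** Modular transformation of the theta function *)

(* l'Hopital's rule *)
Lemma ratio_ccont f g (f' g' : C) : cdiff f 0 f' -> cdiff g 0 g' ->
  f 0 = 0 -> g 0 = 0 -> g' != 0 ->
  ccont (fun z => if z == 0 then f' / g' else f z / g z) 0 /\
  exists2 d : R, 0 < d & forall z, z != 0 -> nm z < d -> g z != 0.
Proof.
move=> fd gd f0 g0 g'0; have gn : 0 < nm g' by rewrite nm_gt0.
have gbound : exists2 d : R, 0 < d & forall z, nm z < d -> nm g' / 2 * nm z <= nm (g z).
  have gn2 : 0 < nm g' / 2 by lra.
  have [d d0 dP] := gd _ gn2; exists d => // z /dP; rewrite add0r g0 subr0 => h.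
  have := nm_lower (g' * z) (g' * z - g z); rewrite nmBC in h.
  have -> : g' * z - (g' * z - g z) = g z by ring.
  by rewrite nmM; move: h; lra.
have [d d0 dP] := gbound.
have gz z : z != 0 -> nm z < d -> 0 < nm (g z).
  move=> z0 /dP; apply: lt_le_trans; rewrite mulr_gt0 ?nm_gt0 //; lra.
split; last by exists d => // z z0 /(gz z z0); rewrite nm_gt0.
move=> e e0; rewrite eqxx.
pose e1 := e * nm g' / (4 * (1 + nm (f' / g'))).
have q0 : 0 < 1 + nm (f' / g') by rewrite ltr_pwDl // nm_ge0.
have e10 : 0 < e1 by rewrite divr_gt0 ?mulr_gt0.
have [d1 d10 H1] := fd _ e10; have [d2 d20 H2] := gd _ e10.
exists (Num.min d (Num.min d1 d2)) => [|z]; first by rewrite !lt_min d0 d10.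
rewrite subr0 !lt_min => /and3P[zd zd1 zd2]; have [_|z0] := eqVneq z 0.
  by rewrite subrr nm0.
have gz0 := gz z z0 zd; have gzn : g z != 0 by rewrite -nm_gt0.
have -> : f z / g z - f' / g' = ((f z - f' * z) - (f' / g') * (g z - g' * z)) / g z.
  by field; rewrite ?g'0 ?gzn.
have := H1 z zd1; have := H2 z zd2; rewrite !add0r f0 g0 !subr0 => k2 k1.
rewrite nmM nmV ltr_pdivrMr //; apply: le_lt_trans (nmB _ _) _; rewrite nmM.
have k3 : nm (f' / g') * nm (g z - g' * z) <= nm (f' / g') * (e1 * nm z).
  by rewrite ler_wpM2l ?nm_ge0.
have zn : 0 < nm z by rewrite nm_gt0.
have k4 : (1 + nm (f' / g')) * (e1 * nm z) = e / 4 * nm g' * nm z.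
  by rewrite /e1; field; rewrite gt_eqF.
have k5 := ler_wpM2l (ltW e0) (dP z zd).
have k6 : 0 < e * (nm g' * nm z) by rewrite !mulr_gt0.
apply: le_lt_trans (lerD k1 k3) _.
have -> : e1 * nm z + nm (f' / g') * (e1 * nm z) = (1 + nm (f' / g')) * (e1 * nm z) by ring.
by rewrite k4; lra.
Qed.

Lemma sh_cdiff (a : C) : cdiff (fun z => sh (z * a)) 0 (tpi R * a).
Proof.
have ced (b : C) : cdiff (fun z => ce (z * b)) 0 (tpi R * b).
  move=> e e0; have b1 : 0 < nm (tpi R * b) + 1 by rewrite ltr_pwDr ?nm_ge0.
  have [d d0 dP] := cexp_cdiff0 (divr_gt0 e0 b1).
  exists (d / (nm (tpi R * b) + 1)) => [|h]; first exact: divr_gt0.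
  rewrite ltr_pdivlMr // => hd; rewrite add0r mul0r ce0.
  have nb : nm (tpi R * b * h) <= nm h * (nm (tpi R * b) + 1).
    by rewrite nmM mulrC ler_wpM2l ?nm_ge0 // lerDl.
  have := dP _ (le_lt_trans nb hd).
  rewrite add0r cexp0 mul1r /ce (_ : tpi R * (h * b) = tpi R * b * h); last by ring.
  move=> /le_trans; apply; apply: le_trans (ler_wpM2l (ltW (divr_gt0 e0 b1)) nb) _.
  by rewrite [nm h * _]mulrC mulrA divfK ?gt_eqF.
have -> : (fun z => sh (z * a)) = (fun z => ce (z * (a / 2)) - ce (z * - (a / 2))).
  by apply/funext => z; rewrite /sh mulrN mulrA.
move=> e e0; have e2 : 0 < e / 2 by lra.
have [d1 d10 H1] := ced (a / 2) _ e2; have [d2 d20 H2] := ced (- (a / 2)) _ e2.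
exists (Num.min d1 d2) => [|h]; first by rewrite lt_min d10.
rewrite lt_min => /andP[/H1 k1 /H2 k2].
have comb (u1 v1 u2 v2 : C) : u1 - v1 - (u2 - v2) - tpi R * a * h =
  (u1 - u2 - tpi R * (a / 2) * h) - (v1 - v2 - tpi R * - (a / 2) * h) by field.
by rewrite comb; apply: le_trans (nmB _ _) _; lra.
Qed.

Lemma sh0 : sh 0 = 0. Proof. by rewrite /sh mul0r oppr0 subrr. Qed.

Local Opaque phi ce.

Section Transform.
Variables (a b c d : int) (tau : C).
Hypotheses (det1 : a * d - b * c = 1) (tau0 : UHP tau).

Definition jfac : C := c%:~R * tau + d%:~R.
Definition mtau : C := (a%:~R * tau + b%:~R) / jfac.

Let detC : a%:~R * d%:~R - b%:~R * c%:~R = 1 :> C.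
Proof. by rewrite -!rmorphM -rmorphB /= det1. Qed.

Lemma jfac_neq0 : jfac != 0.
Proof.
apply/eqP => j0; have := congr1 (@complex.Im R) j0.
have iE (n : int) : (n%:~R : C) = (n%:~R : R)%:C%C by rewrite rmorph_int.
rewrite /jfac !iE cImD cImM /= mul0r !addr0 => /eqP; rewrite mulf_eq0 (gt_eqF tau0) orbF intr_eq0 => /eqP c0.
move: j0; rewrite /jfac c0 mul0r add0r => /eqP; rewrite intr_eq0 => /eqP d0.
by move: det1; rewrite c0 d0 !mulr0 subrr.
Qed.

Lemma Im_mtau : complex.Im mtau = complex.Im tau / nm jfac ^+ 2.
Proof.
have iE (n : int) : (n%:~R : C) = (n%:~R : R)%:C%C by rewrite rmorph_int.
have n0 : nm jfac ^+ 2 != 0 by rewrite expf_neq0 // nm_eq0 jfac_neq0.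
apply: (mulIf n0); rewrite divfK //.
have E : mtau * (nm jfac ^+ 2)%:C%C = (a%:~R * tau + b%:~R) * (jfac^*)%C.
  have : (nm jfac ^+ 2)%:C%C = jfac * (jfac^*)%C :> C.
    rewrite nm_sqr; case: (jfac) => u v; apply: eq_cplx => /=; ring.
  move=> ->; rewrite /mtau mulrA divfK //; exact: jfac_neq0.
have : complex.Im (mtau * (nm jfac ^+ 2)%:C%C) = complex.Im mtau * nm jfac ^+ 2.
  by rewrite cImM /=; ring.
move=> <-; rewrite E cImM /jfac !iE; case: (tau) => u v /=.
have D : a%:~R * d%:~R - b%:~R * c%:~R = 1 :> R by rewrite -!rmorphM -rmorphB /= det1.
by rewrite -[RHS]mulr1 -[in RHS]D; ring.
Qed.

Lemma UHP_mtau : UHP mtau.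
Proof.
by rewrite /UHP Im_mtau divr_gt0 // exprn_gt0 // nm_gt0 jfac_neq0.
Qed.

(** The Gaussian factor is chosen so that [Qf] has the same quasi-periods, 1 and [tau], as [sg] at
    [tau]; see [Qf1] and [Qftau]. *)
Definition Qf z : C := ce (- (c%:~R * z ^+ 2 / (2 * jfac))) * sg (z / jfac) mtau.

(** The exponent is [(1 + x) (1 + y) - 1], which is odd because coprime integers are not both
    even. *)
Lemma altsign_odd_pair (x y : int) : (exists u v : int, x * u - y * v = 1) -> altsign (x + y + x * y) = -1.
Proof.
case=> u [v uv]; suff [k ->] : exists k, x + y + x * y = k + k + 1.
  by rewrite altsignD (altsignD k k) altsign_sqr mul1r /altsign expr1z.
have half (n : int) : exists m : int, n = m + m \/ n = m + m + 1.
  by exists (n %/ 2)%Z; lia.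
have [x' [xE|xE]] := half x; have [y' [yE|yE]] := half y; subst x y.
- have : (x' * u - y' * v) + (x' * u - y' * v) = 1 by rewrite -uv; ring.
  by lia.
- by exists (x' + y' + (x' + x') * y' + x'); ring.
- by exists (x' + y' + x' * (y' + y') + y'); ring.
- by exists (x' + y' + (x' + x') * y' + x' + y' + 1); ring.
Qed.

Lemma mtauK : mtau * jfac = a%:~R * tau + b%:~R.
Proof. by rewrite divfK // jfac_neq0. Qed.

Lemma inv_jfac : 1 / jfac = a%:~R + (- c)%:~R * mtau.
Proof.
have j0 := jfac_neq0; apply: (mulIf j0); rewrite divfK //.
have -> : (a%:~R + (- c)%:~R * mtau) * jfac = a%:~R * jfac + (- c)%:~R * (mtau * jfac) by ring.
by rewrite mtauK mulrNz /jfac -[LHS]detC; ring.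
Qed.

Lemma tau_jfac : tau / jfac = d%:~R * mtau - b%:~R.
Proof.
have j0 := jfac_neq0; apply: (mulIf j0); rewrite divfK //.
have -> : (d%:~R * mtau - b%:~R) * jfac = d%:~R * (mtau * jfac) - b%:~R * jfac by ring.
by rewrite mtauK /jfac -[LHS]mulr1 -[in LHS]detC; ring.
Qed.

Let ceZ (n : int) : ce (n%:~R / 2) = altsign n.
Proof.
have -> : n%:~R / 2 = (1 / 2) *~ n :> C by rewrite -mulrzr; field.
by rewrite ceMz ce_half.
Qed.

Let comb4 (A s B S D : C) : s * (A * B) = D -> A * (s * B * S) = D * S.
Proof. by move=> <-; ring. Qed.

Lemma Qf1 z : Qf (z + 1) = - Qf z.
Proof.
have j0 := jfac_neq0; rewrite /Qf.
have -> : (z + 1) / jfac = z / jfac + (- c)%:~R * mtau + a%:~R.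
  by rewrite mulrDl inv_jfac; ring.
rewrite sg_lattice ?UHP_mtau // -[RHS]mulNr; apply: comb4; rewrite -ceD.
have -> : - (c%:~R * (z + 1) ^+ 2 / (2 * jfac)) + (- ((- c)%:~R * (z / jfac)) - (- c)%:~R ^+ 2 * mtau / 2) =
   - (c%:~R * z ^+ 2 / (2 * jfac)) + (- (c * a))%:~R / 2.
  have mE : (- c)%:~R * mtau = 1 / jfac - a%:~R by rewrite inv_jfac; ring.
  have -> : (- c)%:~R ^+ 2 * mtau / 2 = (- c)%:~R * ((- c)%:~R * mtau) / 2 by ring.
  by rewrite mE !mulrNz intrM; field.
rewrite ceD ceZ mulrCA -altsignD -[RHS]mulrN1; congr (_ * _).
 suff -> : altsign (a - c - c * a) = altsign (a + c + a * c) by apply: altsign_odd_pair; exists d, b; rewrite -det1; ring.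
have -> : a - c - c * a = (a + c + a * c) + ((- c - a * c) + (- c - a * c)) by ring.
by rewrite altsignD (altsignD (- c - a * c)) altsign_sqr mulr1.
Qed.

Lemma Qftau z : Qf (z + tau) = - ce (- z - tau / 2) * Qf z.
Proof.
have j0 := jfac_neq0; rewrite /Qf.
have -> : (z + tau) / jfac = z / jfac + d%:~R * mtau + (- b)%:~R.
  by rewrite mulrDl tau_jfac mulrNz addrA.
rewrite sg_lattice ?UHP_mtau // [RHS]mulrA; apply: comb4; rewrite -ceD [RHS]mulNr -[in RHS]ceD.
have -> : - (c%:~R * (z + tau) ^+ 2 / (2 * jfac)) + (- (d%:~R * (z / jfac)) - d%:~R ^+ 2 * mtau / 2) =
   (- z - tau / 2 + - (c%:~R * z ^+ 2 / (2 * jfac))) + (- (b * d))%:~R / 2.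
  have H1 : d%:~R ^+ 2 * mtau + c%:~R * tau ^+ 2 / jfac = tau + (b * d)%:~R.
    apply: (mulIf j0); rewrite mulrDl -[_ * mtau * _]mulrA mtauK divfK //.
    have -> : d%:~R ^+ 2 * (a%:~R * tau + b%:~R) + c%:~R * tau ^+ 2 =
      d%:~R * tau * (a%:~R * d%:~R - b%:~R * c%:~R) + b%:~R * c%:~R * d%:~R * tau + b%:~R * d%:~R ^+ 2 + c%:~R * tau ^+ 2 :> C.
      by ring.
    by rewrite detC /jfac rmorphM /=; ring.
  have H2 : (c%:~R * tau + d%:~R) * (z / jfac) = z by rewrite mulrC divfK.
  rewrite mulrNz.
  have -> : - (c%:~R * (z + tau) ^+ 2 / (2 * jfac)) + (- (d%:~R * (z / jfac)) - d%:~R ^+ 2 * mtau / 2) =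
     - (c%:~R * z ^+ 2 / (2 * jfac)) - (c%:~R * tau + d%:~R) * (z / jfac)
     - (d%:~R ^+ 2 * mtau + c%:~R * tau ^+ 2 / jfac) / 2 by field.
  by rewrite H1 H2; field.
rewrite (ceD _ ((- (b * d))%:~R / 2)) ceZ mulrCA -altsignD -[RHS]mulrN1; congr (_ * _).
 suff -> : altsign (- b + d - b * d) = altsign (b + d + b * d).
  by apply: altsign_odd_pair; exists (- c), (- a); rewrite -det1; ring.
have -> : - b + d - b * d = (b + d + b * d) + ((- b - b * d) + (- b - b * d)) by ring.
by rewrite altsignD (altsignD (- b - b * d)) altsign_sqr mulr1.
Qed.

Lemma sg_neq0_shift1 z : (sg (z + 1) tau == 0) = (sg z tau == 0).
Proof. by rewrite sgD1 oppr_eq0. Qed.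

Lemma sg_neq0_shiftt z : (sg (z + tau) tau == 0) = (sg z tau == 0).
Proof. by rewrite sgDtau // mulf_eq0 oppr_eq0 (negbTE (ce_neq0 _)). Qed.

Lemma holo_Qf z : holo Qf z.
Proof.
have h1 : holo (fun z => - (c%:~R * z ^+ 2 / (2 * jfac))) z.
  apply: holoN; apply: (holoM _ (holo_cst _ z)).
  exact: (holoZ _ (holoXn 2 (holo_id z))).
have h2 : holo (fun z => sg (z / jfac) mtau) z.
  apply: (@holo_sg (fun z => z / jfac) (fun=> mtau)); last exact: UHP_mtau.
    exact: (holoM (holo_id z) (holo_cst _ z)).
  exact: holo_cst.
exact: (holoM (holo_comp h1 (holo_ce _)) h2).
Qed.

Lemma holo_sgz z : holo (fun z => sg z tau) z.
Proof. exact: (@holo_sg (fun z => z) (fun=> tau) z (holo_id z) (holo_cst tau z) tau0). Qed.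

(* the quotient of the two theta functions extends to a doubly periodic function *)
Lemma sg_transform : exists2 k : C, k != 0 & forall z, sg z tau != 0 ->
  sg (z / jfac) mtau = k * ce (c%:~R * z ^+ 2 / (2 * jfac)) * sg z tau.
Proof.
have j0 := jfac_neq0; have tp0 := @tpi_neq0 R.
have q1 := nm_ce_lt1 tau0.
have jV : jfac^-1 != 0 by rewrite invr_eq0.
have D1 : cdiff (fun z => sh (z * jfac^-1)) 0 (tpi R * jfac^-1) by exact: sh_cdiff.
have D2 : cdiff (fun z => sh (z * 1)) 0 (tpi R * 1) by exact: sh_cdiff.
have [|||Sc [r0 r00 shn]] := ratio_ccont D1 D2; rewrite ?mul0r ?sh0 ?mulr1 //.
(* Away from the zeros of the denominator the quotient is [S G]: [G] is holomorphic and nonzero at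
   0, and [S] is the quotient of the two simple zeros, filled in at 0 by its limit. *)
pose S z := if z == 0 then tpi R * jfac^-1 / (tpi R * 1) else sh (z * jfac^-1) / sh (z * 1).
pose G z : C := ce (- (c%:~R * z ^+ 2 / (2 * jfac))) *
  (phi (ce (mtau + z / jfac)) (ce mtau) * phi (ce (mtau - z / jfac)) (ce mtau)) /
  (phi (ce (tau + z)) (ce tau) * phi (ce (tau - z)) (ce tau)).
have phiq_neq0 t : UHP t -> phi (ce (t + 0)) (ce t) != 0.
  move=> tu; rewrite addr0; apply: phi_neq0 => [|n]; first exact: nm_ce_lt1.
  rewrite -exprS; apply/eqP => /(congr1 (@nm R)); rewrite nmX nm1 => E.
  have := nm_ce_lt1 tu; have := nm_ge0 (ce t) => n0 n1.
  have : nm (ce t) ^+ n.+1 < 1 by rewrite exprn_ilt1.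
  by rewrite E ltxx.
have hphi (f : C -> C) t z : holo f z -> UHP t -> holo (fun z => phi (ce (f z)) (ce t)) z.
  move=> fh tu; apply: (@holo_phi _ (fun z => ce (f z)) (fun=> ce t)).
  - exact: (holo_comp fh (holo_ce _)).
  - exact: holo_cst.
  - exact: nm_ce_lt1.
have hz (k : C) z : holo (fun z => z / k) z by exact: (holoM (holo_id z) (holo_cst _ z)).
have sub0E (t : C) : t - 0 = t + 0 by rewrite subr0 addr0.
have Gden0 : phi (ce (tau + 0)) (ce tau) * phi (ce (tau - 0)) (ce tau) != 0.
  by rewrite sub0E; apply: mulf_neq0; exact: phiq_neq0.
have hG : holo G 0.
  apply: holo_div => //; last first.
    apply: holoM; apply: hphi => //; first exact: (holoD (holo_cst tau 0) (holo_id 0)).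
    exact: (holoB (holo_cst tau 0) (holo_id 0)).
  apply: holoM.
    have h1 : holo (fun z => - (c%:~R * z ^+ 2 / (2 * jfac))) 0.
      apply: holoN; apply: (holoM _ (holo_cst _ 0)).
      exact: (holoZ _ (holoXn 2 (holo_id 0))).
    exact: (holo_comp h1 (holo_ce _)).
  apply: holoM; apply: hphi; try exact: UHP_mtau.
    exact: (holoD (holo_cst mtau 0) (hz jfac 0)).
  exact: (holoB (holo_cst mtau 0) (hz jfac 0)).
have G0 : G 0 != 0.
  rewrite /G mul0r; apply: mulf_neq0; last by rewrite invr_eq0.
  apply: mulf_neq0; first exact: ce_neq0.
  by rewrite sub0E; apply: mulf_neq0; apply: phiq_neq0; exact: UHP_mtau.
pose l : C := S 0 * G 0.
have S0 : S 0 != 0.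
  rewrite /S eqxx mulr1; apply: mulf_neq0; last by rewrite invr_eq0.
  exact: (mulf_neq0 tp0 jV).
have l0 : l != 0 by exact: mulf_neq0.
pose h z := if sg z tau == 0 then l else Qf z / sg z tau.
have hE z : sg z tau != 0 -> h z = S z * G z.
  move=> s0; rewrite /h (negbTE s0).
  have z0 : z != 0 by apply: contraNneq s0 => ->; rewrite /sg sh0 !mul0r.
  move: s0; rewrite /S (negbTE z0) /Qf /G /sg !mulr1 !mulf_eq0 !negb_or => /andP[/andP[u1 u2] u3].
  by move: u1 u2 u3; move: (sh z) (phi (ce (tau + z)) _) (phi (ce (tau - z)) _) => *; field;
    apply/and3P.
have near0 : cregular h 0.
  have phc (f : C -> C) : holo f 0 -> f 0 = 0 -> exists2 dl : R, 0 < dl &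
     forall z, nm z < dl -> phi (ce (tau + f z)) (ce tau) != 0.
    move=> fh f0; have ph := holo_ccont (hphi (fun z => tau + f z) tau 0 (holoD (holo_cst tau 0) fh) tau0).
    have e0 : 0 < nm (phi (ce (tau + f 0)) (ce tau)) by rewrite nm_gt0 f0 phiq_neq0.
    have [dl d0 dP] := ph _ e0; exists dl => // z zd; apply/eqP => p0.
    by have := dP z; rewrite subr0 => /(_ zd); rewrite p0 sub0r nmN ltxx.
  have [d1 d10 d1P] := phc id (holo_id 0) erefl.
  have [d2 d20 d2P] := phc (fun z => - z) (holoN (holo_id 0)) (oppr0 _).
  pose dl := Num.min r0 (Num.min d1 d2).
  have d0 : 0 < dl by rewrite !lt_min r00 d10.
  have sgn z : z != 0 -> nm z < dl -> sg z tau != 0.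
    move=> z0; rewrite !lt_min => /and3P[h1 h2 h3].
    rewrite /sg !mulf_neq0 //; [|exact: d1P|exact: d2P].
    by have := shn z z0 h1; rewrite mulr1.
  have sg00 : sg 0 tau = 0 by rewrite /sg sh0 !mul0r.
  split.
    have SG : ccont (fun z => S z * G z) 0 by apply: ccontM Sc (holo_ccont hG).
    apply: (ccont_near _ SG); apply/nbhs_cplxP; exists dl => // z; rewrite subr0 => zd.
    have [->|z0] := eqVneq z 0; first by rewrite /h sg00 eqxx.
    by rewrite hE // sgn.
  exists dl => // z z0; rewrite subr0 => zd.
  have hs := holo_sgz z.
  apply: (@holo_near _ (fun z => Qf z / sg z tau)); last first.
    exact: (@holo_div _ Qf (fun z => sg z tau) z (sgn z z0 zd) (holo_Qf z) hs).
  have e0 : 0 < nm (sg z tau) by rewrite nm_gt0 sgn.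
  have [d3 d30 d3P] := holo_ccont hs e0.
  apply/nbhs_cplxP; exists d3 => // w /d3P wd; rewrite /h ifN //.
  by apply/eqP => w0; move: wd; rewrite w0 sub0r nmN ltxx.
have h1 z : h (z + 1) = h z.
  by rewrite /h sg_neq0_shift1; case: (sg z tau == 0) => [//|]; rewrite Qf1 sgD1 invrN mulrNN.
have ht z : h (z + tau) = h z.
  rewrite /h sg_neq0_shiftt; case: (sg z tau == 0) => [//|]; rewrite Qftau (sgDtau z tau0).
  have c0 := ce_neq0 (- z - tau / 2).
  have c1 : - ce (- z - tau / 2) != 0 by rewrite oppr_eq0.
  by rewrite invfM mulrACA (divff c1) mul1r.
(* All zeros of the denominator are lattice points, which periodicity moves to 0. *)
have hreg z : cregular h z.
  have [s0|s0] := eqVneq (sg z tau) 0.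
    have [m [n zE]] := sg_eq0 tau0 s0.
    have hper w : h (w - z) = h w.
      rewrite -[RHS](period_int h1 (- m)) -[RHS](period_int ht (- n)); congr h.
      by rewrite zE !mulrNz; ring.
    have [hc [dl d0 dP]] := near0; split.
      move=> e e0; have [dl' dl'0 dl'P] := hc e e0; exists dl' => // w wz.
      have := dl'P (w - z); rewrite subr0 => /(_ wz); rewrite hper.
      by have := hper z; rewrite subrr => ->.
    exists dl => // w wz wd.
    have hE2 : h = (fun w => h (w - z)) by apply/funext => v; rewrite hper.
    rewrite hE2.
    apply: (@holo_comp _ h (fun w => w - z)); first exact: (holoB (holo_id w) (holo_cst z w)).
    by apply: dP; rewrite ?subr_eq0 ?subr0.
  apply: holo_cregular; have hs := holo_sgz.
  have e0 : 0 < nm (sg z tau) by rewrite nm_gt0.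
  have [dl d0 dP] := holo_ccont (hs z) e0.
  have sn w : nm (w - z) < dl -> sg w tau != 0.
    by move=> /dP wd; apply/eqP => w0; move: wd; rewrite w0 sub0r nmN ltxx.
  apply/nbhs_cplxP; exists dl => // w wd.
  apply: (@holo_near _ (fun z => Qf z / sg z tau)); last first.
    exact: (@holo_div _ Qf (fun z => sg z tau) w (sn w wd) (holo_Qf w) (hs w)).
  apply/nbhs_cplxP; exists (dl - nm (w - z)) => [|v vw]; first by rewrite subr_gt0.
  rewrite /h ifN; first by [].
  by apply: sn; have := nm_dist_triangle v z w; lra.
exists l => // z s0; have := liouville_torus tau0 hreg h1 ht z 0.
have -> : h 0 = l by rewrite /h /sg sh0 !mul0r eqxx.
rewrite /h (negbTE s0) => E.
have {E} : Qf z = l * sg z tau by rewrite -E divfK.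
rewrite /Qf ceN => E; have c0 := ce_neq0 (c%:~R * z ^+ 2 / (2 * jfac)).
have comb (X Y L S' : C) : X != 0 -> X^-1 * Y = L * S' -> Y = L * X * S'.
  by move=> X0 H; rewrite mulrAC -H mulrC mulrA (mulfV X0) mul1r.
exact: (comb _ _ _ _ c0 E).
Qed.
End Transform.
End Theta.

(** * Klein forms and their leading terms at [i oo] *)

Section KleinForms.
Variable R : realType.
Local Notation C := (R[i]^o).
Implicit Types (f g F G : C -> C) (z w l t q tau : C).
Local Opaque phi ce.

(** ** Limits at i oo *)

Definition ilim F l := forall e : R, 0 < e ->
  exists Y : R, forall tau, Y < complex.Im tau -> nm (F tau - l) < e.

Lemma ilimP F l : ilim F l <-> (F tau @[tau --> @at_ioo R] --> l).
Proof.
have P := @cvg_cplxP R _ (@at_ioo R) (@at_ioo_filter R) F l.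
split=> [Fl|/P Fl e e0].
  by apply/P => e /Fl[Y YP]; exists Y.
by have [Y _ YP] := Fl e e0; exists Y.
Qed.

Lemma ilimM F G l m : ilim F l -> ilim G m -> ilim (fun t => F t * G t) (l * m).
Proof.
move=> /ilimP Fl /ilimP Gm; apply/ilimP.
exact: (@cvgM C C _ (@at_ioo_filter R) F G l m Fl Gm).
Qed.

Lemma ilimV F l : l != 0 -> ilim F l -> ilim (fun t => (F t)^-1) l^-1.
Proof.
move=> l0 /ilimP Fl; apply/ilimP.
exact: (@cvgV C C _ (@at_ioo_filter R) F l l0 Fl).
Qed.

Lemma ilim_cst l : ilim (fun=> l) l.
Proof. by move=> e e0; exists 0 => tau _; rewrite subrr nm0. Qed.

Lemma ilimD F G l m : ilim F l -> ilim G m -> ilim (fun t => F t + G t) (l + m).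
Proof.
move=> Fl Gm e e0; have e2 : 0 < e / 2 by lra.
have [Y1 H1] := Fl _ e2; have [Y2 H2] := Gm _ e2.
exists (Num.max Y1 Y2) => tau; rewrite gt_max => /andP[/H1 h1 /H2 h2].
have -> : F tau + G tau - (l + m) = (F tau - l) + (G tau - m) by ring.
by apply: le_lt_trans (nmD _ _) _; lra.
Qed.

Lemma ilimX F l n : ilim F l -> ilim (fun t => F t ^+ n) (l ^+ n).
Proof.
move=> Fl; elim: n => [|n IH]; first exact: ilim_cst.
by under eq_fun do rewrite exprS; rewrite exprS; exact: (ilimM Fl IH).
Qed.

Lemma ilimXz F l (n : int) : l != 0 -> ilim F l -> ilim (fun t => F t ^ n) (l ^ n).
Proof.
move=> l0 Fl; case: n => n; first exact: (ilimX n Fl).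
exact: (ilimV (expf_neq0 n.+1 l0) (ilimX n.+1 Fl)).
Qed.

Lemma ilim_eq F G l (Y : R) : (forall t, Y < complex.Im t -> F t = G t) ->
  ilim F l -> ilim G l.
Proof.
move=> FG Fl e e0; have [Y1 H1] := Fl e e0; exists (Num.max Y Y1) => t.
by rewrite gt_max => /andP[/FG <- /H1].
Qed.

Lemma ilim_unique F l m : ilim F l -> ilim F m -> l = m.
Proof.
move=> Fl Fm; apply/eqP; rewrite -subr_eq0 -nm_eq0 eq_le nm_ge0 andbT leNgt.
apply/negP => n0; have n2 : 0 < nm (l - m) / 2 by lra.
have [Y1 H1] := Fl _ n2; have [Y2 H2] := Fm _ n2.
pose t : C := (0 +i* (Num.max Y1 Y2 + 1))%C.
have t1 : Y1 < complex.Im t by rewrite /=; apply: le_lt_trans (_ : Num.max Y1 Y2 < _); rewrite ?le_max ?lexx // ltrDl.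
have t2 : Y2 < complex.Im t by rewrite /=; apply: le_lt_trans (_ : Num.max Y1 Y2 < _); rewrite ?le_max ?lexx ?orbT // ltrDl.
have := H1 _ t1; have := H2 _ t2; have := nm_dist_triangle l m (F t).
rewrite (nmBC l (F t)); lra.
Qed.

Lemma ilim_comp F l (al : R) (be : C) : 0 < al -> ilim F l ->
  ilim (fun t => F (al%:C%C * t + be)) l.
Proof.
move=> a0 Fl e e0; have [Y H] := Fl e e0; exists ((Y - complex.Im be) / al) => t.
rewrite ltr_pdivrMr // => tY; apply: H; rewrite cImD cImM /= mul0r addr0.
by move: tY; rewrite mulrC; lra.
Qed.

Lemma ilim_ce0 (al : R) (be : C) : 0 < al -> ilim (fun t => ce (al%:C%C * t + be)) 0.
Proof.
move=> a0 e e0; have p0 : 0 < pi *+ 2 :> R by rewrite mulr2n addr_gt0 ?pi_gt0.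
exists ((- ln e / (pi *+ 2) - complex.Im be) / al) => t.
rewrite ltr_pdivrMr // subr0 nm_ce cImD cImM /= mul0r addr0 => tY.
rewrite -[X in _ < X](@lnK _ e) ?posrE // ltr_expR ltrNl.
rewrite mulrC -ltr_pdivrMr //; move: tY; rewrite mulrC; lra.
Qed.

Lemma ilim_phi (f : C -> C) : ilim f 0 -> ilim (fun t => phi (f t) (ce t)) 1.
Proof.
move=> f0 e e0; have c0 : ilim (fun t => ce t) 0.
  apply: (@ilim_eq (fun t => ce (1%:C%C * t + 0)) _ _ 0); last by apply: ilim_ce0.
  by move=> t _; rewrite mul1r addr0.
have A1 : 1 <= ppbound 1 (1 / 2 : R) by apply: ppbound_ge1; lra.
pose d := Num.min 1 (e / (8 * ppbound 1 (1 / 2))).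
have d0 : 0 < d by rewrite lt_min ltr01 divr_gt0 //; lra.
have h0 : 0 < 1 / 2 :> R by lra.
have [Y1 H1] := f0 _ d0; have [Y2 H2] := c0 _ h0.
exists (Num.max Y1 Y2) => t; rewrite gt_max => /andP[/H1 + /H2].
rewrite !subr0 => /ltW k1 /ltW k2.
have k3 : 1 / 2 < 1 :> R by lra.
apply: le_lt_trans (phi_near1 k1 k2 k3) _.
have d1 : d <= 1 by rewrite ge_min lexx.
have d2 : d * (8 * ppbound 1 (1 / 2)) <= e.
  by rewrite -ler_pdivlMr ?ge_min ?lexx ?orbT //; lra.
have dge : 0 <= d by exact: ltW.
have k4 : ppbound d (1 / 2) <= ppbound 1 (1 / 2).
  by rewrite ler_expR ler_wpM2r // invr_ge0; lra.
have k5 : ppbound d (1 / 2) * d <= ppbound 1 (1 / 2) * d by rewrite ler_wpM2r.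
have -> : 2 * (ppbound d (1 / 2) * d) / (1 - 1 / 2) = 4 * (ppbound d (1 / 2) * d) by field.
lra.
Qed.

(** ** Klein forms, up to a factor independent of the characteristic *)

Definition K (x y tau : C) : C := ce (x * (x * tau + y) / 2) * sg (x * tau + y) tau.

Definition lattice_pt (x y : C) := exists m n : int, x = m%:~R /\ y = n%:~R.

(** The exponential in [K] compensates the Gaussian factor of [sg_transform]. The constant [k] does
    not depend on the characteristic, so it disappears from products with exponents of sum 0. *)
Lemma K_transform (a b c d : int) tau : a * d - b * c = 1 -> UHP tau ->
  exists2 k : C, k != 0 & forall x y : C,
    sg ((x * a%:~R + y * c%:~R) * tau + (x * b%:~R + y * d%:~R)) tau != 0 ->
    K x y (mtau a b c d tau) = k * K (x * a%:~R + y * c%:~R) (x * b%:~R + y * d%:~R) tau.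
Proof.
move=> det1 tau0; have [k k0 kP] := sg_transform det1 tau0.
exists k => // x y; set x' := x * a%:~R + _; set y' := x * b%:~R + _ => s0.
have j0 := jfac_neq0 det1 tau0; have mK := mtauK det1 tau0.
have detC : a%:~R * d%:~R - b%:~R * c%:~R = 1 :> C by rewrite -!rmorphM -rmorphB /= det1.
pose z := x' * tau + y'.
have zE : x * mtau a b c d tau + y = z / jfac c d tau.
  apply: (mulIf j0); rewrite divfK //.
  have -> : (x * mtau a b c d tau + y) * jfac c d tau =
    x * (mtau a b c d tau * jfac c d tau) + y * jfac c d tau by ring.
  by rewrite mK /z /x' /y' /jfac; ring.
rewrite /K zE kP // -/z; set E1 := ce _; set E2 := ce _; set E3 := ce _.
suff -> : E3 = E1 * E2 by ring.
rewrite /E1 /E2 /E3 -ceD; congr ce.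
have xE : x = x' * jfac c d tau - c%:~R * z.
  have -> : x' * jfac c d tau - c%:~R * z = x * (a%:~R * d%:~R - b%:~R * c%:~R).
    by rewrite /z /x' /y' /jfac; ring.
  by rewrite detC mulr1.
by rewrite {1}xE; field.
Qed.

Lemma ce_altsign (n : int) : ce (n%:~R / 2) = altsign R n.
Proof.
have -> : n%:~R / 2 = (1 / 2) *~ n :> C by rewrite -mulrzr; field.
by rewrite ceMz ce_half.
Qed.

Lemma K_shift (x y tau : C) (m l : int) : UHP tau ->
  K (x + m%:~R) (y + l%:~R) tau =
  altsign R (m + l + m * l) * ce ((x * l%:~R - m%:~R * y) / 2) * K x y tau.
Proof.
move=> tau0; rewrite /K.
have -> : (x + m%:~R) * tau + (y + l%:~R) = (x * tau + y) + m%:~R * tau + l%:~R by ring.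
rewrite sg_lattice // (addrC l m) (altsignD R (m + l)) -(ce_altsign (m * l)).
set E1 := ce _; set E2 := ce _; set E3 := ce _; set E4 := ce _; set E5 := ce _.
suff -> : E1 * (altsign R (m + l) * E2 * sg (x * tau + y) tau) =
  (altsign R (m + l) * (E1 * E2)) * sg (x * tau + y) tau.
  suff -> : E1 * E2 = E3 * E4 * E5 by ring.
  by rewrite /E1 /E2 /E3 /E4 /E5 -!ceD rmorphM; congr ce => /=; field.
by ring.
Qed.

Lemma sg_neq0 (x y : R) tau : UHP tau -> ~ lattice_pt x%:C%C y%:C%C ->
  sg (x%:C%C * tau + y%:C%C) tau != 0.
Proof.
move=> tau0 nl; apply/eqP => /(sg_eq0 tau0)[m [n E]]; apply: nl.
have iE (k : int) : (k%:~R : C) = (k%:~R : R)%:C%C by rewrite rmorph_int.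
have /eqP := congr1 (@complex.Im R) E; rewrite !iE !cImD !cImM /= !mul0r !addr0 add0r.
have it0 : complex.Im tau != 0 by rewrite gt_eqF.
rewrite (inj_eq (mulIf it0)) => /eqP xn.
exists n, m; split; first by rewrite iE xn.
have /eqP := congr1 (@complex.Re R) E; rewrite !iE !cReD !cReM /= !mul0r !subr0 xn.
by rewrite [m%:~R + _]addrC (inj_eq (addrI _)) => /eqP ->.
Qed.

Lemma K_neq0 (x y : R) tau : UHP tau -> ~ lattice_pt x%:C%C y%:C%C -> K x%:C%C y%:C%C tau != 0.
Proof. by move=> tau0 nl; rewrite mulf_neq0 ?ce_neq0 // sg_neq0. Qed.

Lemma holo_K (x y : C) (f : C -> C) s : holo f s -> UHP (f s) -> holo (fun s => K x y (f s)) s.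
Proof.
move=> fh f0; have h1 : holo (fun s => x * f s + y) s by exact: (holoD (holoZ x fh) (holo_cst y s)).
apply: holoM; last exact: (holo_sg h1 fh f0).
apply: (@holo_comp _ (@ce R) (fun s => x * (x * f s + y) / 2)); last exact: holo_ce.
exact: (holoM (holoZ x h1) (holo_cst _ s)).
Qed.

(** The exponent [(x^2 - x) / 2] combines [x^2 / 2] from the exponential with [- x / 2] from [sh].
    For [x = 0] the factor [1 - ce Y] survives in the limit, and is nonzero off the lattice. *)
Lemma K_asymp (x y : R) : 0 <= x < 1 -> ~ lattice_pt x%:C%C y%:C%C ->
  exists2 l : C, l != 0 &
    ilim (fun tau => K x%:C%C y%:C%C tau * ce (- (tau * (x ^+ 2 - x)%:C%C / 2))) l.
Proof.
move=> /andP[x0 x1] nl; set X : C := x%:C%C; set Y : C := y%:C%C.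
pose E0 : C := - ce ((X - 1) * Y / 2).
pose l0 : C := if x == 0 then 1 - ce Y else 1.
exists (E0 * l0).
  apply: mulf_neq0; first by rewrite oppr_eq0 ce_neq0.
  rewrite /l0; case: (x =P 0) => [xE|_]; last by exact: (@oner_neq0 R[i]).
  rewrite subr_eq0; apply/eqP => /esym /ce_eq1[n nE]; apply: nl.
  by exists 0, n; rewrite xE.
have key tau : K X Y tau * ce (- (tau * (x ^+ 2 - x)%:C%C / 2)) =
  E0 * ((1 + - ce (X * tau + Y)) * (phi (ce ((1 + x)%:C%C * tau + Y)) (ce tau) *
     phi (ce ((1 - x)%:C%C * tau + - Y)) (ce tau))).
  have e1 : (1 + x)%:C%C * tau + Y = tau + (X * tau + Y) by rewrite rmorphD; ring.
  have e2 : (1 - x)%:C%C * tau + - Y = tau - (X * tau + Y) by rewrite rmorphB; ring.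
  rewrite /K /sg e1 e2; set A := phi _ _; set B := phi _ _.
  set z := X * tau + Y.
  suff E : ce (X * z / 2) * sh z * ce (- (tau * (x ^+ 2 - x)%:C%C / 2)) = E0 * (1 + - ce z).
    by rewrite [RHS]mulrA -E; ring.
  have -> : sh z = - ce (- (z / 2)) * (1 + - ce z).
    rewrite /sh -(ce_half_sqr z) ceN; have := ce_neq0 (z / 2).
    by move: (ce (z / 2)) => u u0; field.
  have -> : E0 = - (ce (X * z / 2) * ce (- (z / 2)) * ce (- (tau * (x ^+ 2 - x)%:C%C / 2))).
    by rewrite /E0 -!ceD; congr (- ce _); rewrite /z rmorphB rmorphXn /= -/X; field.
  by ring.
apply: (@ilim_eq _ _ _ 0 (fun t _ => esym (key t))).
apply: ilimM; first exact: ilim_cst.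
rewrite -[l0]mulr1 -[X in l0 * X]mulr1; apply: ilimM; last first.
  by apply: ilimM; apply: ilim_phi; apply: ilim_ce0; lra.
rewrite /l0; case: eqP => [xE|/eqP xn].
  apply: (@ilim_eq (fun=> 1 - ce Y) _ _ 0); last exact: ilim_cst.
  by move=> t _; rewrite /X xE mul0r add0r.
have xp : 0 < x by rewrite lt_def xn.
have := ilimD (ilim_cst 1) (ilimM (ilim_cst (-1)) (ilim_ce0 Y xp)).
by rewrite mulr0 addr0; apply: (@ilim_eq _ _ _ 0) => t _; rewrite mulN1r.
Qed.

End KleinForms.

(** * Products of Klein forms: characters and orders at cusps *)

Section SiegelProducts.
Variable R : realType.
Local Notation C := (R[i]^o).
Implicit Types (f g F G : C -> C) (z w l t q tau s : C) (u e : nat -> int).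
Local Opaque phi ce.

Lemma cplx_int (n : int) : (n%:~R : C) = (n%:~R : R)%:C%C.
Proof. by rewrite rmorph_int. Qed.

Lemma cplx_nat (n : nat) : (n%:R : C) = (n%:R : R)%:C%C.
Proof. by rewrite rmorph_nat. Qed.

(** [F] behaves like a nonzero constant times [e^(2 pi i k t)] at [i oo]. The order [k] is real,
    since single factors have fractional orders. *)
Definition asy F (k : R) := exists2 l : C, l != 0 & ilim (fun t => F t * ce (- (t * k%:C%C))) l.

Lemma asy_eq F G (k Y : R) : (forall t, Y < complex.Im t -> F t = G t) -> asy F k -> asy G k.
Proof.
move=> FG [l l0 Fl]; exists l => //; apply: ilim_eq Fl => t /FG -> //.
Qed.

Lemma asy1 (l : C) : l != 0 -> asy (fun=> l) 0.
Proof.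
move=> l0; exists l => //; apply: (@ilim_eq _ (fun=> l) _ _ 0); last exact: ilim_cst.
by move=> t _; rewrite mulr0 oppr0 ce0 mulr1.
Qed.

Lemma asyM F G (k m : R) : asy F k -> asy G m -> asy (fun t => F t * G t) (k + m).
Proof.
move=> [l l0 Fl] [l' l'0 Gl]; exists (l * l'); first by rewrite mulf_neq0.
apply: (@ilim_eq _ _ _ _ 0) (ilimM Fl Gl) => t _.
have -> : - (t * (k + m)%:C%C) = - (t * k%:C%C) + - (t * m%:C%C) by rewrite rmorphD mulrDr opprD.
by rewrite ceD mulrACA.
Qed.

Lemma asyXz F (k : R) (n : int) : asy F k -> asy (fun t => F t ^ n) (n%:~R * k).
Proof.
move=> [l l0 Fl]; exists (l ^ n); first by rewrite expfz_neq0.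
apply: (@ilim_eq _ _ _ _ 0) (ilimXz n l0 Fl) => t _.
rewrite expfzMl -ceMz; congr (_ * ce _).
by rewrite mulNrz -mulrzr rmorphM rmorph_int; congr (- _); rewrite -mulrA [k%:C%C * _]mulrC.
Qed.

Lemma asy_prod (I : Type) (r : seq I) (F : I -> C -> C) (k : I -> R) :
  (forall i, asy (F i) (k i)) -> asy (fun t => \prod_(i <- r) F i t) (\sum_(i <- r) k i).
Proof.
move=> Fk; elim: r => [|i r IH].
  rewrite big_nil; under eq_fun do rewrite big_nil; apply: asy1; exact: (@oner_neq0 R[i]).
by rewrite big_cons; under eq_fun do rewrite big_cons; exact: (asyM (Fk i) IH).
Qed.

Lemma asy_comp F (k al : R) (be : C) : 0 < al -> asy F k ->
  asy (fun t => F (al%:C%C * t + be)) (al * k).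
Proof.
move=> a0 [l l0 Fl]; exists (l * ce (be * k%:C%C)); first by rewrite mulf_neq0 ?ce_neq0.
have := ilimM (ilim_comp be a0 Fl) (ilim_cst (ce (be * k%:C%C))).
apply: (@ilim_eq _ _ _ _ 0) => t _; rewrite -mulrA -ceD rmorphM; congr (_ * ce _) => /=.
by ring.
Qed.

(* half of B_2({x}) - 1/6 *)
Definition hB (x : R) : R := let r := x - (Num.floor x)%:~R in (r ^+ 2 - r) / 2.

Lemma K_asy (x y : R) : ~ lattice_pt x%:C%C y%:C%C -> asy (K x%:C%C y%:C%C) (hB x).
Proof.
move=> nl; set n := Num.floor x; pose r := x - n%:~R.
have xE : x = r + n%:~R by rewrite /r subrK.
have r01 : 0 <= r < 1.
  have /andP[h1 h2] := floor_itv x; rewrite -/n in h1 h2.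
  by rewrite /r subr_ge0 h1 /= ltrBlDl; move: h2; rewrite rmorphD.
have nl' : ~ lattice_pt r%:C%C y%:C%C.
  move=> [a [b [ra yb]]]; apply: nl; exists (a + n), b; split=> //.
  by rewrite xE rmorphD /= ra -cplx_int rmorphD.
have [l l0 lP] := K_asymp r01 nl'.
pose k := altsign R (n + 0 + n * 0) * ce ((r%:C%C * 0 - n%:~R * y%:C%C) / 2).
have k0 : k != 0 by rewrite mulf_neq0 ?altsign_neq0 ?ce_neq0.
exists (k * l); first by rewrite mulf_neq0.
apply: (@ilim_eq _ _ _ _ 0) (ilimM (ilim_cst k) lP) => t t0.
rewrite mulrA; congr (_ * ce _); last first.
  by rewrite /hB -/n -/r rmorphM fmorphV rmorph_nat mulrA.
have -> : x%:C%C = r%:C%C + n%:~R by rewrite cplx_int -rmorphD /= /r subrK.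
by have := K_shift r%:C%C y%:C%C n 0 t0; rewrite (mulr0z 1) addr0 => ->.
Qed.

Definition qr (u : int) (M : nat) : R := u%:~R / M%:R.

Definition fS (H M : nat) (u e : nat -> int) (s : C) : C :=
  \prod_(i < H) K (qr (u i) M)%:C%C 0 s ^ e i.

Lemma prod_expz (I : Type) (r : seq I) (k : C) (e : I -> int) : k != 0 ->
  \prod_(i <- r) k ^ e i = k ^ (\sum_(i <- r) e i).
Proof.
move=> k0; elim: r => [|i r IH]; first by rewrite !big_nil.
by rewrite !big_cons IH expfzDr.
Qed.

Lemma qr_nonlattice (u a b c d : int) (M : nat) : (0 < M)%N -> a * d - b * c = 1 ->
  ~~ (M %| u)%Z -> ~ lattice_pt (qr u M * a%:~R)%:C%C (qr u M * b%:~R)%:C%C.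
Proof.
move=> M0 det1 Mu [m [n [E1 E2]]]; move/negP: Mu; apply; apply/dvdzP.
exists (m * d - n * c); apply: (intr_inj (R := R)).
have Mr : M%:R != 0 :> R by rewrite pnatr_eq0 -lt0n.
have e1 : qr u M * a%:~R = m%:~R by move: E1; rewrite cplx_int => /complexI.
have e2 : qr u M * b%:~R = n%:~R by move: E2; rewrite cplx_int => /complexI.
rewrite rmorphM rmorphB !rmorphM /= -e1 -e2 /qr.
have detC : a%:~R * d%:~R - b%:~R * c%:~R = 1 :> R by rewrite -!rmorphM -rmorphB /= det1.
transitivity (u%:~R * (a%:~R * d%:~R - b%:~R * c%:~R) : R); first by rewrite detC mulr1.
by field.
Qed.

Lemma qr_nonlattice0 (u : int) (M : nat) : (0 < M)%N -> ~~ (M %| u)%Z ->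
  ~ lattice_pt (qr u M)%:C%C (0 : R)%:C%C.
Proof.
move=> M0 Mu; have := @qr_nonlattice u 1 0 0 1 M M0 (erefl _) Mu.
by rewrite -[(qr u M * _)]/(qr u M * 1) mulr1 -[X in lattice_pt _ X]/(qr u M * 0)%:C%C mulr0.
Qed.

Lemma fS_neq0 H M u e s : (0 < M)%N -> UHP s -> (forall i, ~~ (M %| u i)%Z) -> fS H M u e s != 0.
Proof.
move=> M0 s0 Mu; apply/prodf_neq0 => i _; apply: expfz_neq0.
exact: (K_neq0 s0 (qr_nonlattice0 M0 (Mu i))).
Qed.

Lemma holo_fS H M u e f z : (0 < M)%N -> (forall i, ~~ (M %| u i)%Z) ->
  holo f z -> UHP (f z) -> holo (fun z => fS H M u e (f z)) z.
Proof.
move=> M0 Mu fh f0; apply: holo_prod => i; apply: holoXz; last exact: holo_K.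
exact: (K_neq0 f0 (qr_nonlattice0 M0 (Mu i))).
Qed.

(** The exponents have sum 0, which cancels the constant of [K_transform]. *)
Lemma fS_tr H M u e (a b c d : int) s : (0 < M)%N -> a * d - b * c = 1 -> UHP s ->
  (forall i, ~~ (M %| u i)%Z) -> \sum_(i < H) e i = 0 ->
  fS H M u e (mtau a b c d s) =
  \prod_(i < H) K (qr (u i) M * a%:~R)%:C%C (qr (u i) M * b%:~R)%:C%C s ^ e i.
Proof.
move=> M0 det1 s0 Mu e0; have [k k0 kP] := K_transform det1 s0.
have kk : \prod_(i < H) k ^ e i = 1 by rewrite prod_expz // e0 expr0z.
rewrite /fS -[RHS]mul1r -[X in X * _]kk -big_split /=.
apply: eq_bigr => i _; rewrite -expfzMl; congr (_ ^ _).
have nl := qr_nonlattice M0 det1 (Mu i).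
have := kP (qr (u i) M)%:C%C 0; rewrite !mul0r !addr0 => -> //.
  by rewrite !rmorphM /= !cplx_int.
by have := sg_neq0 s0 nl; rewrite !rmorphM /= !cplx_int.
Qed.

Lemma mtau_scale (n : nat) (a b c d : int) s : (0 < n)%N ->
  n%:R * mtau a b (n%:Z * c) d s = mtau a (n%:Z * b) c d (n%:R * s).
Proof.
move=> n0; rewrite /mtau /jfac !rmorphM /= mulrA; congr (_ / _); last by ring.
by ring.
Qed.

Lemma altsign_odd (n : int) : altsign R n = if odd `|n| then -1 else 1.
Proof.
rewrite /altsign; case: n => n; rewrite ?NegzE ?abszN -?exprz_inv ?invrN1 -exprnP -signr_odd /=.
  by case: (odd n).
by case: (odd n).
Qed.

Lemma altsign_par (u v x y : int) : odd `|u| = odd `|v| ->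
  altsign R (u * x + u * y + (u * x) * (u * y)) = altsign R (v * x + v * y + (v * x) * (v * y)).
Proof.
move=> uv; rewrite !altsign_odd; congr (if _ then _ else _).
have oD (m n : int) : odd `|m + n| = odd `|m| (+) odd `|n| by lia.
by rewrite !oD !abszM !oddM uv.
Qed.

Lemma ce_prod (I : Type) (r : seq I) (f : I -> C) :
  \prod_(i <- r) ce (f i) = ce (\sum_(i <- r) f i).
Proof.
elim: r => [|i r IH]; first by rewrite !big_nil ce0.
by rewrite !big_cons IH ceD.
Qed.

(** The matrix shifts all characteristics by integers. The signs from [K_shift] agree because the
    [u_i] have the same parity, so they cancel with the sum of the exponents; what remains is a
    character given by the sum of the [e_i u_i^2]. *)
Lemma fS_Gamma1 H M D u e (a b c d : int) s : (0 < M)%N -> (0 < D)%N -> a * d - b * c = 1 ->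
  UHP s -> (forall i, ~~ (M %| u i)%Z) -> \sum_(i < H) e i = 0 ->
  (forall i, odd `|u i| = odd `|u 0%N|) -> ((M * D)%N %| c)%Z -> ((M * D)%N %| a - 1)%Z ->
  fS H M u e ((M * D)%:R * mtau a b c d s) =
  ce ((b * D%:Z * \sum_(i < H) e i * u i ^+ 2)%:~R / (M.*2)%:R) * fS H M u e ((M * D)%:R * s).
Proof.
move=> M0 D0 det1 s0 Mu e0 uo /dvdzP[c' cE] /dvdzP[a' aE].
set N := (M * D)%N; have N0 : (0 < N)%N by rewrite muln_gt0 M0.
rewrite -/N in cE aE.
have Mr : M%:R != 0 :> R by rewrite pnatr_eq0 -lt0n.
have Mc : M%:R != 0 :> C by rewrite pnatr_eq0 -lt0n.
have Ns : UHP (N%:R * s).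
  by rewrite /UHP cplx_nat cImM /= mul0r addr0 mulr_gt0 // ltr0n.
rewrite cE [c' * _]mulrC mtau_scale // fS_tr //; last first.
  by rewrite -det1 cE; ring.
pose eps := altsign R (u 0%N * (D%:Z * a') + u 0%N * (D%:Z * b) + (u 0%N * (D%:Z * a')) * (u 0%N * (D%:Z * b))).
have eps0 : eps != 0 by rewrite altsign_neq0.
have key i : K (qr (u i) M * a%:~R)%:C%C (qr (u i) M * (N%:Z * b)%:~R)%:C%C (N%:R * s) =
   eps * (ce ((u i ^+ 2 * (b * D%:Z))%:~R / (M.*2)%:R) * K (qr (u i) M)%:C%C 0 (N%:R * s)).
  have -> : (qr (u i) M * a%:~R)%:C%C = (qr (u i) M)%:C%C + (u i * (D%:Z * a'))%:~R.
    rewrite cplx_int -rmorphD; congr (_%:C%C).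
    have -> : a = 1 + a' * N%:Z by rewrite -aE addrC subrK.
    by rewrite /qr /N PoszM !rmorphD !rmorphM /=; field.
  have -> : (qr (u i) M * (N%:Z * b)%:~R)%:C%C = 0 + (u i * (D%:Z * b))%:~R.
    rewrite cplx_int add0r; congr (_%:C%C).
    by rewrite /qr /N PoszM !rmorphM /=; field.
  rewrite K_shift // (altsign_par _ _ (uo i)) -/eps -mulrA; congr (_ * (ce _ * _)).
  rewrite mulr0 subr0 /qr rmorphM fmorphV rmorph_nat rmorph_int -mul2n natrM !rmorphM /=.
  by field.
have M3 (x y z : C) (n : int) : (x * (y * z)) ^ n = x ^ n * (y ^ n * z ^ n) by rewrite !expfzMl.
rewrite (eq_bigr (fun i : 'I_H => eps ^ e i * (ce ((e i * u i ^+ 2 * (b * D%:Z))%:~R / (M.*2)%:R) *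
   K (qr (u i) M)%:C%C 0 (N%:R * s) ^ e i))); last first.
  move=> i _; rewrite key M3 -ceMz; congr (_ * (ce _ * _)).
  by rewrite -mulrzr !rmorphM /=; ring.
rewrite big_split /= big_split /= prod_expz // e0 expr0z mul1r ce_prod; congr (ce _ * _).
rewrite -mulr_suml -rmorph_sum /= -mulr_suml; congr (_%:~R / _); ring.
Qed.

(** In matrices: [diag(N, 1)] times the given matrix is a matrix of determinant 1 with first column
    [(n' a, c')] times an upper triangular one with diagonal [(dl, n')]. This brings every cusp to
    [i oo]. *)
Lemma mtau_lower (N dl n' a b c c' d A B D' : int) s : N = dl * n' -> c = dl * c' -> A = n' * a ->
  a * d - b * c = 1 -> A * D' - B * c' = 1 -> n' != 0 -> UHP s ->
  N%:~R * mtau a b c d s =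
  mtau A B c' D' ((dl%:~R / n'%:~R) * s + (D' * N * b - B * d)%:~R / n'%:~R).
Proof.
move=> NE cE AE det1 det2 n0 s0.
have nC : n'%:~R != 0 :> C by rewrite intr_eq0.
have j0 := jfac_neq0 det1 s0.
have e1 : c' * (D' * N * b - B * d) + D' * n' = d.
  transitivity (d * (A * D' - B * c')); last by rewrite det2 mulr1.
  transitivity (c' * (D' * N * b - B * d) + D' * n' * (a * d - b * c)); first by rewrite det1 mulr1.
  by rewrite NE cE AE; ring.
have e2 : A * (D' * N * b - B * d) + B * n' = N * b.
  transitivity (N * b * (A * D' - B * c')); last by rewrite det2 mulr1.
  transitivity (A * (D' * N * b - B * d) + B * n' * (a * d - b * c)); first by rewrite det1 mulr1.
  by rewrite NE cE AE; ring.
rewrite /mtau; set X := (_ / _) * s + _.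
have -> : jfac c' D' X = jfac c d s / n'%:~R.
  transitivity ((c%:~R * s + (c' * (D' * N * b - B * d) + D' * n')%:~R) / n'%:~R : C); last by rewrite e1.
  by rewrite /jfac /X cE !(rmorphM, rmorphD, rmorphB) /=; field.
have -> : A%:~R * X + B%:~R = N%:~R * (a%:~R * s + b%:~R) / n'%:~R.
  transitivity ((A%:~R * dl%:~R * s + (A * (D' * N * b - B * d) + B * n')%:~R) / n'%:~R : C).
    by rewrite /X !(rmorphM, rmorphD, rmorphB) /=; field.
  by rewrite e2 AE NE !rmorphM /=; field.
by move: j0; move: (jfac c d s) => J J0; field; rewrite nC J0.
Qed.

Lemma fS_asy H M u e (N dl n' a b c c' d : int) : (0 < M)%N ->
  (forall i, ~~ (M %| u i)%Z) -> \sum_(i < H) e i = 0 ->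
  N = dl * n' -> c = dl * c' -> 0 < dl -> 0 < n' -> coprimez (n' * a) c' -> a * d - b * c = 1 ->
  asy (fun t => fS H M u e (N%:~R * mtau a b c d t))
    (dl%:~R / n'%:~R * \sum_(i < H) (e i)%:~R * hB (qr (u i * (n' * a)) M)).
Proof.
move=> M0 Mu e0 NE cE dl0 n0 /coprimezP[[D' B0] /= DB] det1.
pose B := - B0; have det2 : (n' * a) * D' - B * c' = 1 by rewrite -DB /B; ring.
have n0' : n' != 0 by rewrite gt_eqF.
have nC : n'%:~R != 0 :> C by rewrite intr_eq0.
pose al : R := dl%:~R / n'%:~R; have al0 : 0 < al by rewrite divr_gt0 // ltr0z.
pose be : C := (D' * N * b - B * d)%:~R / n'%:~R.
apply: (@asy_eq (fun t => \prod_(i < H) K (qr (u i) M * (n' * a)%:~R)%:C%C (qr (u i) M * B%:~R)%:C%C (al%:C%C * t + be) ^ e i) _ _ 0).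
  move=> t t0; rewrite (mtau_lower NE cE erefl det1 det2 n0' t0).
  have -> : dl%:~R / n'%:~R = al%:C%C by rewrite /al rmorphM fmorphV !rmorph_int.
  rewrite -/be fS_tr //; rewrite /UHP cImD cImM /= mul0r addr0 /be.
  have -> : complex.Im ((D' * N * b - B * d)%:~R / n'%:~R : C) = 0.
    have -> : (D' * N * b - B * d)%:~R / n'%:~R = ((D' * N * b - B * d)%:~R / n'%:~R : R)%:C%C.
      by rewrite rmorphM fmorphV !rmorph_int.
    by [].
  by rewrite addr0 mulr_gt0.
apply: (@asy_comp (fun s => \prod_(i < H) K (qr (u i) M * (n' * a)%:~R)%:C%C (qr (u i) M * B%:~R)%:C%C s ^ e i)) => //.
apply: asy_prod => i; apply: asyXz.
have -> : qr (u i * (n' * a)) M = qr (u i) M * (n' * a)%:~R by rewrite /qr rmorphM mulrAC.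
by apply: K_asy; apply: qr_nonlattice det2 (Mu i).
Qed.

Lemma hB_qr (u : int) (M : nat) : (0 < M)%N ->
  hB (qr u M) = ((u %% M)%Z * ((u %% M)%Z - M%:Z))%:~R / ((M.*2)%:R * M%:R).
Proof.
move=> M0; have Mr : M%:R != 0 :> R by rewrite pnatr_eq0 -lt0n.
have Mp : 0 < M%:R :> R by rewrite ltr0n.
rewrite /hB; have -> : Num.floor (qr u M) = (u %/ M)%Z.
  apply/eqP; rewrite floor_eq // /qr rmorphD /= ler_pdivlMr // ltr_pdivrMr //.
  rewrite -[M%:R]/(M%:~R) -[1]/(1%:~R) -rmorphD -!rmorphM ler_int ltr_int /=.
  have Mz : M%:Z != 0 by lia.
  by have := divz_eq u M; have := modz_ge0 u Mz; have := ltz_pmod u (_ : 0 < M%:Z); lia.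
rewrite /qr {1 3}(divz_eq u M) -mul2n natrM !(rmorphM, rmorphD, rmorphB) /= -pmulrn.
by field.
Qed.

Lemma hBN (x : R) : hB (- x) = hB x.
Proof.
have key (y : R) : y \isn't a Num.int -> Num.floor (- y) = - Num.floor y - 1.
  move=> yi; have /andP[h1 h2] := floor_itv y.
  have h1' : (Num.floor y)%:~R < y.
    by rewrite lt_neqAle h1 andbT; apply: contraNneq yi => <-; exact: intr_int.
  apply/eqP; rewrite floor_eq // !(rmorphD, rmorphB, rmorphN) /= in h2 *.
  by rewrite lerNr ltrNl !opprD !opprK addrK; move: (_%:~R : R) h1' h2 => v; lra.
have [/intrP[n ->]|xi] := boolP (x \is a Num.int).
  by rewrite /hB -rmorphN /= !intrKfloor !subrr.
by rewrite /hB key // !(rmorphD, rmorphB, rmorphN) /=; field.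
Qed.

Lemma hB_int (x : R) (n : int) : hB (x + n%:~R) = hB x.
Proof.
have E : Num.floor (x + n%:~R) = Num.floor x + n by rewrite floorDrz ?intr_int // intrKfloor.
by rewrite /hB E rmorphD /=; field.
Qed.

End SiegelProducts.

(** * Modular functions without zeros and poles are constant *)

Section ModularLiouville.
Variable R : realType.
Local Notation C := (R[i]^o).
Implicit Types (f g F G h : C -> C) (z w t q tau s : C).
Local Opaque phi ce.

Lemma mtau_comp (a b c d a' b' c' d' : int) tau : a' * d' - b' * c' = 1 -> UHP tau ->
  mtau a b c d (mtau a' b' c' d' tau) =
  mtau (a * a' + b * c') (a * b' + b * d') (c * a' + d * c') (c * b' + d * d') tau.
Proof.
move=> det1 t0; have j0 := jfac_neq0 det1 t0; have mK := mtauK det1 t0.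
rewrite {1}/mtau /jfac; set m := mtau a' b' c' d' tau in mK *; set j := jfac c' d' tau in j0 mK.
have E (x y : int) : (x%:~R * m + y%:~R) = ((x * a' + y * c')%:~R * tau + (x * b' + y * d')%:~R) / j.
  apply: (mulIf j0); rewrite divfK // mulrDl -mulrA mK /j /jfac !rmorphD !rmorphM /=; ring.
by rewrite !E /mtau /jfac -mulf_div divff ?mulr1 ?invr_eq0 // ; rewrite invr_eq0.
Qed.

Lemma mtau1 tau : mtau 1 0 0 1 tau = tau.
Proof. by rewrite /mtau /jfac mul1r mul0r add0r addr0 divr1. Qed.

Lemma mtau_inv (a b c d : int) tau : a * d - b * c = 1 -> UHP tau ->
  mtau d (- b) (- c) a (mtau a b c d tau) = tau.
Proof.
move=> det1 t0; rewrite mtau_comp // -[RHS]mtau1; congr mtau; rewrite -?det1; ring.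
Qed.

Lemma det2_comp (a b c d a' b' c' d' : int) : a * d - b * c = 1 -> a' * d' - b' * c' = 1 ->
  (a * a' + b * c') * (c * b' + d * d') - (a * b' + b * d') * (c * a' + d * c') = 1.
Proof.
move=> D1 D2; transitivity ((a * d - b * c) * (a' * d' - b' * c')); first by ring.
by rewrite D1 D2.
Qed.

Lemma det2_inv (a b c d : int) : a * d - b * c = 1 -> d * a - (- b) * (- c) = 1.
Proof. by move=> <-; ring. Qed.

Lemma holo_mtau (a b c d : int) tau : a * d - b * c = 1 -> UHP tau -> holo (mtau a b c d) tau.
Proof.
move=> det1 t0; apply: (@holo_div _ (fun t => a%:~R * t + b%:~R) (jfac c d)).
- exact: jfac_neq0 det1 t0.
- exact: (holoD (holoZ _ (holo_id _)) (holo_cst _ _)).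
- exact: (holoD (holoZ _ (holo_id _)) (holo_cst _ _)).
Qed.

Lemma cregular_comp h g tau (inj : forall w, UHP w -> g w = g tau -> w = tau) : UHP tau ->
  (forall w, UHP w -> holo g w) -> cregular h (g tau) -> cregular (fun t => h (g t)) tau.
Proof.
move=> t0 gh [hc [d d0 dP]]; have gc := holo_ccont (gh _ t0).
split; first exact: (ccont_comp gc hc).
have [d1 d10 d1P] := gc _ d0; have [d2 d20 d2P] := UHP_open t0.
exists (Num.min d1 d2); first by rewrite lt_min d10.
move=> w wt; rewrite lt_min => /andP[/d1P w1 /d2P w2].
apply: (@holo_comp _ h g); first exact: gh.
by apply: dP w1; apply/eqP => /(inj _ w2)/eqP; rewrite (negPf wt).
Qed.

Lemma cregular_mtau h (a b c d : int) tau : a * d - b * c = 1 -> UHP tau ->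
  cregular h (mtau a b c d tau) -> cregular (fun t => h (mtau a b c d t)) tau.
Proof.
move=> det1 t0; apply: cregular_comp => // [w w0 E|w]; last exact: holo_mtau.
by rewrite -(mtau_inv det1 w0) E mtau_inv.
Qed.

(* each inversion of a point with |Re| <= 1/2 and Im < 1/2 doubles Im *)
Lemma reduction tau : UHP tau -> exists a b c d : int, a * d - b * c = 1 /\
  (1 / 2 <= complex.Im (mtau a b c d tau) /\
   (- (1 / 2) <= complex.Re (mtau a b c d tau) <= 1 / 2)).
Proof.
move=> t0; have [n nP] : exists n : nat, 1 / 2 <= 2 ^+ n * complex.Im tau.
  have [n nP] : exists n : nat, (complex.Im tau)^-1 < n%:R.
    by exists (Num.truncn (complex.Im tau)^-1).+1; rewrite truncnS_gt.
  exists n; have n2 : n%:R <= 2 ^+ n :> R by rewrite -natrX ler_nat ltnW // ltn_expl.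
  have : 1 <= n%:R * complex.Im tau by rewrite -ler_pdivrMr // div1r ltW.
  have := ler_wpM2r (ltW t0) n2; lra.
elim: n tau t0 nP => [|n IH] tau t0 nP; last first.
  pose k := Num.floor (complex.Re tau + 1 / 2).
  have /andP[k1 k2] := floor_itv (complex.Re tau + 1 / 2); rewrite -/k rmorphD /= in k1 k2.
  have ImT : complex.Im (mtau 1 (- k) 0 1 tau) = complex.Im tau.
    by rewrite /mtau /jfac mul0r add0r divr1 mul1r cImD cplx_int /= addr0.
  have ReT : complex.Re (mtau 1 (- k) 0 1 tau) = complex.Re tau - k%:~R.
    by rewrite /mtau /jfac mul0r add0r divr1 mul1r cReD cplx_int rmorphN.
  have dT : 1 * 1 - (- k) * 0 = 1 :> int by ring.
  have [t2|t2] := leP (1 / 2) (complex.Im tau).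
    by exists 1, (- k), 0, 1; split=> //; rewrite ImT ReT; split=> //; lra.
  set s := mtau 1 (- k) 0 1 tau in ImT ReT.
  have s0 : UHP s by rewrite /UHP ImT.
  have dI : 0 * 0 - (-1) * 1 = 1 :> int by [].
  have s'0 := UHP_mtau dI s0.
  have sP : 1 / 2 <= 2 ^+ n * complex.Im (mtau 0 (-1) 1 0 s).
    have jE : jfac 1 0 s = s by rewrite /jfac mulr1z mul1r addr0.
    rewrite (Im_mtau dI s0) jE nm_sqr ImT mulrA ler_pdivlMr; last first.
      have k3 := sqr_ge0 (complex.Re s); have k4 : 0 < complex.Im tau ^+ 2 by apply: exprn_gt0.
      by apply: (lt_le_trans k4); rewrite lerDr.
    have n1 : 0 < 2 ^+ n :> R by rewrite exprn_gt0.
    have : complex.Re s ^+ 2 <= 1 / 4.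
      by rewrite ReT; have : 0 <= (1 / 2 - (complex.Re tau - k%:~R)) * (1 / 2 + (complex.Re tau - k%:~R)); [apply: mulr_ge0; lra|lra].
    have : complex.Im tau ^+ 2 <= 1 / 4 by have := t0; rewrite /UHP => ?; nra.
    move: nP; rewrite exprS -mulrA; move: (complex.Re s ^+ 2) (complex.Im tau ^+ 2) (2 ^+ n * _) => x y z; lra.
  have [a [b [c [d [det1 H]]]]] := IH _ s'0 sP.
  have dIT := det2_comp dI dT.
  exists (a * (0 * 1 + (-1) * 0) + b * (1 * 1 + 0 * 0)), (a * (0 * (- k) + (-1) * 1) + b * (1 * (- k) + 0 * 1)),
    (c * (0 * 1 + (-1) * 0) + d * (1 * 1 + 0 * 0)), (c * (0 * (- k) + (-1) * 1) + d * (1 * (- k) + 0 * 1)).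
  split; first exact: det2_comp.
  by rewrite -(mtau_comp _ _ _ _ dIT t0) -(mtau_comp _ _ _ _ dT t0).
pose k := Num.floor (complex.Re tau + 1 / 2).
have /andP[k1 k2] := floor_itv (complex.Re tau + 1 / 2); rewrite -/k rmorphD /= in k1 k2.
exists 1, (- k), 0, 1; split=> //; first by ring.
have -> : complex.Im (mtau 1 (- k) 0 1 tau) = complex.Im tau.
  by rewrite /mtau /jfac mul0r add0r divr1 mul1r cImD cplx_int /= addr0.
have -> : complex.Re (mtau 1 (- k) 0 1 tau) = complex.Re tau - k%:~R.
  by rewrite /mtau /jfac mul0r add0r divr1 mul1r cReD cplx_int rmorphN.
by rewrite expr0 mul1r in nP; split=> //; lra.
Qed.

Definition inv1 (N : nat) h := forall (a b c d : int) tau, a * d - b * c = 1 ->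
  (N %| c)%Z -> (N %| a - 1)%Z -> UHP tau -> h (mtau a b c d tau) = h tau.

(** The quotient of the two matrices is the identity modulo [N]. *)
Lemma inv1_congr N h (a b c d a' b' c' d' : int) tau : inv1 N h ->
  a * d - b * c = 1 -> a' * d' - b' * c' = 1 ->
  (N %| a - a')%Z -> (N %| b - b')%Z -> (N %| c - c')%Z -> (N %| d - d')%Z -> UHP tau ->
  h (mtau a b c d tau) = h (mtau a' b' c' d' tau).
Proof.
move=> hN D1 D2 ha hb hc hd t0; have s0 := UHP_mtau D2 t0.
rewrite -(hN (a * d' + b * (- c')) (a * (- b') + b * a') (c * d' + d * (- c')) (c * (- b') + d * a') _ _ _ _ s0).
- rewrite mtau_comp //; congr (h (mtau _ _ _ _ _)).
  + by rewrite -[LHS]mulr1 -D2; ring.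
  + by rewrite -[LHS]mulr1 -D2; ring.
  + by rewrite -[LHS]mulr1 -D2; ring.
  + by rewrite -[LHS]mulr1 -D2; ring.
- exact: (det2_comp D1 (det2_inv D2)).
- have -> : c * d' + d * - c' = (c - c') * d' - (d - d') * c' by ring.
  by apply: rpredB; apply: dvdz_mulr.
- have -> : a * d' + b * - c' - 1 = (a - a') * d' - (b - b') * c' by rewrite -[X in _ - X]D2; ring.
  by apply: rpredB; apply: dvdz_mulr.
Qed.

(** A representative is chosen for each matrix of residues modulo [N] that lifts to determinant 1,
    without deciding which ones do. *)
Lemma finite_cosets N h : (0 < N)%N -> inv1 N h ->
  exists S : seq (int * int * int * int),
  (forall v, v \in S -> v.1.1.1 * v.2 - v.1.1.2 * v.1.2 = 1) /\
  forall a b c d : int, a * d - b * c = 1 -> exists2 v, v \in S &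
    forall tau, UHP tau -> h (mtau a b c d tau) = h (mtau v.1.1.1 v.1.1.2 v.1.2 v.2 tau).
Proof.
move=> N0 hN; pose I := 'I_N.
pose Q (r : I * I * I * I) (v : int * int * int * int) :=
  [/\ v.1.1.1 * v.2 - v.1.1.2 * v.1.2 = 1, (v.1.1.1 %% N)%Z = r.1.1.1, (v.1.1.2 %% N)%Z = r.1.1.2,
      (v.1.2 %% N)%Z = r.1.2 & (v.2 %% N)%Z = r.2].
pose F r : option (int * int * int * int) :=
  if pselect (exists v, `[< Q r v >]) is left H then Some (xchoose H) else None.
have FP r v : F r = Some v -> Q r v.
  rewrite /F; case: pselect => // H [<-]; exact/asboolP/(xchooseP H).
exists (pmap F (enum {: I * I * I * I})); split=> [v|a b c d det1].
  by rewrite mem_pmap => /mapP[r _ /esym/FP[]].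
have Nz : N%:Z != 0 by lia.
have mE (x : int) : (`|(x %% N)%Z| < N)%N.
  by have := modz_ge0 x Nz; have := ltz_pmod x (_ : 0 < N%:Z); lia.
pose r : I * I * I * I := (Ordinal (mE a), Ordinal (mE b), Ordinal (mE c), Ordinal (mE d)).
have aE (x : int) : (x %% N)%Z = `|(x %% N)%Z|%N by rewrite gez0_abs // modz_ge0.
have : exists v, `[< Q r v >].
  by exists (a, b, c, d); apply/asboolP; split=> //=; exact: aE.
move=> H; have [v Fv] : exists v, F r = Some v.
  by rewrite /F; case: pselect => // H'; exists (xchoose H').
exists v; first by rewrite mem_pmap -Fv map_f ?mem_enum.
have [vdet v1 v2 v3 v4] := FP _ _ Fv.
have cg (x y : int) (w : nat) : (y %% N)%Z = w -> w = `|(x %% N)%Z|%N -> (N %| x - y)%Z.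
  by move=> yw wx; rewrite -eqz_mod_dvd yw wx -aE.
by move=> tau t0; apply: (inv1_congr hN) => //; apply: cg; eauto.
Qed.

Definition region tau := 1 / 2 <= complex.Im tau /\ - (1 / 2) <= complex.Re tau <= 1 / 2.

(** Either the limit at [i oo] dominates, or some value exceeds it; in the second case the values
    above a certain height are smaller, and the part of the region below it is compact. *)
Lemma region_sup F (l : C) : (forall t, UHP t -> cregular F t) -> ilim F l ->
  exists m : R, (forall t, region t -> nm (F t) <= m) /\
    ((exists2 t0, UHP t0 & nm (F t0) = m) \/ nm l = m).
Proof.
move=> Fr Fl; have [H|] := pselect (forall t, region t -> nm (F t) <= nm l).
  by exists (nm l); split=> //; right.
move=> /existsNP[t1 /not_implyP[t1r /negP]]; rewrite -ltNge => t1l.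
have [Y YP] := Fl (nm (F t1) - nm l) (ltac:(lra)).
pose Y' := Num.max Y (complex.Im t1).
have Y'1 : Y <= Y' by rewrite le_max lexx.
have Y'2 : complex.Im t1 <= Y' by rewrite le_max lexx orbT.
have [i1 r1] := t1r; have /andP[r11 r12] := r1.
have h1 : - (1 / 2) <= 1 / 2 :> R by lra.
have h2 : 1 / 2 <= Y' by lra.
have [|t0 t0r t0P] := @rect_max R (fun z => nm (F z)) (- (1 / 2)) (1 / 2) (1 / 2) Y' h1 h2.
  move=> z /andP[_ /andP[z2 _]] e e0; have z0 : UHP z by rewrite /UHP; lra.
  exact: (ccont_nm (Fr z z0).1).
exists (nm (F t0)); split; last by left; exists t0 => //; case/andP: t0r => _ /andP[? _]; rewrite /UHP; lra.
move=> t [t2 t3]; have [tY|tY] := leP (complex.Im t) Y'.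
  by apply: t0P; apply/andP; split=> //; apply/andP.
apply: (@le_trans _ _ (nm (F t1))); last by apply: t0P; apply/andP; split=> //; apply/andP.
have := YP t (le_lt_trans Y'1 tY); have := nm_dist_triangle (F t) 0 l.
rewrite !subr0; lra.
Qed.

Lemma cregular_eq f g z (d : R) : 0 < d -> (forall w, nm (w - z) < d -> f w = g w) ->
  cregular f z -> cregular g z.
Proof.
move=> d0 fg [fc [d1 d10 d1P]]; split.
  by apply: ccont_near fc; apply/nbhs_cplxP; exists d.
exists (Num.min d d1); first by rewrite lt_min d0.
move=> w wz; rewrite lt_min => /andP[w1 w2]; apply: holo_near (d1P w wz w2).
apply/nbhs_cplxP; exists (d - nm (w - z)); first by rewrite subr_gt0.
move=> v vw; apply: fg; have := nm_dist_triangle v z w; lra.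
Qed.

(** The supremum of the modulus is attained in the half-plane or as a limit at a cusp. The first
    case is the maximum principle; in the second the cusp is moved to [i oo] and [max_cusp]
    applies. *)
Lemma modular_liouville N h : (0 < N)%N -> inv1 N h -> (forall t, UHP t -> cregular h t) ->
  (forall a b c d : int, a * d - b * c = 1 -> asy (fun t => h (mtau a b c d t)) 0) ->
  forall t t', UHP t -> UHP t' -> h t = h t'.
Proof.
move=> N0 hN hr ha.
have lim (a b c d : int) : a * d - b * c = 1 -> exists l : C, ilim (fun t => h (mtau a b c d t)) l.
  move=> det1; have [l _ lP] := ha _ _ _ _ det1; exists l.
  by apply: (@ilim_eq _ _ _ _ 0) lP => t _; rewrite mulr0 oppr0 ce0 mulr1.
pose Q (m : R) := (exists2 t0, UHP t0 & nm (h t0) = m) \/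
  (exists a b c d : int, a * d - b * c = 1 /\ exists2 l, ilim (fun t => h (mtau a b c d t)) l & nm l = m).
have [S [SP Scov]] := finite_cosets N0 hN.
have [m [Qm mP]] : exists m, Q m /\ forall v, v \in S -> forall t, region t ->
    nm (h (mtau v.1.1.1 v.1.1.2 v.1.2 v.2 t)) <= m.
  elim: S SP {Scov} => [|v S IH] SP.
    pose i0 : C := (0 +i* 1)%C.
    by exists (nm (h i0)); split=> //; left; exists i0 => //; rewrite /UHP /= ltr01.
  have [|m [Qm mP]] := IH; first by move=> w wS; apply: SP; rewrite inE wS orbT.
  have dv : v.1.1.1 * v.2 - v.1.1.2 * v.1.2 = 1 by apply: SP; rewrite inE eqxx.
  have [l lP] := lim _ _ _ _ dv.
  have [|m' [m'P m'Q]] := @region_sup _ l _ lP.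
    by move=> t t0; apply: cregular_mtau => //; apply: hr; exact: UHP_mtau.
  have Qm' : Q m'.
    case: m'Q => [[t0 t00 t0P]|lm]; [left|right].
      by exists (mtau v.1.1.1 v.1.1.2 v.1.2 v.2 t0) => //; exact: UHP_mtau.
    by exists v.1.1.1, v.1.1.2, v.1.2, v.2; split=> //; exists l.
  exists (Num.max m m'); split; first by case: leP.
  move=> w; rewrite inE => /orP[/eqP ->|wS] t tr.
    by rewrite le_max m'P ?orbT.
  by rewrite le_max mP.
have hm t : UHP t -> nm (h t) <= m.
  move=> t0; have [a [b [c [d [det1 H]]]]] := reduction t0.
  have s0 := UHP_mtau det1 t0; have [v vS vP] := Scov _ _ _ _ (det2_inv det1).
  rewrite -(mtau_inv det1 t0) vP //; exact: mP.
suff [k kP] : exists k, forall t, UHP t -> h t = k.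
  by move=> t t' t0 t'0; rewrite !kP.
case: Qm => [[t0 t00 t0m]|[a [b [c [d [det1 [l lP lm]]]]]]].
  exists (h t0); apply: (@max_global R (@UHP R) h t0) => //.
  - by move=> z w t; exact: UHP_conv.
  - by move=> z; exact: UHP_open.
  - by move=> w /hm; rewrite t0m.
exists l => t t0; have Nr : 0 < N%:R :> R by rewrite ltr0n.
have NC : N%:R != 0 :> C by rewrite pnatr_eq0 -lt0n.
have UN z : UHP z -> UHP (N%:R * z) by rewrite /UHP cplx_nat cImM /= mul0r addr0 => ?; exact: mulr_gt0.
(* Rescaling by [N] gives period 1. The value 0 off the half-plane is there because [max_cusp] asks
   for periodicity at all [z]. *)
pose G z := if 0 < complex.Im z then h (mtau a b c d (N%:R * z)) else 0.
have s0 : UHP (mtau d (- b) (- c) a t) := UHP_mtau (det2_inv det1) t0.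
have dK : mtau a b c d (mtau d (- b) (- c) a t) = t by have := mtau_inv (det2_inv det1) t0; rewrite !opprK.
rewrite -[in LHS]dK; set s := mtau d _ _ _ t in s0 *.
have Ns : UHP (s / N%:R).
  have : N%:R^-1 = (N%:R^-1)%:C%C :> C by rewrite fmorphV rmorph_nat.
  by rewrite /UHP => ->; rewrite cImM /= mulr0 add0r mulr_gt0 // invr_gt0.
have := @max_cusp R G l 0; rewrite /G => /(_ _ _ _ _ (s / N%:R) Ns).
rewrite -/(UHP _) Ns [N%:R * _]mulrC divfK //; apply.
- move=> z z0; have [e e0 eP] := UHP_open (z0 : UHP z).
  apply: (@cregular_eq (fun z => h (mtau a b c d (N%:R * z))) _ z e e0).
    by move=> w /eP; rewrite /UHP => ->.
  apply: (@cregular_comp h (fun z => mtau a b c d (N%:R * z))) => //.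
  + move=> w w0 E; apply: (mulfI NC).
    by rewrite -(mtau_inv det1 (UN _ w0)) E mtau_inv //; exact: UN.
  + move=> w w0; apply: (@holo_comp _ (mtau a b c d) (fun z => N%:R * z)).
      exact: (holoZ _ (holo_id _)).
    by apply: holo_mtau => //; exact: UN.
  + by apply: hr; apply: UHP_mtau => //; exact: UN.
- move=> z; have -> : complex.Im (z + 1) = complex.Im z by rewrite cImD /= addr0.
  case: ifP => // z0; have {}z0 := UN _ z0.
  have dT : 1 * 1 - (N%:Z) * 0 = 1 :> int by ring.
  have -> : N%:R * (z + 1) = mtau 1 N 0 1 (N%:R * z).
    by rewrite /mtau /jfac mul0r add0r divr1 mul1r mulrDr mulr1 pmulrn.
  rewrite mtau_comp //; apply: (inv1_congr hN) => //; first exact: det2_comp.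
  + by have -> : a * 1 + b * 0 - a = 0 by ring.
  + have -> : a * N + b * 1 - b = a * N%:Z by ring.
    exact: dvdz_mull.
  + by have -> : c * 1 + d * 0 - c = 0 by ring.
  + have -> : c * N + d * 1 - d = c * N%:Z by ring.
    exact: dvdz_mull.
- move=> e e0; have [Y YP] := lP e e0; exists (Num.max 0 (Y / N%:R)) => z.
  rewrite gt_max => /andP[z0 zY]; rewrite z0; apply: YP.
  by rewrite cplx_nat cImM /= mul0r addr0 mulrC -ltr_pdivrMr.
- move=> z z0; rewrite z0 lm; apply: hm; apply: UHP_mtau => //; exact: UN.
Qed.

End ModularLiouville.

(** * Siegel products of prime power level *)

Section SiegelUnits.
Variable R : realType.
Local Notation C := (R[i]^o).
Implicit Types (f g F G h : C -> C) (z w tau : C).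
Local Opaque phi ce K.

(** Under [t -> t + 1] the leading term is multiplied by [e^(2 pi i k)], and the nonzero limit
    determines the multiplier. *)
Lemma asy_shift F (k Y : R) (chi : C) : asy F k ->
  (forall t, Y < complex.Im t -> F (t + 1) = chi * F t) -> chi = ce k%:C%C.
Proof.
move=> [l l0 Fl] FS.
have l1 : ilim (fun t => F (1%:C%C * t + 1) * ce (- ((1%:C%C * t + 1) * k%:C%C))) l.
  exact: (ilim_comp (F := fun t => F t * ce (- (t * k%:C%C))) 1 ltr01 Fl).
have l2 := ilimM (ilim_cst (chi * ce (- k%:C%C))) Fl.
have E : l = chi * ce (- k%:C%C) * l.
  apply: ilim_unique l1 _; apply: (@ilim_eq _ _ _ _ Y) l2 => t tY.
  rewrite mul1r FS // mulrDl mul1r opprD ceD.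
  by move: (ce _) (ce _) (F t) => x y v; ring.
have : chi * ce (- k%:C%C) = 1 by apply: (mulIf l0); rewrite mul1r -E.
by rewrite ceN => /(congr1 (fun x => x * ce k%:C%C)); rewrite mul1r divfK // ce_neq0.
Qed.

Lemma cls0_real (rho h : nat) (e : nat -> int) (g : nat -> R) : cls0 rho h e ->
  (forall k, g (k + h)%N = g k) -> \sum_(j < rho * h) (e j)%:~R * g j = 0.
Proof.
move=> eA gd; rewrite (sum_ord_mul (fun j => (e j)%:~R * g j)) exchange_big /=.
apply: big1 => l _.
have gq q : g (l + q * h)%N = g l by elim: q => [|q IH]; rewrite ?addn0 // mulSnr addnA gd.
under eq_bigr do rewrite gq.
by rewrite -mulr_suml -rmorph_sum /= eA // mul0r.
Qed.

Lemma hB_eq (u v : int) (M : nat) : (0 < M)%N ->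
  (M %| u - v)%Z || (M %| u + v)%Z -> hB (qr R u M) = hB (qr R v M).
Proof.
move=> M0; have Mr : M%:R != 0 :> R by rewrite pnatr_eq0 -lt0n.
case/orP => /dvdzP[k kE].
  have -> : qr R u M = qr R v M + k%:~R; last exact: hB_int.
  have -> : u = v + k * M by rewrite -kE addrC subrK.
  by rewrite /qr rmorphD rmorphM /= -pmulrn; field.
rewrite -[RHS]hBN; have -> : qr R u M = - qr R v M + k%:~R; last exact: hB_int.
have -> : u = - v + k * M by rewrite -kE addrC addrK.
by rewrite /qr rmorphD rmorphN rmorphM /= -pmulrn; field.
Qed.

Section Level.
Variables (p : nat) (c : int).
Hypothesis D : leveldata p c.
Local Notation M := (lev p).
Local Notation H := (hlev p).
Let pp := ld_prime D.
Let M0 t : (0 < M t)%N := lev_gt0 pp t.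
(** Starting at exponent 1 matches the index [(i + j).+1] in [W]. *)
Definition uc (i : nat) : int := c ^+ i.+1.

Lemma uc_ndvd t i : ~~ (M t.+1 %| uc i)%Z.
Proof.
have cop : coprimez (M t.+1) (uc i) by apply: coprimezXr; exact: (ld_coprime D).
have m2 := lev_gt2 pp (isT : (0 < t.+1)%N).
apply/negP => d; have : (M t.+1 %| 1)%Z by rewrite -(Gauss_dvdzr _ cop) mulr1.
by rewrite dvdzE /= dvdn1; lia.
Qed.

Lemma uc_odd i : odd `|uc i| = odd `|uc 0%N|.
Proof. by rewrite /uc !abszX !oddX. Qed.

Definition fl (s : nat) (e : nat -> int) : C -> C := fS (H s) (M s) uc e.

Lemma Acl_sum0 t e : Acl p t e -> \sum_(j < H t.+1) e j = 0.
Proof.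
move=> eA; have := cls0_dvd (g := fun=> 1) (d := 0) eA; rewrite -(rhoE D) => /(_ _) h.
have : (0 %| \sum_(j < H t.+1) e j * 1)%Z by apply: h => k; rewrite subrr dvdz0.
by rewrite dvd0z => /eqP; under eq_bigr do rewrite mulr1.
Qed.

Definition Sq s (e : nat -> int) : int := \sum_(i < H s) e i * uc i ^+ 2.

Lemma lev_add t k : M (k + t)%N = (p ^ k * M t)%N.
Proof. by elim: k => [|k IH]; rewrite ?mul1n // addSn levS IH expnS mulnA. Qed.

Lemma lev_sub t s : (s <= t)%N -> M t = (M s * p ^ (t - s))%N.
Proof. by move=> st; rewrite -{1}(subnK st) lev_add mulnC. Qed.

Lemma fl_Gamma1 t s e (a b c' d : int) tau : (s < t)%N -> Acl p s e -> a * d - b * c' = 1 -> UHP tau ->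
  (M t %| c')%Z -> (M t %| a - 1)%Z ->
  fl s.+1 e ((M t)%:R * mtau a b c' d tau) =
  ce ((b * (p ^ (t - s.+1))%N%:Z * Sq s.+1 e)%:~R / ((M s.+1).*2)%:R) * fl s.+1 e ((M t)%:R * tau).
Proof.
move=> st eA det1 t0 h1 h2; rewrite (lev_sub st) in h1 h2 *.
apply: fS_Gamma1 => //; first by rewrite expn_gt0 prime_gt0.
- exact: uc_ndvd.
- exact: Acl_sum0.
- exact: uc_odd.
Qed.

Lemma fl_asy_inf t s e (a b c' d : int) i : (s < t)%N -> Acl p s e -> a * d - b * c' = 1 ->
  (M t %| c')%Z -> (M t %| a - c ^+ i)%Z || (M t %| a + c ^+ i)%Z ->
  asy (fun tau => fl s.+1 e ((M t)%:R * mtau a b c' d tau))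
    ((p%:Z ^+ (2 * (t - s.+1)) * W p c s.+1 e i)%:~R / ((M t).*2)%:R).
Proof.
move=> st eA det1 /dvdzP[c'' cE] ai.
have Mt := M0 t; have Ms := M0 s.+1.
have MtR : (M t)%:R != 0 :> R by rewrite pnatr_eq0 -lt0n.
have MsR : (M s.+1)%:R != 0 :> R by rewrite pnatr_eq0 -lt0n.
have cop : coprimez (1 * a) c''.
  rewrite mul1r; apply/coprimezP; exists (d, - b * (M t)%:Z) => /=.
  by rewrite -det1 cE; ring.
have := @fS_asy R (H s.+1) (M s.+1) uc e (M t)%:Z (M t)%:Z 1 a b c' c'' d Ms (@uc_ndvd s) (Acl_sum0 eA)
  (esym (mulr1 _)) (etrans cE (mulrC _ _)) (ltac:(lia)) isT cop det1.
congr asy; rewrite divr1 mul1r /W rmorphM rmorph_sum /= mulr_sumr [RHS]mulrAC mulr_sumr.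
apply: eq_bigr => j _; rewrite mulrCA [RHS]mulrC rmorphM /= -[RHS]mulrA; congr (_ * _).
have -> : hB (qr R (uc j * a) (M s.+1)) = hB (qr R (c ^+ (i + j).+1) (M s.+1)).
  apply: hB_eq => //; rewrite /uc -addnS exprD [c ^+ i * _]mulrC -mulrBr -mulrDr.
  have d1 x : (M t %| x)%Z -> (M s.+1 %| c ^+ j.+1 * x)%Z.
    by move=> h; apply: dvdz_mull; apply: dvdz_trans h; rewrite (lev_sub st) PoszM dvdz_mulr.
  by case/orP: ai => /d1 ->; rewrite ?orbT.
rewrite hB_qr // -/(crep (M s.+1) c (i + j).+1) -/(beta (M s.+1) c (i + j).+1).
rewrite -pmulrn !rmorphXn /= (lev_sub st) -!mul2n !natrM natrX.
have pR : p%:R != 0 :> R by rewrite pnatr_eq0 -lt0n prime_gt0.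
have -> : p%:Z%:~R = p%:R :> R by [].
by rewrite mulnC exprM; field; rewrite MsR expf_neq0.
Qed.

(** At these cusps [p] divides [n'], so up to sign and modulo 1 the characteristics
    [u_j n' a / M_(s+1)] depend only on [j] modulo [H_s], and the vanishing class sums of [e] kill
    the order. *)
Lemma fl_asy_other t s e (a b c' d : int) : (s < t)%N -> Acl p s e -> a * d - b * c' = 1 ->
  ~~ (M t %| c')%Z -> asy (fun tau => fl s.+1 e ((M t)%:R * mtau a b c' d tau)) 0.
Proof.
move=> st eA det1 nc; have Mt := M0 t; have Ms := M0 s.+1.
pose dl := gcdz (M t) c'; have dl0 : 0 < dl by rewrite /dl /gcdz ltz_nat gcdn_gt0 Mt.
have /dvdzP[n' nE] := dvdz_gcdl (M t) c'.
have /dvdzP[c'' cE] := dvdz_gcdr (M t) c'; rewrite -/dl in nE cE.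
have n0 : 0 < n'.
  have : 0 < n' * dl by rewrite -nE; lia.
  by rewrite pmulr_lgt0.
have cop : coprimez (n' * a) c''.
  rewrite coprimezMl; apply/andP; split; apply/coprimezP.
    have [u [v uv]] := Bezoutz (M t) c'; exists (u, v) => /=.
    apply: (mulIf (_ : dl != 0)); first by rewrite gt_eqF.
    by rewrite mul1r -[RHS]uv nE [in RHS]cE; ring.
  by exists (d, - b * dl) => /=; rewrite -det1 cE; ring.
have pn : (p %| n')%Z.
  apply: contraNT nc => pn; have [k kE] : exists k, M t = (p ^ k)%N.
    by rewrite /lev; case: eqP => [->|_]; [exists t.+2|exists t].
  have copn : coprimez n' (M t).
    by rewrite kE coprimezE /= coprimeXr // coprime_sym prime_coprime // -[p]/(`|p%:Z|%N) -dvdzE.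
  have : (n' %| 1)%Z by rewrite -(Gauss_dvdzr _ copn) mulr1 nE dvdz_mulr.
  rewrite dvdzE dvdn1 => /eqP n1; have {}n1 : n' = 1 by rewrite /= in n1; lia.
  by rewrite nE n1 mul1r dvdz_gcdr.
have := @fS_asy R (H s.+1) (M s.+1) uc e (M t)%:Z dl n' a b c' c'' d Ms (@uc_ndvd s) (Acl_sum0 eA)
  (etrans nE (mulrC _ _)) (etrans cE (mulrC _ _)) dl0 n0 cop det1.
congr asy; rewrite (rhoE D) (cls0_real (g := fun j => hB (qr R (uc j * (n' * a)) (M s.+1))) eA) ?mulr0 // => j.
apply: hB_eq => //; have h := ld_H D s.
have [n'' nE'] := dvdzP pn.
have -> : uc (j + H s) = uc j * c ^+ H s by rewrite /uc -addSn exprD.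
have d1 x : (M s %| x)%Z -> (M s.+1 %| uc j * (n' * a) * x)%Z.
  case/dvdzP => y ->; apply/dvdzP; exists (uc j * n'' * a * y).
  by rewrite nE' levS PoszM; ring.
have -> : uc j * c ^+ H s * (n' * a) - uc j * (n' * a) = uc j * (n' * a) * (c ^+ H s - 1) by ring.
have -> : uc j * c ^+ H s * (n' * a) + uc j * (n' * a) = uc j * (n' * a) * (c ^+ H s + 1) by ring.
by case/orP: h => /d1 ->; rewrite ?orbT.
Qed.

Definition Wprod t (E : nat -> nat -> int) (tau : C) : C :=
  \prod_(s < t) fl s.+1 (E s.+1) ((M t)%:R * tau).

Variable E : nat -> nat -> int.
Hypothesis EA : forall s, Acl p s (E s.+1).

Lemma UHP_M t tau : UHP tau -> UHP ((M t)%:R * tau).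
Proof. by move=> t0; rewrite /UHP cplx_nat cImM /= mul0r addr0 mulr_gt0 // ltr0n. Qed.

Lemma Wprod_neq0 t tau : UHP tau -> Wprod t E tau != 0.
Proof.
move=> t0; apply/prodf_neq0 => s _; apply: fS_neq0 => //; first exact: UHP_M.
exact: uc_ndvd.
Qed.

Lemma holo_Wprod t tau : UHP tau -> holo (Wprod t E) tau.
Proof.
move=> t0; apply: holo_prod => s; apply: holo_fS => //; first exact: uc_ndvd.
  exact: (holoZ _ (holo_id _)).
exact: UHP_M.
Qed.

(** [kapS] is the exponent of the character on [Gamma_1], found from the quadratic sums; [ordS] is
    the order at the cusp [c^i], found from [B_2]. *)
Definition kapS t : R := \sum_(s < t) ((p ^ (t - s.+1))%N%:Z * Sq s.+1 (E s.+1))%:~R / ((M s.+1).*2)%:R.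
Definition ordS t i : R := (\sum_(s < t) p%:Z ^+ (2 * (t - s.+1)) * W p c s.+1 (E s.+1) i)%:~R / ((M t).*2)%:R.

Lemma Wprod_Gamma1_S t (a b c' d : int) tau : a * d - b * c' = 1 -> UHP tau ->
  (M t %| c')%Z -> (M t %| a - 1)%Z ->
  Wprod t E (mtau a b c' d tau) = ce (b%:~R * (kapS t)%:C%C) * Wprod t E tau.
Proof.
move=> det1 t0 h1 h2; rewrite /Wprod.
rewrite (eq_bigr (fun s : 'I_t => ce (b%:~R * (((p ^ (t - s.+1))%N%:Z * Sq s.+1 (E s.+1))%:~R / ((M s.+1).*2)%:R : R)%:C%C) *
   fl s.+1 (E s.+1) ((M t)%:R * tau))); last first.
  move=> s _; rewrite (fl_Gamma1 (ltn_ord s) (@EA s) det1 t0 h1 h2); congr (ce _ * _).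
  set X := (_ * Sq _ _)%:~R / _ : R.
  have -> : X%:C%C = ((p ^ (t - s.+1))%N%:Z * Sq s.+1 (E s.+1))%:~R / ((M s.+1).*2)%:R.
    by rewrite /X rmorphM fmorphV rmorph_nat rmorph_int.
  by rewrite -[in LHS]mulrA [in LHS]rmorphM /= mulrA.
rewrite big_split /= ce_prod; congr (ce _ * _).
by rewrite /kapS rmorph_sum mulr_sumr.
Qed.

Lemma Wprod_asy_inf t (a b c' d : int) i : a * d - b * c' = 1 ->
  (M t %| c')%Z -> (M t %| a - c ^+ i)%Z || (M t %| a + c ^+ i)%Z ->
  asy (fun tau => Wprod t E (mtau a b c' d tau)) (ordS t i).
Proof.
move=> det1 h1 h2; rewrite /ordS rmorph_sum mulr_suml; apply: asy_prod => s.
exact: fl_asy_inf.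
Qed.

Lemma Wprod_asy_other t (a b c' d : int) : a * d - b * c' = 1 -> ~~ (M t %| c')%Z ->
  asy (fun tau => Wprod t E (mtau a b c' d tau)) 0.
Proof.
move=> det1 h1; rewrite [X in asy _ X](_ : 0 = \sum_(s < t) (0 : R)); last by rewrite big1.
apply: asy_prod => s.
exact: fl_asy_other.
Qed.

(** The translation by 1 belongs to [Gamma_1], and its multiplier is also determined by the order at
    infinity. So the character is expressed through orders without evaluating the quadratic sums
    [Sq]. *)
Lemma kap_ord t : ce ((kapS t)%:C%C) = ce ((ordS t 0)%:C%C).
Proof.
have d1 : 1 * 1 - 0 * 0 = 1 :> int by [].
have A := @Wprod_asy_inf t 1 0 0 1 0%N d1 (dvdz0 _); rewrite expr0 subrr dvdz0 in A.
apply: (@asy_shift _ (ordS t 0) 0 _ (A isT)) => tau t0.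
have dT : 1 * 1 - 1 * 0 = 1 :> int by [].
have := @Wprod_Gamma1_S t 1 1 0 1 tau dT t0 (dvdz0 _).
rewrite subrr dvdz0 mulr1z mul1r => /(_ isT); rewrite !mtau1 => <-.
by rewrite /mtau /jfac mul0r add0r divr1 mul1r.
Qed.

Lemma Wprod_Gamma1 t (a b c' d : int) tau : a * d - b * c' = 1 -> UHP tau ->
  (M t %| c')%Z -> (M t %| a - 1)%Z ->
  Wprod t E (mtau a b c' d tau) = ce ((ordS t 0)%:C%C) ^ b * Wprod t E tau.
Proof.
move=> det1 t0 h1 h2; rewrite Wprod_Gamma1_S // -kap_ord -ceMz; congr (ce _ * _).
by rewrite mulrC mulrzr.
Qed.

End Level.
End SiegelUnits.

(** * Continuous [p]-th roots along paths *)

Section Roots.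
Variable R : realType.
Local Notation C := (R[i]^o).
Implicit Types (f g F G h : C -> C) (z w tau : C).
Local Opaque phi ce K.

(** [x^p - 1] is [x - 1] times a sum of [p >= 2] powers of [x]; near [x = 1] this sum is close to
    [p], hence of modulus at least 1. *)
Lemma root_rigid (p : nat) : (1 < p)%N -> exists2 e : R, 0 < e <= 1 &
  forall x : C, nm (x - 1) <= e -> nm (x - 1) <= nm (x ^+ p - 1).
Proof.
move=> p1; have P0 : 0 < 2 ^+ p :> R by rewrite exprn_gt0.
have pR : 2 <= p%:R :> R by rewrite (ler_nat R 2).
have dn : 0 < 2 * p%:R * 2 ^+ p :> R by rewrite !mulr_gt0 //; lra.
exists (2 * p%:R * 2 ^+ p)^-1.
  rewrite invr_gt0 dn /= invf_le1 //; have : 1 <= 2 ^+ p :> R by rewrite exprn_ege1 // ler1n.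
  by move=> h; have := ler_pM (ltac:(lra) : 0 <= 4) (ltac:(lra) : 0 <= 1) (ltac:(lra) : 4 <= 2 * p%:R :> R) h; lra.
move=> x; set e := _^-1 => xe; have e0 : 0 < e by rewrite invr_gt0.
have eE : e * (2 * p%:R * 2 ^+ p) = 1 by rewrite mulVf // gt_eqF.
have x2 : nm x <= 2.
  have := nmD (x - 1) 1; rewrite subrK nm1 => h; apply: (le_trans h).
  have : e <= 1.
    rewrite invf_le1 //; have : 1 <= 2 ^+ p :> R by rewrite exprn_ege1 // ler1n.
    by move=> h'; have := ler_pM (ltac:(lra) : 0 <= 4) (ltac:(lra) : 0 <= 1) (ltac:(lra) : 4 <= 2 * p%:R :> R) h'; lra.
  lra.
have xk k : nm (x ^+ k) <= 2 ^+ k.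
  by rewrite nmX; apply: lerXn2r; rewrite ?nnegrE ?nm_ge0.
have xk1 k : (k <= p)%N -> nm (x ^+ k - 1) <= p%:R * 2 ^+ p * e.
  move=> kp; have := subrX1 x k => ->; rewrite nmM.
  have s : nm (\sum_(i < k) x ^+ i) <= p%:R * 2 ^+ p.
    apply: (le_trans (nm_sum _ _ _)); apply: (@le_trans _ _ (\sum_(i < k) 2 ^+ p)).
      apply: ler_sum => i _; apply: (le_trans (xk i)); rewrite ler_weXn2l ?ler1n //.
      by rewrite (leq_trans (ltnW (ltn_ord i))).
    by rewrite sumr_const card_ord -[X in X <= _]mulr_natl ler_wpM2r ?ler_nat // ltW.
  rewrite mulrC; apply: ler_pM => //; exact: nm_ge0.
have S1 : 1 <= nm (\sum_(i < p) x ^+ i).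
  have h : nm (\sum_(i < p) (x ^+ i - 1)) <= p%:R * (p%:R * 2 ^+ p * e).
    apply: (le_trans (nm_sum _ _ _)); apply: (@le_trans _ _ (\sum_(i < p) (p%:R * 2 ^+ p * e))).
      by apply: ler_sum => i _; apply: xk1; exact: ltnW.
    by rewrite sumr_const card_ord -[X in X <= _]mulr_natl.
  have h2 : p%:R * (p%:R * 2 ^+ p * e) = p%:R / 2.
    have -> : p%:R * (p%:R * 2 ^+ p * e) = (p%:R / 2) * (e * (2 * p%:R * 2 ^+ p)) by field.
    by rewrite eE mulr1.
  rewrite h2 in h; have h3 : \sum_(i < p) (x ^+ i - 1) = \sum_(i < p) x ^+ i - p%:R.
    by rewrite sumrB sumr_const card_ord.
  rewrite h3 in h; have := nm_dist_triangle (p%:R : C) 0 (\sum_(i < p) x ^+ i).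
  rewrite !subr0 (nmBC (p%:R)); have -> : nm (p%:R : C) = p%:R.
    by rewrite cplx_nat nm_real ger0_norm.
  lra.
rewrite subrX1 nmM -{1}[nm (x - 1)]mulr1; apply: ler_wpM2l => //; exact: nm_ge0.
Qed.

(** The times at which [|x - 1| <= e] form an open and closed set, because rigidity improves this
    bound to [e / 2]. *)
Lemma path_root (p : nat) (x : R -> C) (e : R) : (1 < p)%N -> 0 < e <= 1 ->
  (forall y : C, nm (y - 1) <= e -> nm (y - 1) <= nm (y ^+ p - 1)) ->
  (forall t, 0 <= t <= 1 -> forall d : R, 0 < d -> exists2 r : R, 0 < r &
     forall s, 0 <= s <= 1 -> `|s - t| < r -> nm (x s - x t) < d) ->
  x 0 = 1 -> (forall t, 0 <= t <= 1 -> nm (x t ^+ p - 1) <= e / 2) ->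
  nm (x 1 - 1) <= nm (x 1 ^+ p - 1).
Proof.
move=> p1 /andP[e0 e1] rig xc x0 xp; have rig' := rig; apply: rig'.
apply: (@segment_clopen R (fun t => nm (x t - 1) <= e)).
- by rewrite x0 subrr nm0 ltW.
- move=> t t01 xt; have xt2 := le_trans (rig _ xt) (xp t t01).
  have [r r0 rP] := xc t t01 (e / 2) (ltac:(lra)); exists r => // s s01 st.
  by have := rP s s01 st; have := nm_dist_triangle (x s) 1 (x t); lra.
- move=> t t01 /negP; rewrite -ltNge => xt.
  have [r r0 rP] := xc t t01 (nm (x t - 1) - e) (ltac:(lra)); exists r => // s s01 st.
  apply/negP; rewrite -ltNge.
  by have := rP s s01 st; have := nm_dist_triangle (x t) 1 (x s); rewrite (nmBC (x t) (x s)); lra.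
Qed.

Lemma path_cont g z w : UHP z -> UHP w -> (forall u, UHP u -> ccont g u) ->
  forall t, 0 <= t <= 1 -> forall d : R, 0 < d -> exists2 r : R, 0 < r &
     forall s, 0 <= s <= 1 -> `|s - t| < r ->
       nm (g (z + s%:C%C * (w - z)) - g (z + t%:C%C * (w - z))) < d.
Proof.
move=> z0 w0 gc t t01 d d0.
have [r r0 rP] := gc _ (UHP_conv z0 w0 t01) _ d0.
have n1 : 0 < nm (w - z) + 1 by have := nm_ge0 (w - z); lra.
exists (r / (nm (w - z) + 1)); first by rewrite divr_gt0.
move=> s s01 st; apply: rP.
have -> : z + s%:C%C * (w - z) - (z + t%:C%C * (w - z)) = (s - t)%:C%C * (w - z) by rewrite rmorphB; ring.
rewrite nmM nm_real; move: st; rewrite ltr_pdivlMr // => st; apply: le_lt_trans st.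
by apply: ler_wpM2l => //; lra.
Qed.

(** Along the segment from [z] to [w], [g / g z] is a continuous path of [p]-th roots of unity that
    starts at 1. *)
Lemma root_const (p : nat) g : (1 < p)%N -> (forall u, UHP u -> ccont g u) ->
  (forall u, UHP u -> g u != 0) -> (forall u v, UHP u -> UHP v -> g u ^+ p = g v ^+ p) ->
  forall z w, UHP z -> UHP w -> g z = g w.
Proof.
move=> p1 gc g0 gp z w z0 w0; have [e e01 rig] := root_rigid p1.
have gz := g0 z z0.
have key := @path_root p (fun t => g (z + t%:C%C * (w - z)) / g z) e p1 e01 rig.
have cc u : UHP u -> ccont (fun u => g u / g z) u.
  by move=> u0; exact: (ccontM (gc u u0) (ccont_cst _ _)).
have xp t : 0 <= t <= 1 -> (g (z + t%:C%C * (w - z)) / g z) ^+ p = 1.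
  move=> t01; rewrite expr_div_n (gp _ z) ?divff ?expf_neq0 //; exact: UHP_conv.
have t11 : (0 <= (1 : R)) && ((1 : R) <= 1) by rewrite ler01 lexx.
have e1 : z + (1 : R)%:C%C * (w - z) = w by rewrite (_ : (1 : R)%:C%C = 1 :> C) // mul1r addrC subrK.
have := key (@path_cont (fun u => g u / g z) z w z0 w0 cc); rewrite e1 mul0r addr0 divff // => /(_ erefl) key2.
have h : nm (g w / g z - 1) <= 0.
  have := xp 1 t11; rewrite e1 => e2.
  rewrite -nm0 -(subrr 1) -[X in _ <= nm (X - _)]e2; apply: key2 => t t01.
  by rewrite xp // subrr nm0; case/andP: e01 => e0 _; lra.
have : nm (g w / g z - 1) = 0.
  by apply/eqP; rewrite eq_le h nm_ge0.
by move/eqP; rewrite nm_eq0 subr_eq0 => /eqP E; rewrite -[LHS]mul1r -E divfK.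
Qed.

(** The asymptotics of [F^p] determine the multiplier up to a [p]-th root of unity. Following
    [F e^(-2 pi i k t)] along a horizontal segment of length 1, high up in the half-plane, removes
    the ambiguity. *)
Lemma asy_root (p : nat) F (k : R) (chi : C) : (1 < p)%N -> (forall u, UHP u -> ccont F u) ->
  (forall u, UHP u -> F u != 0) -> asy (fun t => F t ^+ p) (p%:R * k) ->
  (forall t, UHP t -> F (t + 1) = chi * F t) -> chi = ce k%:C%C.
Proof.
move=> p1 Fc F0 [l l0 lP] FS; have [e e01 rig] := root_rigid p1.
have /andP[e0 e1] := e01; have l00 : 0 < nm l by rewrite nm_gt0.
pose g t := F t * ce (- (t * k%:C%C)).
have gc u : UHP u -> ccont g u.
  move=> u0; apply: (ccontM (Fc u u0)); apply: holo_ccont.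
  apply: (@holo_comp _ (@ce R) (fun t => - (t * k%:C%C))); last exact: holo_ce.
  exact: (holoN (holoM (holo_id _) (holo_cst _ _))).
have gp t : g t ^+ p = F t ^+ p * ce (- (t * (p%:R * k)%:C%C)).
  rewrite /g exprMn -ceMn; congr (_ * ce _); rewrite rmorphM rmorph_nat -mulr_natl; ring.
have [Y YP] := lP (nm l * (e / 8)) (ltac:(rewrite mulr_gt0 //; lra)).
pose Y' := Num.max Y 0 + 1.
have Y'Y : Y < Y' by rewrite ltr_pwDr // le_max lexx.
have Y'0 : 0 < Y' by rewrite ltr_pwDr // le_max lexx orbT.
pose z : C := (0 +i* Y')%C; pose w := z + 1.
have z0 : UHP z by [].
have w0 : UHP w by rewrite /UHP cImD /= addr0.
have g0 u : UHP u -> g u != 0 by move=> u0; rewrite mulf_neq0 ?ce_neq0 // F0.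
have near t : nm (g (z + t%:C%C * (w - z)) ^+ p - l) < nm l * (e / 8).
  by rewrite gp; apply: YP; rewrite cImD cImM !cImD cImN /= !mul0r !addr0; lra.
have ratio t : nm ((g (z + t%:C%C * (w - z)) / g z) ^+ p - 1) <= e / 2.
  have n1 := near t; have := near 0; rewrite mul0r addr0 => n2.
  have gzp : g z ^+ p != 0 by rewrite expf_neq0 // g0.
  have gl : nm l / 2 <= nm (g z ^+ p).
    have := nm_dist_triangle l 0 (g z ^+ p); rewrite !subr0 (nmBC l).
    have : nm l * (e / 8) <= nm l * (1 / 8) by apply: ler_wpM2l; lra.
    lra.
  have gp0 : 0 < nm (g z ^+ p) by rewrite nm_gt0.
  rewrite expr_div_n; have -> : g (z + t%:C%C * (w - z)) ^+ p / g z ^+ p - 1 = (g (z + t%:C%C * (w - z)) ^+ p - g z ^+ p) / g z ^+ p.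
    by rewrite mulrBl divff.
  rewrite nmM nmV ler_pdivrMr //.
  have := nm_dist_triangle (g (z + t%:C%C * (w - z)) ^+ p) (g z ^+ p) l; rewrite (nmBC l) => tr.
  have : nm l / 2 * (e / 2) <= nm (g z ^+ p) * (e / 2) by apply: ler_wpM2r; lra.
  lra.
have cc u : UHP u -> ccont (fun u => g u / g z) u.
  by move=> u0; exact: (ccontM (gc u u0) (ccont_cst _ _)).
have ez : z + (1 : R)%:C%C * (w - z) = z + 1 by rewrite (_ : (1 : R)%:C%C = 1 :> C) // mul1r addrC subrK.
have := @path_root p (fun t => g (z + t%:C%C * (w - z)) / g z) e p1 e01 rig (@path_cont (fun u => g u / g z) z w z0 w0 cc).
rewrite ez mul0r addr0 divff ?g0 // => /(_ erefl (fun t _ => ratio t)).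
have gS t : UHP t -> g (t + 1) = chi * ce (- k%:C%C) * g t.
  move=> t0; rewrite /g FS // mulrDl mul1r opprD ceD.
  by move: (ce _) (ce _) (F t) => x y v; ring.
have chip : (chi * ce (- k%:C%C)) ^+ p = 1.
  apply: (mulIf l0); rewrite mul1r; apply: (@ilim_unique _ (fun t => g (1%:C%C * t + 1) ^+ p)).
    have := ilimM (ilim_cst ((chi * ce (- k%:C%C)) ^+ p)) lP.
    by apply: (@ilim_eq _ _ _ _ 0) => t t0; rewrite mul1r gS // [RHS]exprMn gp.
  have := ilim_comp (F := fun t => F t ^+ p * ce (- (t * (p%:R * k)%:C%C))) 1 ltr01 lP.
  by apply: (@ilim_eq _ _ _ _ 0) => t t0; rewrite gp.
rewrite gS // mulfK ?g0 // chip subrr nm0 => h.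
have : nm (chi * ce (- k%:C%C) - 1) = 0 by apply/eqP; rewrite eq_le h nm_ge0.
move/eqP; rewrite nm_eq0 subr_eq0 ceN => /eqP /(congr1 (fun x => x * ce k%:C%C)).
by rewrite mul1r divfK // ce_neq0.
Qed.

End Roots.

(** * Multipliers, relations between parabolic elements, and saturation *)

Section Saturation.
Variable R : realType.
Local Notation C := (R[i]^o).
Implicit Types (f g F G h : C -> C) (z w tau : C).
Local Opaque phi ce K.

Definition mult F (a b c d : int) (chi : C) := forall tau, UHP tau -> F (mtau a b c d tau) = chi * F tau.

Lemma mult_comp F (a b c d a' b' c' d' : int) (x y : C) : a' * d' - b' * c' = 1 ->
  mult F a b c d x -> mult F a' b' c' d' y ->
  mult F (a * a' + b * c') (a * b' + b * d') (c * a' + d * c') (c * b' + d * d') (x * y).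
Proof.
move=> det1 Fx Fy tau t0; rewrite -mtau_comp // Fx ?Fy ?mulrA //; exact: UHP_mtau.
Qed.

Lemma mult_inv F (a b c d : int) (x : C) : x != 0 -> a * d - b * c = 1 -> mult F a b c d x ->
  mult F d (- b) (- c) a x^-1.
Proof.
move=> x0 det1 Fx tau t0; have s0 := UHP_mtau (det2_inv det1) t0.
have := Fx _ s0; have := mtau_inv (det2_inv det1) t0; rewrite !opprK => -> ->.
by rewrite mulKf.
Qed.

Lemma mult_unique F (a b c d : int) (x y : C) : (forall t, UHP t -> F t != 0) ->
  mult F a b c d x -> mult F a b c d y -> x = y.
Proof.
move=> F0 Fx Fy; pose i0 : C := (0 +i* 1)%C; have i00 : UHP i0 by rewrite /UHP /= ltr01.
by apply: (mulIf (F0 i0 i00)); rewrite -Fx // -Fy.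
Qed.

Lemma mult_eq F (a b c d a' b' c' d' : int) (x : C) : a = a' -> b = b' -> c = c' -> d = d' ->
  mult F a b c d x -> mult F a' b' c' d' x.
Proof. by move=> -> -> -> ->. Qed.

Lemma mult_trans F (x : C) (n : int) : x != 0 -> mult F 1 1 0 1 x -> mult F 1 n 0 1 (x ^ n).
Proof.
move=> x0 Fx; have nat (k : nat) : mult F 1 k 0 1 (x ^+ k).
  elim: k => [|k IH]; first by move=> tau _; rewrite mtau1 mul1r.
  have d1 : 1 * 1 - 1 * 0 = 1 :> int by [].
  have := mult_comp d1 IH Fx; rewrite -exprSr.
  by apply: mult_eq; rewrite ?intS; ring.
case: n => n; first exact: nat.
have d1 : 1 * 1 - n.+1%:Z * 0 = 1 by rewrite mulr0 subr0.
by have := mult_inv (expf_neq0 n.+1 x0) d1 (nat n.+1); apply: mult_eq => //; lia.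
Qed.

Section CuspRelations.
Variables (F : C -> C) (N m a : int) (kap kapa : R).
Hypothesis F0 : forall t, UHP t -> F t != 0.
Hypothesis Delta : forall (x b y d : int), x * d - b * y = 1 -> (m %| y)%Z -> (N %| x - 1)%Z ->
  (N ^+ 2 %| b)%Z -> mult F x b y d 1.
Hypothesis FT : mult F 1 1 0 1 (ce kap%:C%C).
Variable s0 : int.
Hypothesis s0E : (N ^+ 2 %| s0 * (1 - a * m) - 1)%Z.
Let t0 := 1 - a * m.

Let kz (k : R) (n : int) : k%:C%C *~ n = (k * n%:~R)%:C%C :> C.
Proof. by rewrite mulrzr rmorphMz. Qed.

Let y_mult (k : int) : mult F 1 0 (m * k) 1 1.
Proof. by apply: Delta; rewrite ?subrr ?dvdz0 ?dvdz_mulr // mul0r subr0. Qed.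

Let Qm : mult F t0 (1 - s0 * t0) (- (m * a)) (1 + s0 * (m * a)) (ce kap%:C%C * 1 * ce kap%:C%C ^ (- s0)).
Proof.
have d1 : 1 * 1 - 0 * (m * - a) = 1 :> int by ring.
have d2 : 1 * 1 - (- s0) * 0 = 1 :> int by ring.
have h1 := mult_comp d1 FT (y_mult (- a)).
have h2 := mult_comp d2 h1 (mult_trans (- s0) (ce_neq0 _) FT).
by apply: mult_eq h2; rewrite /t0; ring.
Qed.

Let Qdet : t0 * (1 + s0 * (m * a)) - (1 - s0 * t0) * (- (m * a)) = 1.
Proof. by rewrite /t0; ring. Qed.

Let N2 (x : int) : (N ^+ 2 %| x)%Z -> (N %| x)%Z.
Proof. by apply: dvdz_trans; rewrite expr2 dvdz_mulr. Qed.

(** Let [P] be the given parabolic matrix at the cusp [a / m], [T] the translation and [y] the lower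
    unipotent matrix with entry [m]. The words [P T^(-a^2 s0)] and [T y^(-a) T^(-s0)] both have
    first row [(1 - a m, 0)] modulo [N^2], so they differ by an element of the group in [Delta] and
    have equal multipliers. *)
Lemma cusp_relation : mult F (1 - a * m) (a ^+ 2) (- m ^+ 2) (1 + a * m) (ce kapa%:C%C) ->
  exists n : int, kapa - kap * (1 + (a ^+ 2 - 1) * s0)%:~R = n%:~R.
Proof.
move=> FP; pose x' := a ^+ 2 * s0.
have d2 : 1 * 1 - (- x') * 0 = 1 :> int by ring.
have h1 := mult_comp d2 FP (mult_trans (- x') (ce_neq0 _) FT).
have x0 : ce kap%:C%C * 1 * ce kap%:C%C ^ (- s0) != 0 by apply: mulf_neq0; [apply: mulf_neq0; [exact: ce_neq0|exact: (@oner_neq0 R[i])]|apply: expfz_neq0; exact: ce_neq0].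
have Qi := mult_inv x0 Qdet Qm.
have h2 := mult_comp (det2_inv Qdet) h1 Qi.
have [k kE] := dvdzP s0E; rewrite -/t0 in kE.
have h3 := mult_unique F0 h2 (Delta _ _ _ _).
have : ce (kapa - kap * (1 + (a ^+ 2 - 1) * s0)%:~R)%:C%C = 1.
  rewrite -[RHS]h3.
  - rewrite mulr1 invfM -!ceMz -!ceN -!ceD; congr ce.
    rewrite !kz -!rmorphN -!rmorphD; congr (_%:C%C); rewrite /x'.
    have -> : (1 + (a ^+ 2 - 1) * s0)%:~R = 1 + (a%:~R ^+ 2 - 1) * s0%:~R :> R.
      by rewrite rmorphD rmorphM rmorphB rmorphXn.
    have -> : (- (a ^+ 2 * s0))%:~R = - (a%:~R ^+ 2 * s0%:~R) :> R by rewrite rmorphN rmorphM rmorphXn.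
    have -> : (- s0)%:~R = - s0%:~R :> R by rewrite rmorphN.
    by move: (a%:~R : R) (s0%:~R : R) => u v; ring.
  - have E := det2_comp (det2_comp (_ : (1 - a * m) * (1 + a * m) - a ^+ 2 * (- m ^+ 2) = 1) d2) (det2_inv Qdet).
    by apply: E; ring.
  - by apply/dvdzP; exists (- m * (1 + s0 * (m * a)) + (m ^+ 2 * x' + 1 + a * m) * a); ring.
  - rewrite [X in (_ %| X)%Z](_ : _ = (s0 * t0 - 1) * ((m * a) * (1 - a ^+ 2))); last by rewrite /t0 /x'; ring.
    by rewrite kE; apply: dvdz_mulr; apply: N2; exact: dvdz_mull.
  - rewrite [X in (_ %| X)%Z](_ : _ = (s0 * t0 - 1) * (t0 - a ^+ 2 * t0)); last by rewrite /t0 /x'; ring.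
    by rewrite kE; apply: dvdz_mulr; exact: dvdz_mull.
by move=> /ce_eq1[n nE]; exists n; apply: complexI; rewrite nE rmorph_int.
Qed.

(** The same comparison between [T y^(-a) T^(-s0)] and [T^(-1) y^a T^(s0)], which share their first
    row modulo [N^2] and have inverse multipliers; hence the factor 2. *)
Lemma cusp_relation2 : exists n : int, 2 * kap * (1 - s0)%:~R = n%:~R.
Proof.
have d0 : 1 * 1 - 1 * 0 = 1 :> int by ring.
have FTi := mult_inv (ce_neq0 _) d0 FT.
have d1 : 1 * 1 - 0 * (m * a) = 1 :> int by ring.
have d2 : 1 * 1 - s0 * 0 = 1 :> int by ring.
have h1 := mult_comp d1 FTi (y_mult a).
have Q' := mult_comp d2 h1 (mult_trans s0 (ce_neq0 _) FT).
have {h1}Q' : mult F t0 (s0 * t0 - 1) (m * a) (1 + s0 * (m * a)) ((ce kap%:C%C)^-1 * 1 * ce kap%:C%C ^ s0).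
  by apply: mult_eq Q'; rewrite /t0; ring.
have det' : t0 * (1 + s0 * (m * a)) - (s0 * t0 - 1) * (m * a) = 1 by rewrite /t0; ring.
have x0 : (ce kap%:C%C)^-1 * 1 * ce kap%:C%C ^ s0 != 0 by apply: mulf_neq0; [apply: mulf_neq0; [rewrite invr_eq0; exact: ce_neq0|exact: (@oner_neq0 R[i])]|apply: expfz_neq0; exact: ce_neq0].
have Qi := mult_inv x0 det' Q'.
have h2 := mult_comp (det2_inv det') Qm Qi.
have [k kE] := dvdzP s0E; rewrite -/t0 in kE.
have h3 := mult_unique F0 h2 (Delta _ _ _ _).
have : ce (2 * kap * (1 - s0)%:~R)%:C%C = 1.
  rewrite -[RHS]h3.
  - rewrite !mulr1 invfM invrK -!ceMz -!ceN -!ceD; congr ce.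
    rewrite !kz -!rmorphN -!rmorphD; congr (_%:C%C).
    have -> : (1 - s0)%:~R = 1 - s0%:~R :> R by rewrite rmorphB.
    have -> : (- s0)%:~R = - s0%:~R :> R by rewrite rmorphN.
    by move: (s0%:~R : R) => v; ring.
  - exact: (det2_comp Qdet (det2_inv det')).
  - apply/dvdzP; exists (- a * (1 + s0 * (m * a)) - (1 + s0 * (m * a)) * a); ring.
  - rewrite [X in (_ %| X)%Z](_ : _ = (s0 * t0 - 1) * (2 * (m * a))); last by rewrite /t0; ring.
    by rewrite kE; apply: dvdz_mulr; apply: N2; exact: dvdz_mull.
  - rewrite [X in (_ %| X)%Z](_ : _ = (s0 * t0 - 1) * (- 2 * t0)); last by ring.
    by rewrite kE; apply: dvdz_mulr; exact: dvdz_mull.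
by move=> /ce_eq1[n nE]; exists n; apply: complexI; rewrite nE rmorph_int.
Qed.

End CuspRelations.
End Saturation.

Section SaturationStep.
Variable R : realType.
Local Notation C := (R[i]^o).
Implicit Types (g F G h : C -> C) (z w tau : C).
Local Opaque phi ce K.
Variables (p : nat) (c : int).
Hypothesis D : leveldata p c.
Local Notation M := (lev p).
Local Notation H := (hlev p).
Let pp := ld_prime D.
Let p1 := prime_gt1 pp.
Let M0 t : (0 < M t)%N := lev_gt0 pp t.

(** The squares [u_i^2] agree modulo 2 and the exponents have sum 0. This pays for the 2 in the
    denominator [2 M] of the character. *)
Lemma Sq_even s (e : nat -> int) : \sum_(j < H s) e j = 0 -> (2 %| Sq p c s e)%Z.
Proof.
move=> e0; have -> : Sq p c s e = \sum_(i < H s) e i * (uc c i ^+ 2 - uc c 0 ^+ 2).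
  under [RHS]eq_bigr do rewrite mulrBr.
  by rewrite sumrB -mulr_suml e0 mul0r subr0.
apply: rpred_sum => i _; apply: dvdz_mull.
have o : odd `|uc c i| = odd `|uc c 0| := uc_odd c i.
have : ~~ odd `|uc c i ^+ 2 - uc c 0 ^+ 2|.
  move: o; move: (uc c i) (uc c 0) => x y o.
  have oB (m n : int) : odd `|m - n| = odd `|m| (+) odd `|n| by lia.
  by rewrite oB !abszX !oddX o addbb.
by rewrite dvdzE /= dvdn2.
Qed.

Variables (L r : nat).
Hypothesis L0 : (0 < L)%N.
Let T := (L + r)%N.
Variables (f : C -> C) (E : nat -> nat -> int) (K0 : C).
Hypotheses (EA : forall s, Acl p s (E s.+1)) (finv : inv1 (M T) f)
  (freg : forall t, UHP t -> ccont f t) (f0 : forall t, UHP t -> f t != 0)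
  (K00 : K0 != 0) (fp : forall t, UHP t -> f t ^+ p = K0 * Wprod p c T E t).
Hypothesis Ep : forall s j, (L <= s < T)%N -> (j < H s.+1)%N -> (p %| E s.+1 j)%Z.

Let E' s j := (E s j %/ p)%Z.
Let q0 := (p ^ r)%N.
Let MT : M T = (q0 * M L)%N.
Proof. by rewrite /T addnC lev_add. Qed.
Let q00 : (0 < q0)%N. Proof. by rewrite expn_gt0 prime_gt0. Qed.

(** The factors of level above [L] have exponents divisible by [p], so [Fden] is an explicit [p]-th
    root of their product. Dividing it out of [f] and rescaling by [q0 = p^r], so that
    [M_T tau / q0 = M_L tau], leaves a [p]-th root of the part of level at most [L]. *)
Definition Fden tau : C := \prod_(k < r) fl p c (L + k).+1 (E' (L + k).+1) ((M L)%:R * tau).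
Definition Fsat tau : C := f (tau / q0%:R) / Fden tau.

Let E'A (k : 'I_r) : Acl p (L + k) (E' (L + k).+1).
Proof.
move=> l lh; apply: (mulfI (_ : p%:Z != 0)); first by have := prime_gt0 pp; lia.
rewrite mulr0 mulr_sumr -[RHS](EA lh); apply: eq_bigr => q _; rewrite mulrC divzK //.
apply: Ep; first by rewrite leq_addr ltn_add2l ltn_ord.
rewrite (rhoE D); have : ((q.+1) * H (L + k) <= rho p (L + k) * H (L + k))%N by rewrite leq_mul2r ltn_ord orbT.
by apply: leq_trans; rewrite mulSn -addSn leq_add2r.
Qed.

Let UHPq (n : nat) tau : (0 < n)%N -> UHP tau -> UHP (tau / n%:R).
Proof.
move=> n0; have : n%:R^-1 = (n%:R^-1)%:C%C :> C by rewrite fmorphV rmorph_nat.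
by rewrite /UHP => ->; rewrite cImM /= mulr0 add0r => t0; rewrite mulr_gt0 // invr_gt0 ltr0n.
Qed.

Let natC (n : nat) : (0 < n)%N -> n%:R != 0 :> C.
Proof. by rewrite pnatr_eq0 -lt0n. Qed.

Lemma Fden_neq0 tau : UHP tau -> Fden tau != 0.
Proof.
move=> t0; apply/prodf_neq0 => k _; apply: fS_neq0 => //; first exact: (UHP_M D).
exact: (uc_ndvd D).
Qed.

Lemma Fsat_neq0 tau : UHP tau -> Fsat tau != 0.
Proof.
move=> t0; apply: mulf_neq0; first by apply: f0; exact: UHPq.
by rewrite invr_eq0; exact: Fden_neq0.
Qed.

Lemma ccont_Fsat tau : UHP tau -> ccont Fsat tau.
Proof.
move=> t0; apply: ccontM.
  apply: (@ccont_comp _ f (fun t => t / q0%:R)); last by apply: freg; exact: UHPq.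
  exact: (holo_ccont (holoM (holo_id _) (holo_cst _ _))).
apply: ccontV; first exact: Fden_neq0.
apply: holo_ccont; apply: holo_prod => k; apply: holo_fS => //; first exact: (uc_ndvd D).
  exact: (holoZ _ (holo_id _)).
exact: (UHP_M D).
Qed.

Lemma Fsat_p tau : UHP tau -> Fsat tau ^+ p = K0 * Wprod p c L E tau.
Proof.
move=> t0; rewrite /Fsat expr_div_n fp; last exact: UHPq.
have MTq : (M T)%:R * (tau / q0%:R) = (M L)%:R * tau.
  by rewrite MT natrM; field; exact: natC.
rewrite /Wprod MTq big_split_ord /= -mulrA -mulrA; congr (_ * _); rewrite -[RHS]mulr1; congr (_ * _).
have -> : Fden tau ^+ p = \prod_(i < r) fl p c (L + i).+1 (E (L + i).+1) ((M L)%:R * tau).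
  rewrite /Fden -prodrXl; apply: eq_bigr => k _; rewrite /fl /fS -prodrXl; apply: eq_bigr => i _.
  rewrite [LHS]exprnP exprz_exp divzK //; apply: Ep => //.
  by rewrite leq_addr ltn_add2l ltn_ord.
rewrite divff //; apply/prodf_neq0 => k _; apply: fS_neq0 => //; first exact: (UHP_M D).
exact: (uc_ndvd D).
Qed.

Lemma scale_div (n : nat) (a b b1 c' d : int) tau : (0 < n)%N -> b = n%:Z * b1 ->
  mtau a b c' d tau / n%:R = mtau a b1 (n%:Z * c') d (tau / n%:R).
Proof.
move=> n0 ->; apply: (mulIf (natC n0)); rewrite divfK ?natC // [RHS]mulrC mtau_scale //.
by rewrite [_ * (tau / _)]mulrC divfK ?natC.
Qed.

(** Rescaling by a power of [p] divides [b]; the assumption [M_T^2 | b] leaves enough divisibility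
    to make the characters of the factors of [Fden] trivial. *)
Lemma Fsat_Delta (a b c' d : int) : a * d - b * c' = 1 -> (M L %| c')%Z -> (M T %| a - 1)%Z ->
  ((M T)%:Z ^+ 2 %| b)%Z -> mult Fsat a b c' d 1.
Proof.
move=> det1 h1 h2 /dvdzP[b0 bE] tau t0; rewrite mul1r /Fsat; congr (_ / _).
  have bq : b = q0%:Z * (b0 * (M L)%:Z * (M T)%:Z) by rewrite bE MT PoszM; ring.
  rewrite (scale_div _ _ _ _ q00 bq); apply: finv => //; last exact: UHPq.
    by rewrite -det1 [in RHS]bq; ring.
  by rewrite MT PoszM dvdz_mul.
apply: eq_bigr => k _; set s := (L + k)%N.
have kr := ltn_ord k; pose q := (p ^ k.+1)%N; have q_0 : (0 < q)%N by rewrite expn_gt0 prime_gt0.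
have Ms : M s.+1 = (q * M L)%N by rewrite /s -addnS addnC lev_add.
have MTs : M T = (p ^ (r - k.+1) * M s.+1)%N.
  by rewrite Ms mulnA -expnD subnK // MT.
have bq : b = q%:Z * (b0 * (M L)%:Z * (p ^ (r - k.+1))%N * (p ^ (r - k.+1))%N * (M s.+1)%:Z).
  by rewrite bE MTs PoszM expr2 {1}Ms PoszM; ring.
have resc w : (M L)%:R * w = (M s.+1 * 1)%:R * (w / q%:R) :> C.
  by rewrite muln1 Ms natrM; field; exact: natC.
rewrite (resc (mtau _ _ _ _ _)) (resc tau) (scale_div _ _ _ _ q_0 bq) /fl fS_Gamma1 //.
- set X := _ * \sum_(_ < _) _; have -> : X%:~R / (M s.+1).*2%:R = (X %/ ((M s.+1)%:Z *+ 2))%Z%:~R :> C.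
    have dX : ((M s.+1)%:Z *+ 2 %| X)%Z.
      have [v vE] := dvdzP (Sq_even (Acl_sum0 D (@E'A k))).
      apply/dvdzP; exists (b0 * (M L)%:Z * (p ^ (r - k.+1))%N * (p ^ (r - k.+1))%N * v).
      by rewrite /X -/(Sq p c s.+1 (E' s.+1)) vE; ring.
    rewrite -[X in X%:~R / _](divzK dX) rmorphM /= -mul2n natrM rmorphMn /= -pmulrn.
    by field; exact: natC.
  by rewrite ce_int mul1r.
- by rewrite -det1 [in RHS]bq; ring.
- exact: UHPq.
- exact: (uc_ndvd D).
- exact: (Acl_sum0 D (@E'A k)).
- exact: uc_odd.
- by rewrite muln1 Ms PoszM dvdz_mul.
- by apply: dvdz_trans h2; rewrite muln1 MTs PoszM dvdz_mull.
Qed.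

(** For the parabolic matrix [P], the [p]-th power of [F(P u) / F(u)] is constant, hence so is the
    quotient by [root_const]. Its value is read off by [asy_root] at the cusp fixed by [P], where
    [P] becomes the translation by 1. *)
Lemma Fsat_parabolic (a b c' d : int) i : a * d - b * c' = 1 -> (M L %| c')%Z ->
  (M L %| a - c ^+ i)%Z || (M L %| a + c ^+ i)%Z ->
  mult Fsat (1 - a * c') (a ^+ 2) (- c' ^+ 2) (1 + a * c') (ce (ordS R p c E L i / p%:R)%:C%C).
Proof.
move=> det1 h1 h2; have Fs0 := Fsat_neq0.
have detP : (1 - a * c') * (1 + a * c') - a ^+ 2 * (- c' ^+ 2) = 1 by ring.
have mP1 : (M L %| - c' ^+ 2)%Z by rewrite rpredN expr2 dvdz_mulr.
have mP2 : (M L %| 1 - a * c' - 1)%Z by rewrite addrAC subrr sub0r rpredN dvdz_mull.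
pose P := mtau (1 - a * c') (a ^+ 2) (- c' ^+ 2) (1 + a * c') : C -> C.
have UP u : UHP u -> UHP (P u) := UHP_mtau detP.
pose g u := Fsat (P u) / Fsat u.
have gc u : UHP u -> ccont g u.
  move=> u0; apply: ccontM; last exact: (ccontV (Fs0 u u0) (ccont_Fsat u0)).
  apply: (@ccont_comp _ Fsat P); first exact: (holo_ccont (holo_mtau detP u0)).
  by apply: ccont_Fsat; exact: UP.
have g0 u : UHP u -> g u != 0 by move=> u0; rewrite mulf_neq0 ?invr_eq0 ?Fs0 //; exact: UP.
have gp u : UHP u -> g u ^+ p = ce (ordS R p c E L 0)%:C%C ^ (a ^+ 2).
  move=> u0; have e1 := Fsat_p (UP u u0); have e2 := Fsat_p u0.
  rewrite /g expr_div_n e1 e2 /P (Wprod_Gamma1 D EA detP u0 mP1 mP2); have w0 := Wprod_neq0 D E L u0.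
  by move: w0 K00; move: (Wprod _ _ _ _ _) (_ ^ _) => x y x0 k0; field; rewrite x0 k0.
pose i0 : C := (0 +i* 1)%C; have i00 : UHP i0 by rewrite /UHP /= ltr01.
have gcon u : UHP u -> g u = g i0.
  move=> u0.
  exact: (@root_const R p g p1 gc g0 (fun x y x0 y0 => etrans (gp x x0) (esym (gp y y0))) u i0 u0 i00).
have mg : mult Fsat (1 - a * c') (a ^+ 2) (- c' ^+ 2) (1 + a * c') (g i0).
  by move=> u u0; rewrite -(gcon u u0) divfK ?Fs0.
have <- : g i0 = ce (ordS R p c E L i / p%:R)%:C%C; last exact: mg.
have A1 u : UHP u -> ccont (fun t => Fsat (mtau a b c' d t)) u.
  move=> u0; apply: (@ccont_comp _ Fsat (mtau a b c' d)); first exact: (holo_ccont (holo_mtau det1 u0)).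
  by apply: ccont_Fsat; exact: UHP_mtau.
have A2 u : UHP u -> Fsat (mtau a b c' d u) != 0 by move=> u0; apply: Fs0; exact: UHP_mtau.
have A3 : asy (fun t => Fsat (mtau a b c' d t) ^+ p) (p%:R * (ordS R p c E L i / p%:R)).
  have -> : p%:R * (ordS R p c E L i / p%:R) = 0 + ordS R p c E L i.
    by rewrite mulrC divfK ?add0r // pnatr_eq0 -lt0n prime_gt0.
  apply: (@asy_eq _ (fun t => K0 * Wprod p c L E (mtau a b c' d t)) _ _ 0).
    by move=> u u0; rewrite Fsat_p //; exact: UHP_mtau.
  exact: (asyM (asy1 K00) (Wprod_asy_inf R D EA det1 h1 h2)).
have A4 u : UHP u -> Fsat (mtau a b c' d (u + 1)) = g i0 * Fsat (mtau a b c' d u).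
  move=> u0; have <- := mg _ (UHP_mtau det1 u0); rewrite (mtau_comp _ _ _ _ det1 u0).
  have dT : 1 * 1 - 1 * 0 = 1 :> int by [].
  have -> : u + 1 = mtau 1 1 0 1 u by rewrite /mtau /jfac mul0r add0r divr1 mul1r.
  rewrite (mtau_comp _ _ _ _ dT u0).
  have e01 : (1 - a * c') * b + a ^+ 2 * d = a * 1 + b * 1.
    by transitivity (b + a * (a * d - b * c')); [ring|rewrite det1; ring].
  have e11 : - c' ^+ 2 * b + (1 + a * c') * d = c' * 1 + d * 1.
    by transitivity (d + c' * (a * d - b * c')); [ring|rewrite det1; ring].
  by rewrite e01 e11; congr (Fsat (mtau _ _ _ _ _)); ring.
exact: (@asy_root R p (fun t => Fsat (mtau a b c' d t)) _ _ p1 A1 A2 A3 A4).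
Qed.

(** With [ord_j / p = Z_j / p^2], the cusp relations give [Z_j = c^(2j) Z_0] modulo [p^2]. So [p^2]
    divides [c^2 Z_i - Z_(i+1)], which is [p] times a sum with last term [Cv] at level [L] and all
    other terms divisible by [p]. Hence [p] divides [Cv], and [ld_unit] applies. *)
Lemma saturation_step j : (j < H L)%N -> (p %| E L j)%Z.
Proof.
move: j; apply: (ld_unit D L0) => i _; rewrite -/(Cv p c L (E L) i).
have Ls : exists l, L = l.+1 by exists L.-1; rewrite prednK.
have [l lE] := Ls.
have pz : p%:Z != 0 by have := prime_gt0 pp; lia.
have pR : p%:R != 0 :> R by rewrite pnatr_eq0 -lt0n prime_gt0.
have Mz s : (M s)%:Z *+ 2 != 0 by have := M0 s; lia.
have ML s : (s < L)%N -> (M L)%:Z = p%:Z ^+ (L - s.+1) * (M s.+1)%:Z.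
  by move=> sL; rewrite (lev_sub p sL) PoszM mulrC; congr (_ * _); elim: (L - s.+1)%N => // n IH; rewrite expnS PoszM IH exprS.
pose O j := \sum_(s < L) p%:Z ^+ (2 * (L - s.+1)) * W p c s.+1 (E s.+1) j.
have [Z ZE] : exists Z : nat -> int, forall j, p%:Z * O j = (M L)%:Z *+ 2 * Z j.
  have Zj j : exists y : int, p%:Z * O j = (M L)%:Z *+ 2 * y.
    suff /dvdzP[y yE] : ((M L)%:Z *+ 2 %| p%:Z * O j)%Z by exists y; rewrite yE mulrC.
    rewrite /O mulr_sumr; apply: rpred_sum => s _; have [u uE] := dvdzP (W_dvd D j (@EA s)).
    apply/dvdzP; exists (p%:Z ^+ (L - s.+1) * u); rewrite uE (ML s) // levS PoszM mul2n -addnn exprD; ring.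
  by exists (fun j => projT1 (cid (Zj j))) => j; case: cid.
have ordZ j : ordS R p c E L j / p%:R = (Z j)%:~R / p%:R ^+ 2.
  have MR : (M L).*2%:R != 0 :> R by rewrite pnatr_eq0 double_eq0 -lt0n.
  rewrite /ordS -/(O j); have := congr1 (fun z : int => z%:~R : R) (ZE j).
  rewrite !rmorphM /= rmorphMn /= -!pmulrn -mul2n natrM => h.
  have M2 : 2 * (M L)%:R != 0 :> R by rewrite -natrM mul2n.
  have -> : (O j)%:~R = 2 * (M L)%:R * (Z j)%:~R / p%:R :> R.
    by apply: (mulfI pR); rewrite h; field.
  have MLR : (M L)%:R != 0 :> R by rewrite pnatr_eq0 -lt0n.
  by field; rewrite ?pR ?MLR.
have ZC j : c ^+ 2 * Z j - Z j.+1 = p%:Z * \sum_(s < L) p%:Z ^+ (L - s.+1) * Cv p c s.+1 (E s.+1) j.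
  apply: (mulfI (Mz L)); transitivity (c ^+ 2 * ((M L)%:Z *+ 2 * Z j) - (M L)%:Z *+ 2 * Z j.+1); first by ring.
  rewrite -!ZE /O mulrCA [in RHS]mulrCA -mulrBr; congr (_ * _).
  rewrite !mulr_sumr -sumrB; apply: eq_bigr => s _.
  transitivity (p%:Z ^+ (2 * (L - s.+1)) * (c ^+ 2 * W p c s.+1 (E s.+1) j - W p c s.+1 (E s.+1) j.+1)); first by ring.
  by rewrite (W_Cv D) (ML s) // mul2n -addnn exprD; ring.
suff p2 : (p%:Z ^+ 2 %| c ^+ 2 * Z i - Z i.+1)%Z.
  move: p2; rewrite ZC expr2 dvdz_mul2l // lE big_ord_recr /= subnn mul1r => h.
  rewrite -[X in (_ %| X)%Z](addKr (\sum_(s < l) p%:Z ^+ (l.+1 - s.+1) * Cv p c s.+1 (E s.+1) i)) rpredD // rpredN.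
  apply: rpred_sum => s _; apply: dvdz_mulr; have sl := ltn_ord s.
  by rewrite subSS -(prednK (_ : 0 < l - s)%N) ?subn_gt0 // exprS dvdz_mulr.
set m : int := (M L)%:Z; set N : int := (M T)%:Z.
have mN : (m %| N)%Z by rewrite /N /m MT PoszM dvdz_mull.
have pm : (p %| m)%Z by rewrite dvdzE; exact: p_dvd_lev.
have Tpos : (0 < T)%N by rewrite /T addn_gt0 L0.
have p2N : (p%:Z ^+ 2 %| N ^+ 2)%Z by apply: dvdz_exp2r; rewrite dvdzE; exact: p_dvd_lev.
have m2N : (m %| N ^+ 2)%Z by apply: dvdz_trans mN _; rewrite expr2 dvdz_mulr.
have [kT kE] : exists k, N = (p ^ k)%N.
  by rewrite /N /lev; case: eqP => [->|_]; [exists T.+2|exists T].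
have cinv a : exists s0, (N ^+ 2 %| s0 * (1 - a * m) - 1)%Z.
  have : coprimez (1 - a * m) (N ^+ 2).
    rewrite coprimezXr // kE coprimezE /= coprimeXr // coprime_sym prime_coprime // -[p]/(`|p%:Z|%N) -dvdzE.
    apply/negP => h; have : (p %| (1 - a * m) + a * m)%Z by rewrite rpredD // dvdz_mull.
    by rewrite subrK dvdzE dvdn1 /=; have := p1; lia.
  by case/coprimezP => -[u v] /= uv; exists u; apply/dvdzP; exists (- v); rewrite -[X in _ - X]uv; ring.
have Del (x b y d : int) : x * d - b * y = 1 -> (m %| y)%Z -> (N %| x - 1)%Z -> (N ^+ 2 %| b)%Z -> mult Fsat x b y d 1.
  by move=> *; exact: Fsat_Delta.
have FT : mult Fsat 1 1 0 1 (ce ((Z 0%N)%:~R / p%:R ^+ 2 : R)%:C%C).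
  have d1 : 1 * 1 - 0 * 0 = 1 :> int by [].
  have := @Fsat_parabolic 1 0 0 1 0%N d1 (dvdz0 _); rewrite expr0 subrr dvdz0 ordZ => /(_ isT).
  by apply: mult_eq.
(* From [cusp_relation2] with [a = 1], because [(1 - s0) (1 - m) = -m] modulo [N^2]. The factor 2
   can be cancelled for odd [p]; for [p = 2] already [4 | m]. *)
have rel2 : (p%:Z ^+ 2 %| Z 0%N * m)%Z.
  have [s0 s0E] := cinv 1; have [n nE] := cusp_relation2 Fsat_neq0 Del FT s0E.
  have {}nE : 2 * Z 0%N * (1 - s0) = n * p%:Z ^+ 2.
    apply: (intr_inj (R := R)); rewrite rmorphM [in RHS]rmorphM /= rmorphXn /= -nE rmorphM /= -pmulrn; field.
    by [].
  have [k kE'] := dvdzP s0E.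
  have p2 : (p%:Z ^+ 2 %| 2 * (Z 0%N * m))%Z.
    have -> : 2 * (Z 0%N * m) = - (2 * Z 0%N * (1 - s0) * (1 - 1 * m)) - 2 * Z 0%N * (s0 * (1 - 1 * m) - 1) by ring.
    rewrite nE kE'; apply: rpredB; first by rewrite rpredN; apply: dvdz_mulr; exact: dvdz_mull.
    by apply: dvdz_mull; apply: dvdz_mull.
  have [po|pe] := boolP (odd p).
    rewrite -(@Gauss_dvdzr _ 2) //; apply: coprimezXl; rewrite coprimezE /= prime_coprime //.
    by rewrite dvdn_prime2 //; apply: contraTneq po => ->.
  have p2' : p = 2%N by apply/prime_oddPn.
  apply: dvdz_mull; rewrite /m p2' /lev /= !expnS mulnA PoszM; exact: dvdz_mulr.
(* [s0] is 1 modulo [m], so [1 + (a^2 - 1) s0] can be replaced by [a^2] at the cost of a multiple of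
   [Z_0 m]. *)
have Zrel i' : (p%:Z ^+ 2 %| Z i' - Z 0%N * (c ^+ i') ^+ 2)%Z.
  set a := c ^+ i'; have [s0 s0E] := cinv a.
  have cop : coprimez a m by rewrite coprimez_sym; apply: coprimezXr; exact: (ld_coprime D).
  have /coprimezP[[u v] /= uv] := cop.
  have d1 : a * u - (- v) * m = 1 by rewrite -uv; ring.
  have FP := @Fsat_parabolic a (- v) m u i' d1 (dvdzz _).
  rewrite -/a subrr dvdz0 ordZ in FP; have {}FP := FP isT.
  have [n nE] := cusp_relation Fsat_neq0 Del FT s0E FP.
  have {}nE : Z i' - Z 0%N * (1 + (a ^+ 2 - 1) * s0) = n * p%:Z ^+ 2.
    apply: (intr_inj (R := R)); rewrite [in RHS]rmorphM /= rmorphXn /= -nE rmorphB rmorphM /= -pmulrn; field.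
    by [].
  have [k kE'] := dvdzP s0E; have [n2 n2E] := dvdzP m2N.
  have -> : Z i' - Z 0%N * a ^+ 2 = (Z i' - Z 0%N * (1 + (a ^+ 2 - 1) * s0)) +
     Z 0%N * (a ^+ 2 - 1) * ((s0 * (1 - a * m) - 1) + m * (s0 * a)) by ring.
  rewrite nE kE' n2E; apply: rpredD; first exact: dvdz_mull.
  have -> : Z 0%N * (a ^+ 2 - 1) * (k * (n2 * m) + m * (s0 * a)) = (Z 0%N * m) * ((a ^+ 2 - 1) * (k * n2 + s0 * a)) by ring.
  exact: dvdz_mulr.
have -> : c ^+ 2 * Z i - Z i.+1 = c ^+ 2 * (Z i - Z 0%N * (c ^+ i) ^+ 2) - (Z i.+1 - Z 0%N * (c ^+ i.+1) ^+ 2).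
  by rewrite (exprS c i); ring.
by apply: rpredB => //; apply: dvdz_mull.
Qed.

End SaturationStep.

(** * Modular units and the congruence conditions *)

Section ModularUnits.
Variable R : realType.
Local Notation C := (R[i]^o).
Implicit Types (f g F G h : C -> C) (tau : C).
Local Opaque phi ce K.

Definition regular_unit h := forall t : C, UHP t -> cregular h t /\ h t != 0.

Lemma holo_cregular_UHP h (t : C) : UHP t -> (forall u, UHP u -> holo h u) -> cregular h t.
Proof.
move=> t0 hh; split; first exact: holo_ccont (hh t t0).
by have [d d0 dP] := UHP_open t0; exists d => // w _ /dP; exact: hh.
Qed.

Lemma regular_unitM f g : regular_unit f -> regular_unit g -> regular_unit (fun t => f t * g t).
Proof.
move=> fU gU t t0; have [[fc [d d0 dP]] f0] := fU t t0; have [[gc [e e0 eP]] g0] := gU t t0.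
split; last by rewrite mulf_neq0.
split; first exact: ccontM.
exists (Num.min d e); first by rewrite lt_min d0.
move=> w wt; rewrite lt_min => /andP[w1 w2]; exact: (holoM (dP w wt w1) (eP w wt w2)).
Qed.

Lemma regular_unitV f : regular_unit f -> regular_unit (fun t => (f t)^-1).
Proof.
move=> fU t t0; have [[fc [d d0 dP]] f0] := fU t t0.
split; last by rewrite invr_eq0.
split; first exact: ccontV.
have [e e0 eP] := UHP_open t0; exists (Num.min d e); first by rewrite lt_min d0.
move=> w wt; rewrite lt_min => /andP[w1 w2]; apply: (holoV _ (dP w wt w1)).
by have [] := fU w (eP w w2).
Qed.

Lemma regular_unit_cst (k : C) : k != 0 -> regular_unit (fun=> k).
Proof.
by move=> k0 t t0; split=> //; apply: holo_cregular_UHP => // u _; exact: holo_cst.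
Qed.

Lemma regular_unitXz f (n : int) : regular_unit f -> regular_unit (fun t => f t ^ n).
Proof.
move=> fU; have nat (k : nat) : regular_unit (fun t => f t ^+ k).
  elim: k => [|k IH]; first by apply: regular_unit_cst; exact: (@oner_neq0 R[i]).
  by under eq_fun do rewrite exprS; exact: regular_unitM.
by case: n => n; [exact: nat|exact: (regular_unitV (nat n.+1))].
Qed.

Variables (p : nat) (c : int).
Hypothesis D : leveldata p c.
Local Notation M := (lev p).
Local Notation H := (hlev p).
Let pp := ld_prime D.
Let M0 t : (0 < M t)%N := lev_gt0 pp t.
Variable T : nat.
Hypothesis T0 : (0 < T)%N.

(* h has order x i at the cusps (a : c') with N | c', a = +-c^i mod N, and order 0 at the others *)
Definition cusp_orders h (x : nat -> int) := forall a b c' d : int, a * d - b * c' = 1 ->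
  ((M T %| c')%Z -> forall i, (i < H T)%N -> (M T %| a - c ^+ i)%Z || (M T %| a + c ^+ i)%Z ->
     asy (fun t => h (mtau a b c' d t)) (x i)%:~R) /\
  (~~ (M T %| c')%Z -> asy (fun t => h (mtau a b c' d t)) 0).

Definition modular_unit (x : nat -> int) := exists h, [/\ inv1 (M T) h, regular_unit h & cusp_orders h x].

Lemma cusp_orders_lin f g (a b : int) x z : cusp_orders f x -> cusp_orders g z ->
  cusp_orders (fun t => f t ^ a * g t ^ b) (fun j => a * x j + b * z j).
Proof.
move=> fx gz a' b' c' d' det1; have [f1 f2] := fx _ _ _ _ det1; have [g1 g2] := gz _ _ _ _ det1.
split=> [h1 i iH h2|h1].
  by rewrite rmorphD !rmorphM /=; apply: asyM; apply: asyXz; [exact: f1|exact: g1].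
rewrite -[X in asy _ X]addr0 -[X in asy _ (X + _)](mulr0 a%:~R) -[X in asy _ (_ + X)](mulr0 b%:~R).
by apply: asyM; apply: asyXz; [exact: f2|exact: g2].
Qed.

Lemma modular_unit_lin (a b : int) x z : modular_unit x -> modular_unit z ->
  modular_unit (fun j => a * x j + b * z j).
Proof.
move=> [f [fi fU fx]] [g [gi gU gz]]; exists (fun t => f t ^ a * g t ^ b); split.
- by move=> a' b' c' d' tau det1 h1 h2 t0; rewrite (fi _ _ _ _ _ det1 h1 h2 t0) (gi _ _ _ _ _ det1 h1 h2 t0).
- by apply: regular_unitM; exact: regular_unitXz.
- exact: cusp_orders_lin.
Qed.

Lemma cusp_orders0_const h : inv1 (M T) h -> regular_unit h -> cusp_orders h (fun=> 0) ->
  forall t t', UHP t -> UHP t' -> h t = h t'.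
Proof.
move=> hi hU h0; apply: (modular_liouville (M0 T) hi) => [t t0|a b c' d det1].
  by case: (hU t t0).
have [h1 h2] := h0 _ _ _ _ det1; have [Nc|Nc] := boolP (M T %| c')%Z; last exact: h2.
have cop : coprimez (M T) a.
  case/dvdzP: Nc => k kE; apply/coprimezP; exists (- b * k, d) => /=.
  by rewrite -[RHS]det1 kE; ring.
have [i iH ia] := ld_gen D T0 cop.
exact: (h1 Nc i iH ia).
Qed.

Lemma eq_cusp_orders h x z : (forall i, (i < H T)%N -> x i = z i) -> cusp_orders h x -> cusp_orders h z.
Proof.
move=> xz hx a b c' d det1; have [h1 h2] := hx _ _ _ _ det1; split=> // Nc i iH ia.
by rewrite -xz //; exact: h1.
Qed.

Definition siegel_rep (x : nat -> int) (E : nat -> nat -> int) :=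
  (forall t, Acl p t (E t.+1)) /\
  forall i, (M T)%:Z *+ 2 * x i = \sum_(t < T) p%:Z ^+ (2 * (T - t.+1)) * W p c t.+1 (E t.+1) i.

Lemma ordS_int x E i : siegel_rep x E -> ordS R p c E T i = (x i)%:~R.
Proof.
move=> [_ xE]; rewrite /ordS -xE rmorphM rmorphMn /= -pmulrn -mul2n natrM.
have MR : (M T)%:R != 0 :> R by rewrite pnatr_eq0 -lt0n.
by field.
Qed.

Lemma siegel_orders x E : siegel_rep x E -> [/\ inv1 (M T) (@Wprod R p c T E), regular_unit (@Wprod R p c T E) &
  cusp_orders (@Wprod R p c T E) x].
Proof.
move=> xE; have [EA _] := xE; split.
- move=> a b c' d tau det1 h1 h2 t0; rewrite (Wprod_Gamma1 D EA det1 t0 h1 h2) (ordS_int _ xE).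
  by rewrite -cplx_int ce_int exp1rz mul1r.
- move=> t t0; split; last exact: (Wprod_neq0 D).
  by apply: holo_cregular_UHP => // u u0; exact: (holo_Wprod D).
- move=> a b c' d det1; split=> [h1 i _ h2|h1]; last exact: (Wprod_asy_other R D EA det1 h1).
  by rewrite -(ordS_int _ xE); exact: (Wprod_asy_inf R D EA det1 h1 h2).
Qed.

Lemma Cond_modular_unit x : per (H T) x -> yy p T T x 0%N = 0 -> Cond p c T x ->
  exists2 m : int, ~~ (p %| m)%Z & modular_unit (fun j => m * x j).
Proof.
move=> xp x0 xC; have [m [E [pm EA xE]]] := Cond_rep D xp x0 xC.
have [h1 h2 h3] := @siegel_orders (fun j => m * x j) E (conj EA xE).
by exists m => //; exists (@Wprod R p c T E).
Qed.

(** [f^p] and the Siegel product have the same orders [p x], so their quotient is constant, and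
    [saturation_step] can be run from the top level downwards. *)
Lemma saturation f x E : inv1 (M T) f -> regular_unit f -> cusp_orders f x ->
  siegel_rep (fun j => p%:Z * x j) E -> exists E', siegel_rep x E'.
Proof.
move=> fi fU fx xE; have [W1 W2 W3] := siegel_orders xE; have [EA xE2] := xE.
pose i0 : C := (0 +i* 1)%C; have i00 : UHP i0 by rewrite /UHP /= ltr01.
pose g (t : C) : C := f t ^ p%:Z * Wprod p c T E t ^ (- 1).
have gi : inv1 (M T) g.
  by move=> a b c' d tau det1 h1 h2 tau0; rewrite /g (fi _ _ _ _ _ det1 h1 h2 tau0) (W1 _ _ _ _ _ det1 h1 h2 tau0).
have gU : regular_unit g by exact: (regular_unitM (regular_unitXz p fU) (regular_unitXz (- 1) W2)).
have g0 : cusp_orders g (fun=> 0).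
  apply: eq_cusp_orders (cusp_orders_lin p (- 1) fx W3) => i _.
  by rewrite mulN1r subrr.
have gc t : UHP t -> g t = g i0 by move=> t0; exact: (cusp_orders0_const gi gU g0 t0 i00).
have K00 : g i0 != 0 by case: (gU i0 i00).
have fp t : UHP t -> f t ^+ p = g i0 * Wprod p c T E t.
  move=> t0; rewrite -(gc t t0) /g exprnP exprN1 divfK //.
  by case: (W2 t t0).
have div n : (n <= T)%N -> forall s j, (T - n <= s < T)%N -> (j < H s.+1)%N -> (p %| E s.+1 j)%Z.
  elim: n => [|n IH] nT s j /andP[s1 s2]; first by rewrite subn0 leqNgt s2 in s1.
  have [s3|s3] := leqP (T - n) s; first by apply: IH; rewrite ?s3 // ltnW.
  have TE : T = (s.+1 + n)%N by lia.
  move: j; have fi' := fi; have fp' := fp; rewrite TE in fi' fp'.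
  apply: (@saturation_step R p c D s.+1 n isT f E (g i0) EA fi' _ _ K00 fp').
  - by move=> t t0; case: (fU t t0) => -[].
  - by move=> t t0; case: (fU t t0).
  - move=> s' j' /andP[h1 h2] jH; apply: IH jH; first exact: ltnW.
    by rewrite -TE in h2; rewrite h2 andbT; lia.
have divE s j : (s < T)%N -> (j < H s.+1)%N -> p%:Z * (E s.+1 j %/ p)%Z = E s.+1 j.
  by move=> sT jH; rewrite mulrC divzK //; apply: (div T (leqnn _)); rewrite ?subnn.
have pz : p%:Z != 0 by have := prime_gt0 pp; lia.
exists (fun s j => if (s <= T)%N then (E s j %/ p)%Z else 0); split.
  move=> s l lh; case: ltnP => sT; last by rewrite big1.
  apply: (mulfI pz); rewrite mulr0 mulr_sumr -[RHS](EA s l lh); apply: eq_bigr => q _.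
  rewrite divE // (rhoE D); have : (q.+1 * H s <= rho p s * H s)%N by rewrite leq_mul2r ltn_ord orbT.
  by apply: leq_trans; rewrite mulSn -addSn leq_add2r.
move=> i; apply: (mulfI pz); rewrite mulrCA xE2 mulr_sumr; apply: eq_bigr => s _.
rewrite mulrCA; congr (_ * _); rewrite /W mulr_sumr; apply: eq_bigr => j _.
by rewrite ltn_ord [RHS]mulrA (divE s j) // ltn_ord.
Qed.

(** [p^(2T) x] satisfies [Cond] trivially, so [m p^(2T) x] is a Siegel divisor for some [m] prime to
    [p]. Since multiples of [x] are divisors of modular units, [saturation] removes the factors [p]
    one at a time, until [m x] is a Siegel divisor. *)
Lemma modular_unit_Cond x : per (H T) x -> yy p T T x 0%N = 0 -> modular_unit x -> Cond p c T x.
Proof.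
move=> xp x0 [h [hi hU hx]].
have main k m E : siegel_rep (fun j => m * (p%:Z ^+ k * x j)) E -> exists E', siegel_rep (fun j => m * x j) E'.
  elim: k E => [|k IH] E xE.
    by exists E; case: xE => EA xE; split=> // i; rewrite -xE mul1r.
  have mU : modular_unit (fun j => (m * p%:Z ^+ k) * x j + 0 * x j).
    by apply: modular_unit_lin; exists h.
  have [f [fi fU fx]] := mU.
  have [|E' [EA' E'x]] := @saturation f _ E fi fU fx.
    by case: xE => EA xE; split=> // i; rewrite -xE exprS; ring.
  by apply: (IH E'); split=> // i; rewrite -E'x; ring.
have zC : Cond p c T (fun j => p%:Z ^+ (2 * T) * x j).
  move=> t tT; split=> [|i _ _]; rewrite !yyZ.
    by apply: dvdz_mulr; apply: dvdz_exp2l; lia.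
  by rewrite mulrCA -mulrBr; apply: dvdz_mulr; apply: dvdz_exp2l; lia.
have [||m [E [pm EA xE]]] := Cond_rep D _ _ zC.
- by move=> j; rewrite xp.
- by rewrite yyZ x0 mulr0.
have [E' [EA' E'x]] := main (2 * T)%N m E (conj EA xE).
exact: (rep_Cond D pm EA' E'x).
Qed.

End ModularUnits.

(** * Decomposition of finite abelian groups given by congruences *)

Lemma Zp_intr_eq0 (q : nat) (n : int) : (1 < q)%N -> (n%:~R == 0 :> 'Z_q) = (q %| n)%Z.
Proof.
move=> q1; rewrite dvdzE /=; have nat_eq0 (m : nat) : (m%:R == 0 :> 'Z_q) = (q %| m)%N.
  by rewrite -(inj_eq val_inj) /= val_Zp_nat.
case: n => m; first exact: (nat_eq0 m).
by rewrite NegzE rmorphN oppr_eq0 /=; exact: (nat_eq0 m.+1).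
Qed.

(** The forms embed [G], the quotient of [A] by the common kernel, into the product of the [Z/q];
    the last hypothesis, a Chinese remainder property, makes the embedding onto. *)
Lemma primary_decomposition_forms (A G : zmodType) (psi : A -> G) (K : eqType) (s : seq K)
    (phi : K -> A -> int) (q : K -> nat) :
  {morph psi : x y / x + y} -> (forall g, exists x, psi x = g) -> uniq s ->
  (forall k, k \in s -> exists l e : nat, [/\ prime l, (0 < e)%N & q k = (l ^ e)%N]) ->
  (forall k, {morph phi k : x y / x + y}) ->
  (forall x, psi x = 0 <-> forall k, k \in s -> (q k %| phi k x)%Z) ->
  (forall n : K -> int, exists x, forall k, k \in s -> (q k %| phi k x - n k)%Z) ->
  primary_decomposition G (map q s).
Proof.
move=> psiD psiS us qs phiD ker surj; split.
  by move=> _ /mapP[k ks ->]; exact: qs.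
have q1 k : k \in s -> (1 < q k)%N.
  move=> /qs[l [e [lp e0 ->]]]; apply: leq_trans (prime_gt1 lp) _.
  by rewrite -{1}[l]expn1 leq_exp2l // prime_gt1.
(* The empty list is treated apart, since [nth] needs a default key. *)
case: s us qs ker surj q1 => [|k0 s0] us qs ker surj q1.
  exists (fun _ i => 0); last by move=> x y [].
  exists (fun=> 0) => [g|f]; last by apply: functional_extensionality_dep => -[].
  by have [x <-] := psiS g; apply/esym; apply/ker.
set s := k0 :: s0 in us qs ker surj q1 *.
pose kk (i : 'I_(size (map q s))) := nth k0 s i.
have iS (i : 'I_(size (map q s))) : (i < size s)%N by rewrite -(size_map q) ltn_ord.
have ks i : kk i \in s by apply: mem_nth; exact: iS.
have qE (i : 'I_(size (map q s))) : nth 0%N (map q s) i = q (kk i) by rewrite (nth_map k0) //; exact: iS.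
have Zq (i : 'I_(size (map q s))) (n : int) : (n%:~R == 0 :> 'Z_(nth 0%N (map q s) i)) = (q (kk i) %| n)%Z.
  by rewrite Zp_intr_eq0 qE ?q1.
have psiB x y : psi (x - y) = psi x - psi y by apply: (addIr (psi y)); rewrite -psiD !subrK.
have phiB k x y : phi k (x - y) = phi k x - phi k y by apply: (addIr (phi k y)); rewrite -phiD !subrK.
pose pre g := projT1 (cid (psiS g)).
have preE g : psi (pre g) = g by rewrite /pre; case: cid.
pose F (g : G) (i : 'I_(size (map q s))) : 'Z_(nth 0%N (map q s) i) := (phi (kk i) (pre g))%:~R.
have FE g (i : 'I_(size (map q s))) x : psi x = g -> F g i = (phi (kk i) x)%:~R.
  move=> xg; apply/eqP; rewrite /F -subr_eq0 -rmorphB Zq -phiB; have /ker h : psi (pre g - x) = 0 by rewrite psiB preE xg subrr.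
  exact: h.
exists F; last first.
  move=> x y i; rewrite (@FE (x + y) i (pre x + pre y)) ?psiD ?preE //.
  by rewrite /F phiD rmorphD.
have inj : injective F.
  move=> g h gh; apply/eqP; rewrite -subr_eq0 -(preE g) -(preE h) -psiB; apply/eqP/ker => k kS.
  have jS : (index k s < size (map q s))%N by rewrite size_map index_mem.
  have kE : kk (Ordinal jS) = k by rewrite /kk nth_index.
  have := congr1 (fun f => f (Ordinal jS)) gh; rewrite /F => /eqP.
  by rewrite -subr_eq0 -rmorphB Zq kE phiB.
have sur f : exists g, F g = f.
  pose n k : int := if insub (index k s) is Some i then (f i : nat)%:Z else 0.
  have [x xn] := surj n; exists (psi x); apply: functional_extensionality_dep => i.
  rewrite (FE _ i x erefl); have := xn _ (ks i); rewrite /n.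
  have -> : index (kk i) s = i by rewrite index_uniq //; exact: iS.
  rewrite valK => h; apply/eqP; rewrite -subr_eq0.
  by move: h; rewrite -(Zq i) rmorphB /= -pmulrn natr_Zp.
exists (fun f => projT1 (cid (sur f))) => [g|f]; last by case: cid.
by case: cid => g' /= /inj.
Qed.

Lemma chinese_seq (n : nat -> int) (q : nat -> nat) (s : seq nat) :
  uniq s -> (forall k l, k \in s -> l \in s -> k != l -> coprime (q k) (q l)) ->
  exists y : int, forall k, k \in s -> (q k %| y - n k)%Z.
Proof.
elim: s => [|a s IH] /=; first by exists 0.
move=> /andP[as_ us] cop; have [|y yP] := IH us.
  by move=> k l ks ls; apply: cop; rewrite inE ?ks ?ls orbT.
pose Q := (\prod_(k <- s) q k)%N.
have copa : coprimez (q a) Q.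
  rewrite coprimezE /= /Q big_seq; elim/big_rec: _ => [|k x ks]; first exact: coprimen1.
  rewrite coprimeMr => ->; rewrite andbT; apply: cop; rewrite ?inE ?eqxx ?ks ?orbT //.
  by apply: contraNneq as_ => ->.
exists (zchinese (q a) Q (n a) y) => k; rewrite inE => /orP[/eqP ->|ks].
  by rewrite -eqz_mod_dvd; apply/eqP; exact: zchinese_modl.
rewrite -(subrKA y); apply: rpredD; last exact: yP.
have : (Q %| zchinese (q a) Q (n a) y - y)%Z by rewrite -eqz_mod_dvd; apply/eqP; exact: zchinese_modr.
by apply: dvdz_trans; rewrite dvdzE /= /Q (big_rem k) //= dvdn_mulr.
Qed.

Lemma card_Zp_torsion (p q : nat) : prime p -> (1 < q)%N ->
  #|[pred z : 'Z_q | z *+ p == 0]| = (if p %| q then p else 1)%N.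
Proof.
move=> pp q1; have zE (z : 'Z_q) : (z *+ p == 0) = (q %| z * p)%N.
  by rewrite -{1}[z]natr_Zp -mulrnA; have := Zp_intr_eq0 (Posz (z * p)) q1; rewrite dvdzE.
have zlt (z : 'Z_q) : (z < q)%N by rewrite -[X in (_ < X)%N](Zp_cast q1) ltn_ord.
have [pq|pq] := boolP (p %| q)%N; last first.
  rewrite -(card1 (0 : 'Z_q)); apply: eq_card => z; rewrite !inE zE Gauss_dvdl; last first.
    by rewrite coprime_sym prime_coprime.
  rewrite -(inj_eq val_inj) /=; have := zlt z; case: (z : nat) => [|m] ml; first by rewrite dvdn0 eqxx.
  by rewrite gtnNdvd.
case/dvdnP: pq => q' qE; have q'0 : (0 < q')%N by case: q' qE => // q0; move: q1; rewrite q0.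
pose f (k : 'I_p) : 'Z_q := (q' * k)%:R.
have fE k : f k = (q' * k)%N :> nat.
  by rewrite /f val_Zp_nat // modn_small // qE ltn_mul2l q'0 ltn_ord.
have fi : injective f.
  move=> k l /(congr1 val); rewrite /= !fE => /eqP; rewrite eqn_mul2l gtn_eqF //= => /eqP.
  exact: val_inj.
rewrite -[RHS]card_ord -(card_codom fi); apply: eq_card => z; rewrite !inE zE.
have -> : (q %| z * p)%N = (q' %| z)%N by rewrite [X in (X %| _)%N]qE dvdn_pmul2r ?prime_gt0.
apply/idP/codomP => [/dvdnP[k zk]|[k ->]]; last by rewrite fE dvdn_mulr.
have kp : (k < p)%N by have := zlt z; rewrite zk qE mulnC ltn_mul2l q'0.
by exists (Ordinal kp); apply: val_inj; rewrite /= fE zk mulnC.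
Qed.

Lemma primary_decomposition_rank (G : zmodType) (s : seq nat) (p : nat) : prime p ->
  primary_decomposition G s -> is_p_rank G p (count (dvdn p) s).
Proof.
move=> pp [sP [phi [psi phiK psiK] phiD]].
have q1 (i : 'I_(size s)) : (1 < nth 0%N s i)%N.
  have /sP[l [e [lp e0 ->]]] := mem_nth 0%N (ltn_ord i).
  by apply: leq_trans (prime_gt1 lp) _; rewrite -{1}[l]expn1 leq_exp2l // prime_gt1.
have phi0 i : phi 0 i = 0 by apply: (addIr (phi 0 i)); rewrite -phiD !add0r.
have phiMn x n i : phi (x *+ n) i = phi x i *+ n.
  by elim: n => [|n IH]; rewrite ?mulr0n // !mulrS phiD IH.
pose F (i : 'I_(size s)) := [pred z : 'Z_(nth 0%N s i) | z *+ p == 0].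
pose S := enum (family F : {pred {dffun forall i : 'I_(size s), 'Z_(nth 0%N s i)}}).
pose f0 : {dffun forall i : 'I_(size s), 'Z_(nth 0%N s i)} := [ffun i => 0].
have szS : size S = (p ^ count (dvdn p) s)%N.
  rewrite -cardE card_family foldrE big_map big_enum /=.
  under eq_bigr => i _ do rewrite (card_Zp_torsion pp (q1 i)).
  pose f x := if (p %| x)%N then p else 1%N.
  have -> : (\prod_(i < size s) f (nth 0%N s i) = \prod_(x <- s) f x)%N by rewrite (big_nth 0%N) big_mkord.
  by rewrite /f -big_mkcond /= big_const_seq iter_muln_1.
pose g k : G := psi (fun i => nth f0 S k i).
have inE' k : (k < size S)%N -> forall i, nth f0 S k i *+ p = 0.
  by move=> kS i; have := mem_nth f0 kS; rewrite mem_enum => /familyP /(_ i) /eqP.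
rewrite /is_p_rank -szS.
have -> : [set x : G | x *+ p = 0] = [set g k | k in `I_(size S)].
  apply/seteqP; split=> [x /= xp|_ [k /= kS <-] /=]; last first.
    apply: (can_inj phiK); apply: functional_extensionality_dep => i.
    by rewrite phi0 phiMn /g psiK inE'.
  pose f : {dffun forall i : 'I_(size s), 'Z_(nth 0%N s i)} := [ffun i => phi x i].
  have fS : f \in S.
    rewrite mem_enum; apply/familyP => i; rewrite ffunE inE /= -phiMn xp phi0.
    by rewrite eqxx.
  exists (index f S); first by rewrite /= index_mem.
  rewrite /g nth_index // -[RHS]phiK; congr psi; apply: functional_extensionality_dep => i.
  by rewrite ffunE.
apply: inj_card_eq => k l; rewrite !mem_setE /= => kS lS /(congr1 phi); rewrite /g !psiK => e.
apply/eqP; rewrite -(nth_uniq f0 kS lS) ?enum_uniq //; apply/eqP/ffunP => i.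
exact: (congr1 (fun h => h i) e).
Qed.

(** Containing [m Z^h], the lattice is spanned by its vectors with entries in [[0, m)] together with
    [m] times the unit vectors. The Smith form of this finite matrix provides [B] and [d], and
    [d i | m] because [m Z^h] lies in the lattice. *)
Lemma smith_lattice (h m : nat) (P : 'rV[int]_h -> Prop) : (0 < m)%N ->
  (forall a b x y, P x -> P y -> P (a *: x + b *: y)) -> (forall x, P (m%:Z *: x)) ->
  exists B : 'M[int]_h, exists2 d : 'I_h -> nat, B \in unitmx /\ (forall i, d i %| m)%N &
    forall x, P x <-> forall i, (d i %| (x *m B) 0%R i)%Z.
Proof.
move=> m0 Plin Pm; have P0 : P 0 by have := Pm 0; rewrite scaler0.
pose vec (f : {ffun 'I_h -> 'I_m}) : 'rV[int]_h := \row_j (f j : nat)%:Z.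
pose M1 : 'M[int]_(#|{ffun 'I_h -> 'I_m}|, h) :=
  \matrix_k (if `[< P (vec (enum_val k)) >] then vec (enum_val k) else 0).
pose M := col_mx M1 (m%:Z%:M : 'M[int]_h).
have MP x : P x <-> exists u, x = u *m M.
  split=> [Px|[u ->]]; last first.
    rewrite -[u]hsubmxK mul_row_col mul_mx_scalar -[X in P (X + _)]scale1r -[X in P (_ + X)]scale1r.
    apply: (Plin) => //; rewrite mulmx_sum_row; apply: (big_ind P) => // [y z Py Pz|k _].
      by rewrite -[y]scale1r -[z]scale1r; exact: Plin.
    rewrite -[X in P X]addr0 -[X in P (_ + X)](scale0r 0); apply: (Plin) => //; rewrite rowK.
    by case: asboolP.
  pose w : 'rV[int]_h := \row_j (x 0%R j %/ m)%Z.
  have rm j : (`|(x 0%R j %% m)%Z| < m)%N.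
    have m0z : 0 < m%:Z by rewrite ltz_nat.
    move: (ltz_pmod (x 0 j) m0z) (modz_ge0 (x 0 j) (lt0r_neq0 m0z)).
    by case: (x 0%R j %% m)%Z => k //; rewrite ltz_nat.
  pose f : {ffun 'I_h -> 'I_m} := [ffun j => Ordinal (rm j)].
  have xE : vec f = x - m%:Z *: w.
    apply/rowP => j; rewrite !mxE ffunE /= gez0_abs ?modz_ge0 //; last by lia.
    by rewrite {2}(divz_eq (x 0 j) m) mulrC addrAC subrr add0r.
  have Pf : P (vec f).
    by rewrite xE -[X in X - _]scale1r -scaleN1r; apply: Plin.
  exists (row_mx (delta_mx 0 (enum_rank f)) w).
  rewrite mul_row_col mul_mx_scalar -rowE rowK enum_rankK; case: asboolP => // _.
  by rewrite xE subrK.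
have [L Lu [R Ru [d _ ME]]] := int_Smith_normal_form M.
exists (invmx R).
have key x : P x <-> forall i : 'I_h, (absz (nth 0%R d i) %| (x *m invmx R) 0%R i)%Z.
  rewrite MP ME; split=> [[u ->] i|dx].
    rewrite !mulmxA mulmxK // mxE; apply: rpred_sum => j _; rewrite [X in _ * X]mxE.
    case: (nat_of_ord j =P i) => [->|_]; last by rewrite mulr0n mulr0 dvdz0.
    by rewrite mulr1n; apply: dvdz_mull; rewrite dvdzE.
  pose v : 'rV[int]_(#|{ffun 'I_h -> 'I_m}| + h) :=
    \row_j (if insub (j : nat) is Some i then ((x *m invmx R) 0%R (i : 'I_h) %/ d`_i)%Z else 0).
  exists (v *m invmx L); rewrite !mulmxA mulmxKV //; apply: (can_inj (mulmxKV Ru)).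
  rewrite mulmxK //; apply/rowP => i; rewrite [RHS]mxE.
  have ih : (i < #|{ffun 'I_h -> 'I_m}| + h)%N by rewrite (leq_trans (ltn_ord i)) ?leq_addl.
  rewrite (bigD1 (Ordinal ih)) //= big1 => [|j ji]; last first.
    by rewrite [X in _ * X]mxE; case: (nat_of_ord j =P i) => [e|_]; [case/eqP: ji; exact: val_inj|rewrite mulr0n mulr0].
  by rewrite addr0 !mxE eqxx mulr1n /= valK divzK //; have := dx i; rewrite !mxE !dvdzE.
exists (fun i : 'I_h => absz (nth 0 d i)); last exact: key.
split=> [|i]; first by rewrite unitmx_inv.
have := (proj1 (key _) (Pm (delta_mx 0 i *m R))) i.
by rewrite -scalemxAl mulmxK // !mxE !eqxx mulr1 dvdzE.
Qed.

(** * Matrices of determinant 1 and their action on cusps *)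

Definition mk2 (a b c d : int) : 'M[int]_2 :=
  \matrix_(i, j) if i == 0 then (if j == 0 then a else b) else (if j == 0 then c else d).

Lemma mk2E a b c d : (mk2 a b c d 0 0 = a) * (mk2 a b c d 0 1 = b) *
  (mk2 a b c d 1 0 = c) * (mk2 a b c d 1 1 = d).
Proof. by rewrite !mxE. Qed.

Lemma mx2P (g h : 'M[int]_2) : g 0 0 = h 0 0 -> g 0 1 = h 0 1 -> g 1 0 = h 1 0 -> g 1 1 = h 1 1 -> g = h.
Proof.
move=> e00 e01 e10 e11; apply/matrixP.
by case=> [[|[|//]] i] [[|[|//]] j]; [move: e00|move: e01|move: e10|move: e11]; congr (g _ _ = h _ _); exact: val_inj.
Qed.

Lemma mul2E (g h : 'M[int]_2) i j : (g *m h) i j = g i 0 * h 0 j + g i 1 * h 1 j.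
Proof.
rewrite mxE !big_ord_recl big_ord0 addr0; congr (_ + g i _ * h _ _); exact: val_inj.
Qed.

Lemma det2E (g : 'M[int]_2) : \det g = g 0 0 * g 1 1 - g 0 1 * g 1 0.
Proof.
rewrite (expand_det_row _ 0) !big_ord_recl big_ord0 addr0 /cofactor !det_mx11 !mxE /=.
have -> : fintype.lift ord0 ord0 = 1 :> 'I_2 by exact: val_inj.
have -> : fintype.lift (1 : 'I_2) ord0 = 0 :> 'I_2 by exact: val_inj.
by rewrite expr0 expr1; ring.
Qed.

Lemma SL2P (g : 'M[int]_2) : SL2Z g <-> g 0 0 * g 1 1 - g 0 1 * g 1 0 = 1.
Proof. by rewrite /SL2Z det2E. Qed.

Lemma SL2_mk a b c d : a * d - b * c = 1 -> SL2Z (mk2 a b c d).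
Proof. by move=> h; apply/SL2P; rewrite !mk2E. Qed.

Lemma SL2M g h : SL2Z g -> SL2Z h -> SL2Z (g *m h).
Proof. by rewrite /SL2Z det_mulmx => -> ->. Qed.

Lemma SL2_inv (g : 'M[int]_2) : SL2Z g -> invmx g = mk2 (g 1 1) (- g 0 1) (- g 1 0) (g 0 0).
Proof.
move=> gS; have gu : g \in unitmx by rewrite unitmxE gS unitr1.
apply: (can_inj (mulKmx gu)); rewrite mulmxV //; have /SL2P h := gS.
by apply: mx2P; rewrite !mul2E !mk2E !mxE /= -?h; ring.
Qed.

Lemma SL2V g : SL2Z g -> SL2Z (invmx g).
Proof. by move=> gS; rewrite SL2_inv //; apply: SL2_mk; move/SL2P: gS => <-; ring. Qed.

Lemma SL2_opp (g : 'M[int]_2) : SL2Z g -> SL2Z (- g).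
Proof. by move/SL2P => h; apply/SL2P; rewrite !mxE -h; ring. Qed.

Lemma Gamma1P N (g : 'M[int]_2) : Gamma1 N g <->
  [/\ SL2Z g, (N %| g 0%R 0%R - 1)%Z, (N %| g 1%R 1%R - 1)%Z & (N %| g 1%R 0%R)%Z].
Proof.
split=> -[? h1 h2 ?]; split=> //; first by rewrite -eqz_mod_dvd; apply/eqP.
- by rewrite -eqz_mod_dvd; apply/eqP.
- by apply/eqP; rewrite eqz_mod_dvd.
- by apply/eqP; rewrite eqz_mod_dvd.
Qed.

Lemma Gamma1M N g h : Gamma1 N g -> Gamma1 N h -> Gamma1 N (g *m h).
Proof.
move=> /Gamma1P[g0 g1 g2 g3] /Gamma1P[h0 h1 h2 h3]; apply/Gamma1P; split; first exact: SL2M.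
- rewrite mul2E.
  have -> : g 0 0 * h 0 0 + g 0 1 * h 1 0 - 1 = (g 0 0 - 1) * h 0 0 + (h 0 0 - 1) + g 0 1 * h 1 0 by ring.
  apply: rpredD; first by apply: rpredD => //; exact: dvdz_mulr.
  exact: dvdz_mull.
- rewrite mul2E.
  have -> : g 1 0 * h 0 1 + g 1 1 * h 1 1 - 1 = g 1 0 * h 0 1 + (g 1 1 - 1) * h 1 1 + (h 1 1 - 1) by ring.
  apply: rpredD => //; apply: rpredD; first exact: dvdz_mulr.
  exact: dvdz_mulr.
- by rewrite mul2E; apply: rpredD; [exact: dvdz_mulr|exact: dvdz_mull].
Qed.

Lemma Gamma1V N g : Gamma1 N g -> Gamma1 N (invmx g).
Proof.
move=> /Gamma1P[g0 g1 g2 g3]; apply/Gamma1P; rewrite SL2_inv // !mk2E; split=> //; last by rewrite rpredN.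
by have := SL2V g0; rewrite SL2_inv.
Qed.

Lemma Gamma1_1 N : Gamma1 N 1%:M.
Proof.
apply/Gamma1P; split; [exact: det1|..]; by rewrite !mxE /= ?subrr dvdz0.
Qed.

(* a / c as a point of P^1(Q) *)
Definition frac (a c : int) : option rat := if c == 0 then None else Some (a%:~R / c%:~R).

Lemma cusp_act_oo (g : 'M[int]_2) : cusp_act g None = frac (g 0 0) (g 1 0).
Proof. by rewrite /cusp_act /frac intr_eq0. Qed.

Lemma cusp_act_frac (g : 'M[int]_2) (u v : int) : SL2Z g -> (u != 0) || (v != 0) ->
  cusp_act g (frac u v) = frac (g 0 0 * u + g 0 1 * v) (g 1 0 * u + g 1 1 * v).
Proof.
move=> /SL2P g1; rewrite {1}/frac; case: (v =P 0) => [-> /=|/eqP v0 _]; last first.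
  have vr : v%:~R != 0 :> rat by rewrite intr_eq0.
  have E (x y : int) : x%:~R * (u%:~R / v%:~R) + y%:~R = (x * u + y * v)%:~R / v%:~R :> rat.
    have -> : (x * u + y * v)%:~R = x%:~R * u%:~R + y%:~R * v%:~R :> rat by rewrite intrD !intrM.
    by rewrite mulrDl mulfK // mulrA.
  rewrite /cusp_act !E mulf_eq0 invr_eq0 (negbTE vr) orbF intr_eq0 /frac; case: eqP => // /eqP h.
  by congr Some; rewrite invf_div mulrA divfK.
rewrite orbF => u0; rewrite !mulr0 !addr0 cusp_act_oo /frac mulf_eq0 (negbTE u0) orbF.
case: eqP => // /eqP h; congr Some.
by rewrite !intrM invfM mulrACA divff ?mulr1 // intr_eq0.
Qed.

Lemma col1_neq0 (g : 'M[int]_2) : SL2Z g -> (g 0 0 != 0) || (g 1 0 != 0).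
Proof.
move=> /SL2P h; rewrite -negb_and; apply/negP => /andP[/eqP a /eqP b].
by move: h; rewrite a b mul0r mulr0 subrr.
Qed.

Lemma cusp_actM_oo (g h : 'M[int]_2) : SL2Z g -> SL2Z h -> cusp_act g (cusp_act h None) = cusp_act (g *m h) None.
Proof. by move=> gS hS; rewrite !cusp_act_oo cusp_act_frac ?col1_neq0 // !mul2E. Qed.

Lemma cusp_transitive (s : option rat) : exists2 g, SL2Z g & cusp_act g None = s.
Proof.
case: s => [x|]; last first.
  by exists 1%:M; [exact: det1|rewrite cusp_act_oo !mxE].
have : coprimez (numq x) (denq x) by rewrite coprimezE coprime_num_den.
case/coprimezP => -[u v] /= uv; exists (mk2 (numq x) (- v) (denq x) u).
  by apply: SL2_mk; rewrite -uv; ring.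
by rewrite cusp_act_oo !mk2E /frac (negbTE (denq_neq0 _)) divq_num_den.
Qed.

Lemma cusp_actM (g h : 'M[int]_2) s : SL2Z g -> SL2Z h -> cusp_act g (cusp_act h s) = cusp_act (g *m h) s.
Proof.
move=> gS hS; have [k kS <-] := cusp_transitive s.
by rewrite !cusp_actM_oo ?mulmxA //; exact: SL2M.
Qed.

Lemma cusp_act1 s : cusp_act 1%:M s = s.
Proof.
have [k kS <-] := cusp_transitive s.
by rewrite cusp_actM_oo ?mul1mx //; exact: det1.
Qed.

(** Proportional first columns of matrices of determinant 1 differ by a factor that is a unit of the
    integers. *)
Lemma cusp_oo_eq (g h : 'M[int]_2) : SL2Z g -> SL2Z h -> cusp_act g None = cusp_act h None ->
  (g 0 0 = h 0 0 /\ g 1 0 = h 1 0) \/ (g 0 0 = - h 0 0 /\ g 1 0 = - h 1 0).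
Proof.
move=> /SL2P gS /SL2P hS; rewrite !cusp_act_oo /frac => e.
have cr : g 0 0 * h 1 0 = h 0 0 * g 1 0.
  move: e; case: eqP => [->|/eqP a]; case: eqP => [->|/eqP b] //; first by rewrite !mulr0.
  move=> [] /eqP; rewrite eqr_div ?intr_eq0 // -!rmorphM /= => /eqP /intr_inj.
  by [].
pose k := h 0 0 * g 1 1 - g 0 1 * h 1 0.
have k0 : h 0 0 = k * g 0 0.
  transitivity (h 0 0 * (g 0 0 * g 1 1 - g 0 1 * g 1 0)); first by rewrite gS mulr1.
  by transitivity (h 0 0 * g 0 0 * g 1 1 - g 0 1 * (h 0 0 * g 1 0)); [ring|rewrite -cr /k; ring].
have k1 : h 1 0 = k * g 1 0.
  transitivity (h 1 0 * (g 0 0 * g 1 1 - g 0 1 * g 1 0)); first by rewrite gS mulr1.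
  by transitivity ((g 0 0 * h 1 0) * g 1 1 - g 0 1 * g 1 0 * h 1 0); [ring|rewrite cr /k; ring].
have : k \is a GRing.unit.
  apply/unitrPr; exists (g 0 0 * h 1 1 - h 0 1 * g 1 0).
  by rewrite -[RHS]hS k0 k1; ring.
case/orP => /eqP kE; [left|right]; by rewrite k0 k1 kE ?mul1r ?mulN1r ?opprK.
Qed.

From mathcomp Require Import finmap.

Lemma translationE w : translation w = mk2 1 w 0 1.
Proof. by apply: mx2P; rewrite !mxE /=; ring. Qed.

Lemma conj_translation g w : SL2Z g -> g *m translation w *m invmx g =
  mk2 (1 - g 0 0 * g 1 0 * w) (g 0 0 ^+ 2 * w) (- (g 1 0 ^+ 2 * w)) (1 + g 0 0 * g 1 0 * w).
Proof.
move=> gS; rewrite SL2_inv // translationE; move/SL2P: gS => h.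
by apply: mx2P; rewrite !mul2E !mk2E /=; [move: h; nia|ring|ring|move: h; nia].
Qed.

Lemma Gamma1_conj_translation (N w : nat) (g : 'M[int]_2) : SL2Z g -> (N %| g 1%R 0%R * w)%Z -> Gamma1 N (g *m translation w *m invmx g).
Proof.
move=> gS Nd; apply/Gamma1P; rewrite conj_translation // !mk2E; split.
- by apply: SL2_mk; ring.
- by rewrite addrAC subrr sub0r rpredN -mulrA dvdz_mull.
- by rewrite addrAC subrr add0r -mulrA dvdz_mull.
- by rewrite rpredN expr2 -mulrA dvdz_mull.
Qed.

Lemma cusp_width1 (N : nat) (g : 'M[int]_2) : SL2Z g -> (N %| g 1%R 0%R)%Z -> is_cusp_width N g 1.
Proof. by move=> gS Nd; split=> //; left; apply: Gamma1_conj_translation; rewrite ?mulr1. Qed.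

Lemma cusp_width_ex (N : nat) (g : 'M[int]_2) : (0 < N)%N -> SL2Z g -> exists w, is_cusp_width N g w.
Proof.
move=> N0 gS; pose P w := (0 < w)%N && `[< pmGamma1 N (g *m translation w *m invmx g) >].
have exP : exists w, P w.
  exists N; rewrite /P N0 /=; apply/asboolP; left; apply: Gamma1_conj_translation => //.
  exact: dvdz_mull.
exists (ex_minn exP); case: ex_minnP => w /andP[w0 /asboolP ws] wmin; split=> // v v0 vs.
by apply: wmin; rewrite /P v0; apply/asboolP.
Qed.

(** * Points of [X_1(N)], stabilizers and oo-cusps *)

Section Points.
Variable R : realType.
Local Notation C := (R[i]^o).
Variable N : nat.
Hypothesis N4 : (4 <= N)%N.

(** A matrix other than [+-1] with a fixed point in the half-plane has trace -1, 0 or 1, while the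
    trace is [+-2] modulo [N] here; for [N >= 4] the two exclude each other. *)
Lemma mobius_fix (g : 'M[int]_2) (tau : C) : UHP tau -> pmGamma1 N g -> mobius g tau = tau -> g = 1%:M \/ g = - 1%:M.
Proof.
move=> t0 gG gt.
have gS : SL2Z g by case: gG => -[] // h _ _ _; rewrite -[g]opprK; exact: SL2_opp.
have /SL2P det1 := gS; have := mtauK det1 t0; rewrite -[mtau _ _ _ _ _]/(mobius g tau) gt /jfac.
have : (N %| g 0%R 0%R + g 1%R 1%R - 2)%Z \/ (N %| g 0%R 0%R + g 1%R 1%R + 2)%Z.
  case: gG => /Gamma1P[_ h1 h2 _]; [left|right].
    have -> : g 0 0 + g 1 1 - 2 = (g 0 0 - 1) + (g 1 1 - 1) by ring.
    exact: rpredD.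
  have -> : g 0 0 + g 1 1 + 2 = - (((- g) 0 0 - 1) + ((- g) 1 1 - 1)) by rewrite !mxE; ring.
  by rewrite rpredN; exact: rpredD.
have : (g 0 0 = 1 /\ g 0 1 = 0 /\ g 1 0 = 0 /\ g 1 1 = 1) \/
       (g 0 0 = -1 /\ g 0 1 = 0 /\ g 1 0 = 0 /\ g 1 1 = -1) -> g = 1%:M \/ g = - 1%:M.
  by case=> -[e0 [e1 [e2 e3]]]; [left|right]; apply: mx2P; rewrite !mxE /= ?oppr0.
move: (g 0 0) (g 0 1) (g 1 0) (g 1 1) det1 => a b c d det1 fin tr.
move: t0; rewrite /UHP; case: tau {gt} => x y /= y0 e.
have cI (n : int) : n%:~R = (n%:~R : R)%:C%C :> R[i] := cplx_int R n.
move: e; rewrite !cI => e; have := congr1 (@complex.Re R) e; have /= := congr1 (@complex.Im R) e => {e}.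
rewrite !mul0r !subr0 !addr0.
set ar := a%:~R; set br := b%:~R; set cr := c%:~R; set dr := d%:~R => im re.
have detr : ar * dr - br * cr = 1 by rewrite -!intrM -intrB det1.
have e1 : ar - dr = 2 * cr * x by apply: (mulIf (lt0r_neq0 y0)); lra.
have e2 : br = - (cr * (x ^+ 2 + y ^+ 2)) by rewrite expr2; nra.
have e3 : (ar + dr) ^+ 2 = 4 - 4 * cr ^+ 2 * y ^+ 2.
  have -> : (ar + dr) ^+ 2 = (ar - dr) ^+ 2 + 4 * (1 + br * cr).
    by transitivity ((ar - dr) ^+ 2 + 4 * ((ar * dr - br * cr) + br * cr)); [ring|rewrite detr].
  have aux (u v w : R) : (2 * u * v) ^+ 2 + 4 * (1 + - (u * (v ^+ 2 + w ^+ 2)) * u) = 4 - 4 * u ^+ 2 * w ^+ 2 by ring.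
  by rewrite e1 e2 aux.
have [c0|c0] := eqVneq c 0.
  have cr0 : cr = 0 by rewrite /cr c0.
  have ad : a = d by apply: (intr_inj (R := R)); rewrite -/ar -/dr; move: e1; rewrite cr0; lra.
  have b0 : b = 0 by apply: (intr_inj (R := R)); rewrite -/br e2 cr0; ring.
  apply: fin; move: det1; rewrite ad b0 c0 mul0r subr0 => dd.
  have : d \is a GRing.unit by apply/unitrPr; exists d.
  by case/orP => /eqP ->; [left|right].
have c2 : 0 < cr ^+ 2 by rewrite exprn_even_gt0 //= intr_eq0.
have : (ar + dr) ^+ 2 < 4 by rewrite e3 gtrBl; apply: mulr_gt0; [exact: mulr_gt0|exact: exprn_gt0].
have -> : (ar + dr) ^+ 2 = ((a + d) ^+ 2)%:~R by rewrite rmorphXn rmorphD.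
have -> : 4 = (4 : int)%:~R :> R by [].
rewrite ltr_int => sm.
have {sm} [h1 h2] : -1 <= a + d /\ a + d <= 1 by split; nia.
case: tr => /dvdzP[k kE]; exfalso; have [k0|[k0|k0]] : k <= -1 \/ k = 0 \/ 1 <= k by lia.
all: nia.
Qed.

Lemma stabilizer_card (tau : C) : UHP tau ->
  ([set g | pmGamma1 N g /\ mobius g tau = tau] #= `I_(1.*2))%card.
Proof.
move=> t0; have -> : [set g | pmGamma1 N g /\ mobius g tau = tau] = [set` [fset (1%:M : 'M[int]_2); - 1%:M]%fset].
  apply/seteqP; split=> g /=.
    by move=> [gG gt]; rewrite !inE; case: (mobius_fix t0 gG gt) => ->; rewrite eqxx ?orbT.
  have m1 : mobius 1%:M tau = tau by rewrite /mobius !mxE /= mul1r mul0r addr0 add0r divr1.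
  rewrite !inE => /orP[/eqP ->|/eqP ->]; split=> //.
  - by left; exact: Gamma1_1.
  - by right; rewrite opprK; exact: Gamma1_1.
  - rewrite /mobius !mxE /= !oppr0 mul0r addr0 add0r rmorphN /= mulN1r invrN invr1 mulrN1 opprK.
    by [].
apply/card_eq_fsetP; rewrite -[size _]/(#|` _|)%fset cardfs2.
suff -> : (1%:M : 'M[int]_2) != - 1%:M by [].
by apply/eqP => /matrixP /(_ 0 0); rewrite !mxE.
Qed.

Definition X1_point (y : C + option rat) (hy : ext_upper_half_plane y) : X1 R N :=
  @SigSub _ _ _ (orbit1 N y) (mem_set (imageP (orbit1 N) hy)).

Lemma X1_pointE y hy : val (@X1_point y hy) = orbit1 N y. Proof. by []. Qed.

Lemma X1_val (P : X1 R N) : exists2 y, ext_upper_half_plane y & val P = orbit1 N y.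
Proof. by have [y hy <-] := set_valP P; exists y. Qed.

Lemma orbit1_cusp s (y : C + option rat) : orbit1 N y (inr s) -> orbit1 N y = orbit1 N (inr s).
Proof.
move=> [g gG]; case: y => [//|s'] /= [->]; have [gS _ _ _] := gG.
apply/seteqP; split=> x [h hG ->] /=; have [hS _ _ _] := hG.
  exists (h *m invmx g); first by apply: Gamma1M => //; exact: Gamma1V.
  rewrite /= cusp_actM -?mulmxA; [|exact: SL2M (SL2V gS)|by []].
  by rewrite mulVmx ?mulmx1 // unitmxE gS unitr1.
by exists (h *m g); [exact: Gamma1M|rewrite /= cusp_actM].
Qed.

Lemma X1_cusp_eq (P Q : X1 R N) s : val P (inr s) -> val Q (inr s) -> P = Q.
Proof.
have [y _ yE] := X1_val P; have [z _ zE] := X1_val Q; rewrite yE zE => h1 h2.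
by apply: val_inj; rewrite yE zE (orbit1_cusp h1) (orbit1_cusp h2).
Qed.

End Points.

Section InfinityCusps.
Variable R : realType.
Local Notation C := (R[i]^o).
Variables (p : nat) (c : int) (T : nat).
Hypothesis D : leveldata p c.
Hypothesis T0 : (0 < T)%N.
Local Notation N := (lev p T).
Local Notation H := (hlev p T).
Let N0 : (0 < N)%N := lev_gt0 (ld_prime D) T.

Definition oo_cusp (i : nat) : X1 R N := @X1_point R N (inr (Some ((c ^+ i)%:~R / N%:R))) I.

Lemma oo_cusp_col i : exists2 g, SL2Z g & [/\ g 0 0 = c ^+ i, g 1 0 = N%:Z &
  cusp_act g None = Some ((c ^+ i)%:~R / N%:R)].
Proof.
have : coprimez (c ^+ i) N by rewrite coprimez_sym; apply: coprimezXr; exact: (ld_coprime D).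
case/coprimezP => -[u v] /= uv; exists (mk2 (c ^+ i) (- v) N u).
  by apply: SL2_mk; rewrite -uv; ring.
by rewrite !mk2E cusp_act_oo !mk2E /frac; case: eqP => //; lia.
Qed.

Lemma oo_cuspP i g s : SL2Z g -> cusp_act g None = s ->
  val (oo_cusp i) (inr s) <->
  (N %| g 1%R 0%R)%Z /\ (N %| g 0%R 0%R - c ^+ i)%Z || (N %| g 0%R 0%R + c ^+ i)%Z.
Proof.
move=> gS <-; have [h hS [h0 h1 hE]] := oo_cusp_col i; rewrite X1_pointE -hE; split.
  move=> [k kG] [e]; have [kS _ _ _] := kG; have /Gamma1P[_ k0 k1 k2] := kG.
  rewrite cusp_actM_oo // in e; have := cusp_oo_eq gS (SL2M kS hS) e; rewrite !mul2E h0 h1 => E.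
  have d0 : (N %| k 1%R 0%R * c ^+ i + k 1%R 1%R * N)%Z by apply: rpredD; [exact: dvdz_mulr|exact: dvdz_mull].
  have d1 : (N %| k 0%R 0%R * c ^+ i + k 0%R 1%R * N - c ^+ i)%Z.
    have -> : k 0 0 * c ^+ i + k 0 1 * N - c ^+ i = (k 0 0 - 1) * c ^+ i + k 0 1 * N by ring.
    by apply: rpredD; [exact: dvdz_mulr|exact: dvdz_mull].
  case: E => -[-> ->]; split=> //; first by rewrite d1.
    by rewrite rpredN.
  by apply/orP; right; rewrite -rpredN opprD opprK.
move=> [g1 g0].
have [e e2 ge] : exists2 e : int, e * e = 1 & (N %| e * g 0%R 0%R - c ^+ i)%Z.
  case/orP: g0 => g0; [exists 1|exists (- 1)] => //; first by rewrite mul1r.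
  by rewrite mulN1r -opprD rpredN.
have gmS : SL2Z (e *: g).
  by move/SL2P: gS => gd; apply/SL2P; rewrite !mxE -gd -[RHS]mul1r -e2; ring.
have kE : cusp_act (e *: g) None = cusp_act g None.
  rewrite !cusp_act_oo !mxE /frac mulf_eq0; have en : e != 0 by apply/eqP => ez; move: e2; rewrite ez mul0r.
  rewrite (negbTE en) /=; case: eqP => // /eqP gn; congr Some.
  by rewrite !intrM invfM mulrACA divff ?mul1r // intr_eq0.
have kS := SL2M gmS (SL2V hS); exists (e *: g *m invmx h); last first.
  rewrite /= (cusp_actM_oo kS hS).
  by rewrite -mulmxA mulVmx ?mulmx1 ?kE // unitmxE hS unitr1.
have /SL2P gd := gS; have /SL2P hd := hS.
apply/Gamma1P; split=> //.
- rewrite mul2E SL2_inv // !mk2E !mxE.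
  have -> : e * g 0 0 * h 1 1 + e * g 0 1 * - h 1 0 - 1 =
    (e * g 0 0 - c ^+ i) * h 1 1 + (h 0 1 - e * g 0 1) * h 1 0 by rewrite -[X in _ - X]hd h0; ring.
  by apply: rpredD; [exact: dvdz_mulr|rewrite h1 dvdz_mull].
- rewrite mul2E SL2_inv // !mk2E !mxE.
  have -> : e * g 1 0 * - h 0 1 + e * g 1 1 * h 0 0 - 1 =
    g 1 0 * (g 0 1 - e * h 0 1) - e * g 1 1 * (e * g 0 0 - h 0 0).
    have e3 : e * e * (g 1 1 * g 0 0) = g 1 1 * g 0 0 by rewrite e2 mul1r.
    by move: e3 gd; lia.
  by rewrite h0; apply: rpredB; [exact: dvdz_mulr|exact: dvdz_mull].
- rewrite mul2E SL2_inv // !mk2E !mxE h1 mulrN.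
  by apply: rpredB; [rewrite mulrAC; exact: dvdz_mull|exact: dvdz_mull].
Qed.

Lemma oo_cusp_inj i j : (i < H)%N -> (j < H)%N -> oo_cusp i = oo_cusp j -> i = j.
Proof.
move=> iH jH ij; have [h hS [h0 h1 hE]] := oo_cusp_col i.
have /(oo_cuspP j hS hE)[_] : val (oo_cusp j) (inr (Some ((c ^+ i)%:~R / N%:R))).
  by rewrite -ij; apply/(oo_cuspP i hS hE); rewrite h0 h1 subrr dvdz0.
by rewrite h0; exact: (ld_inj D).
Qed.

Lemma infinity_cuspP (P : X1 R N) : infinity_cusp P <-> exists2 i, (i < H)%N & P = oo_cusp i.
Proof.
split=> [[k cop kP]|[i iH ->]].
  case/coprimezP: (cop) => -[u v] /= uv.
  have gS : SL2Z (mk2 k (- v) N u) by apply: SL2_mk; rewrite -uv; ring.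
  have gE : cusp_act (mk2 k (- v) N u) None = Some (k%:~R / N%:R).
    by rewrite cusp_act_oo !mk2E /frac; case: eqP => //; lia.
  have cop' : coprimez N k by rewrite coprimez_sym.
  have [i iH ik] := ld_gen D T0 cop'.
  by exists i => //; apply: (X1_cusp_eq kP); apply/(oo_cuspP i gS gE); rewrite !mk2E.
exists (c ^+ i); first by rewrite coprimez_sym; apply: coprimezXr; exact: (ld_coprime D).
have [h hS [h0 h1 hE]] := oo_cusp_col i.
by apply/(oo_cuspP i hS hE); rewrite h0 h1 subrr dvdz0.
Qed.

End InfinityCusps.

From mathcomp Require Import generic_quotient ring_quotient freeg.

(** * Principal divisors and modular units *)

Section Orders.
Variable R : realType.
Local Notation C := (R[i]^o).
Implicit Types (f h F : C -> C) (tau w u l : C).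

Lemma qparam_expz (n : nat) tau (m : int) : qparam n tau ^ (- m) = ce (- (tau * (m%:~R / n%:R)%:C%C)).
Proof.
have -> : qparam n tau = ce (tau / n%:R) by rewrite /qparam /ce /tpi mulrA.
rewrite -ceMz; congr ce; rewrite mulrNz; congr (- _).
have -> : (m%:~R / n%:R)%:C%C = m%:~R / n%:R :> C.
  by rewrite rmorphM fmorphV /= rmorph_int rmorph_nat.
by rewrite -mulrzr mulrA mulrAC.
Qed.

Local Opaque ce.

Lemma has_order_asy (n : nat) F (m : int) : has_order_along (@at_ioo R) (qparam n) F m <-> asy F (m%:~R / n%:R).
Proof.
split=> -[l l0 Fl]; exists l => //.
  apply/ilimP; suff -> : (fun t => F t * ce (- (t * (m%:~R / n%:R)%:C%C))) = (fun z => F z * qparam n z ^ (- m)) by [].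
  by apply/funext => t; rewrite qparam_expz.
suff -> : (fun z => F z * qparam n z ^ (- m)) = (fun t => F t * ce (- (t * (m%:~R / n%:R)%:C%C))) by apply/ilimP.
by apply/funext => t; rewrite qparam_expz.
Qed.

Definition plim f tau l := forall e : R, 0 < e ->
  exists2 d : R, 0 < d & forall w, nm (w - tau) < d -> w != tau -> nm (f w - l) < e.

Lemma plimP f tau l : plim f tau l <-> (f w @[w --> tau^'] --> l).
Proof.
split=> [fl|/cvg_cplxP fl e e0]; last by apply/dnbhs_cplxP; exact: fl.
by apply/cvg_cplxP => e /fl; apply: (proj2 (dnbhs_cplxP _ _)).
Qed.

Lemma ccont_plim f tau : ccont f tau -> plim f tau (f tau).
Proof. by move=> fc e /fc[d d0 dP]; exists d => // w wd _; exact: dP. Qed.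

Lemma near_point tau (d : R) : 0 < d -> exists2 w, nm (w - tau) < d & w != tau /\ complex.Im tau < complex.Im w.
Proof.
move=> d0; exists (tau + (0 +i* (d / 2))%C).
  by rewrite addrAC subrr add0r /nm /= expr0n add0r sqrtr_sqr ger0_norm; lra.
split; last by rewrite cImD /=; lra.
by rewrite -subr_eq0 addrAC subrr add0r eq_complex /= eqxx /= gt_eqF //; lra.
Qed.

Lemma plim_unique f tau l l' : plim f tau l -> plim f tau l' -> l = l'.
Proof.
move=> fl fl'; apply/eqP; rewrite -subr_eq0 -nm_eq0; apply/negPn/negP => n0.
have e0 : 0 < nm (l - l') / 2 by rewrite divr_gt0 // lt_def n0 nm_ge0.
have [d d0 dP] := fl _ e0; have [d' d'0 dP'] := fl' _ e0.
have dd0 : 0 < Num.min d d' by rewrite lt_min d0.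
have [w wd [wt _]] := near_point tau dd0; move: wd; rewrite lt_min => /andP[w1 w2].
have := nm_dist_triangle l l' (f w); rewrite (nmBC l (f w)).
by have := dP w w1 wt; have := dP' w w2 wt; lra.
Qed.

Lemma has_order_unit N h tau : cregular h tau -> h tau != 0 -> has_order N h (inl tau) 0.
Proof.
move=> [hc [d d0 dP]] h0; split.
  by apply/dnbhs_cplxP; exists d => // w wd wt; apply/holoP; exact: dP.
exists 0; last by move=> e _; rewrite mulr0.
exists (h tau) => //; under eq_fun do rewrite oppr0 expr0z mulr1.
exact: (proj1 (plimP _ _ _) (ccont_plim hc)).
Qed.

(* holomorphic near tau and with a nonzero limit at tau, except that the value at tau is arbitrary *)
Definition almost_unit f tau := (exists2 d : R, 0 < d & forall w, nm (w - tau) < d -> w != tau -> holo f w) /\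
  exists2 l, l != 0 & plim f tau l.

Lemma has_order0_almost_unit N f tau : (4 <= N)%N -> UHP tau -> has_order N f (inl tau) 0 -> almost_unit f tau.
Proof.
move=> N4 t0 [/dnbhs_cplxP[d d0 dP] [k [l l0 fl] kE]]; split.
  by exists d => // w wd wt; apply/holoP; exact: dP.
exists l => //; apply/plimP; move: fl; rewrite (kE 1%N (stabilizer_card N4 t0)) mulr0.
by under eq_fun do rewrite oppr0 expr0z mulr1.
Qed.

(** In [principal], the order at an interior point only constrains [f] on a punctured neighbourhood,
    so [f] may have arbitrary values at isolated points. [hstar] replaces each value by the
    limit. *)
Definition hstar f tau : C := xget 0 [set l | plim f tau l].

Lemma hstarE f tau l : plim f tau l -> hstar f tau = l.
Proof. by move=> fl; apply: xget_unique => //= l' fl'; exact: plim_unique fl' fl. Qed.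

Section Regularization.
Variable f : C -> C.
Hypothesis fU : forall tau, UHP tau -> almost_unit f tau.

Lemma hstar_plim tau : UHP tau -> plim f tau (hstar f tau) /\ hstar f tau != 0.
Proof. by move=> /fU[_ [l l0 fl]]; rewrite (hstarE fl). Qed.

Lemma hstar_near tau : UHP tau -> exists2 d : R, 0 < d & forall w, nm (w - tau) < d -> w != tau ->
  [/\ hstar f w = f w, holo f w & UHP w].
Proof.
move=> t0; have [[d d0 dP] _] := fU t0; have [e e0 eP] := UHP_open t0.
exists (Num.min d e); first by rewrite lt_min d0.
move=> w; rewrite lt_min => /andP[w1 w2] wt; have fw := dP w w1 wt; split=> //; last exact: eP.
by apply: hstarE; apply: ccont_plim; exact: holo_ccont.
Qed.

Lemma hstar_ccont tau : UHP tau -> ccont (hstar f) tau.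
Proof.
move=> t0 e e0; have [hp _] := hstar_plim t0; have [d d0 dP] := hp e e0.
have [d' d'0 dP'] := hstar_near t0; exists (Num.min d d'); first by rewrite lt_min d0.
move=> w; rewrite lt_min => /andP[w1 w2]; have [->|wt] := eqVneq w tau; first by rewrite subrr nm0.
by have [-> _ _] := dP' w w2 wt; exact: dP.
Qed.

Lemma regular_unit_hstar : regular_unit (hstar f).
Proof.
move=> tau t0; have [_ h0] := hstar_plim t0; split=> //; split; first exact: hstar_ccont.
have [d d0 dP] := hstar_near t0; exists d => // w wt wd; have [hw fw w0] := dP w wd wt.
apply: (@holo_near _ f) => //; apply/nbhs_cplxP; have [e e0 eP] := hstar_near w0.
exists e => // u ue; have [->//|uw] := eqVneq u w.
by have [-> _ _] := eP u ue uw.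
Qed.

Lemma mtau_neq (a b c d : int) w tau : a * d - b * c = 1 -> UHP w -> UHP tau -> w != tau ->
  mtau a b c d w != mtau a b c d tau.
Proof.
move=> det1 w0 t0; apply: contra => /eqP e; apply/eqP.
by rewrite -(mtau_inv det1 w0) e (mtau_inv det1 t0).
Qed.

Lemma hstar_inv1 N : Gamma1_invariant N f -> inv1 N (hstar f).
Proof.
move=> fN a b c d tau det1 h1 h2 t0; apply/esym/hstarE => e e0.
have [hp _] := hstar_plim (UHP_mtau det1 t0); have [dl dl0 dlP] := hp e e0.
have [d1 d10 d1P] := holo_ccont (holo_mtau det1 t0) dl0; have [d2 d20 d2P] := UHP_open t0.
exists (Num.min d1 d2); first by rewrite lt_min d10.
move=> w; rewrite lt_min => /andP[w1 w2] wt; have w0 := d2P w w2.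
have <- : f (mtau a b c d w) = f w; last by apply: dlP; [exact: d1P|exact: mtau_neq].
have gG : Gamma1 N (mk2 a b c d).
  apply/Gamma1P; rewrite !mk2E; split=> //; first exact: SL2_mk.
  have -> : d - 1 = - ((a - 1) * d) + b * c by rewrite -[X in _ - X]det1; ring.
  by apply: rpredD; [rewrite rpredN; exact: dvdz_mulr|exact: dvdz_mull].
by have := fN _ w gG w0; rewrite /mobius !mk2E.
Qed.

(** Arbitrarily close to each [t] there is a [u] with larger imaginary part at which [f] and
    [hstar f] agree, so the estimate for [f] at [u] passes to [hstar f] at [t] by continuity. *)
Lemma hstar_asy (a b c d : int) (k : R) : a * d - b * c = 1 ->
  asy (fun t => f (mtau a b c d t)) k -> asy (fun t => hstar f (mtau a b c d t)) k.
Proof.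
move=> det1 [l l0 fl]; exists l => // e e0.
have e20 : 0 < e / 2 by rewrite divr_gt0.
have [Y YP] := fl _ e20; exists (Num.max Y 0) => t; rewrite gt_max => /andP[tY t0].
pose G (u : C) : C := hstar f (mtau a b c d u) * ce (- (u * k%:C%C)).
have Gc : ccont G t.
  apply: ccontM.
    apply: (@ccont_comp _ (hstar f) (mtau a b c d)); first exact: (holo_ccont (holo_mtau det1 t0)).
    by apply: hstar_ccont; exact: UHP_mtau.
  apply: holo_ccont; apply: (@holo_comp _ _ (fun u : C => - (u * k%:C%C))); last exact: holo_ce.
  by apply: holoN; apply: holoM; [exact: holo_id|exact: holo_cst].
have [d1 d10 d1P] := Gc _ e20; have [d2 d20 d2P] := hstar_near (UHP_mtau det1 t0).
have [d3 d30 d3P] := holo_ccont (holo_mtau det1 t0) d20.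
have dd0 : 0 < Num.min d1 d3 by rewrite lt_min d10.
have [u ud [ut tu]] := near_point t dd0; move: ud; rewrite lt_min => /andP[u1 u2].
have u0 : UHP u by exact: lt_trans tu.
have [hu _ _] := d2P _ (d3P u u2) (mtau_neq det1 u0 t0 ut).
have h1 : nm (G u - l) < e / 2 by rewrite /G hu; exact: (YP u (lt_trans tY tu)).
have h2 : nm (G u - G t) < e / 2 := d1P u u1.
change (nm (G t - l) < e).
by have := nm_dist_triangle (G t) l (G u); rewrite (nmBC (G t) (G u)); lra.
Qed.

End Regularization.

Section Bridge.
Variables (p : nat) (c : int) (T : nat).
Hypothesis D : leveldata p c.
Hypothesis T0 : (0 < T)%N.
Local Notation N := (lev p T).
Local Notation H := (hlev p T).
Hypothesis N4 : (4 <= N)%N.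
Let N0 : (0 < N)%N := lev_gt0 (ld_prime D) T.
Local Notation cusp := (oo_cusp R p c T).

Definition cusp_div (x : nat -> int) : {freeg (X1 R N)} := \sum_(i < H) << x i *g cusp i >>.

Lemma coeff_cusp_div x i : (i < H)%N -> coeff (cusp i) (cusp_div x) = x i.
Proof.
move=> iH; rewrite /cusp_div raddf_sum /= (bigD1 (Ordinal iH)) //= coeffU eqxx mulr1 big1 ?addr0 // => j ji.
rewrite coeffU; case: eqP => [e|_]; last by rewrite mulr0.
by case/eqP: ji; apply: val_inj; exact: (oo_cusp_inj D T0 _ _ e).
Qed.

Lemma coeff_cusp_div0 x (P : X1 R N) : (forall i, (i < H)%N -> P <> cusp i) -> coeff P (cusp_div x) = 0.
Proof.
move=> h; rewrite /cusp_div raddf_sum /= big1 // => j _.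
by rewrite coeffU; case: eqP => [e|_]; [case: (h j (ltn_ord j))|rewrite mulr0].
Qed.

Lemma deg_cusp_div x : deg (cusp_div x) = \sum_(i < H) x i.
Proof. by rewrite /cusp_div raddf_sum; apply: eq_bigr => i _; exact: degU. Qed.

Lemma coeff_interior x (P : X1 R N) (tau : C) : (val P) (inl tau) -> coeff P (cusp_div x) = 0.
Proof.
move=> Pt; apply: coeff_cusp_div0 => i _ Pi; move: Pt; rewrite Pi X1_pointE.
by case.
Qed.

(** Cusp widths cause no trouble: the width is 1 at the oo-cusps, and elsewhere the order is 0 in
    every local parameter. *)
Lemma principal_modular_unit x : principal (cusp_div x) <-> modular_unit R p c T x.
Proof.
split=> [[f fN fD]|[h [hi hU hx]]].
  have fU tau : UHP tau -> almost_unit f tau.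
    move=> t0; apply: (@has_order0_almost_unit N) => //.
    have Pt : val (@X1_point R N (inl tau) t0) (inl tau).
      exists 1%:M; first exact: Gamma1_1.
      by rewrite /= /mobius !mxE /= mul1r mul0r addr0 add0r divr1.
    by have := fD _ _ Pt; rewrite (coeff_interior _ Pt).
  exists (hstar f); split; [exact: hstar_inv1|exact: regular_unit_hstar|].
  move=> a b c' d det1; have gS := SL2_mk det1.
  have [s sE] : exists s, cusp_act (mk2 a b c' d) None = s by exists (cusp_act (mk2 a b c' d) None).
  have mE : f \o mobius (mk2 a b c' d) = (fun t => f (mtau a b c' d t)).
    by apply/funext => t; rewrite /= /mobius !mk2E.
  split=> [h1 i iH h2|h1].
    have Ps : val (cusp i) (inr s) by apply/(oo_cuspP R D T0 i gS sE); rewrite !mk2E.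
    have w1 : is_cusp_width N (mk2 a b c' d) 1 by apply: cusp_width1; rewrite ?mk2E.
    have := fD _ _ Ps _ _ gS sE w1; rewrite coeff_cusp_div // => /has_order_asy; rewrite mE divr1.
    exact: hstar_asy.
  have [w ww] := cusp_width_ex N0 gS.
  have Ps : val (@X1_point R N (inr s) I) (inr s) by exists 1%:M; [exact: Gamma1_1|rewrite /= cusp_act1].
  have := fD _ _ Ps _ _ gS sE ww; rewrite coeff_cusp_div0 => [/has_order_asy|i iH e].
    by rewrite mE mul0r; exact: hstar_asy.
  by move: Ps; rewrite e => /(oo_cuspP R D T0 i gS sE); rewrite !mk2E (negbTE h1) => -[].
exists h.
  move=> g tau /Gamma1P[/SL2P gS g0 g1 g2] t0; exact: (hi _ _ _ _ tau gS g2 g0 t0).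
move=> P [tau|s] Ps.
  have t0 : UHP tau.
    have [y yU yE] := X1_val P; move: Ps; rewrite yE => -[g [gS _ _ _]]; case: y yU {yE} => [u|//] /= u0 [->].
    by move/SL2P: gS => gd; exact: (UHP_mtau gd u0).
  rewrite (coeff_interior _ Ps); have [h1 h2] := hU tau t0.
  exact: has_order_unit.
move=> g w gS gs ww; apply/has_order_asy; have /SL2P gd := gS.
have [h1 h2] := hx _ _ _ _ gd; have [Nd|Nd] := boolP (N %| g 1%R 0%R)%Z; last first.
  rewrite coeff_cusp_div0 ?mul0r; first exact: h2.
  by move=> i iH e; move: Ps; rewrite e => /(oo_cuspP R D T0 i gS gs)[]; rewrite (negbTE Nd).
have cop : coprimez N (g 0 0).
  case/dvdzP: Nd => k kE; apply/coprimezP; exists (- g 0 1 * k, g 1 1) => /=.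
  by rewrite -[RHS]gd kE; ring.
have [i iH ia] := ld_gen D T0 cop.
have -> : P = cusp i by apply: (X1_cusp_eq Ps); apply/(oo_cuspP R D T0 i gS gs).
have -> : w = 1%N.
  have [w0 ws wmin] := ww; have [_ s1 _] := cusp_width1 gS Nd.
  by apply/eqP; rewrite eqn_leq wmin.
by rewrite coeff_cusp_div // divr1; exact: h1.
Qed.

End Bridge.
End Orders.

(** * The cuspidal group as a quotient of a lattice *)

Section CuspidalGroup.
Variable R : realType.
Variables (p : nat) (c : int) (T : nat).
Hypothesis D : leveldata p c.
Hypothesis T0 : (0 < T)%N.
Local Notation N := (lev p T).
Local Notation H := (hlev p).
Let pp := ld_prime D.
Let H0 t : (0 < H t)%N := hlev_gt0 pp t.
Local Notation V := 'rV[int]_(hlev p T).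
Implicit Types (v w : V) (x : nat -> int).

Definition cusp_index (i : nat) : 'I_(H T) := Ordinal (ltn_pmod i (hlev_gt0 (ld_prime D) T)).

(* the degree-0 divisor v - (deg v) cusp_(H T - 1), as a periodic sequence of coefficients *)
Definition deg0_seq v : nat -> int := fun i =>
  v 0 (cusp_index i) - (if (i %% H T == (H T).-1)%N then \sum_j v 0 j else 0).

Lemma deg0_seq_per v : per (H T) (deg0_seq v).
Proof.
move=> i; rewrite /deg0_seq; have -> : cusp_index (i + H T) = cusp_index i by apply: val_inj; rewrite /= modnDr.
by rewrite modnDr.
Qed.

Lemma deg0_seq_sum v : \sum_(i < H T) deg0_seq v i = 0.
Proof.
rewrite /deg0_seq sumrB.
have iE (i : 'I_(H T)) : cusp_index i = i by apply: val_inj; rewrite /= modn_small.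
under eq_bigr do rewrite iE.
have lastP : ((H T).-1 < H T)%N by rewrite prednK // H0.
rewrite [X in _ - X](bigD1 (Ordinal lastP)) //= modn_small // eqxx [X in _ - (_ + X)]big1 ?addr0 ?subrr // => i ih.
by rewrite modn_small //; case: eqP => // e; case/eqP: ih; exact: val_inj.
Qed.

Lemma deg0_seq_lin (a b : int) v w i : deg0_seq (a *: v + b *: w) i = a * deg0_seq v i + b * deg0_seq w i.
Proof.
rewrite /deg0_seq !mxE; case: ifP => _; last by rewrite !subr0.
have -> : \sum_j (a *: v + b *: w) 0 j = a * (\sum_j v 0 j) + b * (\sum_j w 0 j).
  by rewrite !mulr_sumr -big_split /=; apply: eq_bigr => j _; rewrite !mxE.
by ring.
Qed.

Lemma deg0_seqZ (a : int) v i : deg0_seq (a *: v) i = a * deg0_seq v i.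
Proof. by have := deg0_seq_lin a 0 v 0 i; rewrite scaler0 addr0 mul0r addr0. Qed.

Lemma deg0_seqD v w i : deg0_seq (v + w) i = deg0_seq v i + deg0_seq w i.
Proof. by have := deg0_seq_lin 1 1 v w i; rewrite !scale1r !mul1r. Qed.

Lemma deg0_seq_surj x : per (H T) x -> \sum_(i < H T) x i = 0 -> exists v, deg0_seq v =1 x.
Proof.
move=> xp x0; exists (\row_j x j) => i; rewrite /deg0_seq !mxE /= (per_mod i xp).
by under eq_bigr do rewrite mxE; rewrite x0 if_same subr0.
Qed.

Lemma eq_cusp_div x z : (forall i, (i < H T)%N -> x i = z i) -> cusp_div R p c T x = cusp_div R p c T z.
Proof. by move=> xz; apply: eq_bigr => i _; rewrite xz. Qed.

Lemma cusp_divD x z : cusp_div R p c T (fun i => x i + z i) = cusp_div R p c T x + cusp_div R p c T z.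
Proof.
apply/eqP/freeg_eqP => P; rewrite coeffD /cusp_div !raddf_sum -big_split /=.
by apply: eq_bigr => i _; rewrite !coeffU mulrDl.
Qed.

Lemma deg0_cusp_div v : cusp_div R p c T (deg0_seq v) \in @Defs.deg0 R N.
Proof. by rewrite inE deg_cusp_div deg0_seq_sum. Qed.

Definition cusp_class v : J1 R N := divisor_class (MkDiv0 (deg0_cusp_div v)).

Lemma divisor_class_eq0 (E : Div0 R N) : divisor_class E = 0 <-> principal (Div0_val E).
Proof.
have -> : (divisor_class E = 0) <-> (divisor_class E = \pi_(Quotient.quot (@principal_pred R N)) 0)%qT.
  by rewrite pi_zeror.
split=> [/eqP|Ep].
  by rewrite /divisor_class -Quotient.idealrBE subr0 => /asboolP.
by apply/eqP; rewrite /divisor_class -Quotient.idealrBE subr0; apply/asboolP.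
Qed.

Lemma divisor_classD (E F : Div0 R N) : divisor_class (E + F) = divisor_class E + divisor_class F.
Proof. by rewrite /divisor_class !piE. Qed.

Lemma supported_cusp_div (E : {freeg (X1 R N)}) : supported_at_infinity E <->
  exists2 x, per (H T) x & E = cusp_div R p c T x.
Proof.
split=> [Es|[x _ ->] P Pn].
  exists (fun i => coeff (oo_cusp R p c T (i %% H T)) E) => [i|]; first by rewrite modnDr.
  apply/eqP/freeg_eqP => P; have [[i iH ->]|nP] := pselect (exists2 i, (i < H T)%N & P = oo_cusp R p c T i).
    by rewrite (coeff_cusp_div R D T0) // modn_small.
  rewrite (@coeff_cusp_div0 R) => [|i iH e]; last by apply: nP; exists i.
  apply/eqP/negPn/negP => /Es /(infinity_cuspP D T0) [i iH e].
  by apply: nP; exists i.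
apply/(infinity_cuspP D T0); apply: contrapT => nP; move/eqP: Pn; apply.
by apply: (@coeff_cusp_div0 R) => i iH e; apply: nP; exists i.
Qed.

Lemma cusp_class_C1inf v : cusp_class v \in @C1inf_pred R N.
Proof.
apply/asboolP => S _; apply; apply/supported_cusp_div.
by exists (deg0_seq v) => //; exact: deg0_seq_per.
Qed.

Definition cusp_map v : C1inf R N := MkC1inf (cusp_class_C1inf v).

Lemma cusp_classD v w : cusp_class (v + w) = cusp_class v + cusp_class w.
Proof.
rewrite /cusp_class -divisor_classD; congr divisor_class; apply: val_inj => /=.
by rewrite -cusp_divD; apply: eq_cusp_div => i _; exact: deg0_seqD.
Qed.

Lemma cusp_mapD : {morph cusp_map : v w / v + w}.
Proof. by move=> v w; apply: val_inj; exact: cusp_classD. Qed.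

Lemma cusp_map_eq0 v : cusp_map v = 0 <-> principal (cusp_div R p c T (deg0_seq v)).
Proof.
rewrite -(divisor_class_eq0 (MkDiv0 (deg0_cusp_div v))); split=> [/(congr1 val) //|e].
by apply: val_inj.
Qed.

Lemma cusp_class_surj (E : Div0 R N) : supported_at_infinity (Div0_val E) -> exists v, cusp_class v = divisor_class E.
Proof.
move=> /supported_cusp_div[x xp Ex].
have x0 : \sum_(i < H T) x i = 0.
  by case: E Ex => E Ed /= Ex; move: Ed; rewrite Ex inE deg_cusp_div => /eqP.
have [v vx] := deg0_seq_surj xp x0; exists v; rewrite /cusp_class; congr divisor_class.
by apply: val_inj; rewrite /= Ex; apply: eq_cusp_div => i _; exact: vx.
Qed.

Lemma cusp_map_surj g : exists v, cusp_map v = g.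
Proof.
have /asboolP gP := valP g.
have [v vg] : exists v, cusp_class v = val g; last by exists v; apply: val_inj.
pose S : {pred J1 R N} := fun y => `[< exists v, cusp_class v = y >].
have SP y : y \in S <-> exists v, cusp_class v = y by split=> /asboolP.
apply/SP; apply: gP => [|E Es]; last by apply/SP; exact: cusp_class_surj.
have cB v w : cusp_class (v - w) = cusp_class v - cusp_class w.
  by apply: (addIr (cusp_class w)); rewrite -cusp_classD !subrK.
split=> [|y z]; first by apply/SP; exists 0; have := cB 0 0; rewrite !subrr.
by move=> /SP[v <-] /SP[w <-]; apply/SP; exists (v - w); exact: cB.
Qed.

End CuspidalGroup.

Lemma PoszX (n k : nat) : (n ^ k)%N%:Z = n%:Z ^+ k.
Proof. by rewrite -natz natrX natz. Qed.

Section Structure.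
Variable R : realType.
Variables (p : nat) (c : int) (T : nat).
Hypothesis D : leveldata p c.
Hypothesis T0 : (0 < T)%N.
Local Notation N := (lev p T).
Local Notation H := (hlev p).
Hypothesis N4 : (4 <= N)%N.
Let pp := ld_prime D.
Local Notation V := 'rV[int]_(hlev p T).
Implicit Types (v w : V).
Local Notation xi := (deg0_seq D (T := T)).

Definition Prin v : Prop := modular_unit R p c T (xi v).

Lemma Prin_lin (a b : int) v w : Prin v -> Prin w -> Prin (a *: v + b *: w).
Proof.
move=> vP wP; rewrite /Prin; have -> : xi (a *: v + b *: w) = (fun j => a * xi v j + b * xi w j).
  by apply/funext => i; exact: deg0_seq_lin.
exact: modular_unit_lin.
Qed.

Lemma PrinZ (a : int) v : Prin v -> Prin (a *: v).
Proof. by move=> vP; have := Prin_lin a 0 vP vP; rewrite scale0r addr0. Qed.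

Lemma xi_total v : yy p T T (xi v) 0%N = 0.
Proof. by rewrite (yy_total D (deg0_seq_per D v)); exact: deg0_seq_sum. Qed.

Lemma Prin_Cond v : Prin v -> Cond p c T (xi v).
Proof. by move=> vP; apply: (modular_unit_Cond D T0 _ _ vP); [exact: deg0_seq_per|exact: xi_total]. Qed.

Lemma Cond_Prin v : Cond p c T (xi v) -> exists2 m : nat, ~~ (p %| m)%N & Prin (m%:Z *: v).
Proof.
move=> vC; have [m pm mU] := Cond_modular_unit R D (deg0_seq_per D v) (xi_total v) vC.
have mP : Prin (m *: v).
  rewrite /Prin; have -> : xi (m *: v) = (fun j => m * xi v j) by apply/funext => i; exact: deg0_seqZ.
  exact: mU.
exists `|m|%N; first by move: pm; rewrite dvdzE.
by rewrite abszE normrEsign -scalerA; exact: PrinZ.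
Qed.

Lemma Cond_exp v : Cond p c T (xi ((p ^ (2 * T))%N%:Z *: v)).
Proof.
have -> : xi ((p ^ (2 * T))%N%:Z *: v) = (fun j => p%:Z ^+ (2 * T) * xi v j).
  by apply/funext => i; rewrite deg0_seqZ PoszX.
move=> t tT; split=> [|i _ _]; rewrite !yyZ; first by apply: dvdz_mulr; apply: dvdz_exp2l; lia.
by rewrite mulrCA -mulrBr; apply: dvdz_mulr; apply: dvdz_exp2l; lia.
Qed.

Lemma Prin_sum (I : finType) (F : I -> V) : (forall i, Prin (F i)) -> Prin (\sum_i F i).
Proof.
move=> FP; apply: (big_ind Prin) => // [|v w vP wP].
  by have [m _] := Cond_Prin (Cond_exp 0); rewrite !scaler0.
by rewrite -[v]scale1r -[w]scale1r; exact: Prin_lin.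
Qed.

(** Each basis vector times [p^(2T)] satisfies [Cond], so it becomes principal after a factor prime
    to [p]; [m] is the product of these factors. *)
Lemma prime_to_p_exponent : exists m : nat, [/\ (0 < m)%N, coprime p m &
  forall v, Prin ((p ^ (2 * T))%N%:Z *: (m%:Z *: v))].
Proof.
have [m mP] := choice (fun i => let: ex_intro2 m h1 h2 := Cond_Prin (Cond_exp (delta_mx 0 i : V)) in
  ex_intro (fun m : nat => ~~ (p %| m)%N /\ Prin (m%:Z *: ((p ^ (2 * T))%N%:Z *: (delta_mx 0 i : V)))) m (conj h1 h2)).
exists (\prod_i m i)%N.
have cop : coprime p (\prod_i m i)%N.
  rewrite prime_coprime // Euclid_dvd_prod // big_has; apply/hasPn => i _.
  by case: (mP i).
split=> // [|v]; first by case: posnP cop => // ->; rewrite prime_coprime // dvdn0.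
rewrite [v]row_sum_delta !scaler_sumr; apply: Prin_sum => i.
rewrite (bigD1 i) //= PoszM; set m' := (\prod_(_ < _ | _) _)%N.
have -> : (p ^ (2 * T))%N%:Z *: ((m i * m')%:Z *: (v 0 i *: delta_mx 0 i)) =
  (m'%:Z * v 0 i) *: ((m i)%:Z *: ((p ^ (2 * T))%N%:Z *: delta_mx 0 i)) :> V.
  by rewrite !scalerA PoszM; congr (_ *: _); ring.
by apply: PrinZ; case: (mP i).
Qed.

(** A vector is principal exactly when it satisfies [Cond] and some [p^k] times it is principal: a
    Bezout relation between [p^k] and the multiplier of [Cond_Prin] joins the two. The first
    condition is the list of congruences modulo powers of [p]; the second defines a lattice
    containing [m Z^H], whose Smith form is split into prime powers. *)
Lemma structure : exists2 s : seq nat,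
  primary_decomposition (C1inf R N) (map (fun k => (p ^ cond_exp p T k)%N) (cond_keys p T) ++ s) &
  forall q, q \in s -> ~~ (p %| q)%N.
Proof.
have [m [m0 pm mP]] := prime_to_p_exponent.
pose P2 v := exists k, Prin ((p ^ k)%N%:Z *: v).
have P2lin (a b : int) v w : P2 v -> P2 w -> P2 (a *: v + b *: w).
  move=> [k vP] [l wP]; exists (k + l)%N; rewrite scalerDr.
  have -> : (p ^ (k + l))%N%:Z *: (a *: v) = ((p ^ l)%N%:Z * a) *: ((p ^ k)%N%:Z *: v).
    by rewrite !scalerA expnD PoszM; congr (_ *: _); ring.
  have -> : (p ^ (k + l))%N%:Z *: (b *: w) = ((p ^ k)%N%:Z * b) *: ((p ^ l)%N%:Z *: w).
    by rewrite !scalerA expnD PoszM; congr (_ *: _); ring.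
  exact: Prin_lin.
have P2m v : P2 (m%:Z *: v) by exists (2 * T)%N.
have [B [d [Bu dm] dP]] := smith_lattice m0 P2lin P2m.
have d0 i : (0 < d i)%N by apply: dvdn_gt0 (dm i).
have PrinE v : Prin v <-> Cond p c T (xi v) /\ P2 v.
  split=> [vP|[vC [k kP]]]; first by split; [exact: Prin_Cond|exists 0%N; rewrite expn0 scale1r].
  have [n pn nP] := Cond_Prin vC.
  have : coprimez n (p ^ k)%N by rewrite coprimezE /= coprime_sym coprimeXl // prime_coprime.
  case/coprimezP => -[a b] /= ab; rewrite -[v]scale1r -ab scalerDl -!scalerA.
  exact: Prin_lin.
pose s1 := cond_keys p T; pose s2 := [seq (i, l) | i <- enum 'I_(H T), l <- primes (d i)].
pose keys : seq ((nat * nat) + ('I_(H T) * nat)) := map inl s1 ++ map inr s2.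
pose form (k : (nat * nat) + ('I_(H T) * nat)) v : int :=
  match k with inl k => cond_form p c T k (xi v) | inr k => (v *m B) 0 k.1 end.
pose mod (k : (nat * nat) + ('I_(H T) * nat)) : nat :=
  match k with inl k => (p ^ cond_exp p T k)%N | inr k => (k.2 ^ logn k.2 (d k.1))%N end.
have s2P i l : ((i, l) \in s2) = (l \in primes (d i)).
  by apply/allpairsPdep/idP => [[i' [l' [_ h [-> ->]]]]|h] //; exists i, l; rewrite mem_enum.
have keysP k : (k \in keys) = match k with inl k => k \in s1 | inr k => k \in s2 end.
  rewrite mem_cat; case: k => k.
    rewrite mem_map; last by move=> ? ? [].
    by rewrite [X in _ || X](_ : _ = false) ?orbF //; apply/negbTE/mapP => -[].
  rewrite [X in X || _](_ : _ = false) ?orFb; last by apply/negbTE/mapP => -[].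
  by rewrite mem_map // => ? ? [].
exists (map mod (map inr s2)); last first.
  move=> _ /mapP[_ /mapP[[i l] il ->] ->] /=; move: il; rewrite s2P mem_primes => /and3P[lp _ ld].
  apply: contraL pm => pl; have pl' : p = l.
    by move: pl; rewrite Euclid_dvdX // => /andP[]; rewrite dvdn_prime2 // => /eqP.
  by rewrite prime_coprime // negbK pl' (dvdn_trans ld).
have -> : map (fun k => (p ^ cond_exp p T k)%N) (cond_keys p T) ++ map mod (map inr s2) = map mod keys.
  by rewrite map_cat -!map_comp.
apply: (@primary_decomposition_forms V (C1inf R N) (cusp_map R D T0) _ keys form mod).
- exact: cusp_mapD.
- exact: cusp_map_surj.
- rewrite cat_uniq !map_inj_uniq; [|by move=> ? ? []|by move=> ? ? []].
  rewrite cond_keys_uniq andTb; apply/andP; split.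
    by apply/hasPn => _ /mapP[k _ ->]; apply/negP => /mapP[].
  apply: allpairs_uniq_dep; [exact: enum_uniq|by move=> i _; exact: primes_uniq|].
  by move=> [i l] [i' l'] _ _ /= [-> ->].
- move=> [k|[i l]]; rewrite keysP => kS.
    by exists p, (cond_exp p T k); split=> //; exact: cond_exp_gt0.
  by move: kS; rewrite s2P => lP; exists l, (logn l (d i)); split=> //; [move: lP; rewrite mem_primes => /andP[]|rewrite logn_gt0].
- move=> [k|[i l]] v w /=; last by rewrite mulmxDl mxE.
  have -> : xi (v + w) = (fun j => 1 * xi v j + 1 * xi w j).
    by apply/funext => j; rewrite !mul1r; exact: deg0_seqD.
  by rewrite cond_form_lin !mul1r.
- move=> v; rewrite cusp_map_eq0 (principal_modular_unit R D T0 N4) -/(Prin v) PrinE.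
  rewrite (Cond_forms D (deg0_seq_per D v) (xi_total v)) dP; split.
    move=> [h1 h2] [k|[i l]]; rewrite keysP => kS /=.
      by have := h1 k kS; rewrite -PoszX.
    apply: dvdz_trans (h2 i); rewrite dvdzE /=; exact: pfactor_dvdnn.
  move=> h; split=> [k kS|i].
    by have := h (inl k); rewrite keysP => /(_ kS) /=; rewrite PoszX.
  rewrite dvdzE /=; apply/(dvdn_partP _ (d0 i)) => l; rewrite p_part => lP.
  have kS : inr (i, l) \in keys by rewrite keysP s2P.
  by have := h _ kS; rewrite dvdzE.
move=> n; have [x [xp x0 xn]] := cond_forms_surj D T (fun k => n (inl k)).
have [|v1 v1x] := deg0_seq_surj D xp; first by rewrite -(yy_total D xp).
have [y yn] : exists y : 'I_(H T) -> int, forall i l, l \in primes (d i) ->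
    ((l ^ logn l (d i))%N %| y i - n (inr (i, l)))%Z.
  have yi i : exists y : int, forall l, l \in primes (d i) -> ((l ^ logn l (d i))%N %| y - n (inr (i, l)))%Z.
    apply: chinese_seq; first exact: primes_uniq.
    move=> k l; rewrite !mem_primes => /andP[kp _] /andP[lp _] kl.
    by rewrite coprimeXl // coprimeXr // prime_coprime // dvdn_prime2.
  by have [y yP] := choice yi; exists y.
pose v2 : V := (\row_i y i) *m invmx B.
have : coprimez (p ^ (2 * T))%N m by rewrite coprimezE /= coprimeXl.
case/coprimezP => -[a b] /= ab.
(* [b m] is 1 modulo [p^(2T)] and 0 modulo [m], and [a p^(2T)] is the reverse. Every modulus on the
   [p]-side divides [p^(2T)], and every other one divides [m]. *)
exists (b * m *: v1 + a * (p ^ (2 * T))%N *: v2) => -[k|[i l]]; rewrite keysP => kS /=.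
  have -> : xi (b * m *: v1 + a * (p ^ (2 * T))%N *: v2) = (fun j => (b * m) * xi v1 j + (a * (p ^ (2 * T))%N) * xi v2 j).
    by apply/funext => j; exact: deg0_seq_lin.
  rewrite cond_form_lin; have -> : xi v1 = x by apply/funext.
  rewrite xn //; set z := cond_form _ _ _ _ _.
  have -> : b * m * n (inl k) + a * (p ^ (2 * T))%N * z - n (inl k) = (p ^ (2 * T))%N%:Z * (a * (z - n (inl k))).
    by rewrite -[X in _ - X]mul1r -ab; ring.
  apply: dvdz_mulr; rewrite dvdzE /=; apply: dvdn_exp2l; rewrite /cond_exp; case: ifP => _; lia.
have E (u w : V) (s t : int) j : (s *: u + t *: w) 0 j = s * u 0 j + t * w 0 j by rewrite !mxE.
rewrite mulmxDl -!scalemxAl /v2 mulmxKV // E [(\row_i y i) _ _]mxE; set z := (v1 *m B) _ _.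
have -> : b * m * z + a * (p ^ (2 * T))%N * y i - n (inr (i, l)) = (y i - n (inr (i, l))) + m%:Z * (b * (z - y i)).
  have -> : a * (p ^ (2 * T))%N = 1 - b * m by rewrite -ab; ring.
  by ring.
rewrite s2P in kS; apply: rpredD; first exact: yn.
by apply: dvdz_mulr; rewrite dvdzE /=; apply: dvdn_trans (dm i); exact: pfactor_dvdnn.
Qed.

End Structure.

(** * Counting the cyclic factors *)

Section Counting.
Variable R : realType.
Variables (p : nat) (c : int) (T : nat).
Hypothesis D : leveldata p c.
Hypothesis T0 : (0 < T)%N.
Local Notation N := (lev p T).
Local Notation H := (hlev p).
Hypothesis N4 : (4 <= N)%N.
Let pp := ld_prime D.

Lemma C1inf_rank : is_p_rank (C1inf R N) p (H T.-1 - 1).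
Proof.
have [s sP sp] := structure R D T0 N4; have := primary_decomposition_rank pp sP.
rewrite count_cat count_map -(size_cond_keys D T0) -(count_predT (cond_keys p T)).
rewrite (_ : count (dvdn p) s = 0%N) ?addn0; last first.
  by apply/eqP; rewrite -leqn0 leqNgt -has_count; apply/hasPn => q /sp.
congr is_p_rank; apply: eq_in_count => k kS /=.
by rewrite dvdn_exp // (cond_exp_gt0 kS).
Qed.

Lemma C1inf_copies e : (0 < e)%N ->
  number_of_copies (C1inf R N) (p ^ e) (count (fun k => cond_exp p T k == e) (cond_keys p T)).
Proof.
move=> e0; have [s sP sp] := structure R D T0 N4; exists (map (fun k => (p ^ cond_exp p T k)%N) (cond_keys p T) ++ s) => //.
rewrite count_cat count_map (_ : count_mem (p ^ e)%N s = 0%N) ?addn0; last first.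
  apply/eqP; rewrite -leqn0 leqNgt -has_count; apply/hasPn => q /sp; apply: contra => /eqP ->.
  by rewrite dvdn_exp.
by apply: eq_count => k /=; rewrite eqn_exp2l // prime_gt1.
Qed.

(** Only the block of level [t = T - k] contributes. It has [H_t - H_(t-1)] keys, the first of which
    carries the odd exponent [2k - 1]. *)
Lemma C1inf_copies_even k : (0 < k)%N -> number_of_copies (C1inf R N) (p ^ (2 * k))
  (if (k < T)%N then H (T - k) - H (T - k).-1 - 1 else 0)%N.
Proof.
move=> k0; have k20 : (0 < 2 * k)%N by lia.
have := C1inf_copies k20; rewrite count_cond_exp; congr number_of_copies.
have tE (t : nat) : (0 < t < T)%N -> (((2 * k == (2 * (T - t)).-1) * (H t.-1 < H t) + (2 * k == 2 * (T - t)) * (H t - H t.-1 - 1)) =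
    if t == (T - k)%N then H t - H t.-1 - 1 else 0)%N.
  move: (H t.-1) (H t) => a b tT; rewrite (_ : (2 * k == (2 * (T - t)).-1)%N = false) ?mul0n ?add0n; last by lia.
  rewrite (_ : (2 * k == 2 * (T - t))%N = (t == T - k)%N); last by lia.
  by case: ifP => _; rewrite ?mul1n ?mul0n.
rewrite big_nat (eq_bigr _ tE) -big_nat; case: ltnP => kT.
  by rewrite -big_mkcond big_nat1_eq /= (_ : (0 < T - k < T)%N = true) //; lia.
by rewrite big_nat big1 // => t tT; case: eqP => //; lia.
Qed.

Lemma C1inf_copies_odd k : (0 < k)%N -> number_of_copies (C1inf R N) (p ^ (2 * k - 1))
  (if (k < T)%N then nat_of_bool (H (T - k).-1 < H (T - k)) else 0)%N.
Proof.
move=> k0; have k20 : (0 < 2 * k - 1)%N by lia.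
have := C1inf_copies k20; rewrite count_cond_exp; congr number_of_copies.
have tE (t : nat) : (0 < t < T)%N -> (((2 * k - 1 == (2 * (T - t)).-1) * (H t.-1 < H t) + (2 * k - 1 == 2 * (T - t)) * (H t - H t.-1 - 1)) =
    if t == (T - k)%N then nat_of_bool (H t.-1 < H t) else 0)%N.
  move: (H t.-1) (H t) => a b tT; rewrite (_ : (2 * k - 1 == 2 * (T - t))%N = false) ?mul0n ?addn0; last by lia.
  rewrite (_ : (2 * k - 1 == (2 * (T - t)).-1)%N = (t == T - k)%N); last by lia.
  by case: ifP => _; rewrite ?mul1n ?mul0n.
rewrite big_nat (eq_bigr _ tE) -big_nat; case: ltnP => kT.
  by rewrite -big_mkcond big_nat1_eq /= (_ : (0 < T - k < T)%N = true) //; lia.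
by rewrite big_nat big1 // => t tT; case: eqP => //; lia.
Qed.

End Counting.

Close Scope ring_scope.
Close Scope classical_set_scope.

Lemma hlev_odd p t : p <> 2 -> hlev p t.+1 = (p.-1)./2 * p ^ t.
Proof. by rewrite /hlev; case: eqP. Qed.

Lemma hlev_odd_diff p t : prime p -> p <> 2 ->
  hlev p t.+2 - hlev p t.+1 = ((p - 1) ^ 2 * p ^ t) %/ 2.
Proof.
move=> pp p2; rewrite !hlev_odd // expnS; have p_odd : odd p.
  by case: (even_prime pp).
have [h hE] : exists h, p = h.*2.+1 by exists p./2; rewrite -[LHS]odd_double_half p_odd.
move: (p ^ t) => q; rewrite hE subn1 /= doubleK.
have -> : h.*2 ^ 2 * q = (h * h.*2 * q) * 2 by rewrite -muln2; ring.
rewrite mulnK // mulSn mulnDr addnC addnK; ring.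
Qed.

Theorem theorem1 (R : realType) (p n : nat) :
  prime p -> p = 2 \/ regular_prime p ->
  2 <= n -> 8 <= p ^ n ->
  [/\ is_p_rank (C1inf R (p ^ n)) p (((p - 1) * p ^ (n - 2)) %/ 2 - 1),
      forall k : nat, 1 <= k ->
        number_of_copies (C1inf R (p ^ n)) (p ^ (2 * k))
          (if (p == 2) && (k + 3 <= n) || (3 <= p) && (k + 2 <= n) then
             ((p - 1) ^ 2 * p ^ (n - k - 2)) %/ 2 - 1
           else if (5 <= p) && (k + 1 == n) then (p - 5) %/ 2
           else 0)
    & forall k : nat, 1 <= k ->
        number_of_copies (C1inf R (p ^ n)) (p ^ (2 * k - 1))
          (if [|| (p == 2) && (k + 3 <= n),
                  (p == 3) && (k + 2 <= n)
                | (5 <= p) && (k + 1 <= n)] then 1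
           else 0)].
Proof.
move=> pp preg n2 n8; have [p2|p2] := p =P 2.
  (* Here [T = n - 2], since [lev 2 T = 2^(T+2)]; the bound [8 <= 2^n] makes it positive. *)
  subst p; have n3 : 3 <= n by rewrite -(@leq_exp2l 2).
  have nE : n = (n - 3).+3 by rewrite -addn3 subnK.
  move: (n - 3) nE => m nE; have T0 : 0 < m.+1 by [].
  have NE : 2 ^ n = lev 2 m.+1 by rewrite nE.
  have N4 : 4 <= lev 2 m.+1 by rewrite -NE; apply: leq_trans n8.
  rewrite NE; split=> [|k k0|k k0].
  - have := C1inf_rank R leveldata2 T0 N4; congr is_p_rank.
    by rewrite /hlev /= nE mul1n subn2 /= expnS mulKn.
  - have := C1inf_copies_even R leveldata2 T0 N4 k0; congr number_of_copies.
    rewrite /= orbF addn3 nE !ltnS; case: ltnP => // km; rewrite /hlev /= exp1n mul1n.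
    have -> : m.+1 - k = (m - k).+1 by rewrite subSn.
    have -> : m.+3 - k - 2 = (m - k).+1 by lia.
    by rewrite /= expnS mulKn // mul2n -addnn addnK.
  - have := C1inf_copies_odd R leveldata2 T0 N4 k0; congr number_of_copies.
    rewrite /= orbF addn3 nE !ltnS; case: (leqP k m) => // km; rewrite /hlev /=.
    have -> : m.+1 - k = (m - k).+1 by rewrite subSn.
    by rewrite /= ltn_exp2l // ltnSn.
have [//|pr] := preg; have [c D] := leveldata_odd pp pr.
have p3 : 3 <= p by have := prime_gt1 pp; lia.
have podd : odd p by case: pr.
have T0 : 0 < n by apply: leq_trans n2.
have NE : p ^ n = lev p n by rewrite /lev; case: eqP.
have N4 : 4 <= lev p n by rewrite -NE; apply: leq_trans n8.
have p5 : p <> 3 -> 5 <= p.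
  move=> ne; have p4 : p <> 4 by move=> e; move: podd; rewrite e.
  by move: p3 ne p4; clear; lia.
have hp : p = ((p.-1)./2).*2.+1 by move: podd; clear; lia.
have hp2 : p - 1 = (p.-1)./2 * 2 by move: hp; clear; lia.
have h1 : hlev p 1 = (p.-1)./2 by rewrite hlev_odd // muln1.
rewrite NE; split=> [|k k0|k k0].
- have := C1inf_rank R D T0 N4; congr is_p_rank.
  have -> : n.-1 = (n - 2).+1 by lia.
  rewrite hlev_odd //; move: (p ^ (n - 2)) => q; by rewrite hp2 mulnAC mulnK.
- have := C1inf_copies_even R D T0 N4 k0; congr number_of_copies.
  rewrite p3 /= addn2 addn1; case: (ltnP k.+1 n) => kn.
    have [m mE] : exists m, n - k = m.+2 by exists (n - k - 2); lia.
    by rewrite (ltnW kn) mE subn2 [_.+1.-1]/= hlev_odd_diff.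
  case: (ltnP k n) => kn'; last by rewrite gtn_eqF ?andbF // ltnS.
  have nE : n = k.+1 by apply/eqP; rewrite eqn_leq kn.
  (* At the last level [H_1 - H_0 - 1 = (p - 1)/2 - 2 = (p - 5)/2]; for [p = 3] the subtraction
     truncates to 0. *)
  rewrite nE eqxx andbT subSnn h1 hlev0.
  by case: leqP; move: hp; clear; lia.
- have := C1inf_copies_odd R D T0 N4 k0; congr number_of_copies.
  rewrite /= addn2 addn1; have [kn|kn] := ltnP k n; last first.
    by rewrite ltnNge ltnW ?andbF.
  have [e3|ne3] := p =P 3.
    rewrite e3 /= orbF; case: (ltnP k.+1 n) => kn'.
      have [m ->] : exists m, n - k = m.+2 by exists (n - k - 2); lia.
      rewrite [_.-1]/= !hlev_odd // ltn_pmul2l ?ltn_exp2l ?ltnSn //; lia.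
    (* For [p = 3] both [H_1] and [H_0] are 1, so the first block is empty. *)
    have -> : n - k = 1 by lia.
    by [].
  rewrite (p5 ne3) /=; have [m ->] : exists m, n - k = m.+1 by exists (n - k - 1); lia.
  rewrite [_.+1.-1]/=; case: m => [|m]; last by rewrite !hlev_odd // ltn_pmul2l ?ltn_exp2l ?ltnSn //; have := p5 ne3; lia.
  rewrite h1 hlev0.
  by have -> : 1 < p.-1./2 by have := p5 ne3; lia.
Qed.
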